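(* Suppose that for any initial condition $x\in\mathbb R^d$ the stochastic differential equation $$dX(t)=b(X(t))\,dt+\sigma(X(t))\,dW(t)+\int_U c(X(t-),u)\,\widetilde N(dt,du)$$ has a non-exploding weak solution $X^x$ which is unique in the sense of probability law. Suppose moreover that at least one of the following holds: (a) there exist $\delta_0>0$ and a nondecreasing concave function $\rho:[0,\infty)\to[0,\infty)$ with $\rho(r)>0$ for $r>0$ and $\int_{0+}\frac{dr}{\rho(r)}=\infty$ such that for every $R>0$ there is $\kappa_R>0$ such that for all $x,z\in\mathbb R^d$ with $|x|\vee|z|\le R$ and $|x-z|\le\delta_0$, $$2\langle z-x,b(z)-b(x)\rangle+|\sigma(z)-\sigma(x)|^2\le\kappa_R|z-x|\rho(|z-x|),\qquad \int_U|c(z,u)-c(x,u)|\,\nu(du)\le\kappa_R\rho(|z-x|);$$ in addition $\int_U|c(0,u)|\,\nu(du)<\infty$; (b) there exist $\delta_0>0$ and a nondecreasing concave function $\varrho:[0,\infty)\to[0,\infty)$ with $0<\varrho(r)\le(1+r)^2\varrho(\tfrac r{1+r})$ for all $r>0$ and $\int_{0+}\frac{dr}{\varrho(r)}=\infty$ such that for every $R>0$ there is $\kappa_R>0$ such that for all $x,z\in\mathbb R^d$ with $|x|\vee|z|\le R$ and $|x-z|\le\delta_0$, $$2\langle x-z,b(x)-b(z)\rangle+|\sigma(x)-\sigma(z)|^2+\int_U|c(x,u)-c(z,u)|^2\,\nu(du)\le\kappa_R\,\varrho(|x-z|^2).$$ Then the process $X$ is Feller continuous.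
   Context: Let $d\ge2$, $(U,\mathfrak U)$ a measurable space, $\nu$ a $\sigma$-finite measure on $U$. The functions $b:\mathbb R^d\to\mathbb R^d$, $\sigma:\mathbb R^d\to\mathbb R^{d\times d}$, $c:\mathbb R^d\times U\to\mathbb R^d$ are Borel measurable; $b$, $\sigma$ and $c(\cdot,u)$ (for each $u\in U$) are continuous, and $x\mapsto\int_U|c(x,u)|^2\nu(du)$ is continuous. For a matrix or vector $A$, $|A|=\sqrt{\mathrm{tr}(AA^T)}$. $W$ is a standard $d$-dimensional Brownian motion, $N$ a Poisson random measure on $[0,\infty)\times U$ with intensity $dt\,\nu(du)$ independent of $W$, and $\widetilde N$ its compensated measure, on a filtered probability space satisfying the usual hypotheses. For a bounded measurable $f:\mathbb R^d\to\mathbb R$ put $P_tf(x)=\mathbb E[f(X^x(t))]$, $t\ge0$. The process $X$ is Feller continuous if $P_t$ maps the set $C_b(\mathbb R^d)$ of bounded continuous functions into itself for every $t\ge0$. *)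

(* Defs.v *)
From Stdlib Require List.
From HB Require Import structures.
From mathcomp Require Import all_boot all_order all_algebra.
From mathcomp Require Import all_classical all_reals all_analysis.
From mathcomp Require Import measurable_realfun.
Set Implicit Arguments.
Unset Strict Implicit.
Unset Printing Implicit Defensive.
Import Order.TTheory GRing.Theory Num.Theory.
Import numFieldNormedType.Exports.
Local Open Scope classical_set_scope.
Local Open Scope ring_scope.

Notation borel S := (g_sigma_algebraType (@open S)).

(* |A| = sqrt (tr (A A^T)); the library norm on matrices is the sup norm. *)
Definition euc (R : realType) (m n : nat) (A : 'M[R]_(m, n)) : R :=
  Num.sqrt (\tr (A *m A^T)).

Definition dotv (R : realType) (d : nat) (x y : 'cV[R]_d) : R :=
  \sum_(i < d) x i ord0 * y i ord0.

Definition sigma_gen (T I : Type) d (S : measurableType d) (J : set I)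
    (Y : I -> T -> S) : set (set T) :=
  <<s \bigcup_(i in J) preimage_set_system setT (Y i) measurable >>.

(* Processes are written X t w, with time first; only times t >= 0 matter. *)

Definition path_cadlag (R : realType) (S : ptopologicalType) (p : R -> S) :=
  (forall t, 0 <= t -> p s @[s --> t^'+] --> p t) /\
  (forall t, 0 < t -> cvg (p s @[s --> t^'-])).

Definition left_lim (R : realType) (S : ptopologicalType) (p : R -> S) (t : R)
  : S := lim (p s @[s --> t^'-]).

Section stochastic_basis.
Context (R : realType) d (T : measurableType d) (P : probability T R).

Definition indep_systems (G H : set (set T)) :=
  forall A B, G A -> H B -> P (A `&` B) = (P A * P B)%E.

Record usual_filtration (F : R -> set (set T)) : Prop := {
  filt_sigma : forall t, 0 <= t -> sigma_algebra setT (F t);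
  filt_sub : forall t, 0 <= t -> F t `<=` measurable;
  filt_mono : forall s t, 0 <= s -> s <= t -> F s `<=` F t;
  filt_right : forall t, 0 <= t -> \bigcap_(s in `]t, +oo[) F s `<=` F t;
  filt_complete : P.-negligible `<=` F 0 }.

Definition rv_wrt (G : set (set T)) d' (S : measurableType d') (Y : T -> S) :=
  preimage_set_system setT Y measurable `<=` G.

Definition adapted (F : R -> set (set T)) d' (S : measurableType d')
    (X : R -> T -> S) :=
  forall t, 0 <= t -> rv_wrt (F t) (X t).

(* bm_incr: the coordinates of W t - W s are independent of each other and of
   F s, and each has the law N(0, t - s) (normal_prob takes the standard
   deviation). *)
Record brownian (n : nat) (F : R -> set (set T)) (W : R -> T -> 'cV[R]_n)
  : Prop := {
  bm_adapted : adapted F (W : R -> T -> borel 'cV[R]_n);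
  bm_start : forall w, W 0 w = 0;
  bm_cont : forall w, {within `[0, +oo[, continuous (W ^~ w)};
  bm_incr : forall s t (A : set T) (B : 'I_n -> set (measurableTypeR R)),
    0 <= s -> s < t -> F s A -> (forall i, measurable (B i)) ->
    P (A `&` [set w | forall i, B i (W t w i ord0 - W s w i ord0)]) =
    (P A * \prod_(i < n) normal_prob 0 (Num.sqrt (t - s)) (B i))%E }.

Section jumps.
Context dU (U : measurableType dU)
  (nu : {sigma_finite_measure set U -> \bar R}).

Definition time_slab (D : set R) : set (set (measurableTypeR R * U)) :=
  [set A | measurable A /\ A `<=` D `*` setT].

Definition intensity : set (measurableTypeR R * U) -> \bar R :=
  ((@lebesgue_measure R) \x nu)%E.

(* A random measure on [0, +oo[ x U: the values on sets that are not contained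
   in [0, +oo[ x U are irrelevant. The second argument of poisson_prob is
   unused. *)
Record poisson_random_measure (F : R -> set (set T))
    (N : T -> {measure set (measurableTypeR R * U) -> \bar R}) : Prop := {
  prm_rv : forall A, time_slab `[0, +oo[ A -> measurable_fun setT (fun w => N w A : \bar R);
  prm_integer : forall A w, time_slab `[0, +oo[ A ->
    N w A = +oo%E \/ exists k : nat, N w A = (k%:R)%:E;
  prm_law : forall A, time_slab `[0, +oo[ A -> (intensity A < +oo)%E ->
    forall k : nat, P [set w | N w A = (k%:R)%:E] =
      poisson_prob (fine (intensity A)) 0 [set k];
  prm_law_infty : forall A, time_slab `[0, +oo[ A -> intensity A = +oo%E ->
    P [set w | N w A = +oo%E] = 1%E;
  prm_indep : forall n (A : 'I_n -> set (measurableTypeR R * U))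
      (B : 'I_n -> set (\bar R)),
    (forall i, time_slab `[0, +oo[ (A i)) -> trivIset setT A ->
    (forall i, measurable (B i)) ->
    P [set w | forall i, B i (N w (A i))] =
    (\prod_(i < n) P [set w | B i (N w (A i))])%E;
  prm_adapted : forall t A, 0 <= t -> time_slab `[0, t] A ->
    rv_wrt (F t) (fun w => N w A : \bar R);
  prm_future : forall s, 0 <= s ->
    indep_systems (F s)
      (sigma_gen (time_slab `]s, +oo[) (fun A w => N w A : \bar R)) }.

Definition cvg_in_prob (Y : nat -> T -> \bar R) :=
  forall e : R, 0 < e ->
    P [set w | (e%:E <= Y n w)%E] @[n --> \oo] --> 0%E.

(* The elementary predictable integrand (s, w) |-> coef w 1_{]lo, hi]}(s). *)
Record step := Step { lo : R; hi : R; coef : T -> R }.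

Definition step_ok (F : R -> set (set T)) (h : step) :=
  [/\ 0 <= lo h, lo h <= hi h, exists M, forall w, `|coef h w| <= M
    & rv_wrt (F (lo h)) (coef h : T -> measurableTypeR R)].

Definition step_val (h : step) (s : R) (w : T) : R :=
  coef h w * \1_(`]lo h, hi h]%classic) s.

Definition simple_int_bm (B : R -> T -> R) (H : seq step) (t : R) (w : T) : R :=
  \sum_(h <- H) coef h w *
    (B (Num.min (hi h) t) w - B (Num.min (lo h) t) w).

(* The pair (h, A) stands for (s, u, w) |-> coef h w 1_{]lo, hi]}(s) 1_A(u). *)
Definition jump_step_ok (F : R -> set (set T)) (h : step * set U) :=
  [/\ step_ok F h.1, measurable h.2 & (nu h.2 < +oo)%E].

Definition jump_val (H : seq (step * set U)) (s : R) (u : U) (w : T) : R :=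
  \sum_(h <- H) step_val h.1 s w * \1_(h.2) u.

Definition simple_int_jump
    (N : T -> {measure set (measurableTypeR R * U) -> \bar R})
    (H : seq (step * set U)) (t : R) (w : T) : R :=
  \sum_(h <- H) let a := Num.min (lo h.1) t in let b := Num.min (hi h.1) t in
    coef h.1 w *
      (fine (N w (`]a, b]%classic `*` h.2)) - (b - a) * fine (nu h.2)).

Definition ucp_limit (In : nat -> R -> T -> R) (I : R -> T -> R) :=
  forall t, 0 <= t -> cvg_in_prob (fun n w =>
    ereal_sup [set (`|In n s w - I s w|)%:E | s in `[0, t]]).

(* I is (a version of) the Ito integral of H against the scalar Brownian
   motion B: the limit, uniformly on compacts in probability, of the integrals
   of simple predictable processes that approximate H in L^2([0, t], ds) in
   probability, for every t. *)
Definition ito_integral (F : R -> set (set T)) (B H I : R -> T -> R) :=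
  [/\ adapted F (I : R -> T -> measurableTypeR R),
      forall w, path_cadlag (I ^~ w) &
  exists Hn : nat -> seq step,
  [/\ forall n h, List.In h (Hn n) -> step_ok F h,
      forall t, 0 <= t -> cvg_in_prob (fun n w =>
        \int[@lebesgue_measure R]_(s in `]0%R, t])
          ((\sum_(h <- Hn n) step_val h s w - H s w) ^+ 2)%:E)%E
    & ucp_limit (fun n => simple_int_bm B (Hn n)) I]].

(* The same for the compensated Poisson random measure, with approximation in
   L^2(]0, t] x U, ds nu(du)) in probability. *)
Definition compensated_integral (F : R -> set (set T))
    (N : T -> {measure set (measurableTypeR R * U) -> \bar R})
    (H : R -> U -> T -> R) (I : R -> T -> R) :=
  [/\ adapted F (I : R -> T -> measurableTypeR R),
      forall w, path_cadlag (I ^~ w) &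
  exists Hn : nat -> seq (step * set U),
  [/\ forall n h, List.In h (Hn n) -> jump_step_ok F h,
      forall t, 0 <= t -> cvg_in_prob (fun n w =>
        \int[@lebesgue_measure R]_(s in `]0%R, t]) \int[nu]_u
          ((jump_val (Hn n) s u w - H s u w) ^+ 2)%:E)%E
    & ucp_limit (fun n => simple_int_jump N (Hn n)) I]].

Definition solves_sde (n : nat) (b : 'cV[R]_n -> 'cV[R]_n)
    (sigma : 'cV[R]_n -> 'M[R]_n) (c : 'cV[R]_n -> U -> 'cV[R]_n)
    (x : 'cV[R]_n) (F : R -> set (set T)) (W : R -> T -> 'cV[R]_n)
    (N : T -> {measure set (measurableTypeR R * U) -> \bar R})
    (X : R -> T -> 'cV[R]_n) :=
  exists (IW : 'I_n -> 'I_n -> R -> T -> R) (IN : 'I_n -> R -> T -> R),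
  [/\ forall i j, ito_integral F (fun t w => W t w j ord0)
        (fun s w => sigma (X s w) i j) (IW i j),
      forall i, compensated_integral F N
        (fun s u w => c (left_lim (X ^~ w) s) u i ord0) (IN i)
    & {ae P, forall w, forall t i, 0 <= t ->
        X t w i ord0 = x i ord0
          + \int[@lebesgue_measure R]_(s in `[0, t]) b (X s w) i ord0
          + \sum_(j < n) IW i j t w + IN i t w}].

End jumps.
End stochastic_basis.

(* Non-explosion is built in: X takes its values in R^n at every time. *)
Record weak_solution (R : realType) (n : nat) dU (U : measurableType dU)
    (nu : {sigma_finite_measure set U -> \bar R})
    (b : 'cV[R]_n -> 'cV[R]_n) (sigma : 'cV[R]_n -> 'M[R]_n)
    (c : 'cV[R]_n -> U -> 'cV[R]_n) (x : 'cV[R]_n) := WeakSolution {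
  ws_disp : measure_display;
  ws_space : measurableType ws_disp;
  ws_prob : probability ws_space R;
  ws_filt : R -> set (set ws_space);
  ws_bm : R -> ws_space -> 'cV[R]_n;
  ws_prm : ws_space -> {measure set (measurableTypeR R * U) -> \bar R};
  ws_proc : R -> ws_space -> 'cV[R]_n;
  ws_usual : usual_filtration ws_prob ws_filt;
  ws_brownian : brownian ws_prob ws_filt ws_bm;
  ws_poisson : poisson_random_measure ws_prob nu ws_filt ws_prm;
  ws_indep : indep_systems ws_prob
    (sigma_gen [set t | 0 <= t] (ws_bm : R -> ws_space -> borel 'cV[R]_n))
    (sigma_gen (time_slab `[0, +oo[) (fun A w => ws_prm w A : \bar R));
  ws_adapted : adapted ws_filt (ws_proc : R -> ws_space -> borel 'cV[R]_n);
  ws_cadlag : forall w, path_cadlag (ws_proc ^~ w);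
  ws_sde : solves_sde ws_prob nu b sigma c x ws_filt ws_bm ws_prm ws_proc }.

Arguments ws_space {R n dU U nu b sigma c x} _.
Arguments ws_prob {R n dU U nu b sigma c x} _.
Arguments ws_filt {R n dU U nu b sigma c x} _ _ _.
Arguments ws_bm {R n dU U nu b sigma c x} _ _ _.
Arguments ws_prm {R n dU U nu b sigma c x} _ _.
Arguments ws_proc {R n dU U nu b sigma c x} _ _ _.

(* Equality of the laws on path space, for the sigma-algebra generated by the
   evaluations at times t >= 0; on cadlag paths it is the Borel sigma-algebra
   of the Skorokhod topology. *)
Definition same_law (R : realType) (n : nat) dU (U : measurableType dU)
    (nu : {sigma_finite_measure set U -> \bar R})
    (b : 'cV[R]_n -> 'cV[R]_n) (sigma : 'cV[R]_n -> 'M[R]_n)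
    (c : 'cV[R]_n -> U -> 'cV[R]_n) (x : 'cV[R]_n)
    (S1 S2 : weak_solution nu b sigma c x) :=
  forall A : set (R -> 'cV[R]_n),
    sigma_gen [set t | 0 <= t]
      (fun (t : R) (p : R -> 'cV[R]_n) => (p t : borel 'cV[R]_n)) A ->
    ws_prob S1 [set w | A (ws_proc S1 ^~ w)] =
    ws_prob S2 [set w | A (ws_proc S2 ^~ w)].

Definition semigroup (R : realType) (n : nat) dU (U : measurableType dU)
    (nu : {sigma_finite_measure set U -> \bar R})
    (b : 'cV[R]_n -> 'cV[R]_n) (sigma : 'cV[R]_n -> 'M[R]_n)
    (c : 'cV[R]_n -> U -> 'cV[R]_n)
    (X : forall x, weak_solution nu b sigma c x)
    (t : R) (f : 'cV[R]_n -> R) (x : 'cV[R]_n) : R :=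
  fine ('E_(ws_prob (X x)) [fun w => f (ws_proc (X x) t w)])%E.

Definition bounded_continuous (R : realType) (n : nat) (f : 'cV[R]_n -> R) :=
  continuous f /\ exists M : R, forall x, `|f x| <= M.

Definition feller_continuous (R : realType) (n : nat)
    (Q : R -> ('cV[R]_n -> R) -> 'cV[R]_n -> R) :=
  forall t f, 0 <= t -> bounded_continuous f -> bounded_continuous (Q t f).

(* A function from [0, +oo[ to [0, +oo[, nondecreasing, concave, positive on
   ]0, +oo[ and with a divergent integral of 1/rho at 0+. *)
Record osgood_modulus (R : realType) (rho : R -> R) : Prop := {
  osg_ge0 : forall r, 0 <= r -> 0 <= rho r;
  osg_gt0 : forall r, 0 < r -> 0 < rho r;
  osg_nd : forall r s, 0 <= r -> r <= s -> rho r <= rho s;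
  osg_concave :
    convex_function (E := R^o) `[0, +oo[%classic (fun r => - rho r);
  osg_div : forall e, 0 < e ->
    (\int[@lebesgue_measure R]_(r in `]0%R, e]) ((rho r)^-1)%:E = +oo)%E }.

Definition condition_a (R : realType) (d : nat) dU (U : measurableType dU)
    (nu : {sigma_finite_measure set U -> \bar R})
    (b : 'cV[R]_d -> 'cV[R]_d) (sigma : 'cV[R]_d -> 'M[R]_d)
    (c : 'cV[R]_d -> U -> 'cV[R]_d) :=
  (exists (delta0 : R) (rho : R -> R),
    [/\ 0 < delta0, osgood_modulus rho &
     forall K, 0 < K -> exists2 kappa, 0 < kappa &
     forall x z : 'cV[R]_d, Num.max (euc x) (euc z) <= K ->
       euc (x - z) <= delta0 ->
       2 * dotv (z - x) (b z - b x) + euc (sigma z - sigma x) ^+ 2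
         <= kappa * euc (z - x) * rho (euc (z - x)) /\
       (\int[nu]_u (euc (c z u - c x u))%:E
         <= (kappa * rho (euc (z - x)))%:E)%E]) /\
  (\int[nu]_u (euc (c 0%R u))%:E < +oo)%E.

Definition condition_b (R : realType) (d : nat) dU (U : measurableType dU)
    (nu : {sigma_finite_measure set U -> \bar R})
    (b : 'cV[R]_d -> 'cV[R]_d) (sigma : 'cV[R]_d -> 'M[R]_d)
    (c : 'cV[R]_d -> U -> 'cV[R]_d) :=
  exists (delta0 : R) (rho : R -> R),
    [/\ 0 < delta0, osgood_modulus rho,
     forall r, 0 < r -> rho r <= (1 + r) ^+ 2 * rho (r / (1 + r)) &
     forall K, 0 < K -> exists2 kappa, 0 < kappa &
     forall x z : 'cV[R]_d, Num.max (euc x) (euc z) <= K ->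
       euc (x - z) <= delta0 ->
       ((2 * dotv (x - z) (b x - b z) + euc (sigma x - sigma z) ^+ 2)%:E
         + \int[nu]_u (euc (c x u - c z u) ^+ 2)%:E
         <= (kappa * rho (euc (x - z) ^+ 2))%:E)%E].

(* Main.v *)
Require Import Defs.
From HB Require Import structures.
From mathcomp Require Import all_boot all_order all_algebra.
From mathcomp Require Import all_classical all_reals all_analysis.
From mathcomp Require Import measurable_realfun.
From mathcomp Require Import ring lra.
Set Implicit Arguments.
Unset Strict Implicit.
Unset Printing Implicit Defensive.
Import Order.TTheory GRing.Theory Num.Theory.
Import numFieldNormedType.Exports.
Local Open Scope classical_set_scope.
Local Open Scope ring_scope.

(** The increments of the Brownian motion and of the Poisson measure over a
    finite time grid have the same joint law on every basis, so an Euler scheme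
    [Y] with finitely many coefficient values, started at [z], has the same law
    on the basis of [X^x] and on that of [X^z]. On either basis, [Y] is close to
    the solution once [z] is close to [x] and the mesh is small: feeding the
    solution into the scheme gives an interpolant that is close to the solution
    (Lenglart's inequality), and the difference between [Y] and the interpolant
    is controlled by conditions (a) or (b) through a discrete Osgood inequality
    for [E sqrt (|D|^2 + eps^2)] or [E |D|^2]. Comparing both solutions with
    their own copy of [Y] gives the continuity of [P_t f] without any
    coupling of the two solutions. *)

(** * Expectations *)

(** Conditions (a) and (b) act on balls only, and nothing bounds the exit of [X z] from a ball
    uniformly in [z]. The scheme carries this information between the bases: [X x] stays within [K1]
    with high probability, so on its basis the scheme stays within [K1 + 1]; this event depends on
    the law of the increments only, hence is as likely on the basis of [X z], where it keeps [X z]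
    within [K1 + 2]. The order of choices matters: how close [z] must be to [x] is fixed before [z],
    whereas the net and the mesh may depend on [z]. Finitely many coefficient values make every
    function of the discretised state bounded and measurable, and reduce the jump noise to
    compensated counts of disjoint cells of finite measure. The square root in case (a) is forced by
    the jump hypothesis, an L1 bound: jumps enter through the triangle inequality, drift and
    Brownian part through the tangent of the root. All energy estimates are discrete and rest on
    conditional first and second moments of the increments. *)

Section expect.
Context (R : realType) d (T : measurableType d) (P : probability T R).
Implicit Types (f g : T -> R).

Definition L1 f := P.-integrable setT (EFin \o f).
Definition Ex f := (\int[P]_w f w).

Lemma L1_meas f : L1 f -> measurable_fun setT f.
Proof. by move=> /measurable_int /measurable_EFinP. Qed.

Lemma L1_ext f g : f =1 g -> L1 f -> L1 g.
Proof. by move=> /funext ->. Qed.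

Lemma Ex_ext f g : f =1 g -> Ex f = Ex g.
Proof. by move=> /funext ->. Qed.

Lemma L1_le f g : measurable_fun setT f -> L1 g -> (forall w, `|f w| <= g w) -> L1 f.
Proof.
move=> mf ig fg; apply: (le_integrable _ _ _ ig) => //; first exact/measurable_EFinP.
by move=> w _; rewrite /= lee_fin (le_trans (fg w))// ler_norm.
Qed.

Lemma L1_cst c : L1 (fun=> c).
Proof. exact: finite_measure_integrable_cst. Qed.

Lemma L1_bdd f M : measurable_fun setT f -> (forall w, `|f w| <= M) -> L1 f.
Proof. by move=> mf fM; exact: (L1_le mf (L1_cst M)). Qed.

Lemma L1D f g : L1 f -> L1 g -> L1 (fun w => f w + g w).
Proof. by move=> lf lg; exact: (integrableD measurableT lf lg). Qed.

Lemma L1Z c f : L1 f -> L1 (fun w => c * f w).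
Proof. by move=> lf; exact: (integrableZl measurableT c lf). Qed.

Lemma L1B f g : L1 f -> L1 g -> L1 (fun w => f w - g w).
Proof. by move=> lf lg; exact: (integrableB measurableT lf lg). Qed.

Lemma L1_norm f : L1 f -> L1 (fun w => `|f w|).
Proof. by move=> lf; exact: integrable_norm. Qed.

Lemma L1_sum (I : Type) (s : seq I) (p : pred I) (F : I -> T -> R) :
  (forall i, p i -> L1 (F i)) -> L1 (fun w => \sum_(i <- s | p i) F i w).
Proof.
move=> lF; elim: s => [|i s ih].
  by apply: (L1_ext _ (L1_cst 0)) => w; rewrite big_nil.
case pi : (p i); last by apply: (L1_ext _ ih) => w; rewrite big_cons pi.
by apply: (L1_ext _ (L1D (lF _ pi) ih)) => w; rewrite big_cons pi.
Qed.

Lemma L1M f g M : measurable_fun setT f -> (forall w, `|f w| <= M) -> L1 g ->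
  L1 (fun w => f w * g w).
Proof.
move=> mf fM lg; apply: (L1_le (g := fun w => M * `|g w|)).
- by apply: measurable_funM => //; exact: L1_meas.
- exact/L1Z/L1_norm.
- by move=> w; rewrite normrM ler_wpM2r.
Qed.

Lemma ExD f g : L1 f -> L1 g -> Ex (fun w => f w + g w) = Ex f + Ex g.
Proof. by move=> lf lg; rewrite /Ex RintegralD. Qed.

Lemma ExB f g : L1 f -> L1 g -> Ex (fun w => f w - g w) = Ex f - Ex g.
Proof. by move=> lf lg; rewrite /Ex RintegralB. Qed.

Lemma ExZ c f : L1 f -> Ex (fun w => c * f w) = c * Ex f.
Proof. by move=> lf; rewrite /Ex RintegralZl. Qed.

Lemma Ex_cst c : Ex (fun=> c) = c.
Proof.
rewrite /Ex Rintegral_cst// -[RHS]mulr1; congr (_ * _).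
by have := congr1 fine (probability_setT P).
Qed.

Lemma Ex_sum (I : Type) (s : seq I) (p : pred I) (F : I -> T -> R) :
  (forall i, p i -> L1 (F i)) ->
  Ex (fun w => \sum_(i <- s | p i) F i w) = \sum_(i <- s | p i) Ex (F i).
Proof.
move=> lF; elim: s => [|i s ih].
  by rewrite big_nil -[RHS](Ex_cst 0); apply: Ex_ext => w; rewrite big_nil.
rewrite big_cons; case pi : (p i).
  by rewrite -ih -ExD; [|exact: lF|exact: L1_sum]; apply: Ex_ext => w; rewrite big_cons pi.
by rewrite -ih; apply: Ex_ext => w; rewrite big_cons pi.
Qed.

Lemma Ex_le f g : L1 f -> L1 g -> (forall w, f w <= g w) -> Ex f <= Ex g.
Proof. by move=> lf lg fg; exact: le_Rintegral. Qed.

Lemma Ex_ge0 f : (forall w, 0 <= f w) -> 0 <= Ex f.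
Proof. by move=> f0; exact: Rintegral_ge0. Qed.

Lemma Ex_abs f : L1 f -> `|Ex f| <= Ex (fun w => `|f w|).
Proof. by move=> lf; exact: le_normr_Rintegral. Qed.

Lemma Ex_EFin f : L1 f -> (Ex f)%:E = (\int[P]_w (f w)%:E)%E.
Proof. by move=> lf; rewrite /Ex /Rintegral fineK//; exact: integrable_fin_num. Qed.

Lemma L1_indic A : measurable A -> L1 (\1_A).
Proof.
move=> mA; apply: (@L1_bdd _ 1); first exact: measurable_indic.
by move=> w; rewrite indicE; case: (_ \in _); rewrite ?normr1 ?normr0.
Qed.

Lemma Ex_indic A : measurable A -> Ex (\1_A) = fine (P A).
Proof. by move=> mA; rewrite /Ex /Rintegral integral_indic// setIT. Qed.

Lemma PfineK A : measurable A -> (fine (P A))%:E = P A.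
Proof. by move=> mA; rewrite fineK// fin_num_measure. Qed.

Lemma markov_ge f (a : R) : 0 < a -> L1 f -> (forall w, 0 <= f w) ->
  (P [set w | (a <= f w)%R] <= (Ex f / a)%:E)%E.
Proof.
move=> a0 lf f0.
have mf := L1_meas lf.
have mA : measurable [set w | a <= f w].
  rewrite -[X in measurable X]setTI.
  by have := measurable_fun_ler (measurable_cst a) mf; move=> /(_ measurableT [set true]); apply.
rewrite -PfineK// lee_fin ler_pdivlMr// mulrC -Ex_indic// -ExZ; last exact: L1_indic.
apply: Ex_le => //; first exact/L1Z/L1_indic.
move=> w; rewrite indicE; case: (boolP (w \in _)) => [/set_mem/= aw|_].
  by rewrite mulr1.
by rewrite mulr0.
Qed.

Definition L2 f := measurable_fun setT f /\ L1 (fun w => f w ^+ 2).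

Lemma L2M f g : L2 f -> L2 g -> L1 (fun w => f w * g w).
Proof.
move=> [mf f2] [mg g2]; apply: (L1_le (g := fun w => f w ^+ 2 + g w ^+ 2)).
- exact: measurable_funM.
- exact: L1D.
- move=> w; rewrite normrM -(real_normK (num_real (f w))) -(real_normK (num_real (g w))).
  have : 0 <= (`|f w| - `|g w|) ^+ 2 by exact: sqr_ge0.
  have : 0 <= `|f w| * `|g w| by exact: mulr_ge0.
  nra.
Qed.

Lemma L2_ext f g : f =1 g -> L2 f -> L2 g.
Proof. by move=> /funext ->. Qed.

Lemma L2_cst c : L2 (fun=> c).
Proof. by split; [exact: measurable_cst|exact: L1_cst]. Qed.

Lemma L2_L1 f : L2 f -> L1 f.
Proof.
by move=> lf; apply: (L1_ext _ (L2M lf (L2_cst 1))) => w; rewrite mulr1.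
Qed.

Lemma L2D f g : L2 f -> L2 g -> L2 (fun w => f w + g w).
Proof.
move=> lf lg; split; first by apply: measurable_funD; [case: lf|case: lg].
rewrite (_ : (fun w => _) = fun w => (f w ^+ 2 + g w ^+ 2) + 2 * (f w * g w)); last first.
  by apply/funext => w; ring.
by apply: L1D; [apply: L1D; [case: lf|case: lg]|exact/L1Z/L2M].
Qed.

Lemma L2Mb f g M : measurable_fun setT f -> (forall w, `|f w| <= M) -> L2 g ->
  L2 (fun w => f w * g w).
Proof.
move=> mf fM [mg lg]; split; first exact: measurable_funM.
rewrite (_ : (fun w => _) = fun w => f w ^+ 2 * g w ^+ 2); last first.
  by apply/funext => w; ring.
apply: (L1M (M := M ^+ 2)) => //; first exact: measurable_funX.
by move=> w; rewrite normrX ler_sqr// nnegrE (le_trans _ (fM w)).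
Qed.

Lemma L2Z c f : L2 f -> L2 (fun w => c * f w).
Proof. by apply: (L2Mb (M := `|c|)) => //; exact: measurable_cst. Qed.

Lemma L2B f g : L2 f -> L2 g -> L2 (fun w => f w - g w).
Proof.
move=> lf lg; rewrite (_ : (fun w => _) = fun w => f w + (-1) * g w); last first.
  by apply/funext => w; ring.
exact/L2D/L2Z.
Qed.

Lemma L2_sum (I : Type) (s : seq I) (p : pred I) (F : I -> T -> R) :
  (forall i, p i -> L2 (F i)) -> L2 (fun w => \sum_(i <- s | p i) F i w).
Proof.
move=> lF; elim: s => [|i s ih].
  by apply: (L2_ext _ (L2_cst 0)) => w; rewrite big_nil.
case pi : (p i); last by apply: (L2_ext _ ih) => w; rewrite big_cons pi.
by apply: (L2_ext _ (L2D (lF _ pi) ih)) => w; rewrite big_cons pi.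
Qed.

Lemma L2_bdd f M : measurable_fun setT f -> (forall w, `|f w| <= M) -> L2 f.
Proof.
by move=> mf fM; apply: (L2_ext _ (L2Mb mf fM (L2_cst 1))) => w; rewrite mulr1.
Qed.

(** The quadratic form [E (x f + y g)^2] is nonnegative; at [(a, - b)], with [a = E g^2] and
    [b = E (f g)], it is [a] times the gap of the inequality. *)
Lemma Ex_CS f g : L2 f -> L2 g ->
  Ex (fun w => f w * g w) ^+ 2 <= Ex (fun w => f w ^+ 2) * Ex (fun w => g w ^+ 2).
Proof.
move=> lf lg; set a := Ex (fun w => g w ^+ 2); set b := Ex (fun w => f w * g w).
set c := Ex (fun w => f w ^+ 2).
have key x y : 0 <= x ^+ 2 * c + 2 * (x * y) * b + y ^+ 2 * a.
  have := @Ex_ge0 (fun w => (x * f w + y * g w) ^+ 2) (fun w => sqr_ge0 _).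
  rewrite (_ : (fun w => _) = fun w => (x ^+ 2 * f w ^+ 2 + y ^+ 2 * g w ^+ 2)
     + 2 * (x * y) * (f w * g w)); last by apply/funext => w; ring.
  rewrite ExD; [|apply: L1D|]; last first.
  - exact/L1Z/L2M.
  - by apply: L1Z; case: lg.
  - by apply: L1Z; case: lf.
  rewrite ExD; [|by apply: L1Z; case: lf|by apply: L1Z; case: lg].
  rewrite !ExZ; [|exact: L2M|by case: lg|by case: lf].
  by rewrite -/a -/b -/c => h; apply: le_trans h _; rewrite le_eqVlt; apply/orP; left; apply/eqP; ring.
have a0 : 0 <= a by apply: Ex_ge0 => w; exact: sqr_ge0.
have [a00|an0] := eqVneq a 0.
  have c0 : 0 <= c by apply: Ex_ge0 => w; exact: sqr_ge0.
  suff -> : b = 0 by rewrite expr0n mulr_ge0.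
  apply/eqP/negPn/negP => bn0.
  (* When [E g^2 = 0] the form is affine in [y]; this value of [y] makes it equal to
     [- c - 2 < 0]. *)
  have := key 1 (- ((c + 1) / b)); rewrite a00.
  have -> : 1 ^+ 2 * c + 2 * (1 * - ((c + 1) / b)) * b + (- ((c + 1) / b)) ^+ 2 * 0 =
    - c - 2 by field.
  lra.
have a1 : 0 < a by rewrite lt_neqAle eq_sym an0.
have := key a (- b).
have -> : a ^+ 2 * c + 2 * (a * - b) * b + (- b) ^+ 2 * a = a * (c * a - b ^+ 2) by ring.
by rewrite pmulr_rge0// subr_ge0.
Qed.

End expect.

(** * Independence and weights measurable for a sub-sigma-algebra *)

Section independence.
Context (R : realType) d (T : measurableType d) (P : probability T R).

(** The joint law of [(f, g)] agrees with the product of the two laws on rectangles, hence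
    everywhere; Tonelli on the product gives the integrability and Fubini the value. *)
Lemma indep_Ex (f g : T -> R) : L1 P f -> L1 P g ->
  (forall A B, measurable A -> measurable B ->
     P (f @^-1` A `&` g @^-1` B) = (P (f @^-1` A) * P (g @^-1` B))%E) ->
  L1 P (fun w => f w * g w) /\ Ex P (fun w => f w * g w) = Ex P f * Ex P g.
Proof.
move=> lf lg ind.
have mf := L1_meas lf; have mg := L1_meas lg.
pose F : {mfun T >-> R} := HB.pack f (isMeasurableFun.Build _ _ _ _ _ mf).
pose G : {mfun T >-> R} := HB.pack g (isMeasurableFun.Build _ _ _ _ _ mg).
have mfg : measurable_fun setT (fun w => (f w, g w)) by exact: measurable_fun_pair.
pose FG : {mfun T >-> (R * R)%type} := HB.pack (fun w => (f w, g w))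
  (isMeasurableFun.Build _ _ _ _ _ mfg).
pose m1 := distribution P F; pose m2 := distribution P G; pose m := distribution P FG.
have mE X : measurable X -> (m1 \x m2)%E X = m X.
  by move=> mX; apply: product_measure_unique => // A B mA mB; exact: ind.
have lx : m1.-integrable setT EFin.
  by apply: integrable_pushforward => //; exact: EFin_measurable.
have ly : m2.-integrable setT EFin.
  by apply: integrable_pushforward => //; exact: EFin_measurable.
have mm : measurable_fun setT (fun z : R * R => (z.1 * z.2)%:E).
  apply/measurable_EFinP/measurable_funM; first exact: measurable_fst.
  exact: measurable_snd.
have im : (m1 \x m2)%E.-integrable setT (fun z : R * R => (z.1 * z.2)%:E).
  apply/integrable12ltyP => //=.
  rewrite (eq_integral (fun x : R => `|x|%:E * \int[m2]_y `|y|%:E)%E); last first.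
    move=> x _; rewrite -ge0_integralZl//=.
    - by apply: eq_integral => y _; rewrite normrM EFinM.
    - by apply/measurable_EFinP; exact: normr_measurable.
  rewrite ge0_integralZr//=.
  - apply: lte_mul_pinfty.
    + by apply: integral_ge0 => x _; rewrite lee_fin.
    + have /integrableP[_] := lx; rewrite -ge0_fin_numE//; exact: integral_ge0.
    + by have /integrableP[_] := ly.
  - by apply/measurable_EFinP; exact: normr_measurable.
  - by apply: integral_ge0 => x _; rewrite lee_fin.
have im' : m.-integrable setT (fun z : R * R => (z.1 * z.2)%:E).
  have /integrableP[_ h] := im; apply/integrableP; split => //.
  rewrite (eq_measure_integral (m1 \x m2)%E)// => A mA _.
  by apply/esym; exact: mE.
have lfg : L1 P (fun w => f w * g w).
  have /integrableP[_ h] := im'; apply/integrableP; split.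
    exact/measurable_EFinP/measurable_funM.
  move: h; rewrite ge0_integral_pushforward//.
  exact: measurableT_comp.
split => //; apply: EFin_inj; rewrite EFinM !Ex_EFin//.
transitivity (\int[m]_z (z.1 * z.2)%:E)%E.
  by rewrite integral_pushforward//.
rewrite (eq_measure_integral (m1 \x m2)%E); last first.
  by move=> A mA _; apply/esym; exact: mE.
rewrite -(integral12_prod_meas1 im) /=.
have -> : (\int[P]_w (f w)%:E = \int[m1]_x x%:E)%E.
  by rewrite integral_pushforward//; exact: EFin_measurable.
have -> : (\int[P]_w (g w)%:E = \int[m2]_x x%:E)%E.
  by rewrite integral_pushforward//; exact: EFin_measurable.
have fin2 : (\int[m2]_x x%:E)%E \is a fin_num by exact: integrable_fin_num.
rewrite (eq_integral (fun x : R => x%:E * \int[m2]_y y%:E)%E); last first.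
  by move=> x _; rewrite -integralZl//; apply: eq_integral => y _; rewrite EFinM.
by rewrite -(fineK fin2) integralZr.
Qed.

(** A filtration is a family of bare set systems, not of measurable types, so measurability with
    respect to [F t] is expressed by preimages; [GmP] translates it into a measurable function on
    the generated type when [G] is a sigma-algebra. *)
Definition Gm (G : set (set T)) (f : T -> R) :=
  forall B, measurable B -> G (f @^-1` B).

Section subsigma.
Variable G : set (set T).
Hypothesis sG : sigma_algebra setT G.
Hypothesis subG : G `<=` measurable.

Lemma GmP f : Gm G f <-> measurable_fun [set: g_sigma_algebraType G] f.
Proof.
split=> [h _ B mB|h B mB].
  by rewrite setTI; apply: sub_sigma_algebra; exact: h.
by rewrite -(sigma_algebra_id sG) -[X in <<s _ >> X]setTI; exact: h.
Qed.

Lemma Gm_meas f : Gm G f -> measurable_fun setT f.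
Proof. by move=> h _ B mB; rewrite setTI; exact/subG/h. Qed.

Lemma Gm_cst c : Gm G (fun=> c). Proof. by apply/GmP; exact: measurable_cst. Qed.

Lemma GmD f g : Gm G f -> Gm G g -> Gm G (fun w => f w + g w).
Proof. by move=> /GmP mf /GmP mg; apply/GmP; exact: measurable_funD. Qed.

Lemma GmB f g : Gm G f -> Gm G g -> Gm G (fun w => f w - g w).
Proof. by move=> /GmP mf /GmP mg; apply/GmP; exact: measurable_funB. Qed.

Lemma GmM f g : Gm G f -> Gm G g -> Gm G (fun w => f w * g w).
Proof. by move=> /GmP mf /GmP mg; apply/GmP; exact: measurable_funM. Qed.

Lemma Gm_sum (I : Type) (s : seq I) (p : pred I) (F : I -> T -> R) :
  (forall i, Gm G (F i)) -> Gm G (fun w => \sum_(i <- s | p i) F i w).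
Proof.
move=> GF; elim: s => [|i s ih].
  by rewrite (_ : (fun w => _) = fun=> 0); [exact: Gm_cst|apply/funext => w; rewrite big_nil].
rewrite (_ : (fun w => _) = fun w => if p i then F i w + \sum_(j <- s | p j) F j w
   else \sum_(j <- s | p j) F j w); last by apply/funext => w; rewrite big_cons.
by case: (p i) => //; exact: GmD.
Qed.

Lemma Gm_indic A : G A -> Gm G (\1_A).
Proof.
move=> GA; apply/GmP; apply: measurable_indic.
by rewrite /measurable/= (sigma_algebra_id sG).
Qed.

Lemma Gm_comp (h : R -> R) f : measurable_fun setT h -> Gm G f -> Gm G (h \o f).
Proof. by move=> mh /GmP mf; apply/GmP; exact: measurableT_comp. Qed.

(* A G-measurable bounded function is a uniform limit of G-measurable functions
   with finitely many values, so averages over the sets of G determine the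
   averages against it. *)
Lemma Gm_Ex (Z : T -> R) (k : R) (xi : T -> R) (M : R) : L1 P Z ->
  (forall A, G A -> Ex P (fun w => \1_A w * Z w) = k * fine (P A)) ->
  Gm G xi -> (forall w, `|xi w| <= M) ->
  Ex P (fun w => xi w * Z w) = k * Ex P xi.
Proof.
move=> lZ hZ Gxi xiM.
have M0 : 0 <= M by apply: le_trans (xiM point).
have mxi := Gm_meas Gxi.
apply/eqP; rewrite -subr_eq0 -normr_eq0; apply/negPn/negP => nz.
set D := `|_| in nz.
(* [C] exceeds [E |Z| + |k|] by [1], and [e] will be [D / (2 C)]: approximating [xi] within [e]
   leaves an error [e (C - 1) < D / 2], against the supposed gap [D > 0]. *)
pose C := Ex P (fun w => `|Z w|) + `|k| + 1.
have C0 : 0 < C.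
  by rewrite ltr_pwDr// addr_ge0//; exact: Ex_ge0.
have D0 : 0 < D by rewrite lt_neqAle eq_sym nz normr_ge0.
pose e := D / (2 * C).
have e0 : 0 < e by rewrite divr_gt0// mulr_gt0.
pose N := (Num.truncn (2 * M / e)).+1.
pose S (i : nat) := [set w | i%:R * e <= xi w + M < i.+1%:R * e].
have GS i : G (S i).
  rewrite (_ : S i = xi @^-1` `[i%:R * e - M, i.+1%:R * e - M[); first exact: Gxi.
  apply/seteqP; split => w; rewrite /S/= in_itv/= => /andP[a b]; apply/andP; split; lra.
pose xin := fun w => \sum_(i < N) (i%:R * e - M) * \1_(S i) w.
have Sx w : exists2 i : 'I_N, S i w & forall j : 'I_N, j != i -> ~ S j w.
  have xm : 0 <= xi w + M by have := xiM w; rewrite ler_norml => /andP[]; lra.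
  have h := Num.Theory.truncn_itv (divr_ge0 xm (ltW e0)).
  move: h => /andP[h1 h2].
  have iN : (Num.truncn ((xi w + M) / e) < N)%N.
    rewrite ltnS le_truncn//; apply: ler_wpM2r; first by rewrite invr_ge0 ltW.
    by have := xiM w; rewrite ler_norml => /andP[]; lra.
  exists (Ordinal iN); first by rewrite /S/= -ler_pdivlMr// -ltr_pdivrMr// h1 h2.
  move=> j ji; rewrite /S/= -ler_pdivlMr// -ltr_pdivrMr// => /truncn_def E.
  by move/eqP: ji; apply; apply/val_inj; rewrite /= E.
have xine w : `|xi w - xin w| <= e.
  have [i Si Sj] := Sx w.
  rewrite /xin (bigD1 i)//= big1 ?addr0; last first.
    by move=> j /Sj nS; rewrite indicE memNset// mulr0.
  rewrite indicE mem_set// mulr1; move: Si; rewrite /S/= -natr1 mulrDl mul1r => /andP[a b].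
  by rewrite ler_norml; apply/andP; split; lra.
have Gxin : Gm G xin.
  by apply: Gm_sum => i; apply: GmM; [exact: Gm_cst|exact/Gm_indic/GS].
have lxi : L1 P xi by exact: (@L1_bdd _ _ _ _ _ M).
have lS i : L1 P (\1_(S i)) by apply/L1_indic/subG/GS.
have lxin : L1 P xin by apply: L1_sum => i _; exact: L1Z.
have lxZ : L1 P (fun w => xi w * Z w) by apply: L1M (xiM) lZ.
have lSZ i : L1 P (fun w => \1_(S i) w * Z w).
  apply: (L1M (M := 1)) => //; first exact/Gm_meas/Gm_indic/GS.
  by move=> w; rewrite indicE; case: (_ \in _); rewrite ?normr1 ?normr0.
have xinZE : (fun w => xin w * Z w) =1
    fun w => \sum_(i < N) (i%:R * e - M) * (\1_(S i) w * Z w).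
  by move=> w /=; rewrite /xin mulr_suml; apply: eq_bigr => i _; exact: (esym (mulrA _ _ _)).
have lxinZ : L1 P (fun w => xin w * Z w).
  apply: (@L1_ext _ _ _ _ (fun w => \sum_(i < N) (i%:R * e - M) * (\1_(S i) w * Z w))).
    by move=> w; rewrite xinZE.
  by apply: L1_sum => i _; exact: L1Z.
have E1 : Ex P (fun w => xin w * Z w) = k * Ex P xin.
  rewrite (Ex_ext _ xinZE) Ex_sum; last by move=> i _; exact: L1Z.
  rewrite /xin Ex_sum; last by move=> i _; exact: L1Z.
  rewrite mulr_sumr; apply: eq_bigr => i _.
  rewrite !ExZ// Ex_indic; last exact/subG/GS.
  by rewrite hZ; [rewrite mulrCA|exact: GS].
have : D <= e * Ex P (fun w => `|Z w|) + `|k| * e.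
  have E2 : Ex P (fun w => xi w * Z w) - k * Ex P xi =
      Ex P (fun w => (xi w - xin w) * Z w) - k * Ex P (fun w => xi w - xin w).
    rewrite ExB// (@Ex_ext _ _ _ _ (fun w => (xi w - xin w) * Z w)
      (fun w => xi w * Z w - xin w * Z w)); last by move=> w; rewrite mulrBl.
    by rewrite ExB// E1; ring.
  rewrite /D E2.
  apply: le_trans (ler_normB _ _) _; apply: lerD.
    apply: le_trans (Ex_abs _) _.
      apply: (L1_ext (f := fun w => xi w * Z w - xin w * Z w)).
        by move=> w; rewrite mulrBl.
      exact: L1B.
    rewrite -ExZ; last exact: L1_norm.
    apply: Ex_le; [|exact/L1Z/L1_norm|].
      apply: L1_norm; apply: (L1_ext (f := fun w => xi w * Z w - xin w * Z w)).
        by move=> w; rewrite mulrBl.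
      exact: L1B.
    by move=> w; rewrite normrM ler_wpM2r.
  rewrite normrM ler_wpM2l//.
  apply: le_trans (Ex_abs _) _; first exact: L1B.
  rewrite -[leRHS](Ex_cst P); apply: Ex_le => //; first exact/L1_norm/L1B.
  exact: L1_cst.
have -> : e * Ex P (fun w => `|Z w|) + `|k| * e = e * (C - 1) by rewrite /C; ring.
have : e * (C - 1) < e * C by rewrite ltr_pM2l// ltrBlDr ltrDl.
have -> : e * C = D / 2 by rewrite /e; field; rewrite gt_eqF.
by move=> a b; lra.
Qed.

End subsigma.
End independence.

(** * Gaussian and Poisson moments *)

Section gaussian.
Context (R : realType).
Local Notation mu := (@lebesgue_measure R).
Variable s : R.
Hypothesis s0 : 0 < s.

(** [normal_prob] integrates [normal_pdf] by definition. Functions with equal integrals over all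
    measurable sets agree almost everywhere, so the density may replace the Radon-Nikodym derivative
    under the integral. *)
Lemma ge0_integral_normal (h : R -> \bar R) :
  measurable_fun setT h -> (forall x, 0 <= h x)%E ->
  (\int[normal_prob 0 s]_x h x = \int[mu]_x (h x * (normal_pdf 0 s x)%:E))%E.
Proof.
move=> mh h0; have dom := @normal_prob_dominates R 0 s.
pose g := Radon_Nikodym_SigmaFinite.f (normal_prob 0 s : {finite_measure set _ -> \bar R}) mu.
have ig : mu.-integrable setT g by exact: Radon_Nikodym_SigmaFinite.f_integrable.
have aeg : ae_eq mu setT g (fun x => (normal_pdf 0 s x)%:E).
  apply: integral_ae_eq => //.
    by apply/measurable_EFinP; exact: measurable_normal_pdf.
  by move=> E _ mE; rewrite -Radon_Nikodym_SigmaFinite.f_integral.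
rewrite -(Radon_Nikodym_SigmaFinite.change_of_variables dom) //.
apply: ge0_ae_eq_integral => //.
- by apply: emeasurable_funM => //; exact: measurable_int ig.
- by apply: emeasurable_funM => //; apply/measurable_EFinP; exact: measurable_normal_pdf.
- by move=> x _; rewrite mule_ge0//; exact: Radon_Nikodym_SigmaFinite.f_ge0.
- by move=> x _; rewrite mule_ge0// lee_fin normal_pdf_ge0.
- by apply: filterS aeg => x /(_ Logic.I) gx _; congr (_ * _)%E; exact: gx.
Qed.

End gaussian.

Section gaussian_moments.
Context (R : realType).
Local Notation mu := (@lebesgue_measure R).

(** With [u = x^2 (s^-2 - r^-2) / 2], the right-hand side is [exp u] times [s * normal_pdf 0 s x],
    and [1 + u <= exp u]. Integrated over [x] for varying [r], this inequality determines the second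
    moment. *)
Lemma normal_pdf_change (s r x : R) : 0 < s -> 0 < r ->
  s * normal_pdf 0 s x * (1 + x ^+ 2 * ((s ^+ 2)^-1 - (r ^+ 2)^-1) / 2) <=
  r * normal_pdf 0 r x.
Proof.
move=> s0 r0.
have pk (t : R) : 0 < t -> t * normal_peak t = (Num.sqrt (pi *+ 2))^-1.
  move=> t0; rewrite /normal_peak -mulrnAr sqrtrM ?sqr_ge0// sqrtr_sqr gtr0_norm//.
  by rewrite invfM mulrA divff ?mul1r// gt_eqF.
rewrite !normal_pdfE ?gt_eqF// !mulrA pk// pk// -mulrA ler_wpM2l ?invr_ge0//.
rewrite /normal_fun !subr0.
set u := x ^+ 2 * _ / 2.
have -> : - x ^+ 2 / (r ^+ 2 *+ 2) = - x ^+ 2 / (s ^+ 2 *+ 2) + u.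
  by rewrite /u; field; rewrite !gt_eqF.
by rewrite expRD ler_wpM2l ?expR_ge0// expR_ge1Dx.
Qed.

Let m2 (s : R) := \int[mu]_x (x ^+ 2 * normal_pdf 0 s x).

Let im2 s : 0 < s -> mu.-integrable setT (fun x => (x ^+ 2 * normal_pdf 0 s x)%:E).
Proof.
move=> s0.
(* Taking [r = 2 s] in [normal_pdf_change] and dropping the summand [1] gives
   [3 / (8 s) x^2 pdf_s <= 2 s pdf_2s], whence the factor [16 / 3 s^2]. *)
have i2 := integrableZl measurableT (16 / 3 * s ^+ 2) (integrable_normal_pdf 0 (2 * s)).
apply: (le_integrable _ _ _ i2) => //.
  apply/measurable_EFinP/measurable_funM; last exact: measurable_normal_pdf.
  exact: measurable_funX.
move=> x _ /=; rewrite lee_fin !ger0_norm; last 2 first.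
  by rewrite !mulr_ge0 ?normal_pdf_ge0 ?invr_ge0 ?ltW// exprn_gt0.
  by rewrite mulr_ge0 ?sqr_ge0 ?normal_pdf_ge0.
have s20 : 0 < 2 * s by rewrite mulr_gt0.
have := normal_pdf_change x s0 s20.
have -> : (s ^+ 2)^-1 - ((2 * s) ^+ 2)^-1 = 3 / 4 / s ^+ 2 by field; rewrite gt_eqF.
set a := normal_pdf 0 s x; set b := normal_pdf 0 (2 * s) x => h.
have a0 : 0 <= a by exact: normal_pdf_ge0.
have : s * a * (x ^+ 2 * (3 / 4 / s ^+ 2) / 2) <= 2 * s * b.
  apply: le_trans h; apply: ler_wpM2l; first exact: mulr_ge0 (ltW s0) a0.
  by rewrite lerDr ler01.
have -> : s * a * (x ^+ 2 * (3 / 4 / s ^+ 2) / 2) = (x ^+ 2 * a) * (3 / (8 * s)).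
  by field; rewrite gt_eqF.
rewrite -ler_pdivlMr ?divr_gt0 ?mulr_gt0// => /le_trans; apply.
by rewrite le_eqVlt; apply/orP; left; apply/eqP; field; rewrite gt_eqF.
Qed.

Let m2_le s r : 0 < s -> 0 < r ->
  s + s * ((s ^+ 2)^-1 - (r ^+ 2)^-1) / 2 * m2 s <= r.
Proof.
move=> s0 r0.
have p1 t : \int[mu]_x normal_pdf 0 t x = 1 by rewrite /Rintegral integral_normal_pdf.
set k := s * _ / 2.
have -> : s + k * m2 s = \int[mu]_x (s * normal_pdf 0 s x + k * (x ^+ 2 * normal_pdf 0 s x)).
  rewrite RintegralD//; last 2 first.
  - exact: (integrableZl measurableT s (integrable_normal_pdf 0 s)).
  - exact: (integrableZl measurableT k (im2 s0)).
  rewrite RintegralZl//; last exact: integrable_normal_pdf.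
  by rewrite RintegralZl//; [rewrite p1 mulr1|exact: im2].
have -> : r = \int[mu]_x (r * normal_pdf 0 r x).
  rewrite RintegralZl//; last exact: integrable_normal_pdf.
  by rewrite p1 mulr1.
apply: le_Rintegral => //.
- have I1 := integrableZl measurableT s (integrable_normal_pdf 0 s).
  exact: (integrableD measurableT I1 (integrableZl measurableT k (im2 s0))).
- exact: (integrableZl measurableT r (integrable_normal_pdf 0 r)).
- move=> x _; apply: le_trans (normal_pdf_change x s0 r0).
  by rewrite le_eqVlt; apply/orP; left; apply/eqP; rewrite /k; ring.
Qed.

(* Comparing the density of variance [s ^+ 2] with the one of variance [m2 s]
   by [1 + y <= exp y] leaves no room for [m2 s != s ^+ 2]. *)
Let m2E s : 0 < s -> m2 s = s ^+ 2.
Proof.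
move=> s0.
have mpos : 0 < m2 s.
  (* At [r = s / 2] the coefficient of [m2 s] is negative and the bound reads
     [3 / (2 s) m2 s >= s / 2]. *)
  have := @m2_le s (s / 2) s0 (divr_gt0 s0 (ltr0n _ 2)).
  have -> : s * ((s ^+ 2)^-1 - ((s / 2) ^+ 2)^-1) / 2 = - (3 / (2 * s)) by field; rewrite gt_eqF.
  rewrite mulNr => h.
  have : 0 < 3 / (2 * s) * m2 s by lra.
  by rewrite pmulr_rgt0// divr_gt0// mulr_gt0.
(* For this [r] the left-hand side of [m2_le] is [r + (r - s)^2 / (2 s)], which forces [r = s]. *)
pose r := Num.sqrt (m2 s).
have r0 : 0 < r by rewrite sqrtr_gt0.
have r2 : m2 s = r ^+ 2 by rewrite sqr_sqrtr// ltW.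
have := m2_le s0 r0; rewrite r2.
have -> : s + s * ((s ^+ 2)^-1 - (r ^+ 2)^-1) / 2 * r ^+ 2 = r + (r - s) ^+ 2 / (2 * s).
  by field; rewrite !gt_eqF.
rewrite gerDl pmulr_lle0 ?invr_gt0 ?mulr_gt0// => h.
have : (r - s) ^+ 2 == 0 by rewrite eq_le h sqr_ge0.
by rewrite sqrf_eq0 subr_eq0 => /eqP ->.
Qed.

Variables (d : measure_display) (T : measurableType d) (P : probability T R).

Lemma normal_second_moment (Z : T -> R) (s : R) : 0 < s -> measurable_fun setT Z ->
  (forall B, measurable B -> P (Z @^-1` B) = normal_prob 0 s B) ->
  L2 P Z /\ Ex P (fun w => Z w ^+ 2) = s ^+ 2.
Proof.
move=> s0 mZ ZE.
have E2 : (\int[P]_w (Z w ^+ 2)%:E = (s ^+ 2)%:E)%E.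
  have msq : measurable_fun setT (fun x : R => (x ^+ 2)%:E).
    by apply/measurable_EFinP; exact: measurable_funX.
  pose F : {mfun T >-> measurableTypeR R} := HB.pack (Z : T -> measurableTypeR R)
    (isMeasurableFun.Build _ _ T (measurableTypeR R) Z mZ).
  transitivity (\int[distribution P F]_x (x ^+ 2)%:E)%E.
    by rewrite ge0_integral_pushforward// => x _; rewrite lee_fin sqr_ge0.
  transitivity (\int[normal_prob 0 s]_x (x ^+ 2)%:E)%E.
    by apply: eq_measure_integral => A mA _; exact: ZE.
  rewrite ge0_integral_normal//; last by move=> x; rewrite lee_fin sqr_ge0.
  rewrite -(m2E s0) /m2 /Rintegral fineK//.
  exact: integrable_fin_num (im2 s0).
have l2 : L2 P Z.
  split => //; apply/integrableP; split.
    exact/measurable_EFinP/measurable_funX.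
  under eq_integral do rewrite /= ger0_norm ?sqr_ge0//.
  by rewrite E2 ltry.
by split => //; rewrite /Ex /Rintegral E2.
Qed.

Lemma normal_prob_symmetric (s : R) (B : set R) : 0 < s -> measurable B ->
  normal_prob 0 s (-%R @^-1` B) = normal_prob 0 s B.
Proof.
move=> s0 mB; rewrite /normal_prob.
have mo : measurable_fun setT (-%R : R -> R) by exact: oppr_measurable.
transitivity (\int[pushforward mu (-%R : _ -> measurableTypeR R)]_(x in B)
    (normal_pdf 0 s x)%:E)%E; last first.
  by apply: eq_measure_integral => A mA _; exact: lebesgue_measureN.
rewrite ge0_integral_pushforward//.
- by apply: eq_integral => x _; rewrite /= !normal_pdfE ?gt_eqF// /normal_fun !subr0 sqrrN.
- by apply/measurable_EFinP/measurable_funTS; exact: measurable_normal_pdf.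
- by move=> x _; rewrite lee_fin normal_pdf_ge0.
Qed.

(** [Z] and [- Z] have the same law by symmetry of the density, so the mean equals its opposite. *)
Lemma normal_first_moment (Z : T -> R) (s : R) : 0 < s -> measurable_fun setT Z ->
  (forall B, measurable B -> P (Z @^-1` B) = normal_prob 0 s B) -> Ex P Z = 0.
Proof.
move=> s0 mZ ZE.
have lZ := L2_L1 (normal_second_moment s0 mZ ZE).1.
suff : Ex P Z = Ex P (fun w => -1 * Z w) by rewrite ExZ//; lra.
apply: EFin_inj; rewrite !Ex_EFin//; last exact: L1Z.
have mE : measurable_fun setT (@EFin R) by exact: EFin_measurable.
pose F : {mfun T >-> measurableTypeR R} := HB.pack (Z : T -> measurableTypeR R)
    (isMeasurableFun.Build _ _ T (measurableTypeR R) Z mZ).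
have lN : L1 P (fun w => -1 * Z w) by exact: L1Z.
pose G : {mfun T >-> measurableTypeR R} := HB.pack (fun w => -1 * Z w : measurableTypeR R)
  (isMeasurableFun.Build _ _ T (measurableTypeR R) (fun w => -1 * Z w) (L1_meas lN)).
transitivity (\int[distribution P F]_x x%:E)%E.
  by rewrite integral_pushforward.
rewrite (eq_measure_integral (distribution P G)); last first.
  move=> A mA _; rewrite /= /distribution /= /pushforward ZE// -normal_prob_symmetric//.
  rewrite -ZE; last by rewrite -[X in measurable X]setTI; exact: oppr_measurable.
  by congr (P _); apply/seteqP; split => w /=; rewrite mulN1r.
by rewrite integral_pushforward.
Qed.

End gaussian_moments.

(** * Moments of a Poisson count *)

Section poisson_moments.
Context (R : realType) d (T : measurableType d) (P : probability T R).
Variables (la : R) (K : T -> \bar R).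
Hypothesis la0 : 0 <= la.
Hypothesis mK : measurable_fun setT K.
Hypothesis KE : forall k : nat,
  P [set w | K w = (k%:R)%:E] = poisson_prob la 0 [set k].

Let p (k : nat) : R := la ^+ k / k`!%:R * expR (- la).

Let p0 k : 0 <= p k.
Proof. by rewrite !mulr_ge0 ?invr_ge0 ?exprn_ge0 ?expR_ge0. Qed.

Let pE k : poisson_prob la 0 [set k] = (p k)%:E.
Proof.
rewrite /poisson_prob; case: ifPn => [l0|].
  by rewrite esum_set1 ?lee_fin ?poisson_pmf_ge0// /poisson_pmf l0.
(* Unless the rate is positive, [poisson_prob] is the Dirac mass at [0]; at rate [0] the formula for
   [p] agrees with it because [0 ^+ 0 = 1]. *)
rewrite -leNgt => l0; rewrite /p; have -> : la = 0 by apply/eqP; rewrite eq_le l0 la0.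
rewrite diracE; case: k => [|k].
  by rewrite mem_set// expr0 fact0 divr1 oppr0 expR0 mulr1.
by rewrite memNset//= expr0n/= !mul0r.
Qed.

(** The factor [k + 1] shifts the Poisson weights: the first moment follows from the total mass, and
    the second from the first moment and the total mass. *)
Let pS k : k.+1%:R * p k.+1 = la * p k.
Proof.
rewrite /p factS natrM exprS; field.
by rewrite !pnatr_eq0 -lt0n fact_gt0 nat1r pnatr_eq0.
Qed.

Let F (k : nat) := [set w | K w = (k%:R)%:E].

Let mF k : measurable (F k).
Proof. by rewrite -[F k]setTI; exact: (mK measurableT (emeasurable_set1 _)). Qed.

Let tF : trivIset setT F.
Proof.
apply/trivIsetP => i j _ _ ij; apply/seteqP; split => // w [/=]; rewrite /F/= => -> [] /eqP.
by rewrite eqr_nat (negbTE ij).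
Qed.

Let sum_p : (\sum_(k <oo) (p k)%:E = 1)%E.
Proof.
have := @probability_setT _ _ _ (poisson_prob la 0 : probability nat R).
rewrite (_ : setT = \bigcup_k [set k]); last by apply/seteqP; split => // x _; exists x.
rewrite measure_bigcup//=; last first.
  by apply/trivIsetP => i j _ _ ij; apply/seteqP; split => // w [/= ->] /eqP; rewrite (negbTE ij).
by under eq_eseriesl do rewrite in_setT; under eq_eseriesr do rewrite pE.
Qed.

Let mD : measurable (\bigcup_k F k).
Proof. exact: bigcupT_measurable. Qed.

(** Only the point masses at the integers are given; since they already sum to [1], every other
    value, [+oo] included, carries no mass. *)
Lemma poisson_ae_nat : P (\bigcup_k F k) = 1%E.
Proof.
rewrite measure_bigcup//=; under eq_eseriesl do rewrite in_setT.
by rewrite -sum_p; apply: eq_eseriesr => k _; rewrite KE pE.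
Qed.

Let pC : P (~` \bigcup_k F k) = 0%E.
Proof. by rewrite probability_setC// poisson_ae_nat subee. Qed.

Lemma poisson_ae_fin : P [set w | K w = +oo%E] = 0%E.
Proof.
have mI : measurable [set w | K w = +oo%E].
  by rewrite -[X in measurable X]setTI; exact: (mK measurableT (emeasurable_set1 _)).
apply/eqP; rewrite eq_le measure_ge0 andbT.
rewrite -pC; apply: le_measure; rewrite ?inE//; first exact: measurableC.
by move=> w /= Kw [k _]; rewrite /F/= Kw.
Qed.

Lemma ge0_integral_poisson (h : R -> R) : measurable_fun setT h -> (forall x, 0 <= h x) ->
  (\int[P]_w (h (fine (K w)))%:E = \sum_(k <oo) (h k%:R * p k)%:E)%E.
Proof.
move=> mh h0.
have mhK : measurable_fun setT (fun w => (h (fine (K w)))%:E).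
  apply/measurable_EFinP; apply: measurableT_comp => //.
  by apply: measurableT_comp => //; exact: fine_measurable.
have -> : (\int[P]_w (h (fine (K w)))%:E = \int[P]_(w in \bigcup_k F k) (h (fine (K w)))%:E)%E.
  rewrite (ge0_negligible_integral (measurableC mD))//.
  - by rewrite setTD setCK.
  - by move=> x _; rewrite lee_fin.
rewrite ge0_integral_bigcup//; last 2 first.
- exact: measurable_funTS.
- by move=> x _; rewrite lee_fin.
apply: eq_eseriesr => k _.
transitivity (\int[P]_(w in F k) (h k%:R)%:E)%E.
  by apply: eq_integral => w; rewrite inE /F/= => ->.
by rewrite integral_cst// EFinM -pE -KE.
Qed.

Let recl (f : nat -> \bar R) : (forall k, 0 <= f k)%E ->
  (\sum_(k <oo) f k = f 0%N + \sum_(k <oo) f k.+1)%E.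
Proof.
move=> f0; rewrite nneseries_recl// -(nneseries_addn 1)//; congr (_ + _)%E.
by apply: eq_eseriesr => k _; rewrite addn1.
Qed.

Let m1 : (\sum_(k <oo) (k%:R * p k)%:E = la%:E)%E.
Proof.
rewrite recl; last by move=> k; rewrite lee_fin mulr_ge0.
rewrite mul0r add0e.
under eq_eseriesr => k _ do rewrite pS EFinM.
rewrite nneseriesZl//; last by move=> k _; rewrite lee_fin.
by rewrite sum_p mule1.
Qed.

Let m2 : (\sum_(k <oo) (k%:R ^+ 2 * p k)%:E = (la ^+ 2 + la)%:E)%E.
Proof.
rewrite recl; last by move=> k; rewrite lee_fin mulr_ge0// sqr_ge0.
rewrite expr0n/= mul0r add0e.
rewrite (eq_eseriesr (g := fun k => la%:E * ((k%:R * p k)%:E + (p k)%:E))%E); last first.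
  by move=> k _; rewrite -EFinD -EFinM; congr EFin; rewrite expr2 -mulrA pS -natr1; ring.
rewrite nneseriesZl//; last by move=> k _; rewrite adde_ge0// lee_fin// mulr_ge0.
rewrite nneseriesD//; [|by move=> k _ _; rewrite lee_fin mulr_ge0|by move=> k _ _; rewrite lee_fin].
by rewrite m1 sum_p -EFinD -EFinM; congr EFin; ring.
Qed.

Lemma poisson_moments : [/\ L2 P (fun w => fine (K w)), Ex P (fun w => fine (K w)) = la
  & Ex P (fun w => fine (K w) ^+ 2) = la ^+ 2 + la].
Proof.
have mfK : measurable_fun setT (fun w => fine (K w)).
  by apply: measurableT_comp => //; exact: fine_measurable.
have E2 : (\int[P]_w (fine (K w) ^+ 2)%:E = (la ^+ 2 + la)%:E)%E.
  by rewrite (ge0_integral_poisson (h := fun x => x ^+ 2) (@exprn_measurable R setT 2) (@sqr_ge0 _)).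
have l2 : L2 P (fun w => fine (K w)).
  split => //; apply/integrableP; split.
    exact/measurable_EFinP/measurable_funX.
  under eq_integral do rewrite /= ger0_norm ?sqr_ge0//.
  by rewrite E2 ltry.
split => //; last by rewrite /Ex /Rintegral E2.
(* [ge0_integral_poisson] requires a function that is nonnegative on the whole line, so it is
   applied to the norm; off a null set [K] is a natural number and the norm can be removed. *)
have E1 : (\int[P]_w `|fine (K w)|%:E = la%:E)%E.
  rewrite (ge0_integral_poisson (h := Num.norm))//.
  by under eq_eseriesr do rewrite ger0_norm//.
rewrite /Ex /Rintegral -[RHS]/(fine la%:E) -E1; congr fine.
apply: ae_eq_integral => //.
- exact/measurable_EFinP.
- by apply/measurable_EFinP; exact: measurableT_comp.
exists (~` \bigcup_k F k); split.
- exact: measurableC.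
- exact: pC.
- move=> w /= nw [k _]; rewrite /F/= => Kw; apply: nw => _.
  by rewrite Kw/= ger0_norm.
Qed.

End poisson_moments.

(** * Increments of the driving noise *)

Lemma borel_continuous (R : realType) (S : ptopologicalType) (f : S -> R) :
  continuous f -> measurable_fun [set: borel S] f.
Proof.
move=> cf; apply: (measurability _ (RGenOInfty.measurableE R)).
move=> /= _ [_ [a ->]] <-; rewrite setTI; apply: sub_sigma_algebra.
apply: open_comp; last exact: interval_open.
by move=> x _; exact: cf.
Qed.

Section noise.
Context (R : realType) d (T : measurableType d) (P : probability T R).
Context dU (U : measurableType dU) (nu : {sigma_finite_measure set U -> \bar R}).
Variables (n : nat) (F : R -> set (set T)) (W : R -> T -> 'cV[R]_n).
Variable N : T -> {measure set (measurableTypeR R * U) -> \bar R}.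
Hypothesis hF : usual_filtration P F.
Hypothesis hW : brownian P F W.
Hypothesis hN : poisson_random_measure P nu F N.
Hypothesis hWN : indep_systems P
  (sigma_gen [set t | 0 <= t] (W : R -> T -> borel 'cV[R]_n))
  (sigma_gen (time_slab `[0, +oo[) (fun A w => N w A : \bar R)).

Definition dW a b i w := W b w i ord0 - W a w i ord0.
(** [fine] sends an infinite count to [0]. For [nu A] finite this happens on a null event only
    ([dN_finite]), but additivity in the set and in time has to be stated off that event. *)
Definition dN a b (A : set U) w :=
  fine (N w (`]a, b]%classic `*` A)) - (b - a) * fine (nu A).

Lemma filt_algebra t : 0 <= t -> sigma_algebra setT (F t).
Proof. exact: (filt_sigma hF). Qed.

Lemma filt_measurable t : 0 <= t -> F t `<=` measurable.
Proof. exact: (filt_sub hF). Qed.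

Lemma Gm_mono s t (f : T -> R) : 0 <= s -> s <= t -> Gm (F s) f -> Gm (F t) f.
Proof. by move=> s0 st h B mB; exact: (filt_mono hF s0 st (h B mB)). Qed.

Lemma rv_wrt_comp (S : ptopologicalType) (G : set (set T)) (Y : T -> borel S) (f : S -> R) :
  rv_wrt G Y -> measurable_fun [set: borel S] f -> Gm G (fun w => f (Y w)).
Proof.
move=> hY mf B mB; apply: hY; exists (f @^-1` B); last by rewrite setTI.
by rewrite -[X in measurable X]setTI; exact: mf.
Qed.

Lemma Gm_W t i : 0 <= t -> Gm (F t) (fun w => W t w i ord0).
Proof.
move=> t0; apply: (rv_wrt_comp (f := fun M : 'cV[R]_n => M i ord0) (bm_adapted hW t0)).
apply: borel_continuous; exact: coord_continuous.
Qed.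

Lemma Gm_dW a b i : 0 <= a -> a <= b -> Gm (F b) (dW a b i).
Proof.
move=> a0 ab; have b0 := le_trans a0 ab.
apply: (GmB (filt_algebra b0)); first exact: Gm_W.
exact: Gm_mono ab (Gm_W _ _).
Qed.

Lemma dW_law a b i (A : set T) (B : set R) : 0 <= a -> a < b -> F a A -> measurable B ->
  P (A `&` dW a b i @^-1` B) = (P A * normal_prob 0 (Num.sqrt (b - a)) B)%E.
Proof.
move=> a0 ab FA mB.
pose C (j : 'I_n) : set (measurableTypeR R) := if j == i then B else setT.
have mC j : measurable (C j) by rewrite /C; case: ifP.
have N1 : normal_prob 0 (Num.sqrt (b - a)) setT = 1%E.
  exact: (probability_setT (normal_prob 0 (Num.sqrt (b - a)) : probability _ R)).
have := bm_incr hW a0 ab FA mC.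
rewrite (bigD1 i)//= /C eqxx big1 ?mule1; last by move=> j /negbTE ->.
move=> <-; congr (P (_ `&` _)); apply/seteqP; split => w /=.
  by move=> Bw j; case: ifPn => // /eqP ->.
by move=> /(_ i); rewrite eqxx.
Qed.

Lemma dW_law2 a b i j (A : set T) (B C : set R) : 0 <= a -> a < b -> i != j -> F a A ->
  measurable B -> measurable C ->
  P (A `&` (dW a b i @^-1` B `&` dW a b j @^-1` C)) =
  (P A * (normal_prob 0 (Num.sqrt (b - a)) B * normal_prob 0 (Num.sqrt (b - a)) C))%E.
Proof.
move=> a0 ab ij FA mB mC.
pose D (k : 'I_n) : set (measurableTypeR R) :=
  if k == i then B else if k == j then C else setT.
have mD k : measurable (D k) by rewrite /D; case: ifP => // _; case: ifP.
have N1 : normal_prob 0 (Num.sqrt (b - a)) setT = 1%E.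
  exact: (probability_setT (normal_prob 0 (Num.sqrt (b - a)) : probability _ R)).
have := bm_incr hW a0 ab FA mD.
rewrite (bigD1 i)//= (bigD1 j)/=; last by rewrite eq_sym.
rewrite /D !eqxx [j == i]eq_sym (negbTE ij) big1 ?mule1; last first.
  by move=> k /andP[/negbTE -> /negbTE ->].
move=> <-; congr (P (_ `&` _)); apply/seteqP; split => w /=.
  by move=> [Bw Cw] k; case: ifPn => [/eqP -> //|_]; case: ifPn => // /eqP ->.
by move=> h; split; [have := h i|have := h j]; rewrite eqxx// eq_sym (negbTE ij).
Qed.

Lemma FT t : 0 <= t -> F t setT.
Proof.
by move=> t0; have [F0 FD _] := filt_algebra t0; rewrite -(setD0 setT); exact: FD.
Qed.

Lemma dW_indep a b i (A : set T) (B : set R) : 0 <= a -> a < b -> F a A -> measurable B ->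
  P (A `&` dW a b i @^-1` B) = (P A * P (dW a b i @^-1` B))%E.
Proof.
move=> a0 ab FA mB; rewrite dW_law//; congr (_ * _)%E.
by have := dW_law i a0 ab (FT a0) mB; rewrite setTI (probability_setT P) mul1e => ->.
Qed.

Lemma meas_dW a b i : 0 <= a -> a <= b -> measurable_fun setT (dW a b i).
Proof.
by move=> a0 ab; apply: (Gm_meas (filt_measurable (le_trans a0 ab))); exact: Gm_dW.
Qed.

Lemma dW_prob a b i (B : set R) : 0 <= a -> a < b -> measurable B ->
  P (dW a b i @^-1` B) = normal_prob 0 (Num.sqrt (b - a)) B.
Proof.
move=> a0 ab mB.
by have := dW_law i a0 ab (FT a0) mB; rewrite setTI (probability_setT P) mul1e => ->.
Qed.

Lemma dW_mom a b i : 0 <= a -> a <= b ->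
  [/\ L2 P (dW a b i), Ex P (dW a b i) = 0 & Ex P (fun w => dW a b i w ^+ 2) = b - a].
Proof.
move=> a0; rewrite le_eqVlt => /predU1P[<-|ab].
  have -> : dW a a i = fun=> 0 by apply/funext => w; rewrite /dW subrr.
  by rewrite expr0n/= Ex_cst subrr; split => //; exact: L2_cst.
have s0 : 0 < Num.sqrt (b - a) by rewrite sqrtr_gt0 subr_gt0.
have ml := meas_dW i a0 (ltW ab).
have lw (B : set R) := @dW_prob a b i B a0 ab.
have [l2 E2] := normal_second_moment s0 ml lw.
split => //; first exact: normal_first_moment s0 ml lw.
by rewrite E2 sqr_sqrtr// subr_ge0 ltW.
Qed.

Lemma Ex_indepW a b i (xi : T -> R) (h : R -> R) : 0 <= a -> a <= b ->
  Gm (F a) xi -> L1 P xi -> measurable_fun setT h -> L1 P (fun w => h (dW a b i w)) ->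
  L1 P (fun w => xi w * h (dW a b i w)) /\
  Ex P (fun w => xi w * h (dW a b i w)) = Ex P xi * Ex P (fun w => h (dW a b i w)).
Proof.
move=> a0; rewrite le_eqVlt => /predU1P[<-|ab] Gx lx mh lh.
  have -> : dW a a i = fun=> 0 by apply/funext => w; rewrite /dW subrr.
  split; first by apply: (L1_ext _ (L1Z (h 0) lx)) => w; rewrite mulrC.
  by rewrite Ex_cst mulrC -ExZ//; apply: Ex_ext => w; rewrite mulrC.
apply: indep_Ex => // A B mA mB.
have mhB : measurable (h @^-1` B) by rewrite -[X in measurable X]setTI; exact: mh.
by apply: (dW_indep (A := xi @^-1` A) i a0 ab _ mhB); exact: Gx.
Qed.

Lemma Ex_dW a b i (xi : T -> R) : 0 <= a -> a <= b -> Gm (F a) xi -> L1 P xi ->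
  L1 P (fun w => xi w * dW a b i w) /\ Ex P (fun w => xi w * dW a b i w) = 0.
Proof.
move=> a0 ab Gx lx; have [l2 E1 _] := dW_mom i a0 ab.
have [? ->] := Ex_indepW a0 ab Gx lx (@measurable_id _ _ setT) (L2_L1 l2).
by split => //; rewrite E1 mulr0.
Qed.

Lemma Ex_dW2 a b i (xi : T -> R) : 0 <= a -> a <= b -> Gm (F a) xi -> L1 P xi ->
  Ex P (fun w => xi w * dW a b i w ^+ 2) = (b - a) * Ex P xi.
Proof.
move=> a0 ab Gx lx; have [[_ l2] _ E2] := dW_mom i a0 ab.
have [_ ->] := Ex_indepW a0 ab Gx lx (@exprn_measurable R setT 2) l2.
by rewrite E2 mulrC.
Qed.

(** By [Gm_Ex] the weight may be taken to be the indicator of some [A] in [F a]; then [1_A dW_i] is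
    independent of [dW_j], which is centred. *)
Lemma Ex_dWdW a b i j (xi : T -> R) (M : R) : 0 <= a -> a <= b -> i != j -> Gm (F a) xi ->
  (forall w, `|xi w| <= M) -> Ex P (fun w => xi w * (dW a b i w * dW a b j w)) = 0.
Proof.
move=> a0 ab ij Gx xM.
rewrite (@Gm_Ex _ _ _ P (F a) _ _ _ 0 _ M) ?mul0r//.
- exact: filt_algebra.
- exact: filt_measurable.
- by apply: L2M; [have [] := dW_mom i a0 ab|have [] := dW_mom j a0 ab].
move=> A FA; rewrite mul0r.
move: ab; rewrite le_eqVlt => /predU1P[<-|ab].
  by rewrite -[RHS](Ex_cst P); apply: Ex_ext => w; rewrite /dW subrr mul0r mulr0.
have mA := filt_measurable a0 FA.
have GA : Gm (F a) (\1_A : T -> R) := Gm_indic (filt_algebra a0) FA.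
have [l1 _] := Ex_dW i a0 (ltW ab) GA (L1_indic P mA).
have [l2 E2 _] := dW_mom j a0 (ltW ab).
rewrite (@Ex_ext _ _ _ _ _ (fun w => (\1_A w * dW a b i w) * dW a b j w)); last first.
  by move=> w; rewrite mulrA.
suff ind : forall B C, measurable B -> measurable C ->
    P ((fun w => \1_A w * dW a b i w) @^-1` B `&` dW a b j @^-1` C) =
    (P ((fun w => (\1_A w * dW a b i w)%R) @^-1` B) * P (dW a b j @^-1` C))%E.
  by have [_ ->] := indep_Ex l1 (L2_L1 l2) ind; rewrite E2 mulr0.
move=> B C mB mC.
(* Outside [A] the product is the constant [0], so the preimage of [B] splits into a condition on
   [dW_i] inside [A] and an event of [F a] outside. *)
have split1 : (fun w => \1_A w * dW a b i w) @^-1` B =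
   (A `&` dW a b i @^-1` B) `|` ((~` A) `&` (fun=> 0 : R) @^-1` B).
  apply/seteqP; split => w /=.
    rewrite indicE; have [Aw|nAw] := boolP (w \in A).
      by rewrite mul1r; left; split => //; exact: set_mem.
    by rewrite mul0r; right; split => //; move: nAw; rewrite notin_setE.
  rewrite indicE => -[[Aw]|[nAw]]; first by rewrite mem_set// mul1r.
  by rewrite memNset// mul0r.
have mW k (D : set R) : measurable D -> measurable (dW a b k @^-1` D).
  by move=> mD; rewrite -[X in measurable X]setTI; exact: (meas_dW k a0 (ltW ab)).
have FAC : F a (~` A `&` (fun=> 0 : R) @^-1` B).
  have [B0|nB0] := pselect (B 0).
    rewrite (_ : _ `&` _ = ~` A); last by apply/seteqP; split => w /=; [case|].
    by rewrite -setTD; have [_ FD _] := filt_algebra a0; exact: FD.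
  rewrite (_ : _ `&` _ = set0); last by apply/seteqP; split => w // [].
  by have [] := filt_algebra a0.
have mAC := filt_measurable a0 FAC.
have dis (X Y : set T) : (A `&` X) `&` ((~` A `&` (fun=> 0 : R) @^-1` B) `&` Y) = set0.
  by apply/seteqP; split => w // [[? _] [[]]].
rewrite split1 setIUl -!setIA.
set Z0 := (fun=> 0 : R) @^-1` B; set X := dW a b i @^-1` B; set Y := dW a b j @^-1` C.
have mX : measurable X by exact: mW.
have mY : measurable Y by exact: mW.
have -> : P (A `&` (X `&` Y) `|` ~` A `&` (Z0 `&` Y)) =
    (P (A `&` (X `&` Y)) + P ((~` A `&` Z0) `&` Y))%E.
  rewrite -(setIA (~` A)) measureU//.
  - by apply: measurableI => //; exact: measurableI.
  - by rewrite setIA; exact: measurableI.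
  - by rewrite (setIA (~` A)) dis.
have -> : P (A `&` X `|` ~` A `&` Z0) = (P (A `&` X) + P (~` A `&` Z0))%E.
  by rewrite measureU//; [exact: measurableI|rewrite -[X in _ `&` X]setIT dis].
rewrite /X /Y /Z0 dW_law2// (dW_law j a0 ab FAC mC) (dW_law i a0 ab FA mB) (dW_prob j a0 ab mC).
rewrite muleA -ge0_muleDl//.
by rewrite mule_ge0.
Qed.

End noise.

Section generated.
Context (R : realType) d (T : measurableType d) (I : Type) d' (S : measurableType d').
Variables (J : set I) (Y : I -> T -> S).

Lemma rv_wrt_Gm (G : set (set T)) (Z : T -> S) (h : S -> R) :
  rv_wrt G Z -> measurable_fun setT h -> Gm G (fun w => h (Z w)).
Proof.
move=> hZ mh B mB; apply: hZ; exists (h @^-1` B); last by rewrite setTI.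
by rewrite -[X in measurable X]setTI; exact: mh.
Qed.

Lemma sigma_gen_algebra : sigma_algebra setT (sigma_gen J Y).
Proof. exact: smallest_sigma_algebra. Qed.

Lemma sigma_gen_rv i : J i -> rv_wrt (sigma_gen J Y) (Y i).
Proof. by move=> Ji A YA; apply: sub_sigma_algebra; exists i. Qed.

End generated.

Lemma Ex_indep (R : realType) d (T : measurableType d) (P : probability T R)
    (G H : set (set T)) (f g : T -> R) : indep_systems P G H ->
  Gm G f -> Gm H g -> L1 P f -> L1 P g ->
  L1 P (fun w => f w * g w) /\ Ex P (fun w => f w * g w) = Ex P f * Ex P g.
Proof. by move=> ind Gf Hg lf lg; apply: indep_Ex => // A B mA mB; apply: ind; [exact: Gf|exact: Hg]. Qed.

Lemma Ex_ae (R : realType) d (T : measurableType d) (P : probability T R) (f g : T -> R)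
    (A : set T) : L1 P f -> L1 P g -> measurable A -> P A = 0%E ->
  (forall w, ~ A w -> f w = g w) -> Ex P f = Ex P g.
Proof.
move=> lf lg mA A0 fg; rewrite /Ex /Rintegral; congr fine.
apply: ae_eq_integral => //; first by case/integrableP: lf.
  by case/integrableP: lg.
exists A; split => //; move=> w /= h; apply: contrapT => nA; apply: h => _.
by rewrite fg.
Qed.

(** * Compensated increments of the Poisson measure *)

Section jump_noise.
Context (R : realType) d (T : measurableType d) (P : probability T R).
Context dU (U : measurableType dU) (nu : {sigma_finite_measure set U -> \bar R}).
Variables (n : nat) (F : R -> set (set T)).
Variable N : T -> {measure set (measurableTypeR R * U) -> \bar R}.
Hypothesis hF : usual_filtration P F.
Hypothesis hN : poisson_random_measure P nu F N.
Notation dN := (dN nu N).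

Lemma slab (a b : R) (A : set U) (D : set R) : measurable A -> `]a, b] `<=` D ->
  time_slab D (`]a, b]%classic `*` A).
Proof.
move=> mA abD; split; first by apply: measurableX.
by move=> [s u] [/= h _]; split => //; exact: abD.
Qed.

Lemma slab0 (a b : R) (A : set U) : 0 <= a -> measurable A ->
  time_slab `[0, +oo[ (`]a, b]%classic `*` A).
Proof.
move=> a0 mA; apply: slab => // s /=; rewrite !in_itv/= andbT => /andP[h _].
exact: le_trans a0 (ltW h).
Qed.

Lemma intensity_itv (a b : R) (A : set U) : a <= b -> measurable A -> (nu A < +oo)%E ->
  intensity nu (`]a, b]%classic `*` A) = ((b - a) * fine (nu A))%:E.
Proof.
move=> ab mA nA; rewrite /intensity product_measure1E//= lebesgue_measure_itv/= lte_fin.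
rewrite EFinM fineK ?ge0_fin_numE//; case: ifPn => [_|]; first by rewrite EFinB.
rewrite -leNgt => ba; have -> : b = a by apply/eqP; rewrite eq_le ba ab.
by rewrite subrr mul0e.
Qed.

Lemma Gm_dN (a b : R) (A : set U) : 0 <= a -> a <= b -> measurable A -> Gm (F b) (dN a b A).
Proof.
move=> a0 ab mA; have b0 := le_trans a0 ab.
apply: (GmB (filt_algebra hF b0)); last exact: Gm_cst (filt_algebra hF b0) _.
apply: (rv_wrt_Gm (h := @fine R)); last exact: fine_measurable.
apply: (prm_adapted hN b0); apply: slab => // s /=; rewrite !in_itv/= => /andP[h ->].
by rewrite (le_trans a0 (ltW h)).
Qed.

Definition future a := sigma_gen (time_slab `]a, +oo[) (fun A w => N w A : \bar R).

Lemma Gm_future (a b s : R) (A : set U) : s <= a -> measurable A -> Gm (future s) (dN a b A).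
Proof.
move=> sa mA; have fa : sigma_algebra setT (future s) by exact: sigma_gen_algebra.
apply: (GmB fa); last exact: Gm_cst fa _.
apply: (rv_wrt_Gm (h := @fine R)); last exact: fine_measurable.
apply: (sigma_gen_rv (Y := fun A w => N w A : \bar R) (i := `]a, b]%classic `*` A)).
apply: slab => // r /=; rewrite !in_itv/= andbT => /andP[h _].
exact: le_lt_trans sa h.
Qed.

Section one_set.
Variables (a b : R) (A : set U).
Hypotheses (a0 : 0 <= a) (ab : a <= b) (mA : measurable A) (nA : (nu A < +oo)%E).
Let K w := N w (`]a, b]%classic `*` A).
Let la := (b - a) * fine (nu A).

Let la0 : 0 <= la.
Proof. by rewrite mulr_ge0 ?subr_ge0// fine_ge0. Qed.

Let mK : measurable_fun setT (K : T -> \bar R).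
Proof. exact: (prm_rv hN (slab0 b a0 mA)). Qed.

Let Klaw (k : nat) : P [set w | K w = (k%:R)%:E] = poisson_prob la 0 [set k].
Proof.
have := prm_law hN (slab0 b a0 mA); rewrite intensity_itv// => h.
by rewrite h// ltry.
Qed.

Lemma dN_finite : measurable [set w | N w (`]a, b]%classic `*` A) = +oo%E] /\
  P [set w | N w (`]a, b]%classic `*` A) = +oo%E] = 0%E.
Proof.
split; last exact: poisson_ae_fin la0 mK Klaw.
by rewrite -[X in measurable X]setTI; exact: (mK measurableT (emeasurable_set1 _)).
Qed.

(** The bound on [E |dN|] comes from [|K - la| <= K + la]. It is linear in the length of the
    interval, unlike the root of the variance; case (a), where jumps are measured in L1, relies on
    this linearity. *)
Lemma dN_mom : [/\ L2 P (dN a b A), Ex P (dN a b A) = 0,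
  Ex P (fun w => dN a b A w ^+ 2) = (b - a) * fine (nu A) &
  Ex P (fun w => `|dN a b A w|) <= 2 * ((b - a) * fine (nu A))].
Proof.
have [l2 E1 E2] := poisson_moments la0 mK Klaw.
have l1 := L2_L1 l2.
split.
- exact: L2B l2 (L2_cst _ _).
- by rewrite ExB//; [rewrite E1 Ex_cst subrr|exact: L1_cst].
- rewrite (@Ex_ext _ _ _ _ _ (fun w => (fine (K w) ^+ 2 + (-2 * la) * fine (K w)) + la ^+ 2)).
    rewrite ExD; [|apply: L1D; [by case: l2|exact: L1Z]|exact: L1_cst].
    rewrite ExD; [|by case: l2|exact: L1Z].
    by rewrite ExZ// E1 E2 Ex_cst /la; ring.
  by move=> w; rewrite /dN -/(K w) -/la; ring.
- apply: (@le_trans _ _ (Ex P (fun w => fine (K w) + la))).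
    apply: Ex_le.
    + exact: L1_norm (L2_L1 (L2B l2 (L2_cst _ _))).
    + exact: L1D l1 (L1_cst _ _).
    + move=> w; rewrite /dN -/(K w) -/la; apply: le_trans (ler_normB _ _) _.
      rewrite (ger0_norm la0) ger0_norm//; apply: fine_ge0; exact: measure_ge0.
  by rewrite ExD//; [rewrite E1 Ex_cst /la; rewrite le_eqVlt; apply/orP; left; apply/eqP; ring|exact: L1_cst].
Qed.

End one_set.

Lemma Ex_dN a b (A : set U) (xi : T -> R) : 0 <= a -> a <= b -> measurable A ->
  (nu A < +oo)%E -> Gm (F a) xi -> L1 P xi ->
  L1 P (fun w => xi w * dN a b A w) /\ Ex P (fun w => xi w * dN a b A w) = 0.
Proof.
move=> a0 ab mA nA Gx lx; have [l2 E1 _ _] := dN_mom a0 ab mA nA.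
have [? ->] := Ex_indep (prm_future hN a0) Gx (Gm_future b (lexx a) mA) lx (L2_L1 l2).
by split => //; rewrite E1 mulr0.
Qed.

Lemma Ex_norm_dN a b (A : set U) (xi : T -> R) : 0 <= a -> a <= b -> measurable A ->
  (nu A < +oo)%E -> Gm (F a) xi -> L1 P xi -> (forall w, 0 <= xi w) ->
  L1 P (fun w => xi w * `|dN a b A w|) /\
  Ex P (fun w => xi w * `|dN a b A w|) <= 2 * ((b - a) * fine (nu A)) * Ex P xi.
Proof.
move=> a0 ab mA nA Gx lx x0; have [l2 _ _ E1] := dN_mom a0 ab mA nA.
have fa : sigma_algebra setT (future a) by exact: sigma_gen_algebra.
have Gd : Gm (future a) (fun w => `|dN a b A w|).
  apply: (Gm_comp fa (h := Num.norm)); first exact: normr_measurable.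
  exact: (Gm_future b (lexx a) mA).
have [? ->] := Ex_indep (prm_future hN a0) Gx Gd lx (L1_norm (L2_L1 l2)).
by split => //; rewrite mulrC ler_wpM2r// Ex_ge0.
Qed.

Lemma dN_setU a b (A B : set U) w : 0 <= a -> a <= b -> measurable A -> measurable B ->
  A `&` B = set0 -> (nu A < +oo)%E -> (nu B < +oo)%E ->
  ~ (N w (`]a, b]%classic `*` A) = +oo%E) -> ~ (N w (`]a, b]%classic `*` B) = +oo%E) ->
  dN a b (A `|` B) w = dN a b A w + dN a b B w.
Proof.
move=> a0 ab mA mB AB nA nB fA fB; rewrite /dN.
have fin (m : {measure set (measurableTypeR R * U) -> \bar R}) X :
    ~ m X = +oo%E -> m X \is a fin_num.
  by move=> h; rewrite ge0_fin_numE// lt_neqAle leey andbT; apply/eqP.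
have mX (X : set U) : measurable X -> measurable (`]a, b]%classic `*` X : set (measurableTypeR R * U)).
  by move=> ?; apply: measurableX.
rewrite measureU//= fineD ?ge0_fin_numE//.
rewrite (_ : `]a, b]%classic `*` (A `|` B) = (`]a, b]%classic `*` A) `|` (`]a, b]%classic `*` B)); last first.
  by apply/seteqP; split => -[s u] /=; [move=> [? []]; [left|right]|move=> [[? ?]|[? ?]]; split => //; [left|right]].
rewrite measureU; [|exact: mX|exact: mX|]; last first.
  apply/seteqP; split => // -[s u] /= [[_ Au] [_ Bu]].
  by have : (A `&` B) u by []; rewrite AB.
by rewrite fineD; [ring|exact: fin|exact: fin].
Qed.

Lemma dN_splitU a b (A B : set U) : 0 <= a -> a <= b -> measurable A -> measurable B ->
  A `&` B = set0 -> (nu A < +oo)%E -> (nu B < +oo)%E ->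
  exists E, [/\ measurable E, P E = 0%E &
    forall w, ~ E w -> dN a b (A `|` B) w = dN a b A w + dN a b B w].
Proof.
move=> a0 ab mA mB AB nA nB.
have [mEA PA] := dN_finite a0 ab mA nA; have [mEB PB] := dN_finite a0 ab mB nB.
eexists; split; [exact: measurableU mEA mEB| |].
  by apply: null_set_setU.
by move=> w nE; apply: dN_setU => // h; apply: nE; [left|right].
Qed.

Lemma dN_add a b c w (A : set U) : 0 <= a -> a <= b -> b <= c -> measurable A ->
  (nu A < +oo)%E ->
  ~ (N w (`]a, c]%classic `*` A) = +oo%E) ->
  dN a c A w = dN a b A w + dN b c A w.
Proof.
move=> a0 ab bc mA nA fA; rewrite /dN.
have mX x y : measurable (`]x, y]%classic `*` A : set (measurableTypeR R * U)).
  exact: measurableX.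
have E : `]a, c]%classic `*` A = (`]a, b]%classic `*` A) `|` (`]b, c]%classic `*` A).
  apply/seteqP; split => -[s u] /=; rewrite !in_itv/=.
    by move=> [/andP[h1 h2] Au]; case: (leP s b) => h; [left; rewrite h1|right; rewrite h2].
  by move=> [] [/andP[h1 h2] Au]; split => //; apply/andP; split => //;
    [exact: le_trans bc|exact: le_lt_trans h1].
have NE : N w (`]a, c]%classic `*` A) =
    (N w (`]a, b]%classic `*` A) + N w (`]b, c]%classic `*` A))%E.
  rewrite E measureU//; apply/seteqP; split => // -[s u] /= [[+ _] [+ _]].
  by rewrite !in_itv/= => /andP[_ h1] /andP[h2 _]; move: (le_lt_trans h1 h2); rewrite ltxx.
have : (N w (`]a, c]%classic `*` A) < +oo)%E.
  by rewrite lt_neqAle leey andbT; apply/eqP.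
rewrite NE => fin.
have [f1 f2] : (N w (`]a, b]%classic `*` A) \is a fin_num) /\
    (N w (`]b, c]%classic `*` A) \is a fin_num).
  by rewrite !ge0_fin_numE//; split; apply: le_lt_trans fin; rewrite ?leeDl ?leeDr.
by rewrite fineD//; ring.
Qed.

(** Polarisation: for disjoint sets the variance of the union is the sum of the variances, so the
    covariance vanishes. In general both sets are split along their intersection [C], and only the
    variance of [C] remains. *)
Lemma dN_cov a b (A B : set U) : 0 <= a -> a <= b -> measurable A -> measurable B ->
  (nu A < +oo)%E -> (nu B < +oo)%E ->
  Ex P (fun w => dN a b A w * dN a b B w) = (b - a) * fine (nu (A `&` B)).
Proof.
have disj (X Y : set U) : 0 <= a -> a <= b -> measurable X -> measurable Y ->
    (nu X < +oo)%E -> (nu Y < +oo)%E -> X `&` Y = set0 ->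
    Ex P (fun w => dN a b X w * dN a b Y w) = 0.
  move=> a0 ab mX mY nX nY XY.
  have nXY : (nu (X `|` Y) < +oo)%E by rewrite measureU//= lte_add_pinfty.
  have mXY : measurable (X `|` Y) by exact: measurableU.
  have [lX _ EX _] := dN_mom a0 ab mX nX; have [lY _ EY _] := dN_mom a0 ab mY nY.
  have [lXY _ EXY _] := dN_mom a0 ab mXY nXY.
  have [E [mE PE hE]] := dN_splitU a0 ab mX mY XY nX nY.
  have : Ex P (fun w => dN a b (X `|` Y) w ^+ 2) =
      Ex P (fun w => (dN a b X w ^+ 2 + dN a b Y w ^+ 2) + 2 * (dN a b X w * dN a b Y w)).
    apply: (Ex_ae (A := E)) => //; first by case: lXY.
      by apply: L1D; [apply: L1D; [case: lX|case: lY]|exact/L1Z/L2M].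
    by move=> w /hE ->; ring.
  rewrite ExD; [|by apply: L1D; [case: lX|case: lY]|exact/L1Z/L2M].
  rewrite ExD; [|by case: lX|by case: lY].
  rewrite ExZ; last exact: L2M.
  rewrite EX EY EXY measureU//= fineD ?ge0_fin_numE//; lra.
move=> a0 ab mA mB nA nB.
pose C := A `&` B; pose A' := A `\` B; pose B' := B `\` A.
have mC : measurable C by exact: measurableI.
have mA' : measurable A' by exact: measurableD.
have mB' : measurable B' by exact: measurableD.
have le_nu X Y : measurable X -> measurable Y -> X `<=` Y -> (nu Y < +oo)%E -> (nu X < +oo)%E.
  by move=> mX mY XY; apply: le_lt_trans; apply: le_measure; rewrite ?inE.
have nC : (nu C < +oo)%E by apply: le_nu nA => //; exact: subIsetl.
have nA' : (nu A' < +oo)%E by apply: le_nu nA => //; exact: subDsetl.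
have nB' : (nu B' < +oo)%E by apply: le_nu nB => //; exact: subDsetl.
have d1 : A' `&` C = set0 by apply/seteqP; split => // x [[_ nB1] [_ ?]].
have d2 : B' `&` C = set0 by apply/seteqP; split => // x [[_ nB1] [? _]].
have d3 : A' `&` B' = set0 by apply/seteqP; split => // x [[? _] [_ ?]].
have AE : A = A' `|` C.
  apply/seteqP; split => x; last by move=> [[]|[]].
  by move=> Ax; have [Bx|nBx] := pselect (B x); [right|left].
have BE : B = B' `|` C.
  apply/seteqP; split => x; last by move=> [[]|[]].
  by move=> Bx; have [Ax|nAx] := pselect (A x); [right|left].
have [E1 [mE1 PE1 hE1]] := dN_splitU a0 ab mA' mC d1 nA' nC.
have [E2 [mE2 PE2 hE2]] := dN_splitU a0 ab mB' mC d2 nB' nC.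
have [lA _ _ _] := dN_mom a0 ab mA nA; have [lB _ _ _] := dN_mom a0 ab mB nB.
have [lA' _ _ _] := dN_mom a0 ab mA' nA'; have [lB' _ _ _] := dN_mom a0 ab mB' nB'.
have [lC _ EC _] := dN_mom a0 ab mC nC.
have -> : Ex P (fun w => dN a b A w * dN a b B w) =
  Ex P (fun w => (dN a b A' w * dN a b B' w + dN a b A' w * dN a b C w) +
    (dN a b B' w * dN a b C w + dN a b C w ^+ 2)).
  apply: (Ex_ae (A := E1 `|` E2)).
  - exact: L2M.
  - by apply: L1D; apply: L1D; [exact: L2M..|case: lC].
  - exact: measurableU.
  - exact: null_set_setU.
  - move=> w nE; rewrite {1}AE {1}BE hE1; last by move=> h; apply: nE; left.
    by rewrite hE2; [ring|move=> h; apply: nE; right].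
have lC2 : L1 P (fun w => dN a b C w ^+ 2) by case: lC.
rewrite ExD; [|by apply: L1D; exact: L2M|by apply: L1D => //; exact: L2M].
rewrite ExD; [|exact: L2M|exact: L2M].
rewrite ExD; [|exact: L2M|by []].
by rewrite (disj A' B') // (disj A' C) // (disj B' C) // EC !add0r.
Qed.

Lemma Ex_dNdN a b (A B : set U) (xi : T -> R) : 0 <= a -> a <= b -> measurable A ->
  measurable B -> (nu A < +oo)%E -> (nu B < +oo)%E -> Gm (F a) xi -> L1 P xi ->
  L1 P (fun w => xi w * (dN a b A w * dN a b B w)) /\
  Ex P (fun w => xi w * (dN a b A w * dN a b B w)) =
  (b - a) * fine (nu (A `&` B)) * Ex P xi.
Proof.
move=> a0 ab mA mB nA nB Gx lx.
have [lA _ _ _] := dN_mom a0 ab mA nA; have [lB _ _ _] := dN_mom a0 ab mB nB.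
have fa : sigma_algebra setT (future a) by exact: sigma_gen_algebra.
have Gd : Gm (future a) (fun w => dN a b A w * dN a b B w).
  by apply: (GmM fa); exact: Gm_future.
have [? ->] := Ex_indep (prm_future hN a0) Gx Gd lx (L2M lA lB).
by split => //; rewrite dN_cov// mulrC.
Qed.

End jump_noise.

(** * Vanishing covariance of Brownian and Poisson increments *)

Section cross_noise.
Context (R : realType) d (T : measurableType d) (P : probability T R).
Context dU (U : measurableType dU) (nu : {sigma_finite_measure set U -> \bar R}).
Variables (n : nat) (F : R -> set (set T)) (W : R -> T -> 'cV[R]_n).
Variable N : T -> {measure set (measurableTypeR R * U) -> \bar R}.
Hypothesis hF : usual_filtration P F.
Hypothesis hW : brownian P F W.
Hypothesis hN : poisson_random_measure P nu F N.
Notation sW := (sigma_gen [set t | 0 <= t] (W : R -> T -> borel 'cV[R]_n)).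
Notation sN := (sigma_gen (time_slab `[0, +oo[) (fun A w => N w A : \bar R)).
Hypothesis hWN : indep_systems P sW sN.
Variables (A : set U) (i : 'I_n).
Hypotheses (mA : measurable A) (nA : (nu A < +oo)%E).
Notation bN a b := (dN nu N a b A).
Notation bW a b := (dW W a b i).

Let Gm_sW a b : 0 <= a -> a <= b -> Gm sW (bW a b).
Proof.
move=> a0 ab; have sa : sigma_algebra setT sW by exact: sigma_gen_algebra.
have h t : 0 <= t -> Gm sW (fun w => W t w i ord0).
  move=> t0; apply: (rv_wrt_comp (f := fun M : 'cV[R]_n => M i ord0)).
    exact: (sigma_gen_rv (Y := W : R -> T -> borel 'cV[R]_n)).
  by apply: borel_continuous; exact: coord_continuous.
by apply: (GmB sa); apply: h => //; exact: le_trans ab.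
Qed.

Let Gm_sN a b : 0 <= a -> Gm sN (bN a b).
Proof.
move=> a0; have sa : sigma_algebra setT sN by exact: sigma_gen_algebra.
apply: (GmB sa); last exact: Gm_cst sa _.
apply: (rv_wrt_Gm (h := @fine R)); last exact: fine_measurable.
apply: (sigma_gen_rv (Y := fun A w => N w A : \bar R) (i := `]a, b]%classic `*` A)).
exact: slab0.
Qed.

Let sWA : sigma_algebra setT sW := sigma_gen_algebra _ _.
Let sNA : sigma_algebra setT sN := sigma_gen_algebra _ _.

Let l2W a b : 0 <= a -> a <= b -> L2 P (bW a b).
Proof. by move=> a0 ab; have [] := dW_mom hF hW i a0 ab. Qed.

Let l2N a b : 0 <= a -> a <= b -> L2 P (bN a b).
Proof. by move=> a0 ab; have [] := dN_mom hN a0 ab mA nA. Qed.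

Lemma Ex_WN a b s t : 0 <= a -> a <= b -> 0 <= s -> s <= t ->
  L1 P (fun w => (bW a b w * bW s t w) * (bN a b w * bN s t w)) /\
  Ex P (fun w => (bW a b w * bW s t w) * (bN a b w * bN s t w)) =
  Ex P (fun w => bW a b w * bW s t w) * Ex P (fun w => bN a b w * bN s t w).
Proof.
move=> a0 ab s0 st; apply: (Ex_indep hWN).
- by apply: (GmM sWA); exact: Gm_sW.
- by apply: (GmM sNA); exact: Gm_sN.
- by apply: L2M; exact: l2W.
- by apply: L2M; exact: l2N.
Qed.

Lemma L2_dWdN a b : 0 <= a -> a <= b -> L2 P (fun w => bW a b w * bN a b w) /\
  Ex P (fun w => (bW a b w * bN a b w) ^+ 2) = (b - a) ^+ 2 * fine (nu A).
Proof.
move=> a0 ab; have [l1 E1] := Ex_WN a0 ab a0 ab.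
have sq w : (bW a b w * bW a b w) * (bN a b w * bN a b w) = (bW a b w * bN a b w) ^+ 2.
  by ring.
split.
  split; last exact: L1_ext sq l1.
  by apply: measurable_funM; [have [] := l2W a0 ab|have [] := l2N a0 ab].
rewrite -(Ex_ext P sq) E1.
have [_ _ E2] := dW_mom hF hW i a0 ab; have [_ _ E3 _] := dN_mom hN a0 ab mA nA.
have -> : Ex P (fun w => bW a b w * bW a b w) = b - a by [].
have -> : Ex P (fun w => bN a b w * bN a b w) = (b - a) * fine (nu A) by [].
by ring.
Qed.

Section xi.
Variables (a : R) (xi : T -> R) (M : R).
Hypotheses (a0 : 0 <= a) (Gx : Gm (F a) xi) (xM : forall w, `|xi w| <= M).

Let mx : measurable_fun setT xi := Gm_meas (filt_measurable hF a0) Gx.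

Lemma L1_xiWN s t s' t' : a <= s -> s <= t -> a <= s' -> s' <= t' ->
  L1 P (fun w => xi w * (bW s t w * bN s' t' w)).
Proof.
move=> as_ st as' st'; apply: L1M mx xM _; apply: L2M.
  exact: l2W (le_trans a0 as_) st.
exact: l2N (le_trans a0 as') st'.
Qed.

(** The mixed terms pair an increment over []b, c]] with an [F b]-measurable factor and vanish, so
    the weighted covariance is additive in the interval. *)
Let cross_add b c : a <= b -> b <= c ->
  Ex P (fun w => xi w * (bW a c w * bN a c w)) =
  Ex P (fun w => xi w * (bW a b w * bN a b w)) + Ex P (fun w => xi w * (bW b c w * bN b c w)).
Proof.
move=> ab bc; have b0 := le_trans a0 ab; have ac := le_trans ab bc.
have [mE PE] := dN_finite hN a0 ac mA nA.
have lxW : L1 P (fun w => xi w * bW a b w) by apply: L1M mx xM (L2_L1 (l2W a0 ab)).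
have lxN : L1 P (fun w => xi w * bN a b w) by apply: L1M mx xM (L2_L1 (l2N a0 ab)).
have Gxb : Gm (F b) xi := Gm_mono hF a0 ab Gx.
have Fb := filt_algebra hF b0.
have [l1 E1] := Ex_dN hN b0 bc mA nA (GmM Fb Gxb (Gm_dW hF hW i a0 ab)) lxW.
have [l2 E2] := Ex_dW hF hW i b0 bc (GmM Fb Gxb (Gm_dN hF hN a0 ab mA)) lxN.
have l3 := L1_xiWN (lexx a) ab (lexx a) ab.
have l4 := L1_xiWN ab bc ab bc.
transitivity (Ex P (fun w => (xi w * (bW a b w * bN a b w) + xi w * (bW b c w * bN b c w)) +
   (xi w * bW a b w * bN b c w + xi w * bN a b w * bW b c w))).
  apply: (Ex_ae (A := [set w | N w (`]a, c]%classic `*` A) = +oo%E])) => //.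
  - exact: L1_xiWN.
  - by apply: L1D; exact: L1D.
  - move=> w /= nE; rewrite (dN_add a0 ab bc mA nA nE).
    have -> : bW a c w = bW a b w + bW b c w by rewrite /dW; ring.
    by ring.
rewrite ExD; [|exact: L1D|exact: L1D].
rewrite [X in X + _]ExD; [|by []|by []].
by rewrite [X in _ + X]ExD// E1 E2 !addr0.
Qed.

Variable b : R.
Hypothesis ab : a <= b.
Variable m : nat.
Let h := (b - a) / m.+1%:R.
Let t (k : nat) := a + k%:R * h.
Let h0 : 0 <= h. Proof. by rewrite divr_ge0// subr_ge0. Qed.
Let tle k l : (k <= l)%N -> t k <= t l.
Proof. by move=> kl; rewrite lerD2l ler_wpM2r// ler_nat. Qed.
Let ta k : a <= t k. Proof. by rewrite lerDl mulr_ge0. Qed.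
Let t0 k : 0 <= t k. Proof. exact: le_trans a0 (ta k). Qed.
Let tS k : t k <= t k.+1. Proof. exact: tle. Qed.
Let Z k w := bW (t k) (t k.+1) w * bN (t k) (t k.+1) w.
Let S k w := \sum_(l < k) Z l w.

Let lZ k : L2 P (Z k). Proof. by have [] := L2_dWdN (t0 k) (tS k). Qed.

Let cross_S k : Ex P (fun w => xi w * (bW a (t k) w * bN a (t k) w)) = Ex P (fun w => xi w * S k w).
Proof.
elim: k => [|k ih].
  apply: Ex_ext => w; rewrite /S big_ord0 /t mul0r addr0.
  by rewrite /dW subrr mul0r.
rewrite (@cross_add (t k) (t k.+1))// ih -ExD.
- by apply: Ex_ext => w; rewrite /S big_ord_recr/= -mulrDr.
- by apply: L1M mx xM (L2_L1 _); apply: L2_sum => l _; exact: lZ.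
- exact: L1_xiWN.
Qed.

(** Independence of the full paths turns the mean into a product, one factor of which is the mean of
    two Brownian increments over disjoint intervals. *)
Let ZZ k l : (l < k)%N -> Ex P (fun w => Z l w * Z k w) = 0.
Proof.
move=> lk; have [_ E1] := Ex_WN (t0 l) (tS l) (t0 k) (tS k).
rewrite (@Ex_ext _ _ _ _ _ (fun w => (bW (t l) (t l.+1) w * bW (t k) (t k.+1) w) *
  (bN (t l) (t l.+1) w * bN (t k) (t k.+1) w))); last by move=> w; rewrite /Z; ring.
rewrite E1; have G : Gm (F (t k)) (bW (t l) (t l.+1)).
  exact: (Gm_mono hF (t0 l.+1) (tle lk) (Gm_dW hF hW i (t0 l) (tS l))).
by have [_ ->] := Ex_dW hF hW i (t0 k) (tS k) G (L2_L1 (l2W (t0 l) (tS l))); rewrite mul0r.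
Qed.

(** The terms are orthogonal and each contributes [h^2 nu A]. Over the whole partition the total is
    of order [1 / (m + 1)], as the mesh enters squared while the number of terms grows linearly. *)
Let S2 k : Ex P (fun w => S k w ^+ 2) = k%:R * (h ^+ 2 * fine (nu A)).
Proof.
have lS l : L2 P (S l) by apply: L2_sum => j _; exact: lZ.
elim: k => [|k ih].
  rewrite mul0r -[RHS](Ex_cst P); apply: Ex_ext => w.
  by rewrite /S big_ord0 expr0n.
rewrite (@Ex_ext _ _ _ _ _ (fun w => (S k w ^+ 2 + 2 * (S k w * Z k w)) + Z k w ^+ 2)); last first.
  by move=> w; rewrite /S big_ord_recr/=; ring.
have lS2 : L1 P (fun w => S k w ^+ 2) by case: (lS k).
have lZ2 : L1 P (fun w => Z k w ^+ 2) by case: (lZ k).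
have lSZ : L1 P (fun w => S k w * Z k w) by exact: L2M.
rewrite ExD; [|by apply: L1D => //; exact: L1Z|by []].
rewrite ExD; [|by []|exact: L1Z].
rewrite ih ExZ//.
have -> : Ex P (fun w => S k w * Z k w) = 0.
  rewrite (@Ex_ext _ _ _ _ _ (fun w => \sum_(l < k) Z l w * Z k w)); last first.
    by move=> w; rewrite /S mulr_suml.
  rewrite Ex_sum; last by move=> l _; exact: L2M.
  by rewrite big1// => l _; rewrite ZZ.
have [_ ->] := L2_dWdN (t0 k) (tS k).
rewrite /t -natr1; ring.
Qed.

(** By additivity the covariance over []a, b]] is [E (xi S)] for the sum [S] of products over the
    partition; Cauchy-Schwarz and [S2] conclude. *)
Lemma cross_bound : Ex P (fun w => xi w * (bW a b w * bN a b w)) ^+ 2 <=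
  M ^+ 2 * ((b - a) ^+ 2 * fine (nu A)) / m.+1%:R.
Proof.
have tm : t m.+1 = b by rewrite /t /h mulrC divfK ?pnatr_eq0//; ring.
rewrite -{1 2}tm cross_S.
have lx : L2 P xi by exact: L2_bdd mx xM.
have lS : L2 P (S m.+1) by apply: L2_sum => j _; exact: lZ.
apply: le_trans (Ex_CS lx lS) _; rewrite S2.
have -> : M ^+ 2 * ((b - a) ^+ 2 * fine (nu A)) / m.+1%:R =
   M ^+ 2 * (m.+1%:R * (h ^+ 2 * fine (nu A))).
  by rewrite /h; field; rewrite nat1r pnatr_eq0.
rewrite ler_wpM2r//.
  by apply: mulr_ge0 => //; apply: mulr_ge0; [exact: sqr_ge0|exact: fine_ge0].
rewrite -[leRHS](Ex_cst P); apply: Ex_le; [by case: lx|exact: L1_cst|].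
move=> w; rewrite -real_normK ?num_real// ler_sqr ?nnegrE//.
exact: le_trans (normr_ge0 _) (xM w).
Qed.

End xi.

(* [W] and [N] share the filtration but only their full paths are independent;
   refining the partition makes the sum of the products of the increments tend
   to [0] in [L^2], hence the conditional covariance of [W] and [N] vanishes. *)
Lemma Ex_dWdN a b (xi : T -> R) M : 0 <= a -> a <= b -> Gm (F a) xi ->
  (forall w, `|xi w| <= M) -> Ex P (fun w => xi w * (bW a b w * bN a b w)) = 0.
Proof.
move=> a0 ab Gx xM; set e := Ex P _.
apply/eqP/negPn/negP => e0.
have e2 : 0 < e ^+ 2 by rewrite exprn_even_gt0.
pose C := M ^+ 2 * ((b - a) ^+ 2 * fine (nu A)).
have := cross_bound a0 Gx xM ab (Num.truncn (C / e ^+ 2)).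
rewrite -/e -/C ler_pdivlMr// mulrC -ler_pdivlMr//.
by rewrite leNgt truncnS_gt.
Qed.

End cross_noise.

(** * Discrete stochastic integrals *)

Section adapted_bool.
Context (T : Type) (G : set (set T)).
Hypothesis sG : sigma_algebra setT G.

Definition Gb (b : T -> bool) := G [set w | b w].

Lemma Gb_and b c : Gb b -> Gb c -> Gb (fun w => b w && c w).
Proof.
have [F0 FD FU] := sG.
move=> hb hc; rewrite /Gb (_ : [set w | _] = ~` (~` [set w | b w] `|` ~` [set w | c w])); last first.
  by rewrite setCU !setCK; apply/seteqP; split => w /= => [/andP[]|[-> ->]].
rewrite -setTD; apply: (FD _); rewrite -bigcup2E; apply: FU => -[|[|k]] /=.
- by rewrite -setTD; exact: FD.
- by rewrite -setTD; exact: FD.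
- exact: F0.
Qed.

Lemma Gb_not b : Gb b -> Gb (fun w => ~~ b w).
Proof.
have [F0 FD FU] := sG.
move=> hb; rewrite /Gb (_ : [set w | _] = setT `\` [set w | b w]); first exact: FD.
by apply/seteqP; split => w /= => [/negP|[_ /negP]].
Qed.

End adapted_bool.

Section adapted_real.
Context (R : realType) d (T : measurableType d) (G : set (set T)).
Hypothesis sG : sigma_algebra setT G.
Implicit Types f g : T -> R.

Lemma Gb_ler f c : Gm G f -> Gb G (fun w => f w <= c).
Proof.
move=> h; rewrite /Gb (_ : [set w | _] = f @^-1` `]-oo, c]); first exact: h.
by apply/seteqP; split => w /=; rewrite in_itv.
Qed.

Lemma Gb_ltr f c : Gm G f -> Gb G (fun w => f w < c).
Proof.
move=> h; rewrite /Gb (_ : [set w | _] = f @^-1` `]-oo, c[); first exact: h.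
by apply/seteqP; split => w /=; rewrite in_itv.
Qed.

Lemma Gm_bool (b : T -> bool) : Gb G b -> Gm G (fun w => (b w)%:R : R).
Proof.
move=> hb; have -> : (fun w => (b w)%:R : R) = \1_[set w | b w].
  by apply/funext => w; rewrite indicE mem_setE.
exact: (Gm_indic (A := [set w | b w]) sG hb).
Qed.

Lemma Gm_norm f : Gm G f -> Gm G (fun w => `|f w|).
Proof. by move=> h; apply: (Gm_comp sG (h := Num.norm)) => //; exact: normr_measurable. Qed.

End adapted_real.

Section discrete_noise.
Context (R : realType) d (T : measurableType d) (P : probability T R).
Variables (G : nat -> set (set T)) (m : nat) (E : finType).
Variables (z : nat -> E -> T -> R) (q : nat -> E -> E -> R).

(** What is retained of the increments: an adapted square integrable array of martingale differences
    with deterministic conditional covariances [q]. Covariances are tested against bounded weights,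
    the form in which [Ex_dWdN] supplies them. *)
Record discrete_noise : Prop := {
  dn_algebra : forall k, sigma_algebra setT (G k);
  dn_sub : forall k, G k `<=` measurable;
  dn_mono : forall k, G k `<=` G k.+1;
  dn_adapted : forall k e, (k < m)%N -> Gm (G k.+1) (z k e);
  dn_L2 : forall k e, (k < m)%N -> L2 P (z k e);
  dn_mean : forall k e xi, (k < m)%N -> Gm (G k) xi -> L1 P xi ->
    Ex P (fun w => xi w * z k e w) = 0;
  dn_cov : forall k e e' xi M, (k < m)%N -> Gm (G k) xi -> (forall w, `|xi w| <= M) ->
    Ex P (fun w => xi w * (z k e w * z k e' w)) = q k e e' * Ex P xi }.

Hypothesis hz : discrete_noise.

Lemma dn_le k l : (k <= l)%N -> G k `<=` G l.
Proof.
move=> /subnK <-; elim: (l - k)%N => [//|j ih] A GA; rewrite addSn.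
by apply: (dn_mono hz); exact: ih.
Qed.

Lemma Gm_le k l (f : T -> R) : (k <= l)%N -> Gm (G k) f -> Gm (G l) f.
Proof. by move=> kl h B mB; exact: (dn_le kl (h B mB)). Qed.

Lemma Gb_le k l (b : T -> bool) : (k <= l)%N -> Gb (G k) b -> Gb (G l) b.
Proof. by move=> kl h; exact: dn_le kl _ h. Qed.

Section sums.
Variable V : nat -> E -> T -> R.
Hypothesis GV : forall k e, Gm (G k) (V k e).
Hypothesis bV : forall k e, exists M, forall w, `|V k e w| <= M.

Definition dsum k w := \sum_(l < k) \sum_e V l e w * z l e w.
(** The predictable quadratic variation of [dsum]: [denergy k.+1] involves the integrands of the
    steps [0] to [k] and is therefore known at time [k] ([Gm_denergy]). *)
Definition denergy k w := \sum_(l < k) \sum_e \sum_e' V l e w * V l e' w * q l e e'.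

Let mV k e : measurable_fun setT (V k e).
Proof. exact: (Gm_meas (dn_sub hz (k := k)) (GV k e)). Qed.

Lemma L2_Vz k e : (k < m)%N -> L2 P (fun w => V k e w * z k e w).
Proof. by move=> km; have [M hM] := bV k e; apply: L2Mb (mV k e) hM (dn_L2 hz e km). Qed.

Lemma Gm_dsum k : (k <= m)%N -> Gm (G k) (dsum k).
Proof.
elim: k => [|k ih] km.
  have -> : dsum 0 = fun=> 0 by apply/funext => w; rewrite /dsum big_ord0.
  exact: Gm_cst (dn_algebra hz _) _.
have -> : dsum k.+1 = fun w => dsum k w + \sum_e V k e w * z k e w.
  by apply/funext => w; rewrite /dsum big_ord_recr.
have Gk := dn_algebra hz k.+1.
apply: (GmD Gk); first exact: Gm_le (leqnSn k) (ih (ltnW km)).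
apply: (Gm_sum Gk) => e; apply: (GmM Gk); last exact: (dn_adapted hz).
exact: Gm_le (leqnSn k) (GV k e).
Qed.

Lemma L2_dstep k : (k < m)%N -> L2 P (fun w => \sum_e V k e w * z k e w).
Proof. by move=> km; apply: L2_sum => e _; exact: L2_Vz. Qed.

Lemma L2_dsum k : (k <= m)%N -> L2 P (dsum k).
Proof.
move=> km; apply: L2_sum => l _; apply: L2_dstep.
exact: leq_trans (ltn_ord l) km.
Qed.

Lemma bdd_VV k e e' : exists M, forall w, `|V k e w * V k e' w| <= M.
Proof.
have [M hM] := bV k e; have [M' hM'] := bV k e'; exists (M * M') => w.
by rewrite normrM ler_pM.
Qed.

Lemma L1_VV k e e' : L1 P (fun w => V k e w * V k e' w).
Proof.
have [M hM] := bdd_VV k e e'; apply: L1_bdd hM.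
by apply: measurable_funM; exact: mV.
Qed.

Lemma Gm_denergy k : Gm (G k) (denergy k.+1).
Proof.
have Gk := dn_algebra hz k.
rewrite /denergy; apply: (Gm_sum Gk) => l; apply: (Gm_sum Gk) => e; apply: (Gm_sum Gk) => e'.
have lk : (l <= k)%N by rewrite -ltnS.
apply: (GmM Gk); last exact: Gm_cst Gk _.
by apply: (GmM Gk); apply: Gm_le lk _; exact: GV.
Qed.

Lemma L1_denergy k : L1 P (denergy k).
Proof.
apply: L1_sum => l _; apply: L1_sum => e _; apply: L1_sum => e' _.
by apply: (L1_ext _ (L1Z (q l e e') (L1_VV l e e'))) => w; rewrite mulrC.
Qed.

Lemma Ex_dstep_orth k xi : (k < m)%N -> Gm (G k) xi -> L2 P xi ->
  Ex P (fun w => xi w * \sum_e V k e w * z k e w) = 0.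
Proof.
move=> km Gx lx.
rewrite (@Ex_ext _ _ _ _ _ (fun w => \sum_e (xi w * V k e w) * z k e w)); last first.
  by move=> w; rewrite mulr_sumr; apply: eq_bigr => e _; rewrite mulrA.
have lxV e : L2 P (fun w => xi w * V k e w).
  have [M hM] := bV k e.
  by apply: (L2_ext _ (L2Mb (mV k e) hM lx)) => w; rewrite mulrC.
rewrite Ex_sum; last by move=> e _; exact: L2M (lxV e) (dn_L2 hz e km).
rewrite big1// => e _; apply: (dn_mean hz) => //; last exact: L2_L1.
exact: (GmM (dn_algebra hz k) Gx (GV k e)).
Qed.

(** Conditional isometry: the square is expanded into products of two noises, whose means against
    the bounded [G k]-measurable weights [xi V e V e'] are given by [dn_cov]. *)
Lemma Ex_dstep2 k xi M : (k < m)%N -> Gm (G k) xi -> (forall w, `|xi w| <= M) ->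
  Ex P (fun w => xi w * (\sum_e V k e w * z k e w) ^+ 2) =
  Ex P (fun w => xi w * \sum_e \sum_e' V k e w * V k e' w * q k e e').
Proof.
move=> km Gx xM; have Gk := dn_algebra hz k.
have mx := Gm_meas (dn_sub hz (k := k)) Gx.
have lzz e e' : L1 P (fun w => z k e w * z k e' w) by exact: L2M (dn_L2 hz e km) (dn_L2 hz e' km).
have bx e e' : exists M', forall w, `|xi w * (V k e w * V k e' w)| <= M'.
  have [M' hM'] := bdd_VV k e e'; exists (M * M') => w.
  by rewrite normrM ler_pM.
have Gxx e e' : Gm (G k) (fun w => xi w * (V k e w * V k e' w)).
  by apply: (GmM Gk) => //; apply: (GmM Gk); exact: GV.
have mxx e e' := Gm_meas (dn_sub hz (k := k)) (Gxx e e').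
rewrite (@Ex_ext _ _ _ _ _
  (fun w => \sum_e \sum_e' (xi w * (V k e w * V k e' w)) * (z k e w * z k e' w))); last first.
  move=> w; rewrite expr2 mulr_suml mulr_sumr; apply: eq_bigr => e _.
  by rewrite !mulr_sumr; apply: eq_bigr => e' _; ring.
rewrite [RHS](@Ex_ext _ _ _ _ _
  (fun w => \sum_e \sum_e' q k e e' * (xi w * (V k e w * V k e' w)))); last first.
  move=> w; rewrite mulr_sumr; apply: eq_bigr => e _.
  by rewrite !mulr_sumr; apply: eq_bigr => e' _; ring.
have l1 e e' : L1 P (fun w => xi w * (V k e w * V k e' w) * (z k e w * z k e' w)).
  by have [M' hM'] := bx e e'; exact: L1M (mxx e e') hM' (lzz e e').
have l2 e e' : L1 P (fun w => q k e e' * (xi w * (V k e w * V k e' w))).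
  by have [M' hM'] := bx e e'; apply: L1Z; exact: L1_bdd (mxx e e') hM'.
rewrite !Ex_sum; try by move=> e _; apply: L1_sum.
apply: eq_bigr => e _; rewrite !Ex_sum//.
apply: eq_bigr => e' _; have [M' hM'] := bx e e'.
by rewrite (dn_cov hz _ _ km (Gxx e e') hM') ExZ//; exact: L1_bdd (mxx e e') hM'.
Qed.

Lemma Ex_dsum2 k : (k <= m)%N -> Ex P (fun w => dsum k w ^+ 2) = Ex P (denergy k).
Proof.
elim: k => [|k ih] km.
  by apply: Ex_ext => w; rewrite /dsum /denergy !big_ord0 expr0n.
have lS := L2_dsum (ltnW km); have lD := L2_dstep km.
rewrite (@Ex_ext _ _ _ _ _ (fun w => (dsum k w ^+ 2 +
   2 * (dsum k w * \sum_e V k e w * z k e w)) + 1 * (\sum_e V k e w * z k e w) ^+ 2)); last first.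
  by move=> w; rewrite /dsum big_ord_recr/=; ring.
have lD1 : L1 P (fun w => 1 * (\sum_e V k e w * z k e w) ^+ 2) by apply: L1Z; case: lD.
rewrite ExD//; last by apply: L1D; [case: lS|exact/L1Z/L2M].
rewrite ExD; [|by case: lS|exact/L1Z/L2M].
rewrite ExZ; last exact: L2M.
rewrite Ex_dstep_orth//; last exact: Gm_dsum (ltnW km).
rewrite (Ex_dstep2 (M := 1) km); last 2 first.
- exact: Gm_cst (dn_algebra hz k) _.
- by move=> w; rewrite normr1.
rewrite mulr0 addr0 ih ?(ltnW km)// -ExD.
- by apply: Ex_ext => w; rewrite /denergy big_ord_recr/= mul1r.
- exact: L1_denergy.
- apply: L1Z; apply: L1_sum => e _; apply: L1_sum => e' _.
  by apply: (L1_ext _ (L1Z (q k e e') (L1_VV k e e'))) => w; rewrite mulrC.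
Qed.

End sums.

Section lenglart.
Variable V : nat -> E -> T -> R.
Hypothesis GV : forall k e, Gm (G k) (V k e).
Hypothesis bV : forall k e, exists M, forall w, `|V k e w| <= M.
Variables (de ep : R).
Hypotheses (de0 : 0 <= de) (ep0 : 0 < ep).

(** The index [k.+1] matters: the energy including the step that leaves [k] is known at time [k], so
    the test precedes that step. *)
Let ok k w := (denergy V k.+1 w <= de) && (`|dsum V k w| < ep).

Fixpoint all_ok k w := if k is k'.+1 then all_ok k' w && ok k w else ok 0 w.

Let all_okP k w : reflect (forall l, (l <= k)%N -> ok l w) (all_ok k w).
Proof.
elim: k => [|k ih] /=; first by apply: (iffP idP) => [h l|/(_ 0%N)]; [rewrite leqn0 => /eqP ->|apply].
apply: (iffP andP) => [[/ih h1 h2] l|h].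
  by rewrite leq_eqVlt ltnS => /predU1P[->//|]; exact: h1.
by split; [apply/ih => l lk; apply: h; exact: leqW|exact: h].
Qed.

Let Gok k : (k <= m)%N -> Gb (G k) (all_ok k).
Proof.
have G1 l : (l <= m)%N -> Gb (G l) (ok l).
  move=> lm; apply: (Gb_and (dn_algebra hz l)); first exact: Gb_ler (Gm_denergy GV _).
  exact: Gb_ltr (Gm_norm (dn_algebra hz l) (Gm_dsum GV lm)).
elim: k => [|k ih] km; first exact: G1.
apply: (Gb_and (dn_algebra hz k.+1)); last exact: G1.
exact: Gb_le (leqnSn k) (ih (ltnW km)).
Qed.

Let V' k e w := ((k <= m)%N && all_ok k w)%:R * V k e w.

Let GV' k e : Gm (G k) (V' k e).
Proof.
have Gb1 : Gb (G k) (fun w => (k <= m)%N && all_ok k w).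
  case: (leqP k m) => km; first exact: Gok.
  rewrite /Gb (_ : [set w | _] = set0); last by apply/seteqP; split.
  by have [] := dn_algebra hz k.
exact: (GmM (dn_algebra hz k) (Gm_bool (dn_algebra hz k) Gb1) (GV k e)).
Qed.

Let bV' k e : exists M, forall w, `|V' k e w| <= M.
Proof.
have [M hM] := bV k e; exists M => w; rewrite /V' normrM.
by case: (_ && _); rewrite ?normr1 ?normr0 ?mul1r ?mul0r//; exact: le_trans (hM w).
Qed.

Let dsum_stop k w : (k <= m)%N -> (forall l, (l < k)%N -> ok l w) -> dsum V' k w = dsum V k w.
Proof.
move=> km h; apply: eq_bigr => l _; apply: eq_bigr => e _; congr (_ * _).
rewrite /V' (leq_trans (ltnW (ltn_ord l)) km)/= (_ : all_ok l w) ?mul1r//.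
by apply/all_okP => j jl; apply: h; exact: leq_ltn_trans jl (ltn_ord l).
Qed.

Let stop_from k l w : ~~ ok k w -> (k <= l)%N -> dsum V' l w = dsum V' k w.
Proof.
move=> nok /subnK <-; elim: (l - k)%N => [//|j ih].
rewrite addSn /dsum big_ord_recr/= -/(dsum _ _ _) ih big1 ?addr0// => e _.
rewrite /V' (negbTE (_ : ~~ all_ok (j + k) w)) ?andbF ?mul0r//.
by apply/negP => /all_okP/(_ k (leq_addl _ _)); rewrite (negbTE nok).
Qed.

(** While all tests succeed the energy of [V'] is that of [V], which the current test bounds by
    [de]; after the first failure [V'] vanishes and its energy stays constant. *)
Let denergy_le w : denergy V' m w <= de.
Proof.
suff h k : (k <= m)%N -> denergy V' k w <= de by exact: h.
elim: k => [|k ih] km; first by rewrite /denergy big_ord0.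
rewrite /denergy big_ord_recr/= -/(denergy _ _ _).
have [/all_okP hk|nk] := boolP (all_ok k w); last first.
  rewrite big1 ?addr0 ?ih ?(ltnW km)// => e _; rewrite big1// => e' _.
  by rewrite /V' (negbTE nk) andbF !mul0r.
have -> : denergy V' k w + \sum_e \sum_e' V' k e w * V' k e' w * q k e e' = denergy V k.+1 w.
  rewrite /denergy big_ord_recr/=; congr (_ + _).
    apply: eq_bigr => l _; apply: eq_bigr => e _; apply: eq_bigr => e' _.
    rewrite /V' (leq_trans (ltnW (ltn_ord l)) (ltnW km))/= (_ : all_ok l w) ?mul1r//.
    by apply/all_okP => j jl; apply: hk; exact: leq_trans jl (ltnW (ltn_ord l)).
  apply: eq_bigr => e _; apply: eq_bigr => e' _.
  by rewrite /V' (ltnW km)/= (_ : all_ok k w) ?mul1r//; apply/all_okP.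
by have := hk k (leqnn k) => /andP[].
Qed.

(* Lenglart's inequality: the integrand is stopped before its energy exceeds
   [de], which is possible because the energy is predictable. *)
Lemma lenglart : exists B, [/\ measurable B, (P B <= (de / ep ^+ 2)%:E)%E &
  forall w, ~ B w -> (forall k, (k <= m)%N -> denergy V k w <= de) ->
  forall k, (k <= m)%N -> `|dsum V k w| < ep].
Proof.
pose B := [set w | ep ^+ 2 <= dsum V' m w ^+ 2].
have lS := L2_dsum GV' bV' (leqnn m).
have l2 : L1 P (fun w => dsum V' m w ^+ 2) by case: lS.
have mB : measurable B.
  rewrite -[X in measurable X]setTI.
  have := measurable_fun_ler (measurable_cst (ep ^+ 2)) (L1_meas l2).
  by move=> /(_ measurableT [set true]); apply.
exists B; split => //.
  have := markov_ge (exprn_gt0 2 ep0) l2 (fun w => sqr_ge0 _).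
  move=> /le_trans; apply; rewrite lee_fin ler_wpM2r ?invr_ge0 ?sqr_ge0//.
  rewrite (Ex_dsum2 GV' bV' (leqnn m)) -[leRHS](Ex_cst P); apply: Ex_le => //.
  - exact: L1_denergy.
  - exact: L1_cst.
move=> w nB hQ k km; rewrite ltNge; apply/negP => kep.
have ex : exists k, (k <= m)%N && (ep <= `|dsum V k w|) by exists k; rewrite km.
(* [j] is the first index at which [|dsum V|] reaches [ep]. Nothing is stopped before [j] and
   nothing is added from [j] on, so the final value of the stopped sum still has norm at least
   [ep]. *)
case: (ex_minnP ex) => j /andP[jm jep] jmin.
have okl l : (l < j)%N -> ok l w.
  move=> lj; apply/andP; split; first exact/hQ/(leq_trans lj).
  rewrite ltNge; apply/negP => h.
  by have := jmin l; rewrite (leq_trans (ltnW lj) jm) h => /(_ isT); rewrite leqNgt lj.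
apply: nB; rewrite /B/= (@stop_from j m w)//; last first.
  by rewrite /ok negb_and -leNgt jep orbT.
rewrite dsum_stop// -(real_normK (num_real (dsum V j w))) ler_sqr ?nnegrE ?normr_ge0//.
exact: ltW.
Qed.

End lenglart.
End discrete_noise.

(** * Osgood's inequality *)

Section osgood.
Context (R : realType) (rho : R -> R).
Hypothesis hr : osgood_modulus rho.
Local Notation mu := (@lebesgue_measure R).

Lemma osgood_concave (t x y : R) : 0 <= t -> t <= 1 -> 0 <= x -> 0 <= y ->
  t * rho x + (1 - t) * rho y <= rho (t * x + (1 - t) * y).
Proof.
move=> t0 t1 x0 y0; have := osg_concave hr (Itv01 t0 t1).
have inD (v : R) : 0 <= v -> v \in (`[0, +oo[%classic : set R).
  by move=> v0; rewrite inE/= in_itv/= v0.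
move=> /(_ x y (inD x x0) (inD y y0)); rewrite !convRE/=.
by rewrite /unstable.onem !mulrN -opprD lerN2.
Qed.

(** Supporting line of a concave function at an interior point. It serves as Jensen's inequality in
    [a_step]: a bound that is affine in a process is integrable as soon as the process is. *)
Lemma osgood_support (m : R) : 0 < m ->
  exists2 s, 0 <= s & forall z, 0 <= z -> rho z <= rho m + s * (z - m).
Proof.
move=> m0; have m0' := ltW m0.
have slope y z : 0 <= y -> y < m -> m < z ->
    (rho z - rho m) / (z - m) <= (rho m - rho y) / (m - y).
  move=> y0 ym mz; have yz := lt_trans ym mz.
  have z0 : 0 <= z by exact: le_trans (ltW mz).
  have d0 : 0 < z - y by rewrite subr_gt0.
  have dm : 0 < m - y by rewrite subr_gt0.
  have dz : 0 < z - m by rewrite subr_gt0.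
  have := @osgood_concave ((z - m) / (z - y)) y z.
  have -> : (z - m) / (z - y) * y + (1 - (z - m) / (z - y)) * z = m by field; rewrite gt_eqF.
  have -> : (z - m) / (z - y) * rho y + (1 - (z - m) / (z - y)) * rho z =
      ((z - m) * rho y + (m - y) * rho z) / (z - y) by field; rewrite gt_eqF.
  have t0 : 0 <= (z - m) / (z - y) by rewrite divr_ge0// ltW.
  have t1 : (z - m) / (z - y) <= 1 by rewrite ler_pdivrMr// mul1r; lra.
  move=> /(_ t0 t1 y0 z0); rewrite ler_pdivrMr// => h.
  rewrite ler_pdivrMr// mulrAC ler_pdivlMr//; lra.
(* The slope is the supremum of the chord slopes to the right of [m]; every chord slope to the left
   is an upper bound, and monotonicity makes it nonnegative. *)
pose S := [set (rho z - rho m) / (z - m) | z in [set z | m < z]].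
have S1 : S ((rho (m + 1) - rho m) / (m + 1 - m)) by exists (m + 1) => //=; rewrite ltrDl.
have Sub y : 0 <= y -> y < m -> ubound S ((rho m - rho y) / (m - y)).
  by move=> y0 ym _ [z /= mz <-]; exact: slope.
have hs : has_sup S.
  split; first by eexists; exact: S1.
  by exists ((rho m - rho 0) / (m - 0)); exact: Sub.
exists (sup S).
  apply: (@le_trans _ _ ((rho (m + 1) - rho m) / (m + 1 - m))); last exact: ub_le_sup hs.2 _ S1.
  rewrite divr_ge0//; last by rewrite addrAC subrr add0r.
  by rewrite subr_ge0; apply: (osg_nd hr) => //; rewrite lerDl.
move=> z z0; case: (ltgtP z m) => [zm|mz|->]; last by rewrite subrr mulr0 addr0.
  have : sup S <= (rho m - rho z) / (m - z).
    by apply: ge_sup => //; [exists ((rho (m + 1) - rho m) / (m + 1 - m))|exact: Sub].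
  by rewrite ler_pdivlMr ?subr_gt0//; lra.
have : (rho z - rho m) / (z - m) <= sup S by apply: ub_le_sup hs.2 _ _; exists z.
by rewrite ler_pdivrMr ?subr_gt0//; lra.
Qed.

Let f (r : R) : \bar R := ((rho r)^-1)%:E.

Let mf (a b : R) : 0 <= a -> measurable_fun `]a, b] f.
Proof.
(* [rho] is monotone on the half-line only; composed with [max 0] it is monotone, hence measurable,
   on the whole line. *)
move=> a0; have m1 : measurable_fun `]a, b] (fun r => (rho (Num.max 0 r))^-1).
  apply: (measurable_comp (F := [set r : R | 0 < r])) => //.
  - by rewrite (_ : [set r : R | 0 < r] = `]0, +oo[%classic)//; apply/seteqP; split => x /=;
      rewrite in_itv/= andbT.
  - move=> _ [r + <-] /=; rewrite ?in_itv/= => /andP[ar _]; apply: (osg_gt0 hr).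
    by rewrite lt_max (le_lt_trans a0 ar) orbT.
  - apply: open_continuous_measurable_fun.
      by rewrite (_ : [set r : R | 0 < r] = `]0, +oo[%classic); [exact: interval_open|
        apply/seteqP; split => x /=; rewrite in_itv/= andbT].
    by move=> x; rewrite inE/= => x0; apply: inv_continuous; rewrite gt_eqF.
  - apply: nondecreasing_measurable => // x y xy; apply: (osg_nd hr); first by rewrite le_max lexx.
    by rewrite ge_max le_max lexx/= le_max xy orbT.
apply/measurable_EFinP; apply: eq_measurable_fun m1 => r; rewrite inE/= in_itv/= => /andP[ar _].
by rewrite (max_idPr _)// (le_trans a0)// ltW.
Qed.

Let f0 (a b : R) : 0 <= a -> forall r, `]a, b]%classic r -> (0 <= f r)%E.
Proof.
move=> a0 r; rewrite /= in_itv/= => /andP[ar _].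
by rewrite lee_fin invr_ge0 (osg_ge0 hr)// (le_trans a0)// ltW.
Qed.

Let I a b := (\int[mu]_(r in `]a, b]) f r)%E.

Let I_step (a b : R) : 0 < a -> a <= b -> (I a b <= ((b - a) / rho a)%:E)%E.
Proof.
move=> a0 ab; have a0' := ltW a0.
apply: (@le_trans _ _ (\int[mu]_(r in `]a, b]) (cst (((rho a)^-1)%:E)) r)%E).
  apply: ge0_le_integral => //.
  - exact: f0.
  - exact: mf.
  - move=> r /=; rewrite in_itv/= => /andP[ar _]; rewrite lee_fin lef_pV2 ?posrE ?(osg_gt0 hr)//.
      exact: (osg_nd hr) (ltW ar).
    exact: lt_trans ar.
rewrite integral_cst//= lebesgue_measure_itv/= lte_fin.
case: ifPn => [_|]; first by rewrite -EFinB -EFinM mulrC.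
by rewrite -leNgt => ba; rewrite mule0 lee_fin divr_ge0 ?subr_ge0// (osg_ge0 hr).
Qed.

Let I_add (a b c : R) : 0 < a -> a <= b -> b <= c -> I a c = (I a b + I b c)%E.
Proof.
move=> a0 ab bc; rewrite /I -ge0_integral_setU//=.
- by rewrite -itv_bndbnd_setU.
- by rewrite -itv_bndbnd_setU//; exact: mf (ltW a0).
- by move=> x [|] h; [exact: f0 (ltW a0) x h|exact: f0 (le_trans (ltW a0) ab) x h].
- apply/disj_set2P/seteqP; split => // x /= []; rewrite !in_itv/= => /andP[_ h1] /andP[h2 _].
  by move: (le_lt_trans h1 h2); rewrite ltxx.
Qed.

(** Monotone convergence along []psi / (n + 2), psi]], whose union carries the infinite integral of
    [osg_div]; the shift by [2] keeps the left end strictly below [psi]. *)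
Let I_diverge (psi C : R) : 0 < psi -> exists2 e, 0 < e < psi & (C%:E < I e psi)%E.
Proof.
move=> psi0.
pose F (n : nat) := `](psi / n.+2%:R), psi]%classic : set R.
have e0 n : 0 < psi / n.+2%:R by rewrite divr_gt0.
have UF : \bigcup_n F n = `]0, psi]%classic.
  apply/seteqP; split => x /=.
    by move=> [n _]; rewrite /F/= !in_itv/= => /andP[h ->]; rewrite (lt_trans (e0 n) h).
  rewrite in_itv/= => /andP[x0 xpsi]; exists (Num.truncn (psi / x)) => //.
  rewrite /F/= in_itv/= xpsi andbT ltr_pdivrMr// mulrC -ltr_pdivrMr//.
  apply: lt_le_trans (truncnS_gt _) _; by rewrite ler_nat.
have ndF : nondecreasing_seq F.
  move=> m n mn; apply/subsetPset => x /=; rewrite /F/= !in_itv/= => /andP[h ->].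
  rewrite andbT; apply: le_lt_trans h.
  by apply: ler_wpM2l; [exact: ltW|rewrite lef_pV2 ?posrE// ler_nat !ltnS].
have h : (\int[mu]_(x in F i) f x)%E @[i --> \oo] --> (\int[mu]_(x in \bigcup_i F i) f x)%E.
  apply: ge0_nondecreasing_set_cvg_integral => //.
  - by move=> i; exact: measurable_itv.
  - by move=> i; exact: mf (ltW (e0 i)).
  - by move=> i; exact: f0 (ltW (e0 i)).
move: h; rewrite UF (osg_div hr psi0) => /cvgeyPgt /(_ C) [n _ /(_ n (leqnn n)) hn].
exists (psi / n.+2%:R); last exact: hn.
by rewrite e0/= ltr_pdivrMr// ltr_pMr// ltr1n.
Qed.

(** [u] is dominated by the iterates [v] of [x + k rho x] from [e]. As [1 / rho] is nonincreasing,
    each iteration uses up at most [k] of the integral of [1 / rho]; passing [psi] would use more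
    than [C >= m k]. The number [e] serves every [m] and [k], so it can be fixed before the mesh. *)
Lemma osgood_discrete (psi C : R) : 0 < psi -> exists2 e, 0 < e &
  forall (m : nat) (k : R) (u : nat -> R), 0 <= k -> m%:R * k <= C ->
  (forall i, 0 <= u i) -> u 0%N <= e ->
  (forall i, (i < m)%N -> u i.+1 <= u i + k * rho (u i)) ->
  forall i, (i <= m)%N -> u i <= psi.
Proof.
move=> psi0; have [e /andP[e0 epsi] he] := I_diverge C psi0.
exists e => // m k u k0 mk u0 u0e uS.
pose v (i : nat) := iter i (fun x => x + k * rho x) e.
have ve i : e <= v i.
  elim: i => [//|i ih] /=; apply: (le_trans ih).
  by rewrite lerDl mulr_ge0//; apply: (osg_ge0 hr); exact: le_trans (ltW e0) ih.
have v0 i : 0 < v i by exact: lt_le_trans (ve i).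
have vS i : v i <= v i.+1 by rewrite /= lerDl mulr_ge0// (osg_ge0 hr)// ltW.
have Iv i : (I e (v i) <= (i%:R * k)%:E)%E.
  elim: i => [|i ih].
    by rewrite mul0r /I set_itv_ge ?integral_set0// bnd_simp ltxx.
  rewrite (I_add e0 (ve i) (vS i)) -natr1 mulrDl mul1r EFinD leeD//.
  apply: le_trans (I_step (v0 i) (vS i)) _.
  rewrite lee_fin /= addrAC subrr add0r mulfK// gt_eqF//; exact: (osg_gt0 hr).
have uv i : (i <= m)%N -> u i <= v i.
  elim: i => [//|i ih] im; apply: le_trans (uS i im) _.
  rewrite /= lerD ?ih ?(ltnW im)// ler_wpM2l//; apply: (osg_nd hr) => //.
  exact: ih (ltnW im).
move=> i im; apply: le_trans (uv i im) _; rewrite leNgt; apply/negP => pv.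
suff : (C%:E < C%:E)%E by rewrite ltxx.
apply: lt_le_trans he _; apply: le_trans (_ : I e (v i) <= _)%E.
  rewrite (I_add e0 (ltW epsi) (ltW pv)) leeDl//; apply: integral_ge0 => r.
  exact: f0 (ltW psi0) r.
apply: le_trans (Iv i) _; rewrite lee_fin; apply: le_trans mk.
by rewrite ler_wpM2r// ler_nat.
Qed.

End osgood.

(** * Stopped Lyapunov functions *)

Section lyapunov.
Context (R : realType) (rho : R -> R).
Hypothesis hr : osgood_modulus rho.

Section stopped.
Context d (T : measurableType d) (P : probability T R).
Variables (m : nat) (h kappa e : R) (Ga : nat -> T -> bool) (l r : nat -> T -> R).
Hypotheses (h0 : 0 <= h) (k0 : 0 < kappa) (e0 : 0 < e).
Hypothesis mGa : forall k, measurable [set w | Ga k w].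
Hypothesis ndGa : forall k w, Ga k.+1 w -> Ga k w.
Hypothesis l0 : forall k w, 0 <= l k w.
Hypothesis L1l0 : L1 P (l 0%N).
Hypothesis L1l : forall k, (k < m)%N -> L1 P (fun w => (Ga k w)%:R * l k.+1 w).
Hypothesis L1r : forall k, (k < m)%N -> L1 P (fun w => (Ga k w)%:R * r k w).
Hypothesis step : forall k, (k < m)%N ->
  Ex P (fun w => (Ga k w)%:R * l k.+1 w) <=
  Ex P (fun w => (Ga k w)%:R * l k w + h * ((Ga k w)%:R * r k w)).
Hypothesis hrl : forall k w, (k < m)%N -> Ga k w ->
  r k w <= kappa * rho (l k w + e) + kappa * rho e.

(** Frozen at the first index [j] where [Ga j] fails, with the value [l j] included: an overshoot at
    the exit remains visible to Markov's inequality. *)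
Fixpoint stopped k w := if k is k'.+1 then
  (if Ga k' w then l k w else stopped k' w) else l 0%N w.

Let Ga_le j k w : (j <= k)%N -> Ga k w -> Ga j w.
Proof. by move=> /subnK <-; elim: (k - j)%N => [//|i ih]; rewrite addSn => /ndGa. Qed.

Let stoppedE k w : (forall j, (j < k)%N -> Ga j w) -> stopped k w = l k w.
Proof. by case: k => [//|k] h1 /=; rewrite h1. Qed.

Let stopped_ge0 k w : 0 <= stopped k w.
Proof. by elim: k => [|k ih] /=; [exact: l0|case: ifP]. Qed.

Let gaE k : (fun w => (Ga k w)%:R : R) = \1_[set w | Ga k w].
Proof. by apply/funext => w; rewrite indicE mem_setE. Qed.

Let mga k : measurable_fun setT (fun w => (Ga k w)%:R : R).
Proof. by rewrite gaE; exact: measurable_indic. Qed.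

Let bga k w : `|(Ga k w)%:R : R| <= 1.
Proof. by case: (Ga k w); rewrite ?normr1 ?normr0. Qed.

Let L1gl k : (k <= m)%N -> L1 P (fun w => (Ga k w)%:R * l k w).
Proof.
case: k => [_|k km]; first exact: (L1M (mga 0) (bga 0) L1l0).
apply: (L1_ext _ (L1M (mga k.+1) (bga k.+1) (L1l km))) => w.
by case E : (Ga k.+1 w); rewrite ?mul0r ?mul1r// (ndGa E) mul1r.
Qed.

Let stoppedS k w : stopped k.+1 w =
  stopped k w + ((Ga k w)%:R * l k.+1 w - (Ga k w)%:R * l k w).
Proof.
rewrite /=; case E : (Ga k w); last by rewrite !mul0r subr0 addr0.
rewrite !mul1r stoppedE; first by rewrite addrC subrK.
by move=> j jk; apply: Ga_le E; exact: ltnW.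
Qed.

Let L1s k : (k <= m)%N -> L1 P (stopped k).
Proof.
elim: k => [//|k ih] km.
apply: (L1_ext (f := fun w => stopped k w + ((Ga k w)%:R * l k.+1 w - (Ga k w)%:R * l k w))).
  by move=> w; rewrite stoppedS.
apply: L1D; first exact: ih (ltnW km).
by apply: L1B; [exact: L1l|exact: L1gl (ltnW km)].
Qed.

Let a k := Ex P (stopped k).

(** The support line of [rho] at [a k + e] bounds the expected rate; where [Ga] fails the weighted
    rate is [0] and the line is nonnegative. The extra [rho e] is absorbed by [rho (a k + e)],
    whence the factor [2 kappa]. *)
Let a_step k : (k < m)%N -> a k.+1 + e <= a k + e + h * (2 * kappa) * rho (a k + e).
Proof.
move=> km; have km' := ltnW km.
have a0 : 0 <= a k by apply: Ex_ge0.
have me : 0 < a k + e by rewrite ltr_wpDl.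
have [s s0 hs] := osgood_support hr me.
have L1rk := L1r km.
have L1dif : L1 P (fun w => (Ga k w)%:R * l k.+1 w - (Ga k w)%:R * l k w).
  by apply: L1B; [exact: L1l|exact: L1gl].
have -> : a k.+1 = a k + (Ex P (fun w => (Ga k w)%:R * l k.+1 w) - Ex P (fun w => (Ga k w)%:R * l k w)).
  rewrite -ExB; [|exact: L1l|exact: L1gl].
  by rewrite -ExD; [apply: Ex_ext => w; rewrite stoppedS|exact: L1s|].
have : Ex P (fun w => (Ga k w)%:R * l k.+1 w) - Ex P (fun w => (Ga k w)%:R * l k w) <=
    h * Ex P (fun w => (Ga k w)%:R * r k w).
  have := step km; rewrite ExD; [|exact: L1gl|exact: L1Z].
  by rewrite ExZ//; lra.
have L1line : L1 P (fun w => (kappa * s) * stopped k w + kappa * (rho (a k + e) - s * a k + rho e)).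
  by apply: L1D; [apply: L1Z; exact: L1s|exact: L1_cst].
have : Ex P (fun w => (Ga k w)%:R * r k w) <= kappa * rho (a k + e) + kappa * rho e.
  have -> : kappa * rho (a k + e) + kappa * rho e = Ex P
      (fun w => (kappa * s) * stopped k w + kappa * (rho (a k + e) - s * a k + rho e)).
    rewrite ExD; [|by apply: L1Z; exact: L1s|exact: L1_cst].
    by rewrite ExZ ?Ex_cst -/(a k); [ring|exact: L1s].
  apply: Ex_le => // w; have st0 := stopped_ge0 k w.
  have re0 := osg_ge0 hr (ltW e0).
  have z0 : 0 <= stopped k w + e by rewrite addr_ge0// ltW.
  have := hs _ z0; have := osg_ge0 hr z0.
  case E : (Ga k w) => /=; last first.
    rewrite mul0r => h1 h2.
    have : 0 <= kappa * (rho (a k + e) + s * (stopped k w + e - (a k + e)) + rho e).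
      by rewrite mulr_ge0 ?(ltW k0)// addr_ge0// (le_trans h1).
    by move=> h3; apply: le_trans h3 _; rewrite le_eqVlt; apply/orP; left; apply/eqP; ring.
  rewrite mul1r => _ h2.
  apply: le_trans (hrl km E) _.
  rewrite -(@stoppedE k w); last by move=> j jk; apply: Ga_le E; exact: ltnW.
  rewrite -mulrDr -mulrA -mulrDr ler_pM2l//; lra.
have : rho e <= rho (a k + e) by apply: (osg_nd hr); [exact: ltW|rewrite lerDr].
move=> h1 h2 h3.
have : h * Ex P (fun w => (Ga k w)%:R * r k w) <= h * (kappa * rho (a k + e) + kappa * rho (a k + e)).
  apply: ler_wpM2l => //; apply: le_trans h2 _; rewrite lerD2l; exact: ler_wpM2l (ltW k0) _ _ h1.
have -> : h * (2 * kappa) * rho (a k + e) = h * (kappa * rho (a k + e) + kappa * rho (a k + e)) by ring.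
by move=> h4; lra.
Qed.

(** If [l k >= lam] at the exit index [k], then [stopped m] has this same value; its mean is at most
    [psi] by the assumed Osgood bound, and Markov's inequality applies. *)
Lemma stopped_exit psi lam (e' : R) : 0 < lam ->
  (forall (u : nat -> R), (forall i, 0 <= u i) -> u 0%N <= e' ->
    (forall i, (i < m)%N -> u i.+1 <= u i + h * (2 * kappa) * rho (u i)) ->
    forall i, (i <= m)%N -> u i <= psi) ->
  Ex P (l 0%N) + e <= e' ->
  exists B, [/\ measurable B, (P B <= (psi / lam)%:E)%E &
    forall w, ~ B w -> forall k, (k <= m)%N -> (forall j, (j < k)%N -> Ga j w) ->
      ((k < m)%N -> ~~ Ga k w) -> l k w < lam].
Proof.
move=> lam0 hu l0e.
have apsi : a m <= psi.
  have := hu (fun i => a i + e); rewrite /= => /(_ _ l0e a_step m (leqnn m)).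
  move=> H; apply: le_trans (H _); first by rewrite lerDl ltW.
  by move=> i; rewrite addr_ge0 ?(ltW e0)//; exact: Ex_ge0.
exists [set w | lam <= stopped m w]; split.
- rewrite -[X in measurable X]setTI.
  have := measurable_fun_ler (measurable_cst lam) (L1_meas (L1s (leqnn m))).
  by move=> /(_ measurableT [set true]); apply.
- apply: le_trans (markov_ge lam0 (L1s (leqnn m)) (stopped_ge0 m)) _.
  by rewrite lee_fin ler_wpM2r// invr_ge0 ltW.
move=> w /= nB k km hk nk; rewrite ltNge; apply/negP => lk; apply: nB.
suff -> : stopped m w = l k w by [].
rewrite -(stoppedE hk).
move: km; rewrite leq_eqVlt => /predU1P[->//|km]; move: {nk}(nk km) => nk.
rewrite -(subnK (ltnW km)); elim: (m - k)%N => [//|j ih].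
rewrite addSn /=; case: ifP => // /(Ga_le (leq_addl j k)).
by rewrite (negbTE nk).
Qed.

End stopped.

(** Spaces, meshes and processes are quantified after [e]: this number depends on [rho], [kappa],
    the horizon [Tm] and [psi] only, while the basis and the scheme are chosen later. *)
Definition exit_estimate (kappa Tm psi e : R) :=
  forall d (T : measurableType d) (P : probability T R) (m : nat)
    (h : R) (Ga : nat -> T -> bool) (l r : nat -> T -> R),
  0 <= h -> m%:R * h <= Tm ->
  (forall k, measurable [set w | Ga k w]) ->
  (forall k w, Ga k.+1 w -> Ga k w) ->
  (forall k w, 0 <= l k w) -> L1 P (l 0%N) -> Ex P (l 0%N) <= e ->
  (forall k, (k < m)%N -> L1 P (fun w => (Ga k w)%:R * l k.+1 w)) ->
  (forall k, (k < m)%N -> L1 P (fun w => (Ga k w)%:R * r k w)) ->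
  (forall k, (k < m)%N -> Ex P (fun w => (Ga k w)%:R * l k.+1 w) <=
     Ex P (fun w => (Ga k w)%:R * l k w + h * ((Ga k w)%:R * r k w))) ->
  (forall k w, (k < m)%N -> Ga k w -> r k w <= kappa * rho (l k w + e) + kappa * rho e) ->
  forall lam, 0 < lam -> exists B, [/\ measurable B, (P B <= (psi / lam)%:E)%E &
    forall w, ~ B w -> forall k, (k <= m)%N -> (forall j, (j < k)%N -> Ga j w) ->
      ((k < m)%N -> ~~ Ga k w) -> l k w < lam].

Lemma lyapunov (kappa Tm psi : R) : 0 < kappa -> 0 < psi ->
  exists2 e, 0 < e & exit_estimate kappa Tm psi e.
Proof.
move=> k0 psi0; have [e1 e10 he1] := osgood_discrete hr (2 * kappa * Tm) psi0.
have e0 : 0 < e1 / 2 by rewrite divr_gt0.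
(* One half of [e1] is for the initial mean, the other for the shift [e] in [a k + e]. *)
exists (e1 / 2) => // d T P m h Ga l r h0 mh mGa ndGa l0 L1l0 El0 L1l L1r step hrl lam lam0.
apply: (@stopped_exit _ _ P m h kappa (e1 / 2) Ga l r h0 k0 e0 mGa ndGa l0 L1l0 L1l L1r step hrl psi lam e1 lam0).
- move=> u u0 ue us; apply: (he1 m (h * (2 * kappa)) u) => //.
  + by rewrite mulr_ge0// mulr_ge0// ltW.
  + by rewrite mulrA mulrC ler_wpM2l// mulr_ge0// ltW.
- by rewrite -lerBrDr; apply: le_trans El0 _; lra.
Qed.

End lyapunov.

(** * Discretised coefficients *)

Section euclid.
Context (R : realType).

Lemma euc_sqr m n (A : 'M[R]_(m, n)) : euc A ^+ 2 = \sum_i \sum_j A i j ^+ 2.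
Proof.
rewrite /euc sqr_sqrtr.
  apply: eq_bigr => i _; rewrite mxE; apply: eq_bigr => j _.
  by rewrite mxE expr2.
apply: sumr_ge0 => i _; rewrite mxE; apply: sumr_ge0 => j _.
by rewrite mxE -expr2 sqr_ge0.
Qed.

Lemma euc_ge0 m n (A : 'M[R]_(m, n)) : 0 <= euc A.
Proof. exact: sqrtr_ge0. Qed.

Lemma euc_cV n (x : 'cV[R]_n) : euc x ^+ 2 = dotv x x.
Proof. by rewrite euc_sqr; apply: eq_bigr => i _; rewrite big_ord1 expr2. Qed.

Lemma dotvC n (x y : 'cV[R]_n) : dotv x y = dotv y x.
Proof. by apply: eq_bigr => i _; rewrite mulrC. Qed.

Lemma dotvDl n (x y z : 'cV[R]_n) : dotv (x + y) z = dotv x z + dotv y z.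
Proof. by rewrite /dotv -big_split; apply: eq_bigr => i _; rewrite mxE mulrDl. Qed.

Lemma dotvDr n (x y z : 'cV[R]_n) : dotv z (x + y) = dotv z x + dotv z y.
Proof. by rewrite dotvC dotvDl !(dotvC z). Qed.

Lemma dotvZl n a (x y : 'cV[R]_n) : dotv (a *: x) y = a * dotv x y.
Proof. by rewrite /dotv mulr_sumr; apply: eq_bigr => i _; rewrite mxE mulrA. Qed.

Lemma dotvZr n a (x y : 'cV[R]_n) : dotv x (a *: y) = a * dotv x y.
Proof. by rewrite dotvC dotvZl dotvC. Qed.

(** As for [Ex_CS], from the quadratic form [|s x + t y|^2], evaluated at [(b^2, - c)]. *)
Lemma dotv_CS n (x y : 'cV[R]_n) : `|dotv x y| <= euc x * euc y.
Proof.
have key s t : 0 <= s ^+ 2 * euc x ^+ 2 + 2 * (s * t) * dotv x y + t ^+ 2 * euc y ^+ 2.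
  have := sqr_ge0 (euc (s *: x + t *: y)); rewrite (euc_cV (s *: x + t *: y)) dotvDl !dotvDr !dotvZl !dotvZr.
  rewrite (dotvC y x) -!euc_cV => h; apply: le_trans h _.
  by rewrite le_eqVlt; apply/orP; left; apply/eqP; ring.
set a := euc x in key *; set b := euc y in key *; set c := dotv x y in key *.
have a0 : 0 <= a by exact: euc_ge0.
have b0 : 0 <= b by exact: euc_ge0.
have [b00|bn0] := eqVneq b 0.
  suff -> : c = 0 by rewrite normr0 b00 mulr0.
  apply/eqP/negPn/negP => cn0; have := key 1 (- ((a ^+ 2 + 1) / c)); rewrite b00.
  have -> : 1 ^+ 2 * a ^+ 2 + 2 * (1 * - ((a ^+ 2 + 1) / c)) * c +
    (- ((a ^+ 2 + 1) / c)) ^+ 2 * 0 ^+ 2 = - a ^+ 2 - 2 by field.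
  by have := sqr_ge0 a; lra.
have b1 : 0 < b by rewrite lt_neqAle eq_sym bn0.
have := key (b ^+ 2) (- c).
have -> : (b ^+ 2) ^+ 2 * a ^+ 2 + 2 * (b ^+ 2 * - c) * c + (- c) ^+ 2 * b ^+ 2 =
  b ^+ 2 * ((a * b) ^+ 2 - c ^+ 2) by ring.
rewrite pmulr_rge0 ?exprn_gt0// subr_ge0 => h.
by rewrite -ler_sqr ?nnegrE ?mulr_ge0// real_normK ?num_real.
Qed.

Lemma dotv_le n (x y : 'cV[R]_n) : dotv x y <= euc x * euc y.
Proof. by apply: le_trans (ler_norm _) _; exact: dotv_CS. Qed.

Lemma eucN m n (A : 'M[R]_(m, n)) : euc (- A) = euc A.
Proof.
apply/eqP; rewrite -(eqrXn2 (n := 2))// ?euc_ge0// !euc_sqr; apply/eqP.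
by apply: eq_bigr => i _; apply: eq_bigr => j _; rewrite mxE sqrrN.
Qed.

Lemma eucB m n (A B : 'M[R]_(m, n)) : euc (A - B) = euc (B - A).
Proof. by rewrite -eucN opprB. Qed.

Lemma euc0 m n : euc (0 : 'M[R]_(m, n)) = 0.
Proof.
apply/eqP; rewrite -sqrf_eq0 euc_sqr big1// => i _; rewrite big1// => j _.
by rewrite mxE expr0n.
Qed.

Lemma euc_triangle n (x y : 'cV[R]_n) : euc (x + y) <= euc x + euc y.
Proof.
rewrite -ler_sqr ?nnegrE ?addr_ge0 ?euc_ge0// euc_cV dotvDl !dotvDr (dotvC y x) -!euc_cV.
have := dotv_le x y; lra.
Qed.

Lemma euc_triangleB n (x y z : 'cV[R]_n) : euc (x - z) <= euc (x - y) + euc (y - z).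
Proof. by rewrite -[x - z](subrKA y); exact: euc_triangle. Qed.

Lemma euc_entry m n (A : 'M[R]_(m, n)) i j : `|A i j| <= euc A.
Proof.
rewrite -ler_sqr ?nnegrE ?euc_ge0// real_normK ?num_real// euc_sqr.
rewrite (bigD1 i)//= (bigD1 j)//= -addrA lerDl addr_ge0// sumr_ge0// => k _.
  exact: sqr_ge0.
by apply: sumr_ge0 => l _; exact: sqr_ge0.
Qed.

Lemma euc_sum_le m n (A : 'M[R]_(m, n)) : euc A <= \sum_i \sum_j `|A i j|.
Proof.
have S0 : 0 <= \sum_i \sum_j `|A i j|.
  by apply: sumr_ge0 => i _; apply: sumr_ge0 => j _.
rewrite -ler_sqr ?nnegrE ?euc_ge0// euc_sqr expr2 mulr_suml.
apply: ler_sum => i _; rewrite mulr_suml; apply: ler_sum => j _.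
rewrite -real_normK ?num_real// expr2 ler_wpM2l//.
rewrite (bigD1 i)//= (bigD1 j)//= -addrA lerDl addr_ge0// sumr_ge0// => k _.
by apply: sumr_ge0.
Qed.

(* Young: [2 a b <= t a^2 + b^2 / t] *)
Lemma euc_sqrD_le n (x y : 'cV[R]_n) (t : R) : 0 < t ->
  euc (x + y) ^+ 2 <= (1 + t) * euc x ^+ 2 + (1 + t^-1) * euc y ^+ 2.
Proof.
move=> t0; rewrite !euc_sqr !mulr_sumr -big_split; apply: ler_sum => i _ /=.
rewrite !big_ord1 mxE; set a := x i _; set b := y i _.
rewrite -subr_ge0.
have -> : (1 + t) * a ^+ 2 + (1 + t^-1) * b ^+ 2 - (a + b) ^+ 2 = (t * a - b) ^+ 2 / t.
  by field; rewrite gt_eqF.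
by rewrite divr_ge0 ?sqr_ge0 ?ltW.
Qed.

Lemma cvgr_sum (S : Type) (Fi : set_system S) (I : Type) (s : seq I) (f : I -> S -> R) (a : I -> R) :
  Filter Fi -> (forall i, f i x @[x --> Fi] --> a i) ->
  \sum_(i <- s) f i x @[x --> Fi] --> \sum_(i <- s) a i.
Proof.
move=> FF h; elim: s => [|i s ih].
  by rewrite big_nil; under eq_cvg do rewrite big_nil; exact: cvg_cst.
by rewrite big_cons; under eq_cvg do rewrite big_cons; exact: cvgD.
Qed.

(** The topology on matrices is that of the sup norm, so the continuity of the Euclidean norm passes
    through the entries. *)
Lemma euc_subr_cont m n (B : 'M[R]_(m, n)) : continuous (fun A : 'M[R]_(m, n) => euc (A - B)).
Proof.
have -> : (fun A : 'M[R]_(m, n) => euc (A - B)) =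
    Num.sqrt \o (fun A : 'M[R]_(m, n) => \sum_i \sum_j (A i j - B i j) * (A i j - B i j)).
  apply/funext => A /=; rewrite -[LHS](ger0_norm (euc_ge0 _)) -sqrtr_sqr euc_sqr.
  congr Num.sqrt; apply: eq_bigr => i _; apply: eq_bigr => j _.
  by rewrite !mxE expr2.
move=> A; apply: continuous_comp; last exact: sqrt_continuous.
have FA : Filter (nbhs A) by exact: nbhs_filter.
apply: (@cvgr_sum _ (nbhs A) _ _ _ _ FA) => i; apply: (@cvgr_sum _ (nbhs A) _ _ _ _ FA) => j.
by apply: cvgM; apply: cvgB; [exact: coord_continuous|exact: cvg_cst|
  exact: coord_continuous|exact: cvg_cst].
Qed.

End euclid.

Section driven.
Context (R : realType) d (T : measurableType d) (P : probability T R).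
Context dU (U : measurableType dU) (nu : {sigma_finite_measure set U -> \bar R}).
Variables (n : nat) (F : R -> set (set T)) (W : R -> T -> 'cV[R]_n).
Variable N : T -> {measure set (measurableTypeR R * U) -> \bar R}.

Record driven : Prop := {
  dr_F : usual_filtration P F;
  dr_W : brownian P F W;
  dr_N : poisson_random_measure P nu F N;
  dr_WN : indep_systems P (sigma_gen [set t | 0 <= t] (W : R -> T -> borel 'cV[R]_n))
    (sigma_gen (time_slab `[0, +oo[) (fun A w => N w A : \bar R)) }.

Variables (p : nat -> R) (J : finType) (A : J -> set U).

Definition noise_z k (e : 'I_n + J) : T -> R :=
  match e with
  | inl i => dW W (p k) (p k.+1) i
  | inr j => dN nu N (p k) (p k.+1) (A j)
  end.

(** Covariance per unit of time; the vanishing mixed block is [Ex_dWdN]. *)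
Definition noise_q0 (e e' : 'I_n + J) : R :=
  match e, e' with
  | inl i, inl i' => (i == i')%:R
  | inr j, inr j' => fine (nu (A j `&` A j'))
  | _, _ => 0
  end.

Definition noise_q k e e' := (p k.+1 - p k) * noise_q0 e e'.

Lemma driven_noise m : driven -> (forall k, 0 <= p k) -> (forall k, p k <= p k.+1) ->
  (forall j, measurable (A j)) -> (forall j, (nu (A j) < +oo)%E) ->
  discrete_noise P (fun k => F (p k)) m noise_z noise_q.
Proof.
move=> [hF hW hN hWN] p0 pS mA nA; split.
- by move=> k; exact: (filt_algebra hF (p0 k)).
- by move=> k; exact: (filt_measurable hF (p0 k)).
- by move=> k; exact: (filt_mono hF (p0 k) (pS k)).
- move=> k [i|j] _; first exact: (Gm_dW hF hW i (p0 k) (pS k)).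
  exact: (Gm_dN hF hN (p0 k) (pS k) (mA j)).
- move=> k [i|j] _; first by have [] := dW_mom hF hW i (p0 k) (pS k).
  by have [] := dN_mom hN (p0 k) (pS k) (mA j) (nA j).
- move=> k [i|j] xi _ Gx lx; first by have [_ ->] := Ex_dW hF hW i (p0 k) (pS k) Gx lx.
  by have [_ ->] := Ex_dN hN (p0 k) (pS k) (mA j) (nA j) Gx lx.
- move=> k e e' xi M _ Gx xM; rewrite /noise_q.
  have mx := Gm_meas (filt_measurable hF (p0 k)) Gx.
  have lx := L1_bdd P mx xM.
  have cross i j := Ex_dWdN hF hW hN hWN i (mA j) (nA j) (p0 k) (pS k) Gx xM.
  case: e e' => [i|j] [i'|j'] /=.
  + have [<-|ii'] := eqVneq i i'.
      rewrite mulr1 -(Ex_dW2 hF hW i (p0 k) (pS k) Gx lx).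
      by apply: Ex_ext => w; rewrite expr2.
    by rewrite mulr0 mul0r (Ex_dWdW hF hW (p0 k) (pS k) ii' Gx xM).
  + by rewrite mulr0 mul0r cross.
  + rewrite mulr0 mul0r -(cross i' j); apply: Ex_ext => w.
    by congr (_ * _); rewrite mulrC.
  + by have [_ ->] := Ex_dNdN hN (p0 k) (pS k) (mA j) (mA j') (nA j) (nA j') Gx lx.
Qed.

End driven.

Section weighted_step.
Context (R : realType) d (T : measurableType d) (P : probability T R).
Variables (G : nat -> set (set T)) (m : nat) (E : finType).
Variables (z : nat -> E -> T -> R) (q : nat -> E -> E -> R).
Hypothesis hz : discrete_noise P G m z q.
Variable V : nat -> E -> T -> R.
Hypothesis GV : forall k e, Gm (G k) (V k e).
Hypothesis bV : forall k e, exists M, forall w, `|V k e w| <= M.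

(** The cross term is a martingale increment and the squared noise is replaced by its conditional
    covariance. Bounds are asked of [xi], [xi x] and [xi x^2] rather than of [x], since [xi] will
    contain the indicator of an event on which [x] is bounded. *)
Lemma weighted_step k (xi x : T -> R) : (k < m)%N -> Gm (G k) xi -> Gm (G k) x ->
  (exists M, forall w, `|xi w| <= M) -> (exists M, forall w, `|xi w * x w| <= M) ->
  (exists M, forall w, `|xi w * x w ^+ 2| <= M) ->
  L1 P (fun w => xi w * (x w + \sum_e V k e w * z k e w) ^+ 2) /\
  Ex P (fun w => xi w * (x w + \sum_e V k e w * z k e w) ^+ 2) =
  Ex P (fun w => xi w * x w ^+ 2 + xi w * \sum_e \sum_e' V k e w * V k e' w * q k e e').
Proof.
move=> km Gxi Gx [M1 b1] [M2 b2] [M3 b3].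
have Gk := dn_algebra hz k; have sk := @dn_sub _ _ _ _ _ _ _ _ _ hz k.
pose S w := \sum_e V k e w * z k e w.
have lS : L2 P S by exact: (L2_dstep hz GV bV km).
have mxi := Gm_meas sk Gxi; have mx := Gm_meas sk Gx.
have G2 : Gm (G k) (fun w => xi w * x w) by exact: (GmM Gk Gxi Gx).
have G3 : Gm (G k) (fun w => xi w * x w ^+ 2) by exact: (GmM Gk Gxi (GmM Gk Gx Gx)).
have l3 := L1_bdd P (Gm_meas sk G3) b3.
have l2 : L2 P (fun w => xi w * x w) := L2_bdd P (Gm_meas sk G2) b2.
have lx2 : L1 P (fun w => 2 * ((xi w * x w) * S w)) by apply: L1Z; exact: L2M.
have lS2 : L1 P (fun w => xi w * S w ^+ 2) by apply: L1M mxi b1 _; case: lS.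
have E1 : (fun w => xi w * (x w + S w) ^+ 2) =1
    (fun w => (xi w * x w ^+ 2 + 2 * ((xi w * x w) * S w)) + xi w * S w ^+ 2).
  by move=> w; ring.
have l4 : L1 P (fun w => xi w * (x w + S w) ^+ 2).
  apply: (L1_ext (f := fun w => (xi w * x w ^+ 2 + 2 * ((xi w * x w) * S w)) + xi w * S w ^+ 2)).
    by move=> w; rewrite E1.
  by apply: L1D => //; exact: L1D.
split => //; rewrite (Ex_ext P E1) ExD//; last exact: L1D.
rewrite ExD// ExZ; last exact: L2M.
rewrite (Ex_dstep_orth hz GV bV km G2 l2) mulr0 addr0.
rewrite (Ex_dstep2 hz GV bV km Gxi b1) -ExD//.
apply: (@L1M _ _ _ _ _ _ M1 mxi b1); apply: L1_sum => e _; apply: L1_sum => e' _.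
apply: (L1_ext _ (L1Z (q k e e') (L1_VV hz GV bV k e e'))) => w.
by rewrite mulrC.
Qed.

End weighted_step.

(** Adaptedness is handled coordinate by coordinate, and [G] has to range over the members of a
    filtration and over the sigma-algebra of the increments; quantifying over [G] lets the notion
    compose with all of them. *)
Definition cmeas (R : realType) n (psi : 'cV[R]_n -> R) :=
  forall d (T : measurableType d) (G : set (set T)) (Y : T -> 'cV[R]_n),
  sigma_algebra setT G -> (forall i, Gm G (fun w => Y w i ord0)) ->
  Gm G (fun w => psi (Y w)).

Section scheme.
Context (R : realType) (n : nat) dU (U : measurableType dU).
Variable nu : {sigma_finite_measure set U -> \bar R}.
Variables (b : 'cV[R]_n -> 'cV[R]_n) (sigma : 'cV[R]_n -> 'M[R]_n) (c : 'cV[R]_n -> U -> 'cV[R]_n).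
Hypothesis c_meas : measurable_fun [set: borel 'cV[R]_n * U]
  (fun z => (c z.1 z.2 : borel 'cV[R]_n)).

(* Coefficients with finitely many values: [x] is replaced by a point [sc_pi x]
   of a finite net and [c (sc_pi x)] by a step function on disjoint cells. *)
Record scheme := Scheme {
  sc_pi : 'cV[R]_n -> 'cV[R]_n;
  sc_J : finType;
  sc_A : sc_J -> set U;
  sc_a : sc_J -> 'cV[R]_n -> 'cV[R]_n }.

Definition sc_fun (s : scheme) (x : 'cV[R]_n) (u : U) : 'cV[R]_n :=
  \sum_(j : sc_J s) \1_(sc_A j) u *: sc_a j x.

(** [so_meas] and [so_bdd] can be asked of arbitrary [phi] because [sc_pi] will take finitely many
    values on measurable pieces. The proposition [l1] switches the L1 approximation on: it is [True]
    under condition (a) and [False] under (b), where the jump coefficient is controlled in L2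
    only. *)
Record scheme_ok (s : scheme) (K q : R) (l1 : Prop) : Prop := {
  so_meas : forall phi : 'cV[R]_n -> R, cmeas (fun x => phi (sc_pi s x));
  so_bdd : forall phi : 'cV[R]_n -> R, exists M, forall x, `|phi (sc_pi s x)| <= M;
  so_mA : forall j : sc_J s, measurable (sc_A j);
  so_nA : forall j : sc_J s, (nu (sc_A j) < +oo)%E;
  so_dis : forall i j : sc_J s, i != j -> sc_A i `&` sc_A j = set0;
  so_K : forall x, euc x <= K -> euc (sc_pi s x) <= K;
  so_pi : forall x, euc x <= K -> euc (sc_pi s x - x) <= q;
  so_b : forall x, euc x <= K -> euc (b (sc_pi s x) - b x) <= q;
  so_s : forall x, euc x <= K -> euc (sigma (sc_pi s x) - sigma x) <= q;
  so_c : forall x, euc x <= K ->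
    (\int[nu]_u (euc (c (sc_pi s x) u - c x u) ^+ 2)%:E <= q%:E)%E;
  so_a : forall x, euc x <= K ->
    (\int[nu]_u (euc (c (sc_pi s x) u - sc_fun s (sc_pi s x) u) ^+ 2)%:E <= q%:E)%E;
  so_a1 : l1 -> forall x, euc x <= K ->
    (\int[nu]_u (euc (c (sc_pi s x) u - sc_fun s (sc_pi s x) u))%:E <= q%:E)%E }.

Lemma meas_c_entry x i : measurable_fun setT (fun u => c x u i ord0).
Proof.
have h : measurable_fun [set: U] (fun u => c x u : borel 'cV[R]_n).
  apply: (measurableT_comp c_meas (g := fun u : U => (x : borel 'cV[R]_n, u))).
  exact: measurable_fun_pair.
apply: (measurableT_comp (f := fun M : borel 'cV[R]_n => (M : 'cV[R]_n) i ord0) _ h).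
by apply: borel_continuous; exact: coord_continuous.
Qed.

Definition vmeas (v : U -> 'cV[R]_n) := forall i, measurable_fun setT (fun u => v u i ord0).

Lemma vmeas_c x : vmeas (c x). Proof. by move=> i; exact: meas_c_entry. Qed.

Lemma vmeasB v w : vmeas v -> vmeas w -> vmeas (fun u => v u - w u).
Proof.
move=> mv mw i; under eq_fun do rewrite !mxE.
exact: measurable_funB.
Qed.

Lemma vmeasD v w : vmeas v -> vmeas w -> vmeas (fun u => v u + w u).
Proof.
move=> mv mw i; under eq_fun do rewrite !mxE.
exact: measurable_funD.
Qed.

Lemma vmeas_euc2 v : vmeas v -> measurable_fun setT (fun u => euc (v u) ^+ 2).
Proof.
move=> mv; under eq_fun do (rewrite euc_sqr; under eq_bigr do rewrite big_ord1).
by apply: measurable_sum => i; apply: measurable_funX; exact: mv.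
Qed.

Lemma vmeas_euc v : vmeas v -> measurable_fun setT (fun u => euc (v u)).
Proof.
move=> /vmeas_euc2 h; rewrite (_ : (fun u => _) = Num.sqrt \o (fun u => euc (v u) ^+ 2)).
  apply: measurableT_comp => //; apply: continuous_measurable_fun; exact: sqrt_continuous.
by apply/funext => u /=; rewrite sqrtr_sqr ger0_norm ?euc_ge0.
Qed.

Lemma vmeas_step (J : finType) (A : J -> set U) (v : J -> 'cV[R]_n) :
  (forall j, measurable (A j)) -> vmeas (fun u => \sum_j \1_(A j) u *: v j).
Proof.
move=> mA i; under eq_fun do (rewrite summxE; under eq_bigr do rewrite mxE).
apply: measurable_sum => j; apply: measurable_funM => //; exact: measurable_indic.
Qed.

(** At most one cell contains [u], so at most one term survives; [phi 0 = 0] covers the points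
    outside all cells. *)
Lemma step_fun (J : finType) (A : J -> set U) (v : J -> 'cV[R]_n) (phi : 'cV[R]_n -> R) u :
  (forall i j, i != j -> A i `&` A j = set0) -> phi 0 = 0 ->
  phi (\sum_j \1_(A j) u *: v j) = \sum_j \1_(A j) u * phi (v j).
Proof.
move=> dis phi0.
have [[j Aj]|nA] := pselect (exists j, A j u).
  have oth k : k != j -> (\1_(A k) u : R) = 0.
    move=> kj; rewrite indicE memNset// => Ak.
    by have : (A k `&` A j) u by []; rewrite dis.
  rewrite (bigD1 j)//= [in RHS](bigD1 j)//= !big1; last 2 first.
  - by move=> k /oth ->; rewrite mul0r.
  - by move=> k /oth ->; rewrite scale0r.
  by rewrite indicE mem_set// scale1r mul1r !addr0.
have z j : (\1_(A j) u : R) = 0 by rewrite indicE memNset// => Aj; apply: nA; exists j.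
by rewrite !big1// => j _; rewrite z ?scale0r ?mul0r.
Qed.

Lemma step_integral (J : finType) (A : J -> set U) (r : J -> R) :
  (forall j, measurable (A j)) -> (forall j, (nu (A j) < +oo)%E) -> (forall j, 0 <= r j) ->
  (\int[nu]_u (\sum_j \1_(A j) u * r j)%:E = (\sum_j fine (nu (A j)) * r j)%:E)%E.
Proof.
move=> mA nA r0; under eq_integral do rewrite -sumEFin.
rewrite ge0_integral_sum//; last 2 first.
- move=> j; apply/measurable_EFinP; apply: measurable_funM => //; exact: measurable_indic.
- by move=> j u _; rewrite lee_fin mulr_ge0.
rewrite -sumEFin; apply: eq_bigr => j _.
under eq_integral do rewrite mulrC EFinM.
rewrite ge0_integralZl//; try (by apply/measurable_EFinP; exact: measurable_indic).
by rewrite integral_indic// setIT mulrC EFinM fineK// ge0_fin_numE.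
by rewrite lee_fin.
Qed.

Definition I2 (v : U -> 'cV[R]_n) : \bar R := (\int[nu]_u (euc (v u) ^+ 2)%:E)%E.
Definition I1 (v : U -> 'cV[R]_n) : \bar R := (\int[nu]_u (euc (v u))%:E)%E.

Lemma I2_ge0 v : (0 <= I2 v)%E.
Proof. by apply: integral_ge0 => u _; rewrite lee_fin sqr_ge0. Qed.

Lemma I2D v w (t : R) : 0 < t -> vmeas v -> vmeas w ->
  (I2 (fun u => v u + w u)%R <= (1 + t)%:E * I2 v + (1 + t^-1)%:E * I2 w)%E.
Proof.
move=> t0 mv mw.
have m1 := vmeas_euc2 mv; have m2 := vmeas_euc2 mw; have m3 := vmeas_euc2 (vmeasD mv mw).
have t1 : 0 <= 1 + t by rewrite addr_ge0// ltW.
have t2 : 0 <= 1 + t^-1 by rewrite addr_ge0// invr_ge0 ltW.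
have Z (k : R) (f : U -> R) : 0 <= k -> measurable_fun setT (fun u : U => f u ^+ 2) ->
    (k%:E * \int[nu]_u (f u ^+ 2)%R%:E = \int[nu]_u (k * f u ^+ 2)%R%:E)%E.
  move=> k0 mf; rewrite -ge0_integralZl//.
  - exact/measurable_EFinP.
  - by move=> u _; rewrite lee_fin sqr_ge0.
rewrite /I2 !Z// -ge0_integralD//; last 4 first.
- by move=> u _; rewrite lee_fin mulr_ge0// sqr_ge0.
- by apply/measurable_EFinP; exact: measurable_funM.
- by move=> u _; rewrite lee_fin mulr_ge0// sqr_ge0.
- by apply/measurable_EFinP; exact: measurable_funM.
apply: ge0_le_integral => //.
- by move=> u _; rewrite lee_fin sqr_ge0.
- exact/measurable_EFinP.
- by apply/measurable_EFinP; apply: measurable_funD; exact: measurable_funM.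
- by move=> u _; rewrite -EFinD lee_fin; exact: euc_sqrD_le.
Qed.

Lemma I2N v : I2 (fun u => - v u) = I2 v.
Proof. by apply: eq_integral => u _; rewrite eucN. Qed.

Lemma I1D v w : vmeas v -> vmeas w -> (I1 (fun u => v u + w u)%R <= I1 v + I1 w)%E.
Proof.
move=> mv mw.
have m1 := vmeas_euc mv; have m2 := vmeas_euc mw; have m3 := vmeas_euc (vmeasD mv mw).
rewrite /I1 -ge0_integralD//; last 4 first.
- by move=> u _; rewrite lee_fin euc_ge0.
- exact/measurable_EFinP.
- by move=> u _; rewrite lee_fin euc_ge0.
- exact/measurable_EFinP.
apply: ge0_le_integral => //.
- by move=> u _; rewrite lee_fin euc_ge0.
- exact/measurable_EFinP.
- by apply/measurable_EFinP; exact: measurable_funD.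
- by move=> u _; rewrite -EFinD lee_fin; exact: euc_triangle.
Qed.

End scheme.

(** * One-step bounds for the discretised coefficients *)

Section deterministic.
Context (R : realType) (n : nat) dU (U : measurableType dU).
Variable nu : {sigma_finite_measure set U -> \bar R}.
Variables (b : 'cV[R]_n -> 'cV[R]_n) (sigma : 'cV[R]_n -> 'M[R]_n) (c : 'cV[R]_n -> U -> 'cV[R]_n).
Hypothesis c_meas : measurable_fun [set: borel 'cV[R]_n * U]
  (fun z => (c z.1 z.2 : borel 'cV[R]_n)).
Variable rho : R -> R.
Hypothesis hr : osgood_modulus rho.
Variables (K kappa delta0 Cb : R).
Hypotheses (kappa0 : 0 < kappa) (d0 : 0 < delta0).
Hypothesis hCb : forall x, euc x <= K -> euc (b x) <= Cb.

Variable s : scheme R n U.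
Notation pi := (sc_pi s).
Definition sc_b X Y := b (pi Y) - b (pi X).
Definition sc_s X Y := sigma (pi Y) - sigma (pi X).
Definition sc_da X Y (j : sc_J s) := sc_a j (pi Y) - sc_a j (pi X).

Lemma scheme_ok_le q q' l1 : q <= q' -> scheme_ok nu b sigma c s K q l1 ->
  scheme_ok nu b sigma c s K q' l1.
Proof.
move=> qq' [] *; split => //.
all: try (by move=> x Kx; apply: le_trans qq'; auto).
all: try (by move=> x Kx; apply: le_trans (_ : q%:E <= q'%:E)%E; [auto|rewrite lee_fin]).
by move=> hl x Kx; apply: le_trans (_ : q%:E <= q'%:E)%E; [auto|rewrite lee_fin].
Qed.

Section bounds.
Variables (q : R) (l1 : Prop).
Hypothesis ok : scheme_ok nu b sigma c s K q l1.
Hypothesis q0 : 0 < q.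
Variables X Y D : 'cV[R]_n.
Hypotheses (KX : euc X <= K) (KY : euc Y <= K).
Hypothesis DXY : euc (D - (Y - X)) <= q.

Let Cb0 : 0 <= Cb. Proof. exact: le_trans (euc_ge0 _) (hCb KX). Qed.

Let KpX : euc (pi X) <= K := so_K ok KX.
Let KpY : euc (pi Y) <= K := so_K ok KY.

(** One [q] for [D] against [Y - X], and one for each of the two projections. *)
Let Dpi : euc (D - (pi Y - pi X)) <= 3 * q.
Proof.
have -> : D - (pi Y - pi X) = (D - (Y - X)) + ((pi X - X) - (pi Y - Y)).
  by apply/matrixP => i j; rewrite !mxE; ring.
apply: le_trans (euc_triangle _ _) _.
have : euc ((pi X - X) - (pi Y - Y)) <= 2 * q.
  apply: le_trans (euc_triangle _ _) _; rewrite eucN.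
  by have := so_pi ok KX; have := so_pi ok KY; lra.
by have := DXY; lra.
Qed.

Lemma pi_dist : euc (pi Y - pi X) <= euc D + 3 * q.
Proof.
have -> : pi Y - pi X = D + - (D - (pi Y - pi X)) by apply/matrixP => i j; rewrite !mxE; ring.
apply: le_trans (euc_triangle _ _) _; rewrite eucN; have := Dpi; lra.
Qed.

(** The difference of the drifts is at most [2 Cb]; replacing [D] by the projected difference costs
    [2 (3 q) (2 Cb)], and the term with [h <= q] costs [q (2 Cb)^2]. *)
Lemma drift_bound h : 0 <= h -> h <= q ->
  2 * dotv D (sc_b X Y) + h * euc (sc_b X Y) ^+ 2 <=
  2 * dotv (pi Y - pi X) (sc_b X Y) + q * (12 * Cb + 4 * Cb ^+ 2).
Proof.
move=> h0 hq.
have bC : euc (sc_b X Y) <= 2 * Cb.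
  apply: le_trans (euc_triangle _ _) _; rewrite eucN.
  by have := hCb KpX; have := hCb KpY; lra.
have -> : dotv D (sc_b X Y) = dotv (pi Y - pi X) (sc_b X Y) + dotv (D - (pi Y - pi X)) (sc_b X Y).
  by rewrite -dotvDl; congr dotv; apply/matrixP => i j; rewrite !mxE; ring.
have h1 : dotv (D - (pi Y - pi X)) (sc_b X Y) <= (3 * q) * (2 * Cb).
  by apply: le_trans (dotv_le _ _) _; apply: ler_pM => //; exact: euc_ge0.
have h2 : h * euc (sc_b X Y) ^+ 2 <= q * (2 * Cb) ^+ 2.
  apply: ler_pM => //; first exact: sqr_ge0.
  by rewrite ler_sqr ?nnegrE ?euc_ge0// mulr_ge0.
move: h1 h2; set u := dotv (D - _) _; set v := h * _ => h1 h2.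
have -> : q * (12 * Cb + 4 * Cb ^+ 2) = 2 * (3 * q * (2 * Cb)) + q * (2 * Cb) ^+ 2 by ring.
lra.
Qed.

Let scE (X' Y' : 'cV[R]_n) u : sc_fun s Y' u - sc_fun s X' u =
  \sum_(j : sc_J s) \1_(sc_A j) u *: (sc_a j Y' - sc_a j X').
Proof. by rewrite /sc_fun -sumrB; apply: eq_bigr => j _; rewrite scalerBr. Qed.

Let vsc x : vmeas (sc_fun s x).
Proof. by apply: vmeas_step; exact: so_mA ok. Qed.

Let err u := (sc_fun s (pi Y) u - c (pi Y) u) + (c (pi X) u - sc_fun s (pi X) u).

Let errE u : sc_fun s (pi Y) u - sc_fun s (pi X) u = (c (pi Y) u - c (pi X) u) + err u.
Proof. by rewrite /err; apply/matrixP => i j; rewrite !mxE; ring. Qed.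

Let verr : vmeas err.
Proof. by apply: vmeasD; apply: vmeasB => //; exact: vmeas_c. Qed.

Let two (x y : \bar R) (r : R) : (0 <= x)%E -> (0 <= y)%E -> (x <= r%:E)%E -> (y <= r%:E)%E ->
  ((1 + 1)%:E * x + (1 + 1^-1)%:E * y <= (4 * r)%:E)%E.
Proof.
move=> x0 y0 xr yr.
have fx : x \is a fin_num by rewrite ge0_fin_numE// (le_lt_trans xr)// ltry.
have fy : y \is a fin_num by rewrite ge0_fin_numE// (le_lt_trans yr)// ltry.
move: xr yr; rewrite -(fineK fx) -(fineK fy) -!EFinM -!EFinD !lee_fin invr1; lra.
Qed.

Let young (I I' : \bar R) (Cc t : R) : (0 <= I)%E -> (0 <= I')%E -> (I <= (4 * Cc)%:E)%E ->
  (I' <= (4 * q)%:E)%E -> 0 < t ->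
  ((1 + t)%:E * I + (1 + t^-1)%:E * I' <= I + (4 * t * Cc + (1 + t^-1) * (4 * q))%:E)%E.
Proof.
case: I => [u| |]//; case: I' => [v| |]//; rewrite -!EFinM -!EFinD !lee_fin => u0 v0 hu hv t0.
have -> : (1 + t) * u + (1 + t^-1) * v = u + (t * u + (1 + t^-1) * v) by ring.
rewrite lerD2l; apply: lerD.
  have -> : 4 * t * Cc = t * (4 * Cc) by ring.
  by apply: ler_wpM2l hu; exact: ltW.
by apply: ler_wpM2l hv; rewrite addr_ge0// invr_ge0 ltW.
Qed.

(** The jump integral must keep the coefficient [1], because condition (b) bounds its sum with a
    drift term of arbitrary sign. Young's inequality with a free parameter [t] achieves this: the
    excess [t] times the integral is at most [4 t Cc] on the ball. *)
Lemma jump_bound2 (Cc t : R) : 0 < t ->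
  (forall x, euc x <= K -> (I2 nu (c x) <= Cc%:E)%E) ->
  ((\sum_(j : sc_J s) fine (nu (sc_A j)) * euc (sc_da X Y j) ^+ 2)%R%:E <=
  I2 nu (fun u => (c (pi Y) u - c (pi X) u)%R) + (4 * t * Cc + (1 + t^-1) * (4 * q))%:E)%E.
Proof.
move=> t0 hCc.
have -> : (\sum_(j : sc_J s) fine (nu (sc_A j)) * euc (sc_da X Y j) ^+ 2)%:E =
    I2 nu (fun u => sc_fun s (pi Y) u - sc_fun s (pi X) u).
  rewrite -(step_integral (r := fun j => euc (sc_da X Y j) ^+ 2) (so_mA ok) (so_nA ok)); last first.
    by move=> j; exact: sqr_ge0.
  apply: eq_integral => u _; rewrite scE.
  rewrite -(step_fun (phi := fun v => euc v ^+ 2) (sc_da X Y) u (so_dis ok))//.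
  by rewrite euc0 expr0n.

have vcc : vmeas (fun u => c (pi Y) u - c (pi X) u) by apply: vmeasB; exact: vmeas_c.
have -> : I2 nu (fun u => sc_fun s (pi Y) u - sc_fun s (pi X) u) =
    I2 nu (fun u => (c (pi Y) u - c (pi X) u) + err u).
  by apply: eq_integral => u _; rewrite errE.
apply: le_trans (I2D nu t0 vcc verr) _.
have Ierr : (I2 nu err <= (4 * q)%:E)%E.
  apply: le_trans (I2D nu ltr01 (vmeasB (vsc _) (vmeas_c c_meas _)) (vmeasB (vmeas_c c_meas _) (vsc _))) _.
  have hY : (I2 nu (fun u => c (pi Y) u - sc_fun s (pi Y) u)%R <= q%:E)%E by exact: (so_a ok KY).
  have hX : (I2 nu (fun u => c (pi X) u - sc_fun s (pi X) u)%R <= q%:E)%E by exact: (so_a ok KX).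
  have -> : I2 nu (fun u => sc_fun s (pi Y) u - c (pi Y) u) = I2 nu (fun u => c (pi Y) u - sc_fun s (pi Y) u).
    by apply: eq_integral => u _; rewrite eucB.
  exact: (two (I2_ge0 _ _) (I2_ge0 _ _) hY hX).
have Icc : (I2 nu (fun u => c (pi Y) u - c (pi X) u)%R <= (4 * Cc)%:E)%E.
  have vN : vmeas (fun u => - c (pi X) u).
    by move=> i; under eq_fun do rewrite mxE; apply: measurable_funN; exact: vmeas_c.
  apply: le_trans (I2D nu ltr01 (vmeas_c c_meas (pi Y)) vN) _.
  rewrite I2N; exact: (two (I2_ge0 _ _) (I2_ge0 _ _) (hCc _ KpY) (hCc _ KpX)).
exact: (young (I2_ge0 _ _) (I2_ge0 _ _) Icc Ierr t0).
Qed.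

Lemma jump_bound1 : l1 ->
  ((\sum_(j : sc_J s) fine (nu (sc_A j)) * euc (sc_da X Y j))%R%:E <=
  I1 nu (fun u => (c (pi Y) u - c (pi X) u)%R) + (2 * q)%:E)%E.
Proof.
move=> hl1.
have -> : (\sum_(j : sc_J s) fine (nu (sc_A j)) * euc (sc_da X Y j))%:E =
    I1 nu (fun u => sc_fun s (pi Y) u - sc_fun s (pi X) u).
  rewrite -(step_integral (r := fun j => euc (sc_da X Y j)) (so_mA ok) (so_nA ok)); last first.
    by move=> j; exact: euc_ge0.
  apply: eq_integral => u _; rewrite scE.
  by rewrite -(step_fun (phi := fun v => euc v) (sc_da X Y) u (so_dis ok))// euc0.
have vcc : vmeas (fun u => c (pi Y) u - c (pi X) u) by apply: vmeasB; exact: vmeas_c.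
have -> : I1 nu (fun u => sc_fun s (pi Y) u - sc_fun s (pi X) u) =
    I1 nu (fun u => (c (pi Y) u - c (pi X) u) + err u).
  by apply: eq_integral => u _; rewrite errE.
apply: le_trans (I1D nu vcc verr) _; rewrite leeD2l//.
apply: le_trans (I1D nu (vmeasB (vsc _) (vmeas_c c_meas _)) (vmeasB (vmeas_c c_meas _) (vsc _))) _.
have -> : 2 * q = q + q by ring.
rewrite EFinD; apply: leeD; last exact: (so_a1 ok hl1 KX).
have -> : I1 nu (fun u => sc_fun s (pi Y) u - c (pi Y) u) = I1 nu (fun u => c (pi Y) u - sc_fun s (pi Y) u).
  by apply: eq_integral => u _; rewrite eucB.
exact: (so_a1 ok hl1 KY).
Qed.

End bounds.
End deterministic.

Section rates.
Context (R : realType) (n : nat) dU (U : measurableType dU).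
Variable nu : {sigma_finite_measure set U -> \bar R}.
Variables (b : 'cV[R]_n -> 'cV[R]_n) (sigma : 'cV[R]_n -> 'M[R]_n) (c : 'cV[R]_n -> U -> 'cV[R]_n).
Hypothesis c_meas : measurable_fun [set: borel 'cV[R]_n * U]
  (fun z => (c z.1 z.2 : borel 'cV[R]_n)).
Variable rho : R -> R.
Hypothesis hr : osgood_modulus rho.
Variables (K kappa delta0 Cb Cc : R).
Hypotheses (kappa0 : 0 < kappa) (d0 : 0 < delta0) (Cb0 : 0 <= Cb) (Cc0 : 0 <= Cc).
Hypothesis hCb : forall x, euc x <= K -> euc (b x) <= Cb.
Hypothesis hCc : forall x, euc x <= K -> (I2 nu (c x) <= Cc%:E)%E.

(** Growth per unit of time of the squared difference: given the past, the mean of [|D|^2] after a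
    step of length [h] is [|D|^2 + h rate_b]. *)
Definition rate_b (s : scheme R n U) h X Y D : R :=
  2 * dotv D (sc_b b s X Y) + h * euc (sc_b b s X Y) ^+ 2 + euc (sc_s sigma s X Y) ^+ 2 +
  \sum_(j : sc_J s) fine (nu (sc_A j)) * euc (sc_da X Y j) ^+ 2.

Definition cond_b := forall x z : 'cV[R]_n, euc x <= K -> euc z <= K -> euc (x - z) <= delta0 ->
  ((2 * dotv (x - z) (b x - b z) + euc (sigma x - sigma z) ^+ 2)%:E
    + I2 nu (fun u => (c x u - c z u)%R) <= (kappa * rho (euc (x - z) ^+ 2))%:E)%E.

Lemma rate_b_le (e theta : R) : cond_b -> 0 < e -> 0 < theta -> theta <= 1 ->
  theta <= delta0 / 2 ->
  exists2 eta, 0 < eta & forall s l1, scheme_ok nu b sigma c s K eta l1 ->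
    forall h X Y D, 0 <= h -> h <= eta -> euc X <= K -> euc Y <= K ->
    euc (D - (Y - X)) <= eta -> euc D <= theta ->
    rate_b s h X Y D <= kappa * rho (euc D ^+ 2 + e) + kappa * rho e.
Proof.
move=> hb e0 th0 th1 thd.
pose k0 := kappa * rho e.
have k00 : 0 < k0 by rewrite mulr_gt0// (osg_gt0 hr).
(* [t] bounds the excess of Young's inequality by half of [kappa rho e]; [eta] has to come
   afterwards, because the remaining error carries [1 / t]. *)
have [t t0 tC] : exists2 t, 0 < t & 4 * t * Cc <= k0 / 2.
  have Cc1 : 0 < Cc + 1 by rewrite ltr_wpDl.
  exists (k0 / (8 * (Cc + 1))); first by rewrite divr_gt0// mulr_gt0.
  have -> : k0 / 2 = 4 * (k0 / (8 * (Cc + 1))) * (Cc + 1) by field; rewrite gt_eqF.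
  apply: ler_wpM2l; last by rewrite lerDl.
  by apply: mulr_ge0 => //; apply: divr_ge0; [exact: ltW|apply: mulr_ge0 => //; exact: ltW].
pose C := 12 * Cb + 4 * Cb ^+ 2 + (1 + t^-1) * 4 + 1.
have C1 : 0 < C.
  have ti0 : 0 < t^-1 by rewrite invr_gt0.
  rewrite /C; apply: ltr_wpDl => //; have h2 := sqr_ge0 Cb.
  have := Cb0; lra.
(* [delta0 / 6] keeps the projected points within [delta0]; [e / 15] gives
   [(|D| + 3 eta)^2 <= |D|^2 + e], using [|D| <= 1] and [eta <= 1]; [k0 / (2 C)] bounds the
   remaining errors by half of [kappa rho e]. *)
pose eta := Num.min (Num.min 1 (delta0 / 6)) (Num.min (e / 15) (k0 / (2 * C))).
have eta0 : 0 < eta by rewrite !lt_min ltr01 !divr_gt0// mulr_gt0.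
exists eta => // s l1 ok h X Y D h0 heta KX KY DXY Dth.
have [eta1 etad etae etak] : [/\ eta <= 1, eta <= delta0 / 6, eta <= e / 15 & eta <= k0 / (2 * C)].
  have : eta <= eta by []. 
  by rewrite {2}/eta !le_min => /andP[/andP[-> ->] /andP[-> ->]].
have KpX := so_K ok KX; have KpY := so_K ok KY.
have D0 := euc_ge0 D.
have dist := pi_dist ok KX KY DXY.
have distd : euc (sc_pi s Y - sc_pi s X) <= delta0 by lra.
have drift := drift_bound hCb ok KX KY DXY h0 heta.
have jump := jump_bound2 c_meas ok KX KY t0 hCc.
have := hb _ _ KpY KpX distd.
set I := I2 nu _ in jump *.
have Ifin : I \is a fin_num.
  rewrite ge0_fin_numE ?I2_ge0//.
  have := hb _ _ KpY KpX distd; rewrite -/I.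
  by case: (I) => // r; rewrite ltry.
move: jump; rewrite -(fineK Ifin) -!EFinD !lee_fin /rate_b.
move: drift; rewrite -/(sc_b b s X Y) -/(sc_s sigma s X Y).
set S := \sum_j _; set v := fine I; set r := euc (sc_pi s Y - sc_pi s X).
set dr := dotv (sc_pi s Y - _) _; set g := euc (sc_s _ _ _ _) ^+ 2.
move=> drift jump cond.
have rr : rho (r ^+ 2) <= rho (euc D ^+ 2 + e).
  apply: (osg_nd hr); first exact: sqr_ge0.
  have r0 : 0 <= r by exact: euc_ge0.
  have : r ^+ 2 <= (euc D + 3 * eta) ^+ 2.
    by rewrite ler_sqr ?nnegrE// addr_ge0// mulr_ge0// ltW.
  have : euc D * eta <= 1 * eta by rewrite ler_wpM2r ?(ltW eta0)//; lra.
  have : eta * eta <= 1 * eta by rewrite ler_wpM2r ?(ltW eta0)//.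
  have -> : (euc D + 3 * eta) ^+ 2 = euc D ^+ 2 + 6 * (euc D * eta) + 9 * (eta * eta) by ring.
  lra.
have krr : kappa * rho (r ^+ 2) <= kappa * rho (euc D ^+ 2 + e) by rewrite ler_wpM2l// ltW.
have eC : eta * C <= k0 / 2.
  have -> : k0 / 2 = k0 / (2 * C) * C by field; rewrite gt_eqF.
  by rewrite ler_wpM2r// ltW.
have eC' : eta * (12 * Cb + 4 * Cb ^+ 2) + (1 + t^-1) * (4 * eta) = eta * C - eta.
  by rewrite /C; ring.
rewrite -/k0; lra.
Qed.

(** Bound for the growth rate of [sqrt (|D|^2 + eps^2)]: the drift and Brownian growth of the square
    divided by twice the root, plus the jumps in L1. The factor [2] of the jumps is that of [E |dN|]
    in [dN_mom]. *)
Definition rate_a (s : scheme R n U) h eps X Y D : R :=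
  (2 * dotv D (sc_b b s X Y) + h * euc (sc_b b s X Y) ^+ 2 + euc (sc_s sigma s X Y) ^+ 2) /
    (2 * Num.sqrt (euc D ^+ 2 + eps ^+ 2)) +
  2 * \sum_(j : sc_J s) fine (nu (sc_A j)) * euc (sc_da X Y j).

Definition cond_a := forall x z : 'cV[R]_n, euc x <= K -> euc z <= K -> euc (x - z) <= delta0 ->
  2 * dotv (z - x) (b z - b x) + euc (sigma z - sigma x) ^+ 2
    <= kappa * euc (z - x) * rho (euc (z - x)) /\
  (I1 nu (fun u => (c z u - c x u)%R) <= (kappa * rho (euc (z - x)))%:E)%E.

(** The constant [3 kappa] is one [kappa] for the quotient and two for the doubled jump term. *)
Lemma rate_a_le (e eps theta : R) : cond_a -> 0 < e -> 0 < eps -> 0 < theta ->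
  theta <= delta0 / 2 ->
  exists2 eta, 0 < eta & forall s, scheme_ok nu b sigma c s K eta True ->
    forall h X Y D, 0 <= h -> h <= eta -> euc X <= K -> euc Y <= K ->
    euc (D - (Y - X)) <= eta -> euc D <= theta ->
    rate_a s h eps X Y D <=
      (3 * kappa) * rho (Num.sqrt (euc D ^+ 2 + eps ^+ 2) + e) + (3 * kappa) * rho e.
Proof.
move=> ha e0 ep0 th0 thd.
pose k0 := kappa * rho e.
have k00 : 0 < k0 by rewrite mulr_gt0// (osg_gt0 hr).
pose C := (12 * Cb + 4 * Cb ^+ 2) / (2 * eps) + 4.
have C1 : 0 < C.
  rewrite /C ltr_wpDl// divr_ge0//; last by rewrite mulr_ge0// ltW.
  by have := sqr_ge0 Cb; have := Cb0; lra.
(* [eps / 3] gives [r <= |D| + 3 eta <= 2 f], so the factor [r] of the condition cancels against the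
   denominator [2 f]; [e / 3] gives [r <= f + e]; [k0 / C] absorbs the errors. *)
pose eta := Num.min (Num.min (eps / 3) (delta0 / 6)) (Num.min (e / 3) (k0 / C)).
have eta0 : 0 < eta by rewrite !lt_min !divr_gt0.
exists eta => // s ok h X Y D h0 heta KX KY DXY Dth.
have [eta1 etad etae etak] : [/\ eta <= eps / 3, eta <= delta0 / 6, eta <= e / 3 & eta <= k0 / C].
  have : eta <= eta by [].
  by rewrite {2}/eta !le_min => /andP[/andP[-> ->] /andP[-> ->]].
have KpX := so_K ok KX; have KpY := so_K ok KY.
have D0 := euc_ge0 D.
have dist := pi_dist ok KX KY DXY.
have distd : euc (sc_pi s X - sc_pi s Y) <= delta0 by rewrite eucB; lra.
have drift := drift_bound hCb ok KX KY DXY h0 heta.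
have jump := jump_bound1 c_meas ok KX KY Logic.I.
have [cond1 cond2] := ha _ _ KpX KpY distd.
move: jump cond2; set I := I1 nu _ => jump cond2.
have I0 : (0 <= I)%E by apply: integral_ge0 => u _; rewrite lee_fin euc_ge0.
have Ifin : I \is a fin_num.
  by rewrite ge0_fin_numE// (le_lt_trans cond2)// ltry.
move: jump cond2; rewrite -(fineK Ifin) -!EFinD !lee_fin /rate_a.
move: drift cond1; rewrite -/(sc_b b s X Y) -/(sc_s sigma s X Y).
set S := \sum_j _; set v := fine I; set r := euc (sc_pi s Y - sc_pi s X).
set dr := dotv (sc_pi s Y - _) _; set g := euc (sc_s _ _ _ _) ^+ 2.
set f := Num.sqrt _.
move=> drift cond1 jump cond2.
have f0 : eps <= f.
  by rewrite -(ger0_norm (ltW ep0)) -sqrtr_sqr ler_wsqrtr// lerDr sqr_ge0.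
have fD : euc D <= f.
  by rewrite -(ger0_norm D0) -sqrtr_sqr ler_wsqrtr// lerDl sqr_ge0.
have fp : 0 < f by exact: lt_le_trans f0.
have distr : r <= euc D + 3 * eta := dist.
have r0 : 0 <= r by exact: euc_ge0.
have rr : rho r <= rho (f + e).
  by apply: (osg_nd hr) => //; lra.
have rho0 : 0 <= rho r by exact: (osg_ge0 hr).
have krr : kappa * rho r <= kappa * rho (f + e) by rewrite ler_wpM2l// ltW.
set Q := 2 * dotv D _ + _ + g.
have h1 : Q <= kappa * r * rho r + eta * (12 * Cb + 4 * Cb ^+ 2) by rewrite /Q; lra.
have h2 : kappa * r * rho r <= kappa * rho r * (2 * f).
  have -> : kappa * r * rho r = kappa * rho r * r by ring.
  by apply: ler_wpM2l; [rewrite mulr_ge0// ltW|lra].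
have h3 : eta * (12 * Cb + 4 * Cb ^+ 2) <= eta * ((12 * Cb + 4 * Cb ^+ 2) / (2 * eps)) * (2 * f).
  have -> : eta * ((12 * Cb + 4 * Cb ^+ 2) / (2 * eps)) * (2 * f) =
      eta * (12 * Cb + 4 * Cb ^+ 2) * (f / eps) by field; rewrite gt_eqF.
  rewrite ler_peMr//; last by rewrite ler_pdivlMr// mul1r.
  by apply: mulr_ge0; [exact: ltW|have := sqr_ge0 Cb; have := Cb0; lra].
have h4 : Q / (2 * f) <= kappa * rho r + eta * ((12 * Cb + 4 * Cb ^+ 2) / (2 * eps)).
  by rewrite ler_pdivrMr ?mulr_gt0// mulrDl; lra.
have eC : eta * C <= k0.
  have -> : k0 = k0 / C * C by field; rewrite gt_eqF.
  by rewrite ler_wpM2r// ltW.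
have eC' : eta * ((12 * Cb + 4 * Cb ^+ 2) / (2 * eps)) = eta * C - 4 * eta by rewrite /C; ring.
have -> : 3 * kappa * rho (f + e) + 3 * kappa * rho e = 3 * (kappa * rho (f + e)) + 3 * k0.
  by rewrite /k0; ring.
lra.
Qed.

End rates.

(** * Stability of the Euler scheme *)

Lemma cmeas_euc (R : realType) n (x : 'cV[R]_n) : cmeas (fun y => euc (y - x)).
Proof.
move=> d T G Y sG GY.
rewrite (_ : (fun w => _) = Num.sqrt \o (fun w => \sum_i (Y w i ord0 - x i ord0) * (Y w i ord0 - x i ord0))).
  apply: (Gm_comp sG); first by apply: continuous_measurable_fun; exact: sqrt_continuous.
  apply: (Gm_sum sG) => i; have h := GmB sG (GY i) (Gm_cst sG (x i ord0)).
  exact: (GmM sG h h).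
apply/funext => w /=; rewrite -[LHS](ger0_norm (euc_ge0 _)) -sqrtr_sqr euc_cV.
by congr Num.sqrt; apply: eq_bigr => i _; rewrite !mxE.
Qed.

Section soft.
Context (R : realType) (n : nat).
Implicit Types (eps : R) (x y : 'cV[R]_n).

(** Smooth substitute for the norm: its derivative [1 / (2 soft)] with respect to [|x|^2] is at most
    [1 / (2 eps)]. *)
Definition soft eps x := Num.sqrt (euc x ^+ 2 + eps ^+ 2).

Lemma soft_sqr eps x : soft eps x ^+ 2 = euc x ^+ 2 + eps ^+ 2.
Proof. by rewrite sqr_sqrtr// addr_ge0// sqr_ge0. Qed.

Lemma soft_ge0 eps x : 0 <= soft eps x. Proof. exact: sqrtr_ge0. Qed.

Lemma soft_ge eps x : euc x <= soft eps x.
Proof. by rewrite -ler_sqr ?nnegrE ?euc_ge0 ?soft_ge0// soft_sqr lerDl sqr_ge0. Qed.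

Lemma soft_ge_eps eps x : 0 <= eps -> eps <= soft eps x.
Proof. by move=> e0; rewrite -ler_sqr ?nnegrE ?soft_ge0// soft_sqr lerDr sqr_ge0. Qed.

Lemma soft_le eps x : 0 <= eps -> soft eps x <= euc x + eps.
Proof.
move=> e0; have x0 := euc_ge0 x.
rewrite -ler_sqr ?nnegrE ?soft_ge0 ?addr_ge0// soft_sqr sqrrD addrAC lerDl.
by rewrite mulrn_wge0// mulr_ge0.
Qed.

Lemma soft_add eps x y : soft eps (x + y) <= soft eps x + euc y.
Proof.
have s0 := soft_ge0 eps x; have y0 := euc_ge0 y; have x0 := euc_ge0 x.
rewrite -ler_sqr ?nnegrE ?soft_ge0 ?addr_ge0// soft_sqr sqrrD soft_sqr.
have h1 : euc (x + y) ^+ 2 <= (euc x + euc y) ^+ 2.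
  by rewrite ler_sqr ?nnegrE ?euc_ge0 ?addr_ge0//; exact: euc_triangle.
have h2 : euc x * euc y <= soft eps x * euc y by apply: ler_wpM2r => //; exact: soft_ge.
move: h1 h2; rewrite sqrrD !mulr2n.
move: (euc (x + y) ^+ 2) (euc x ^+ 2) (euc y ^+ 2) (euc x * euc y) (soft eps x * euc y) => a1 a2 a3 a4 a5.
lra.
Qed.

(** Concavity of the square root in the variable [|x|^2 + eps^2]. The bound is quadratic in [x], so
    its conditional mean after one step is given by [weighted_step]. *)
Lemma soft_tangent eps x y : 0 < eps ->
  soft eps x <= soft eps y + (euc x ^+ 2 - euc y ^+ 2) / (2 * soft eps y).
Proof.
move=> e0; have s0 : 0 < soft eps y := lt_le_trans e0 (soft_ge_eps y (ltW e0)).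
rewrite -lerBlDl ler_pdivlMr ?mulr_gt0//.
have := sqr_ge0 (soft eps x - soft eps y); rewrite sqrrB mulr2n.
have := soft_sqr eps x; have := soft_sqr eps y.
move: (soft eps x) (soft eps y) => a c' h1 h2 h3.
have -> : (a - c') * (2 * c') = 2 * (a * c') - 2 * c' ^+ 2 by ring.
lra.
Qed.

Lemma eucZ r x : euc (r *: x) = `|r| * euc x.
Proof.
apply/eqP; rewrite -(eqrXn2 (n := 2))// ?mulr_ge0 ?euc_ge0//; apply/eqP.
by rewrite exprMn real_normK ?num_real// !euc_cV dotvZl dotvZr mulrA expr2.
Qed.

End soft.

Section euler.
Context (R : realType) (n : nat) dU (U : measurableType dU).
Variables (b : 'cV[R]_n -> 'cV[R]_n) (sigma : 'cV[R]_n -> 'M[R]_n).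
Variable s : scheme R n U.
Notation E := ('I_n + sc_J s)%type.

Definition sc_coef (x : 'cV[R]_n) (e : E) (i : 'I_n) : R :=
  match e with
  | inl l => sigma (sc_pi s x) i l
  | inr j => sc_a j (sc_pi s x) i ord0
  end.

Definition sc_inc (h : R) (z : E -> R) (x : 'cV[R]_n) : 'cV[R]_n :=
  \col_i (h * b (sc_pi s x) i ord0 + \sum_e sc_coef x e i * z e).

Fixpoint sc_sum h (z : nat -> E -> R) (X : nat -> 'cV[R]_n) x0 k : 'cV[R]_n :=
  if k is k'.+1 then sc_sum h z X x0 k' + sc_inc h (z k') (X k') else x0.

Fixpoint euler h (z : nat -> E -> R) y0 k : 'cV[R]_n :=
  if k is k'.+1 then euler h z y0 k' + sc_inc h (z k') (euler h z y0 k') else y0.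

End euler.

Section stability.
Context (R : realType) (n : nat) dU (U : measurableType dU).
Variable nu : {sigma_finite_measure set U -> \bar R}.
Variables (b : 'cV[R]_n -> 'cV[R]_n) (sigma : 'cV[R]_n -> 'M[R]_n) (c : 'cV[R]_n -> U -> 'cV[R]_n).
Context d (T : measurableType d) (P : probability T R).
Variables (F : R -> set (set T)) (W : R -> T -> 'cV[R]_n).
Variable N : T -> {measure set (measurableTypeR R * U) -> \bar R}.
Hypothesis drv : driven P nu F W N.
Variables (s : scheme R n U) (K q eta theta h : R) (l1 : Prop) (m : nat).
Hypothesis ok : scheme_ok nu b sigma c s K q l1.
Hypotheses (h0 : 0 < h) (K0 : 0 <= K) (eta0 : 0 <= eta) (th0 : 0 <= theta).
Notation p k := (k%:R * h).
Notation G k := (F (p k)).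
Notation z := (noise_z nu W N (fun k => p k) (@sc_A _ _ _ _ s)).
Variables (X Y : nat -> T -> 'cV[R]_n) (x0 y0 : 'cV[R]_n).
Hypothesis GX : forall k i, Gm (G k) (fun w => X k w i ord0).
Hypothesis YE : forall k w, Y k w = euler b sigma h (fun k e => z k e w) y0 k.

Definition Xt k w : 'cV[R]_n := sc_sum b sigma h (fun k e => z k e w) (X ^~ w) x0 k.
Definition Dv k w : 'cV[R]_n := Y k w - Xt k w.

Let p0 k : 0 <= p k. Proof. by rewrite mulr_ge0// ltW. Qed.
Let pS k : p k <= p k.+1. Proof. by rewrite ler_wpM2r ?ler_nat// ltW. Qed.

Let hz : discrete_noise P (fun k => G k) m z (noise_q nu (fun k => p k) (@sc_A _ _ _ _ s)).
Proof. by apply: driven_noise => //; [exact: so_mA ok|exact: so_nA ok]. Qed.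

(** [discrete_noise] speaks of the steps below its bound; with the bound [k + 1], step [k] is
    available whatever [m] is. *)
Let hzS k : discrete_noise P (fun k => G k) k.+1 z (noise_q nu (fun k => p k) (@sc_A _ _ _ _ s)).
Proof. by apply: driven_noise => //; [exact: so_mA ok|exact: so_nA ok]. Qed.

Let Gk k : sigma_algebra setT (G k) := dn_algebra hz k.
Let sk k : (G k `<=` measurable)%classic := @dn_sub _ _ _ _ _ _ _ _ _ hz k.

Lemma Gm_sc_inc k (Z : T -> 'cV[R]_n) i : (forall i, Gm (G k) (fun w => Z w i ord0)) ->
  Gm (G k.+1) (fun w => sc_inc b sigma h (fun e => z k e w) (Z w) i ord0).
Proof.
move=> GZ.
have ps (phi : 'cV[R]_n -> R) : Gm (G k.+1) (fun w => phi (sc_pi s (Z w))).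
  exact: (Gm_le hz (leqnSn k) (so_meas ok phi (Gk k) GZ)).
rewrite (_ : (fun w => _) = fun w => h * b (sc_pi s (Z w)) i ord0 +
    \sum_e sc_coef sigma (Z w) e i * z k e w); last by apply/funext => w; rewrite mxE.
apply: (GmD (Gk _)); first exact: (GmM (Gk _) (Gm_cst (Gk _) h) (ps (fun x => b x i ord0))).
apply: (Gm_sum (Gk _)) => e; apply: (GmM (Gk _)); last exact: (dn_adapted (hzS k) e (ltnSn k)).
by case: e => [l|j]; [exact: (ps (fun x => sigma x i l))|exact: (ps (fun x => sc_a j x i ord0))].
Qed.

Lemma Gm_Y k i : Gm (G k) (fun w => Y k w i ord0).
Proof.
have -> : (fun w => Y k w i ord0) = fun w => euler b sigma h (fun k e => z k e w) y0 k i ord0.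
  by apply/funext => w; rewrite YE.
elim: k i => [|k ih] i; first exact: (Gm_cst (Gk _) _).
rewrite (_ : (fun w => _) = fun w => euler b sigma h (fun k e => z k e w) y0 k i ord0 +
   sc_inc b sigma h (fun e => z k e w) (euler b sigma h (fun k e => z k e w) y0 k) i ord0); last first.
  by apply/funext => w; rewrite mxE.
by apply: (GmD (Gk _)); [exact: (Gm_le hz (leqnSn k))|exact: Gm_sc_inc].
Qed.

Lemma Gm_Xt k i : Gm (G k) (fun w => Xt k w i ord0).
Proof.
elim: k i => [|k ih] i; first exact: (Gm_cst (Gk _) _).
rewrite (_ : (fun w => _) = fun w => Xt k w i ord0 +
   sc_inc b sigma h (fun e => z k e w) (X k w) i ord0); last first.
  by apply/funext => w; rewrite /Xt /= mxE.
by apply: (GmD (Gk _)); [exact: (Gm_le hz (leqnSn k))|exact: Gm_sc_inc].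
Qed.

Lemma Gm_Dv k i : Gm (G k) (fun w => Dv k w i ord0).
Proof.
rewrite (_ : (fun w => _) = fun w => Y k w i ord0 - Xt k w i ord0); last first.
  by apply/funext => w; rewrite !mxE.
by apply: (GmB (Gk _)); [exact: Gm_Y|exact: Gm_Xt].
Qed.

Let Gm_euc k (Z : T -> 'cV[R]_n) : (forall i, Gm (G k) (fun w => Z w i ord0)) ->
  Gm (G k) (fun w => euc (Z w)).
Proof.
move=> GZ; have := cmeas_euc (0 : 'cV[R]_n) (Gk k) GZ.
by rewrite (_ : (fun w => _) = fun w => euc (Z w))//; apply/funext => w; rewrite subr0.
Qed.

Definition good k w := [&& euc (X k w) <= K, euc (Y k w) <= K,
  euc (Xt k w - X k w) <= eta & euc (Dv k w) <= theta].

Fixpoint Ga k w := if k is k'.+1 then Ga k' w && good k w else good 0 w.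

Lemma GaP k w : reflect (forall j, (j <= k)%N -> good j w) (Ga k w).
Proof.
elim: k => [|k ih] /=; first by apply: (iffP idP) => [hg j|/(_ 0%N)]; [rewrite leqn0 => /eqP ->|apply].
apply: (iffP andP) => [[/ih h1 h2] j|hj].
  by rewrite leq_eqVlt ltnS => /predU1P[->//|]; exact: h1.
by split; [apply/ih => j jk; apply: hj; exact: leqW|exact: hj].
Qed.

Lemma GGa k : Gb (G k) (Ga k).
Proof.
have G1 j : Gb (G j) (good j).
  have GXX i : Gm (G j) (fun w => (Xt j w - X j w) i ord0).
    rewrite (_ : (fun w => _) = fun w => Xt j w i ord0 - X j w i ord0); last first.
      by apply/funext => w; rewrite !mxE.
    by apply: (GmB (Gk _)) => //; exact: Gm_Xt.
  apply: (Gb_and (Gk j)); first exact: (Gb_ler K (Gm_euc (GX j))).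
  apply: (Gb_and (Gk j)); first exact: (Gb_ler K (Gm_euc (Gm_Y j))).
  apply: (Gb_and (Gk j)); first exact: (Gb_ler eta (Gm_euc GXX)).
  exact: (Gb_ler theta (Gm_euc (Gm_Dv j))).
elim: k => [|k ih]; first exact: G1.
by apply: (Gb_and (Gk k.+1)); [exact: (Gb_le hz (leqnSn k) ih)|exact: G1].
Qed.

Lemma Ga_good k w : Ga k w -> good k w.
Proof. by move/GaP => /(_ k (leqnn k)). Qed.

Lemma Ga_mono k w : Ga k.+1 w -> Ga k w.
Proof. by case/andP. Qed.

Let ga k w : R := (Ga k w)%:R.
Let Gga k : Gm (G k) (ga k) := Gm_bool (Gk k) (GGa k).
Let bga k w : `|ga k w| <= 1.
Proof. by rewrite /ga; case: (Ga k w); rewrite ?normr1 ?normr0. Qed.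

Let be k w i := sc_b b s (X k w) (Y k w) i ord0.
Let Vc (i : 'I_n) k (e : ('I_n + sc_J s)%type) w := sc_coef sigma (Y k w) e i - sc_coef sigma (X k w) e i.

Let GVc i k e : Gm (G k) (Vc i k e).
Proof.
have ps (phi : 'cV[R]_n -> R) (Z : T -> 'cV[R]_n) : (forall i, Gm (G k) (fun w => Z w i ord0)) ->
    Gm (G k) (fun w => phi (sc_pi s (Z w))) by exact: (so_meas ok phi (Gk k)).
apply: (GmB (Gk _)); case: e => [l|j].
- exact: (ps (fun x => sigma x i l) _ (Gm_Y k)).
- exact: (ps (fun x => sc_a j x i ord0) _ (Gm_Y k)).
- exact: (ps (fun x => sigma x i l) _ (GX k)).
- exact: (ps (fun x => sc_a j x i ord0) _ (GX k)).
Qed.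

Let bcoef i (e : ('I_n + sc_J s)%type) : exists M : R, forall x, `|sc_coef sigma x e i| <= M.
Proof.
by case: e => [l|j]; [exact: (so_bdd ok (fun x => sigma x i l))|exact: (so_bdd ok (fun x => sc_a j x i ord0))].
Qed.

Let bVc i k e : exists M : R, forall w, `|Vc i k e w| <= M.
Proof.
have [M hM] := bcoef i e; exists (M + M) => w.
by apply: le_trans (ler_normB _ _) _; apply: lerD.
Qed.

Let Gbe k i : Gm (G k) (fun w => be k w i).
Proof.
rewrite (_ : (fun w => _) = fun w => b (sc_pi s (Y k w)) i ord0 - b (sc_pi s (X k w)) i ord0); last first.
  by apply/funext => w; rewrite /be !mxE.
apply: (GmB (Gk _)); first exact: (so_meas ok (fun x => b x i ord0) (Gk k) (Gm_Y k)).
exact: (so_meas ok (fun x => b x i ord0) (Gk k) (GX k)).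
Qed.

Let bbe k i : exists M : R, forall w, `|be k w i| <= M.
Proof.
have [M hM] := so_bdd ok (fun x => b x i ord0); exists (M + M) => w.
by rewrite /be !mxE; apply: le_trans (ler_normB _ _) _; apply: lerD.
Qed.

Let xi_ i k w := Dv k w i ord0 + h * be k w i.

Let Gx i k : Gm (G k) (xi_ i k).
Proof. by apply: (GmD (Gk _)); [exact: Gm_Dv|exact: (GmM (Gk _) (Gm_cst (Gk _) h) (Gbe k i))]. Qed.

Let bx i k : exists M : R, 0 <= M /\ forall w, Ga k w -> `|xi_ i k w| <= M.
Proof.
have [M hM] := bbe k i; exists (theta + h * `|M|); split.
  by apply: addr_ge0 => //; apply: mulr_ge0 => //; exact: ltW.
move=> w /Ga_good/and4P[_ _ _ hD]; apply: le_trans (ler_normD _ _) _; apply: lerD.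
  exact: le_trans (euc_entry _ _ _) hD.
rewrite normrM (gtr0_norm h0); apply: ler_wpM2l; first exact: ltW.
exact: le_trans (hM w) (ler_norm M).
Qed.

Lemma DvS k w i : Dv k.+1 w i ord0 = xi_ i k w + \sum_e Vc i k e w * z k e w.
Proof.
have e1 : Y k.+1 w = Y k w + sc_inc b sigma h (fun e => z k e w) (Y k w) by rewrite !YE.
have e2 : Xt k.+1 w = Xt k w + sc_inc b sigma h (fun e => z k e w) (X k w) by [].
rewrite /Dv e1 e2 /xi_ /be /Dv /sc_b !mxE /Vc.
rewrite (_ : \sum_e (_ - _) * _ = \sum_e sc_coef sigma (Y k w) e i * z k e w -
    \sum_e sc_coef sigma (X k w) e i * z k e w); last first.
  by rewrite -sumrB; apply: eq_bigr => e _; rewrite mulrBl.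
by ring.
Qed.

Lemma xi_sqr k w : \sum_i xi_ i k w ^+ 2 = euc (Dv k w) ^+ 2 +
  h * (2 * dotv (Dv k w) (sc_b b s (X k w) (Y k w)) + h * euc (sc_b b s (X k w) (Y k w)) ^+ 2).
Proof.
rewrite !euc_cV /dotv !mulr_sumr -big_split/= mulr_sumr -big_split/=.
by apply: eq_bigr => i _; rewrite /xi_ /be; ring.
Qed.

Let dp k : p k.+1 - p k = h. Proof. by rewrite -[k.+1]addn1 natrD mulrDl mul1r addrAC subrr add0r. Qed.

(** Disjointness of the cells makes the covariance diagonal in the jump indices as well. *)
Lemma cov_sum (V : 'I_n -> 'I_n + sc_J s -> R) k :
  \sum_i \sum_e \sum_e' V i e * V i e' * noise_q nu (fun k => p k) (@sc_A _ _ _ _ s) k e e' =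
  h * (\sum_i \sum_l V i (inl l) ^+ 2 + \sum_(j : sc_J s) fine (nu (sc_A j)) * \sum_i V i (inr j) ^+ 2).
Proof.
rewrite exchange_big/= [in RHS]exchange_big/=.
under [X in _ = h * (_ + X)]eq_bigr do rewrite mulr_sumr.
rewrite mulrDr big_sumType/=; congr (_ + _).
  rewrite mulr_sumr; apply: eq_bigr => l _; rewrite mulr_sumr; apply: eq_bigr => i _.
  rewrite big_sumType/= [X in _ + X]big1 ?addr0; last first.
    by move=> j _; rewrite /noise_q/= !mulr0.
  rewrite (bigD1 l)//= big1 ?addr0; last first.
    by move=> l' ll'; rewrite /noise_q/= eq_sym (negbTE ll') !mulr0.
  by rewrite /noise_q dp /= eqxx mulr1 -expr2 mulrC.
rewrite mulr_sumr; apply: eq_bigr => j _; rewrite mulr_sumr; apply: eq_bigr => i _.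
rewrite big_sumType/= [X in X + _]big1 ?add0r; last first.
  by move=> l _; rewrite /noise_q/= !mulr0.
rewrite (bigD1 j)//= big1 ?addr0; last first.
  move=> j' jj'; rewrite /noise_q/= (so_dis ok) ?measure0/= ?mulr0//.
  by rewrite eq_sym.
by rewrite /noise_q dp /= setIid -expr2 mulrC -mulrA.
Qed.

(** At the first index [j] with [|D| > theta], all earlier indices are good and [Ga j] fails, so [j]
    is an exit index to which the hypothesis applies, a contradiction. *)
Lemma exit_good (B : set T) : (forall w, ~ B w -> forall k, (k <= m)%N ->
    (forall j, (j < k)%N -> Ga j w) -> ((k < m)%N -> ~~ Ga k w) -> euc (Dv k w) <= theta) ->
  forall w, ~ B w -> forall k, (k <= m)%N ->
    (forall j, (j < k)%N -> [/\ euc (X j w) <= K, euc (Y j w) <= K & euc (Xt j w - X j w) <= eta]) ->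
    euc (Dv k w) <= theta.
Proof.
move=> hB w nB k km hk.
rewrite leNgt; apply/negP => kth.
have ex : exists k, (k <= m)%N && (theta < euc (Dv k w)) by exists k; rewrite km.
have kmin : (ex_minn ex <= k)%N by case: ex_minnP => j _; apply; rewrite km.
case: ex_minnP kmin => j /andP[jm jth] jmin jk.
have Gaj i : (i < j)%N -> Ga i w.
  move=> ij; apply/GaP => l li.
  have lj := leq_ltn_trans li ij.
  have [? ? ?] := hk l (leq_trans lj jk).
  apply/and4P; split => //; rewrite leNgt; apply/negP => lth.
  by have := jmin l; rewrite lth (leq_trans (ltnW lj) jm) => /(_ isT); rewrite leqNgt lj.
have nG : (j < m)%N -> ~~ Ga j w.
  by move=> _; apply/negP => /Ga_good/and4P[_ _ _]; rewrite leNgt jth.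
by have := hB w nB j jm Gaj nG; rewrite leNgt jth.
Qed.

Section energy_b.

Let lb k w := euc (Dv k w) ^+ 2.
Let rb k w := rate_b nu b sigma s h (X k w) (Y k w) (Dv k w).

Let wstep i k := @weighted_step _ _ _ _ _ k.+1 _ _ _ (hzS k) (Vc i) (GVc i) (bVc i) k
  (ga k) (xi_ i k) (ltnSn k) (Gga k) (Gx i k).

Let wstep' i k : L1 P (fun w => ga k w * Dv k.+1 w i ord0 ^+ 2) /\
  L1 P (fun w => ga k w * xi_ i k w ^+ 2 + ga k w *
    \sum_e \sum_e' Vc i k e w * Vc i k e' w * noise_q nu (fun k => p k) (@sc_A _ _ _ _ s) k e e') /\
  Ex P (fun w => ga k w * Dv k.+1 w i ord0 ^+ 2) =
  Ex P (fun w => ga k w * xi_ i k w ^+ 2 + ga k w *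
    \sum_e \sum_e' Vc i k e w * Vc i k e' w * noise_q nu (fun k => p k) (@sc_A _ _ _ _ s) k e e').
Proof.
have [M [M0 hM]] := bx i k.
have b1 : exists M, forall w, `|ga k w| <= M by exists 1; exact: bga.
have b2 : exists M, forall w, `|ga k w * xi_ i k w| <= M.
  exists M => w; rewrite /ga; case E : (Ga k w); last by rewrite mul0r normr0.
  by rewrite mul1r; exact: hM.
have b3 : exists M, forall w, `|ga k w * xi_ i k w ^+ 2| <= M.
  exists (M ^+ 2) => w; rewrite /ga; case E : (Ga k w); last by rewrite mul0r normr0 sqr_ge0.
  by rewrite mul1r normrX ler_sqr ?nnegrE//; exact: hM.
have [a1 a2] := wstep b1 b2 b3.
split; first by apply: (L1_ext _ a1) => w; rewrite DvS.
split; last by rewrite -a2; apply: Ex_ext => w; rewrite DvS.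
have [M3 hM3] := b3.
apply: L1D; first exact: (L1_bdd _ (Gm_meas (@sk k) (GmM (Gk k) (Gga k) (GmM (Gk k) (Gx i k) (Gx i k)))) hM3).
apply: (L1M (Gm_meas (@sk k) (Gga k)) (bga k)); apply: L1_sum => e _; apply: L1_sum => e' _.
set qq := noise_q _ _ _ _ _ _.
apply: (L1_ext _ (L1Z qq (L1_VV (hzS k) (GVc i) (bVc i) k e e'))) => w.
by rewrite mulrC.
Qed.

Let total k w : \sum_i (ga k w * xi_ i k w ^+ 2 + ga k w *
    \sum_e \sum_e' Vc i k e w * Vc i k e' w * noise_q nu (fun k => p k) (@sc_A _ _ _ _ s) k e e') =
  ga k w * lb k w + h * (ga k w * rb k w).
Proof.
rewrite big_split/= -!mulr_sumr xi_sqr.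
rewrite (cov_sum (fun i e => Vc i k e w)) /rb /rate_b /lb !euc_sqr.
have -> : \sum_i \sum_l Vc i k (inl l) w ^+ 2 = \sum_i \sum_l (sc_s sigma s (X k w) (Y k w)) i l ^+ 2.
  by apply: eq_bigr => i _; apply: eq_bigr => l _; rewrite !mxE.
have -> : \sum_(j : sc_J s) fine (nu (sc_A j)) * \sum_i Vc i k (inr j) w ^+ 2 =
   \sum_(j : sc_J s) fine (nu (sc_A j)) * euc (sc_da (X k w) (Y k w) j) ^+ 2.
  apply: eq_bigr => j _; congr (_ * _); rewrite euc_sqr; apply: eq_bigr => i _.
  by rewrite big_ord1 !mxE.
by ring.
Qed.

Let lbE k w : ga k w * lb k.+1 w = \sum_i ga k w * Dv k.+1 w i ord0 ^+ 2.
Proof. by rewrite /lb euc_sqr mulr_sumr; apply: eq_bigr => i _; rewrite big_ord1. Qed.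

Let L1ga k : L1 P (fun w => ga k w * lb k w).
Proof.
have Gl : Gm (G k) (fun w => ga k w * (euc (Dv k w) * euc (Dv k w))).
  by apply: (GmM (Gk k) (Gga k)); apply: (GmM (Gk k)); exact: Gm_euc (Gm_Dv k).
apply: (@L1_bdd _ _ _ _ _ (theta ^+ 2) (Gm_meas (@sk k) Gl)) => w.
rewrite /ga; case E : (Ga k w); last by rewrite mul0r normr0 sqr_ge0.
rewrite mul1r -expr2 normrX ler_sqr ?nnegrE// ger0_norm ?euc_ge0//.
by have /and4P[] := Ga_good E.
Qed.

(** The exit estimate for [|D|^2] at level [theta^2]; the one-step inequality holds with equality,
    coordinate by coordinate ([wstep'] and [total]). *)
Lemma stability_b rho psi kappa e Tm : exit_estimate rho kappa Tm psi e ->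
  0 < theta -> m%:R * h <= Tm -> euc (y0 - x0) ^+ 2 <= e ->
  (forall k w, Ga k w -> rb k w <= kappa * rho (lb k w + e) + kappa * rho e) ->
  exists B, [/\ measurable B, (P B <= (psi / theta ^+ 2)%:E)%E &
    forall w, ~ B w -> forall k, (k <= m)%N ->
    (forall j, (j < k)%N -> [/\ euc (X j w) <= K, euc (Y j w) <= K & euc (Xt j w - X j w) <= eta]) ->
    euc (Dv k w) <= theta].
Proof.
move=> lyap th1 mh e0 hrate.
have D0 w : Dv 0 w = y0 - x0 by rewrite /Dv YE.
have := lyap _ _ P m h Ga lb rb (ltW h0) mh _ Ga_mono _ _ _ _ _ _ (fun k w _ => hrate k w) _ (exprn_gt0 2 th1).
case.
- by move=> k; exact: sk (GGa k).
- by move=> k w; exact: sqr_ge0.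
- by apply: (L1_ext _ (L1_cst P (euc (y0 - x0) ^+ 2))) => w; rewrite /lb D0.
- by rewrite (@Ex_ext _ _ _ _ _ (fun=> euc (y0 - x0) ^+ 2)) ?Ex_cst// => w; rewrite /lb D0.
- move=> k _; apply: (L1_ext (f := fun w => \sum_i ga k w * Dv k.+1 w i ord0 ^+ 2)).
    by move=> w; rewrite -lbE.
  by apply: L1_sum => i _; have [] := wstep' i k.
- move=> k _.
  have l1s : L1 P (fun w => ga k w * lb k w + h * (ga k w * rb k w)).
    apply: (L1_ext (f := fun w => \sum_i (ga k w * xi_ i k w ^+ 2 + ga k w *
      \sum_e \sum_e' Vc i k e w * Vc i k e' w * noise_q nu (fun k => p k) (@sc_A _ _ _ _ s) k e e'))).
      by move=> w; rewrite total.
    by apply: L1_sum => i _; have [_ []] := wstep' i k.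
  apply: (L1_ext _ (L1Z h^-1 (L1B l1s (L1ga k)))) => w.
  by rewrite addrAC subrr add0r mulKf// gt_eqF.
- move=> k _.
  rewrite (Ex_ext P (lbE k)) Ex_sum; last by move=> i _; have [] := wstep' i k.
  rewrite (@Ex_ext _ _ _ _ (fun w => (Ga k w)%:R * lb k w + h * ((Ga k w)%:R * rb k w)) _ (fun w => esym (total k w))).
  rewrite Ex_sum; last by move=> i _; have [_ []] := wstep' i k.
  by apply: ler_sum => i _; have [_ [_ ->]] := wstep' i k.
move=> B [mB PB hB]; exists B; split => //; apply: exit_good => w nB k km Gk1 nG.
have := hB w nB k km Gk1 nG.
by rewrite /lb ltr_sqr ?nnegrE ?euc_ge0//; exact: ltW.
Qed.

End energy_b.

Section energy_a.
Variable eps : R.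
Hypothesis eps0 : 0 < eps.

Let la k w := soft eps (Dv k w).
Let ra k w := rate_a nu b sigma s h eps (X k w) (Y k w) (Dv k w).
Let wt k w := ga k w / (2 * la k w).
(** The jump entries are set to [0]: [xa] is the difference after the drift and the Brownian step,
    before the jumps are added. *)
Let Vl i k (e : ('I_n + sc_J s)%type) w := if e is inl l then Vc i k (inl l) w else 0.
Let xa i k w := xi_ i k w + \sum_e Vl i k e w * z k e w.
Let ja k w (j : sc_J s) := euc (sc_da (X k w) (Y k w) j).
Let Qa k w := 2 * dotv (Dv k w) (sc_b b s (X k w) (Y k w)) +
  h * euc (sc_b b s (X k w) (Y k w)) ^+ 2 + euc (sc_s sigma s (X k w) (Y k w)) ^+ 2.

Let la_eps k w : eps <= la k w := soft_ge_eps _ (ltW eps0).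
Let la0 k w : 0 < la k w := lt_le_trans eps0 (la_eps k w).

Let Gla k : Gm (G k) (la k).
Proof.
apply: (Gm_comp (Gk k) (h := Num.sqrt)); first by apply: continuous_measurable_fun; exact: sqrt_continuous.
apply: (GmD (Gk k)); last exact: (Gm_cst (Gk k)).
by apply: (GmM (Gk k)); exact: Gm_euc (Gm_Dv k).
Qed.

Let Gwt k : Gm (G k) (wt k).
Proof.
apply: (GmM (Gk k)); first exact: Gga.
(* Written as a function of [la - eps >= 0] that is continuous on the whole line, the norm keeping
   the denominator away from [0]. *)
rewrite (_ : (fun w => _) = (fun r => (2 * (`|r| + eps))^-1) \o (fun w => la k w - eps)); last first.
  by apply/funext => w /=; rewrite ger0_norm ?subr_ge0// subrK.
apply: (Gm_comp (Gk k)); last exact: (GmB (Gk k) (Gla k) (Gm_cst (Gk k) eps)).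
apply: continuous_measurable_fun => r; apply: cvgV.
  by apply: lt0r_neq0; rewrite mulr_gt0// ltr_wpDl.
apply: cvgM; first exact: cvg_cst.
by apply: cvgD; [exact: norm_continuous|exact: cvg_cst].
Qed.

Let wt_le k w : `|wt k w| <= (2 * eps)^-1.
Proof.
have h1 : (2 * la k w)^-1 <= (2 * eps)^-1.
  by rewrite lef_pV2 ?posrE ?mulr_gt0// ler_pM2l.
have h2 : 0 <= (2 * la k w)^-1 by rewrite invr_ge0 mulr_ge0// ltW.
rewrite /wt normrM (ger0_norm h2).
apply: le_trans (_ : 1 * (2 * la k w)^-1 <= _); first exact: ler_wpM2r.
by rewrite mul1r.
Qed.

Let GVl i k e : Gm (G k) (Vl i k e).
Proof. by case: e => [l|j]; [exact: GVc|exact: (Gm_cst (Gk k))]. Qed.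

Let bVl i k e : exists M : R, forall w, `|Vl i k e w| <= M.
Proof. by case: e => [l|j]; [exact: bVc|exists 0 => w; rewrite normr0]. Qed.

Let qq k (e e' : ('I_n + sc_J s)%type) := noise_q nu (fun k => p k) (@sc_A _ _ _ _ s) k e e'.

Let wta i k : L1 P (fun w => wt k w * xa i k w ^+ 2) /\
  L1 P (fun w => wt k w * xi_ i k w ^+ 2 + wt k w * \sum_e \sum_e' Vl i k e w * Vl i k e' w * qq k e e') /\
  Ex P (fun w => wt k w * xa i k w ^+ 2) =
  Ex P (fun w => wt k w * xi_ i k w ^+ 2 + wt k w * \sum_e \sum_e' Vl i k e w * Vl i k e' w * qq k e e').
Proof.
have [M [M0 hM]] := bx i k.
have e2 : 0 <= (2 * eps)^-1 by rewrite invr_ge0 mulr_ge0// ltW.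
have b1 : exists M : R, forall w, `|wt k w| <= M by exists (2 * eps)^-1; exact: wt_le.
have off w : Ga k w = false -> wt k w = 0 by move=> E; rewrite /wt /ga E mul0r.
have b2 : exists M : R, forall w, `|wt k w * xi_ i k w| <= M.
  exists ((2 * eps)^-1 * M) => w; rewrite normrM; case E : (Ga k w).
    by apply: ler_pM; [exact: normr_ge0|exact: normr_ge0|exact: wt_le|exact: hM].
  by rewrite off// normr0 mul0r mulr_ge0.
have b3 : exists M : R, forall w, `|wt k w * xi_ i k w ^+ 2| <= M.
  exists ((2 * eps)^-1 * M ^+ 2) => w; rewrite normrM; case E : (Ga k w).
    apply: ler_pM; [exact: normr_ge0|exact: normr_ge0|exact: wt_le|].
    by rewrite normrX ler_sqr ?nnegrE//; exact: hM.
  by rewrite off// normr0 mul0r mulr_ge0// sqr_ge0.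
have [a1 a2] := @weighted_step _ _ _ _ _ k.+1 _ _ _ (hzS k) (Vl i) (GVl i) (bVl i) k
  (wt k) (xi_ i k) (ltnSn k) (Gwt k) (Gx i k) b1 b2 b3.
split => //; split => //.
have [M3 hM3] := b3.
apply: L1D; first exact: (L1_bdd _ (Gm_meas (@sk k) (GmM (Gk k) (Gwt k) (GmM (Gk k) (Gx i k) (Gx i k)))) hM3).
apply: (L1M (Gm_meas (@sk k) (Gwt k)) (wt_le k)); apply: L1_sum => e _; apply: L1_sum => e' _.
apply: (L1_ext _ (L1Z (qq k e e') (L1_VV (hzS k) (GVl i) (bVl i) k e e'))) => w.
by rewrite mulrC.
Qed.

Let Gja k j : Gm (G k) (fun w => ja k w j).
Proof.
apply: (Gm_euc (Z := fun w => sc_da (X k w) (Y k w) j)) => i.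
rewrite (_ : (fun w => _) = Vc i k (inr j)); first exact: GVc.
by apply/funext => w; rewrite /Vc !mxE.
Qed.

Let bja k j : exists M : R, forall w, `|ga k w * ja k w j| <= M.
Proof.
have [M hM] := so_bdd ok (fun x => euc (sc_a j x)); exists (M + M) => w.
rewrite normrM -[leRHS]mul1r; apply: ler_pM => //.
rewrite ger0_norm ?euc_ge0//; apply: le_trans (euc_triangle _ _) _; rewrite eucN.
by apply: lerD; apply: le_trans (ler_norm _) _; exact: hM.
Qed.

Let jump_step k j : [/\ L1 P (fun w => ga k w * ja k w j),
  L1 P (fun w => ga k w * ja k w j * `|z k (inr j) w|) &
  Ex P (fun w => ga k w * ja k w j * `|z k (inr j) w|) <=
  Ex P (fun w => 2 * (h * fine (nu (sc_A j))) * (ga k w * ja k w j))].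
Proof.
have GG := GmM (Gk k) (Gga k) (Gja k j).
have [M hM] := bja k j.
have lj : L1 P (fun w => ga k w * ja k w j) by exact: (L1_bdd P (Gm_meas (@sk k) GG) hM).
have ge w : 0 <= ga k w * ja k w j.
  by apply: mulr_ge0; [rewrite /ga; case: (Ga k w)|exact: euc_ge0].
have [l1' le] := Ex_norm_dN (dr_N drv) (p0 k) (pS k) (so_mA ok j) (so_nA ok j) GG lj ge.
by split => //; rewrite ExZ//; move: le; rewrite dp.
Qed.

(** The constant term of the tangent bound at [Dv k]; all of it is known at time [k]. *)
Let rest k w := ga k w * (la k w - euc (Dv k w) ^+ 2 / (2 * la k w)).

Let L1rest k : L1 P (rest k).
Proof.
have Gr : Gm (G k) (rest k).
  rewrite (_ : rest k = fun w => ga k w * la k w - wt k w * (euc (Dv k w) * euc (Dv k w))); last first.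
    by apply/funext => w; rewrite /rest /wt; ring.
  apply: (GmB (Gk k)); first exact: (GmM (Gk k) (Gga k) (Gla k)).
  by apply: (GmM (Gk k) (Gwt k)); apply: (GmM (Gk k)); exact: Gm_euc (Gm_Dv k).
apply: (@L1_bdd _ _ _ _ _ (theta + eps) (Gm_meas (@sk k) Gr)) => w.
rewrite /rest /ga; case E : (Ga k w); last by rewrite mul0r normr0 addr_ge0// ltW.
rewrite mul1r; have /and4P[_ _ _ hD] := Ga_good E.
have D2 : euc (Dv k w) ^+ 2 / (2 * la k w) <= la k w.
  rewrite ler_pdivrMr ?mulr_gt0// mulrCA -expr2 soft_sqr.
  have := sqr_ge0 eps; have := sqr_ge0 (euc (Dv k w)); lra.
have D0 : 0 <= euc (Dv k w) ^+ 2 / (2 * la k w).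
  by apply: divr_ge0; [exact: sqr_ge0|apply: mulr_ge0 => //; exact: ltW].
have := soft_le (Dv k w) (ltW eps0); rewrite -/(la k w) => h1.
rewrite ger0_norm ?subr_ge0//; lra.
Qed.

Let DvSa k w : Dv k.+1 w = \col_i xa i k w + \sum_(j : sc_J s) z k (inr j) w *: sc_da (X k w) (Y k w) j.
Proof.
apply/matrixP => i o; rewrite ord1 DvS !mxE summxE.
have e1 : \sum_e Vl i k e w * z k e w = \sum_l Vc i k (inl l) w * z k (inl l) w.
  by rewrite big_sumType/= [X in _ + X]big1 ?addr0// => j _; rewrite mul0r.
rewrite /xa e1 big_sumType/= addrA; congr (_ + _).
by apply: eq_bigr => j _; rewrite !mxE /Vc /= mulrC.
Qed.

(** The jumps change [soft] by at most the sum of their norms; the other part is bounded by the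
    tangent of [soft] at [Dv k], whose slope [1 / (2 la k)] is known at time [k]. *)
Let step_le k w : ga k w * la k.+1 w <= \sum_i wt k w * xa i k w ^+ 2 + rest k w +
  \sum_(j : sc_J s) ga k w * ja k w j * `|z k (inr j) w|.
Proof.
have h1 : la k.+1 w <= soft eps (\col_i xa i k w) + \sum_(j : sc_J s) ja k w j * `|z k (inr j) w|.
  rewrite /la DvSa; apply: le_trans (soft_add _ _ _) _; rewrite lerD2l.
  elim/big_ind2 : _ => [|u1 v1 u2 v2 h1 h2|j _]; first by rewrite euc0.
    by apply: le_trans (euc_triangle _ _) _; exact: lerD.
  by rewrite eucZ mulrC.
have h2 := soft_tangent (\col_i xa i k w) (Dv k w) eps0; rewrite -/(la k w) in h2.
have -> : \sum_i wt k w * xa i k w ^+ 2 = ga k w * (euc (\col_i xa i k w) ^+ 2 / (2 * la k w)).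
  rewrite -mulr_sumr euc_cV /wt -mulrA [_^-1 * _]mulrC; congr (_ * (_ / _)).
  by apply: eq_bigr => i _; rewrite !mxE expr2.
have -> : \sum_(j : sc_J s) ga k w * ja k w j * `|z k (inr j) w| =
    ga k w * \sum_(j : sc_J s) ja k w j * `|z k (inr j) w|.
  by rewrite mulr_sumr; apply: eq_bigr => j _; rewrite mulrA.
rewrite /rest -!mulrDr; apply: ler_wpM2l; first by rewrite /ga; case: (Ga k w).
rewrite mulrBl in h2; lra.
Qed.

Let total_a k w : \sum_i (wt k w * xi_ i k w ^+ 2 + wt k w *
     \sum_e \sum_e' Vl i k e w * Vl i k e' w * qq k e e') + rest k w +
  \sum_(j : sc_J s) 2 * (h * fine (nu (sc_A j))) * (ga k w * ja k w j) =
  ga k w * la k w + h * (ga k w * ra k w).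
Proof.
rewrite big_split/= -!mulr_sumr xi_sqr (cov_sum (fun i e => Vl i k e w)).
have -> : \sum_i \sum_l Vl i k (inl l) w ^+ 2 = euc (sc_s sigma s (X k w) (Y k w)) ^+ 2.
  by rewrite euc_sqr; apply: eq_bigr => i _; apply: eq_bigr => l _; rewrite !mxE.
have -> : \sum_(j : sc_J s) fine (nu (sc_A j)) * \sum_i Vl i k (inr j) w ^+ 2 = 0.
  by rewrite big1// => j _; rewrite big1 ?mulr0// => i _; rewrite /Vl expr0n.
rewrite addr0.
have -> : \sum_(j : sc_J s) 2 * (h * fine (nu (sc_A j))) * (ga k w * ja k w j) =
    h * ga k w * (2 * \sum_(j : sc_J s) fine (nu (sc_A j)) * ja k w j).
  by rewrite !mulr_sumr; apply: eq_bigr => j _; ring.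
rewrite /ra /rate_a -/(Qa k w) /rest /wt /Qa.
rewrite (_ : Num.sqrt _ = la k w)//.
set S := \sum_j _; field; exact: lt0r_neq0.
Qed.

(** The exit estimate for [soft eps D], which dominates [|D|], at level [theta]. Integrability of
    the next value comes from the pathwise bound [step_le], and its conditional mean is bounded
    through [wta] and [jump_step]. *)
Lemma stability_a rho psi kappa e Tm : exit_estimate rho kappa Tm psi e ->
  0 < theta -> m%:R * h <= Tm -> soft eps (y0 - x0) <= e ->
  (forall k w, Ga k w -> ra k w <= kappa * rho (la k w + e) + kappa * rho e) ->
  exists B, [/\ measurable B, (P B <= (psi / theta)%:E)%E &
    forall w, ~ B w -> forall k, (k <= m)%N ->
    (forall j, (j < k)%N -> [/\ euc (X j w) <= K, euc (Y j w) <= K & euc (Xt j w - X j w) <= eta]) ->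
    euc (Dv k w) <= theta].
Proof.
move=> lyap th1 mh e0 hrate.
have D0 w : Dv 0 w = y0 - x0 by rewrite /Dv YE.
have lj k : L1 P (fun w => \sum_(j : sc_J s) ga k w * ja k w j * `|z k (inr j) w|).
  by apply: L1_sum => j _; have [] := jump_step k j.
have lj2 k : L1 P (fun w => \sum_(j : sc_J s) 2 * (h * fine (nu (sc_A j))) * (ga k w * ja k w j)).
  by apply: L1_sum => j _; apply: L1Z; have [] := jump_step k j.
have lx k : L1 P (fun w => \sum_i wt k w * xa i k w ^+ 2).
  by apply: L1_sum => i _; have [] := wta i k.
have lx2 k : L1 P (fun w => \sum_i (wt k w * xi_ i k w ^+ 2 + wt k w *
     \sum_e \sum_e' Vl i k e w * Vl i k e' w * qq k e e')).
  by apply: L1_sum => i _; have [_ []] := wta i k.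
have lxr k := L1D (lx k) (L1rest k); have lxr2 k := L1D (lx2 k) (L1rest k).
have lR k := L1D (lxr k) (lj k); have lR2 k := L1D (lxr2 k) (lj2 k).
have ml k : measurable_fun setT (fun w => ga k w * la k.+1 w).
  apply: measurable_funM; first exact: (Gm_meas (@sk k) (Gga k)).
  exact: (Gm_meas (@sk k.+1) (Gla k.+1)).
have ga0 k w : 0 <= ga k w by rewrite /ga; case: (Ga k w).
have ll k : L1 P (fun w => ga k w * la k.+1 w).
  apply: (L1_le (ml k) (lR k)) => w; rewrite ger0_norm; first exact: step_le.
  by apply: mulr_ge0 => //; exact: ltW.
have llk k : L1 P (fun w => ga k w * la k w).
  have Gl := GmM (Gk k) (Gga k) (Gla k).
  apply: (@L1_bdd _ _ _ _ _ (theta + eps) (Gm_meas (@sk k) Gl)) => w.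
  rewrite /ga; case E : (Ga k w); last by rewrite mul0r normr0 addr_ge0// ltW.
  rewrite mul1r gtr0_norm//; have /and4P[_ _ _ hD] := Ga_good E.
  by have := soft_le (Dv k w) (ltW eps0); rewrite -/(la k w); lra.
have := lyap _ _ P m h Ga la ra (ltW h0) mh _ Ga_mono _ _ _ _ _ _ (fun k w _ => hrate k w) _ th1.
case.
- by move=> k; exact: sk (GGa k).
- by move=> k w; exact: ltW.
- by apply: (L1_ext _ (L1_cst P (soft eps (y0 - x0)))) => w; rewrite /la D0.
- by rewrite (@Ex_ext _ _ _ _ _ (fun=> soft eps (y0 - x0))) ?Ex_cst// => w; rewrite /la D0.
- by move=> k _; exact: ll.
- move=> k _; apply: (L1_ext _ (L1Z h^-1 (L1B (lR2 k) (llk k)))) => w.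
  by rewrite total_a addrAC subrr add0r mulKf// gt_eqF.
- move=> k _; apply: le_trans (Ex_le (ll k) (lR k) (step_le k)) _.
  rewrite -(Ex_ext P (total_a k)) ExD// ExD// [leRHS]ExD// ExD//.
  apply: lerD; first rewrite lerD2r.
    rewrite !Ex_sum; [|by move=> i _; have [_ []] := wta i k|by move=> i _; have [] := wta i k].
    by apply: ler_sum => i _; have [_ [_ ->]] := wta i k.
  rewrite !Ex_sum; [|by move=> j _; apply: L1Z; have [] := jump_step k j|by move=> j _; have [] := jump_step k j].
  by apply: ler_sum => j _; have [] := jump_step k j.
move=> B [mB PB hB]; exists B; split => //; apply: exit_good => w nB k km Gk1 nG.
by apply: le_trans (soft_ge _ _) _; exact: ltW (hB w nB k km Gk1 nG).
Qed.

End energy_a.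
End stability.

(** * Approximation of the stochastic integrals *)

Section partition.
Context (R : realType).
Implicit Types (r : nat -> R) (a t : R).

Definition straddle_free r a := forall i, a <= r i \/ r i.+1 <= a.

(** Each cell of positive length lies inside or outside []l, u]], as its right end tells, and the
    inner ones add up. Elementary integrals with different break points are thus brought to one
    partition. *)
Lemma telescope (zeta : R -> R -> R) r t l u k :
  r 0%N = 0 -> (forall i, r i <= r i.+1) -> (forall i, 0 <= r i <= t) ->
  0 <= l -> l <= u -> straddle_free r l -> straddle_free r u ->
  (forall a, zeta a a = 0) ->
  (forall a b c, 0 <= a -> a <= b -> b <= c -> c <= t -> zeta a c = zeta a b + zeta b c) ->
  zeta (Num.min l (r k)) (Num.min u (r k)) =
  \sum_(i < k) \1_(`]l, u]%classic) (r i.+1) * zeta (r i) (r i.+1).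
Proof.
move=> r0 rS rt l0 lu sl su z0 zA.
have ind (b : bool) s : (s \in `]l, u]) = b -> \1_(`]l, u]%classic) s = b%:R :> R.
  by move=> <-; rewrite indicE; congr (nat_of_bool _)%:R; apply/idP/idP; rewrite inE.
elim: k => [|k ih]; first by rewrite big_ord0 r0 !min_r ?z0//; exact: le_trans lu.
rewrite big_ord_recr /= -ih.
have [rk0 rkt] := andP (rt k); have [rk0' rkt'] := andP (rt k.+1).
have [ur|ru] := su k.
  have ur' := le_trans ur (rS k).
  rewrite !(min_l ur) !(min_l ur') !(min_l (le_trans lu _))//.
  case E : (r k.+1 \in `]l, u]); rewrite (ind _ _ E); last by rewrite mul0r addr0.
  move: E; rewrite in_itv /= => /andP[_ h1].
  have -> : r k.+1 = r k by apply/eqP; rewrite eq_le rS (le_trans h1).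
  by rewrite z0 mulr0 addr0.
rewrite (min_r ru) (min_r (le_trans (rS k) ru)).
have [lr|rl] := sl k.
  rewrite (min_l lr) (min_l (le_trans lr (rS k))) (zA l (r k) (r k.+1))//; congr (_ + _).
  case E : (r k.+1 \in `]l, u]); rewrite (ind _ _ E) ?mul1r//.
  move: E; rewrite in_itv /= ru andbT => /negbT; rewrite -leNgt => h1.
  have e1 : r k.+1 = r k by apply/eqP; rewrite eq_le rS (le_trans h1).
  by rewrite e1 z0 mulr0.
rewrite (min_r rl) (min_r (le_trans (rS k) rl)) !z0 add0r.
case E : (r k.+1 \in `]l, u]); rewrite (ind _ _ E) ?mul0r//.
by move: E; rewrite in_itv /= ltNge rl.
Qed.

(** The points of [pts] in [[0, t]] are sorted and the sequence is continued by the constant [t];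
    points beyond [t] are never straddled, since all values are at most [t]. *)
Lemma partition_exists t (pts : seq R) : 0 <= t -> exists r M,
  [/\ r 0%N = 0, forall i, r i <= r i.+1, forall i, 0 <= r i <= t, r M = t &
   (forall a, a \in pts -> 0 <= a -> straddle_free r a) /\
   (forall a, a \in pts -> 0 <= a <= t -> exists2 i, (i <= M)%N & r i = a)].
Proof.
move=> t0; pose S0 := 0 :: [seq a <- pts | 0 <= a <= t].
pose S := sort <=%R S0; pose r i := nth t S i.
have srt : sorted <=%R S by apply: sort_sorted; exact: le_total.
have inS a : (a \in S) = (a \in S0) by rewrite mem_sort.
have bd a : a \in S -> 0 <= a <= t.
  by rewrite inS inE mem_filter => /predU1P[->|/andP[]//]; rewrite lexx.
have rt i : 0 <= r i <= t.
  rewrite /r; case: (ltnP i (size S)) => iS; first exact/bd/mem_nth.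
  by rewrite nth_default// t0 lexx.
have mono i j : (i <= j)%N -> r i <= r j.
  move=> ij; rewrite /r; case: (ltnP j (size S)) => jS.
    by apply: (sorted_leq_nth le_trans le_refl t srt) => //; rewrite inE// (leq_ltn_trans ij).
  by rewrite [leRHS]nth_default//; case/andP: (rt i).
have hit a : a \in S -> exists2 i, (i < size S)%N & r i = a.
  by move=> aS; exists (index a S); [rewrite index_mem|rewrite /r nth_index].
exists r, (size S); split => //.
- have [i _ ri] : exists2 i, (i < size S)%N & r i = 0 by apply: hit; rewrite inS inE eqxx.
  by apply/eqP; rewrite eq_le; case/andP: (rt 0%N) => -> _; rewrite -ri mono.
- by move=> i; exact: mono.
- by rewrite /r nth_default.
have inS' a : a \in pts -> 0 <= a <= t -> a \in S.
  by move=> ap h; rewrite inS inE mem_filter h ap orbT.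
split=> a ap; last by move=> h; have [i iS ri] := hit _ (inS' _ ap h); exists i => //; exact: ltnW.
move=> a0 i; case: (leP a t) => [at_|ta]; last first.
  by right; apply: le_trans (ltW ta); case/andP: (rt i.+1).
have [j _ <-] := hit _ (inS' _ ap (introT andP (conj a0 at_))).
by case: (leqP j i) => ij; [left|right]; exact: mono.
Qed.

End partition.

Section list_sums.
Context (R : realType) (S : Type).

(** Membership is [List.In] because steps contain functions and have no decidable equality. *)
Lemma eq_bigr_In (V : nmodType) (L : seq S) (f g : S -> V) :
  (forall h, List.In h L -> f h = g h) -> \sum_(h <- L) f h = \sum_(h <- L) g h.
Proof.
elim: L => [|h L ih] hL; first by rewrite !big_nil.
rewrite !big_cons hL; last by left.
by congr (_ + _); apply: ih => h' h1; apply: hL; right.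
Qed.

Lemma Gm_sum_In d (T : measurableType d) (G : set (set T)) (L : seq S) (f : S -> T -> R) :
  sigma_algebra setT G -> (forall h, List.In h L -> Gm G (f h)) ->
  Gm G (fun w => \sum_(h <- L) f h w).
Proof.
move=> sG; elim: L => [|h L ih] hL.
  by under eq_fun do rewrite big_nil; exact: Gm_cst.
under eq_fun do rewrite big_cons; apply: (GmD sG); first by apply: hL; left.
by apply: ih => h' h1; apply: hL; right.
Qed.

Lemma bdd_sum_In (T : Type) (L : seq S) (f : S -> T -> R) :
  (forall h, List.In h L -> exists M : R, forall w, `|f h w| <= M) ->
  exists M : R, forall w, `|\sum_(h <- L) f h w| <= M.
Proof.
elim: L => [|h L ih] hL; first by exists 0 => w; rewrite big_nil normr0.
have [M1 h1] : exists M : R, forall w, `|f h w| <= M by apply: hL; left.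
have [M2 h2] : exists M : R, forall w, `|\sum_(h <- L) f h w| <= M.
  by apply: ih => h' ?; apply: hL; right.
exists (M1 + M2) => w; rewrite big_cons; apply: le_trans (ler_normD _ _) _.
exact: lerD.
Qed.

Lemma In_tnth (L : seq S) i : List.In (tnth (in_tuple L) i) L.
Proof.
case: i => i iL; rewrite (tnth_nth (tnth (in_tuple L) (Ordinal iL))) /=.
generalize (tnth (in_tuple L) (Ordinal iL)) => x0.
elim: L i iL => // a L ih [|i] /=; first by left.
by rewrite ltnS => iL; right; exact: ih.
Qed.

End list_sums.

Section zeta.
Context (R : realType) d (T : measurableType d) (P : probability T R).
Context dU (U : measurableType dU) (nu : {sigma_finite_measure set U -> \bar R}).
Variables (n : nat) (F : R -> set (set T)) (W : R -> T -> 'cV[R]_n).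
Variable N : T -> {measure set (measurableTypeR R * U) -> \bar R}.

Lemma dW_refl a i w : dW W a a i w = 0.
Proof. by rewrite /dW subrr. Qed.

Lemma dW_cat a b c i w : dW W a c i w = dW W a b i w + dW W b c i w.
Proof. by rewrite /dW [RHS]addrC subrKA. Qed.

Lemma dN_refl a A w : dN nu N a a A w = 0.
Proof. by rewrite /dN set_itv_ge ?bnd_simp ?ltxx// set0X measure0 subrr mul0r subrr. Qed.

Lemma N_sub_fin a b t A w : 0 <= a -> b <= t -> measurable A ->
  ~ (N w (`]0, t]%classic `*` A) = +oo%E) -> ~ (N w (`]a, b]%classic `*` A) = +oo%E).
Proof.
move=> a0 bt mA h E; apply: h; apply/eqP; rewrite eq_le leey /= -E.
apply: le_measure; rewrite ?inE; [exact: measurableX|exact: measurableX|].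
move=> [s u] /= [+ Au]; rewrite in_itv /= => /andP[h1 h2]; split => //=.
by rewrite in_itv /= (le_lt_trans a0 h1) (le_trans h2 bt).
Qed.

Lemma dN_cat a b c t A w : 0 <= a -> a <= b -> b <= c -> c <= t -> measurable A ->
  (nu A < +oo)%E -> ~ (N w (`]0, t]%classic `*` A) = +oo%E) ->
  dN nu N a c A w = dN nu N a b A w + dN nu N b c A w.
Proof.
by move=> a0 ab bc ct mA nA fA; apply: dN_add => //; exact: N_sub_fin fA.
Qed.

End zeta.

(** * Cadlag paths *)

Section cadlag.
Context (R : realType).
Implicit Types (g : R -> R) (s t e : R).

Lemma cadlag_comp (S : ptopologicalType) (p : R -> S) (phi : S -> R) :
  hausdorff_space S -> continuous phi -> path_cadlag p ->
  path_cadlag (fun s => phi (p s)) /\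
  forall s, 0 < s -> left_lim (fun s => phi (p s)) s = phi (left_lim p s).
Proof.
move=> hS cphi [pr pl].
have ll s : 0 < s -> phi (p s') @[s' --> s^'-] --> phi (left_lim p s).
  move=> s0; apply: (cvg_comp p phi); first exact: pl s0.
  exact: cphi.
split; last by move=> s s0; apply/cvg_lim; [exact: Rhausdorff|exact: ll].
split; last by move=> s s0; apply/cvg_ex; exists (phi (left_lim p s)); exact: ll.
move=> s s0; apply: (cvg_comp p phi); first exact: pr s0.
exact: cphi.
Qed.

Variable g : R -> R.
Hypothesis gc : path_cadlag g.

Lemma cadlag_right s e : 0 <= s -> 0 < e ->
  exists2 dl, 0 < dl & forall u, s <= u -> u < s + dl -> `|g u - g s| < e.
Proof.
move=> s0 e0; have /cvgrPdist_lt/(_ _ e0)[dl /= dl0 h] := gc.1 s s0.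
exists dl => // u; rewrite le_eqVlt => /predU1P[<-|su] us; first by rewrite subrr normr0.
rewrite distrC; apply: h => //=.
by rewrite ltr0_norm ?subr_lt0// opprB ltrBlDl.
Qed.

Lemma cadlag_left s e : 0 < s -> 0 < e ->
  exists2 dl, 0 < dl & forall u, s - dl < u -> u < s -> `|g u - left_lim g s| < e.
Proof.
move=> s0 e0; have /cvgrPdist_lt/(_ _ e0)[dl /= dl0 h] := gc.2 s s0.
exists dl => // u us su; rewrite distrC; apply: h => //=.
by rewrite gtr0_norm ?subr_gt0// ltrBlDl -ltrBlDr.
Qed.

(** Compactness of [[0, t]]: near each point the one-sided limits bound the path on both sides. *)
Lemma cadlag_bounded t : exists M, forall s, 0 <= s <= t -> `|g s| <= M.
Proof.
have /compact_near_coveringP/near_covering_withinP cv := @segment_compact R 0 t.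
have := cv R +oo (fun M s => `|g s| <= M) _.
case => [x|M [_ hM]]; last first.
  by exists (M + 1) => s st; apply: hM; [rewrite ltrDl|rewrite /= in_itv].
rewrite /= in_itv /= => /andP[x0 xt].
have [d1 d10 h1] := cadlag_right x0 ltr01.
have [M1 hM1] : exists M1, forall u, x <= u -> u < x + d1 -> `|g u| <= M1.
  exists (`|g x| + 1) => u xu ux; have := h1 u xu ux.
  by have := ler_normD (g u - g x) (g x); rewrite subrK; lra.
have [d2 d20 [M2 hM2]] : exists2 d2, 0 < d2 & exists M2, forall u, 0 <= u -> x - d2 < u -> u < x -> `|g u| <= M2.
  case: (ltP 0 x) => x0'.
    have [d2 d20 h2] := cadlag_left x0' ltr01; exists d2 => //.
    exists (`|left_lim g x| + 1) => u _ xu ux; have := h2 u xu ux.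
    by have := ler_normD (g u - left_lim g x) (left_lim g x); rewrite subrK; lra.
  exists 1 => //; exists 0 => u u0 _ ux.
  by have := lt_le_trans ux x0'; rewrite ltNge u0.
exists (ball x (Num.min d1 d2), [set M | Num.max M1 M2 < M]).
  split => /=; first by exists (Num.min d1 d2) => //=; rewrite lt_min d10.
  by exists (Num.max M1 M2); rewrite num_real.
move=> [u M] /= [+ hM]; rewrite /ball /= lt_min => /andP[b1 b2]; rewrite in_itv /= => /andP[u0 _].
move: hM; rewrite gt_max => /andP[m1 m2].
case: (leP x u) => xu.
  by apply: le_trans (ltW m1); apply: hM1 => //; move: b1; rewrite distrC ger0_norm ?subr_ge0// ltrBlDl.
apply: le_trans (ltW m2); apply: hM2 => //.
by move: b2; rewrite gtr0_norm ?subr_gt0// ltrBlDl -ltrBlDr.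
Qed.

Let big_jumps e := [set s | 0 < s /\ e <= `|g s - left_lim g s|].

(** On each side of [s] the path is within [e / 4] of a constant, which excludes other jumps of size
    [e] nearby; a set of reals all of whose points are isolated is countable. *)
Let countable_big_jumps e : 0 < e -> countable (big_jumps e).
Proof.
move=> e0; suff -> : big_jumps e = isolated (big_jumps e) by exact: countable_isolated.
apply/seteqP; split; last exact: isolatedS.
move=> s Js; have [s0 _] := Js; split; first exact/mem_set.
have e4 : 0 < e / 4 by rewrite divr_gt0.
have [d1 d10 h1] := cadlag_right (ltW s0) e4.
have [d2 d20 h2] := cadlag_left s0 e4.
exists (ball s (Num.min d1 d2)); first by apply: nbhsx_ballx; rewrite lt_min d10.
apply/seteqP; split; last first.
  by move=> _ ->; split => //; apply: ballxx; rewrite lt_min d10.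
move=> u [+ [u0 uJ]]; rewrite /ball /= lt_min => /andP[b1 b2].
have [d3 d30 h3] := cadlag_left u0 e4.
(* At [u] and just before it the path is within [e / 4] of the same [a], and just before [u] it is
   within [e / 4] of its left limit there: the jump at [u] is below [3 e / 4]. *)
have key l a : l < u -> (forall v, l < v -> v <= u -> `|g v - a| < e / 4) -> False.
  move=> lu hv; pose v := Num.max ((l + u) / 2) (u - d3 / 2).
  have vu : v < u by rewrite gt_max; apply/andP; split; lra.
  have lv : l < v by rewrite lt_max; apply/orP; left; lra.
  have dv : u - d3 < v by rewrite lt_max; apply/orP; right; lra.
  have a1 := hv v lv (ltW vu); have a2 := hv u lu (lexx u); have a3 := h3 v dv vu.
  have : `|g u - left_lim g u| <= `|g u - a| + `|g v - a| + `|g v - left_lim g u|.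
    have -> : g u - left_lim g u = (g u - a) + (- (g v - a)) + (g v - left_lim g u) by ring.
    apply: le_trans (ler_normD _ _) _; rewrite lerD2r.
    by apply: le_trans (ler_normD _ _) _; rewrite normrN.
  lra.
case: (ltgtP u s) => [us|su|//]; exfalso.
- apply: (key (s - d2) (left_lim g s)).
    by move: b2; rewrite gtr0_norm ?subr_gt0// ltrBlDl -ltrBlDr.
  by move=> v lv vu; apply: h2 => //; exact: le_lt_trans us.
- apply: (key s (g s) su) => v sv vu; apply: h1; first exact: ltW.
  apply: le_lt_trans vu _.
  by move: b1; rewrite distrC gtr0_norm ?subr_gt0// ltrBlDl.
Qed.

Lemma countable_jumps : countable [set s | 0 < s /\ g s <> left_lim g s].
Proof.
suff : [set s | 0 < s /\ g s <> left_lim g s] `<=` \bigcup_k big_jumps (k.+1%:R^-1).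
  move=> /subset_card_le h; apply: (sub_countable h); apply: bigcup_countable => // k _.
  by apply: countable_big_jumps; rewrite invr_gt0.
move=> s [s0 js].
have n0 : 0 < `|g s - left_lim g s| by rewrite normr_gt0 subr_eq0; exact/eqP.
exists (Num.truncn (`|g s - left_lim g s|^-1)) => //; split => //.
rewrite -[leRHS]invrK lef_pV2 ?posrE ?invr_gt0//.
exact/ltW/truncnS_gt.
Qed.

End cadlag.

(** * Uniform grids and sampled paths *)

Section grid.
Context (R : realType).
Variables (t : R).
Hypothesis t0 : 0 < t.
Implicit Types (m k : nat) (s : R).

Definition gpt m k : R := k%:R * (t / m%:R).
Definition cell m k : set R := `]gpt m k, gpt m k.+1]%classic.
Definition gval m (phi : nat -> R) s : R := \sum_(k < m) \1_(cell m k) s * phi k.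

Lemma gpt_ge0 m k : 0 <= gpt m k.
Proof. by apply: mulr_ge0 => //; apply: divr_ge0 => //; exact: ltW. Qed.

Lemma gptS m k : gpt m k.+1 = gpt m k + t / m%:R.
Proof. by rewrite /gpt -natr1 mulrDl mul1r. Qed.

Lemma gpt_le m k l : (k <= l)%N -> gpt m k <= gpt m l.
Proof.
by move=> kl; apply: ler_wpM2r; [apply: divr_ge0 => //; exact: ltW|rewrite ler_nat].
Qed.

Lemma gpt_last m : (0 < m)%N -> gpt m m = t.
Proof. by move=> m0; rewrite /gpt mulrC divfK// pnatr_eq0 -lt0n. Qed.

Lemma gpt0 m : gpt m 0 = 0. Proof. by rewrite /gpt mul0r. Qed.

Lemma gval_cell m phi k s : (k < m)%N -> cell m k s -> gval m phi s = phi k.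
Proof.
move=> km ks; rewrite /gval (bigD1 (Ordinal km))//= indicE mem_set// mul1r big1 ?addr0//.
move=> l lk; rewrite indicE memNset ?mul0r//.
move: ks; rewrite /cell /= !in_itv /= => /andP[k1 k2] /andP[l1 l2].
have : (l : nat) != k by apply: contra lk => /eqP e; apply/eqP/val_inj.
rewrite neq_ltn => /orP[lt|lt].
- by have := le_lt_trans (le_trans l2 (gpt_le m lt)) k1; rewrite ltxx.
- by have := le_lt_trans (le_trans k2 (gpt_le m lt)) l1; rewrite ltxx.
Qed.

Lemma cell_exists m s : (0 < m)%N -> 0 < s <= t -> exists2 k, (k < m)%N & cell m k s.
Proof.
move=> m0 /andP[s0 st].
have ex : exists k, s <= gpt m k by exists m; rewrite gpt_last.
case: (ex_minnP ex) => -[|k] h1 h2.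
  by move: h1; rewrite gpt0 leNgt s0.
exists k; first by have := h2 m; rewrite gpt_last// => /(_ st).
rewrite /cell /= in_itv /= h1 andbT ltNge; apply/negP => h.
by have := h2 _ h; rewrite ltnn.
Qed.

Lemma cell_sub m k s : (k < m)%N -> cell m k s -> 0 < s <= t.
Proof.
move=> km; rewrite /cell /= in_itv /= => /andP[h1 h2].
rewrite (le_lt_trans (gpt_ge0 m k) h1) (le_trans h2)//.
by rewrite -[leRHS](@gpt_last m) ?gpt_le//; exact: leq_ltn_trans km.
Qed.

Lemma gval_out m phi s : ~ (0 < s <= t) -> gval m phi s = 0.
Proof.
move=> h; rewrite /gval big1// => k _; rewrite indicE memNset ?mul0r//.
by move=> /(cell_sub (ltn_ord k)).
Qed.

Lemma small_mesh (dl : R) : 0 < dl -> \forall m \near \oo, (0 < m)%N /\ t / m%:R < dl.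
Proof.
move=> dl0; exists (Num.truncn (t / dl)).+1 => // m /= hm.
have m0 : (0 < m)%N by exact: leq_trans hm.
split => //; rewrite ltr_pdivrMr ?ltr0n// mulrC -ltr_pdivrMr//.
by apply: lt_le_trans (truncnS_gt _) _; rewrite ler_nat.
Qed.

(** Sampling at right ends recovers the path itself at every time; this serves joint measurability,
    where adaptedness is irrelevant. *)
Lemma gval_right (g : R -> R) s : path_cadlag g ->
  gval m (fun k => g (gpt m k.+1)) s @[m --> \oo] --> \1_(`]0, t]%classic) s * g s.
Proof.
move=> gc; case: (boolP (0 < s <= t)) => st; last first.
  rewrite (_ : \1_ _ s = 0); last by rewrite indicE memNset//= in_itv /=; exact/negP.
  rewrite mul0r (_ : (fun m => gval m (fun k => g (gpt m k.+1)) s) = fun=> 0); first exact: cvg_cst.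
  by apply/funext => m; rewrite gval_out//; exact/negP.
rewrite (_ : \1_ _ s = 1); last by rewrite indicE mem_set//= in_itv.
rewrite mul1r; apply/cvgrPdist_lt => e e0.
have s0 : 0 <= s by case/andP: st => /ltW.
have [dl dl0 hd] := cadlag_right gc s0 e0.
apply: filterS (small_mesh dl0) => m [m0 md].
have [k km ks] := cell_exists m0 st.
rewrite (gval_cell _ km ks) distrC; move: ks; rewrite /cell /= in_itv /= gptS => /andP[h1 h2].
by apply: hd => //; lra.
Qed.

(** Sampling at left ends, as the scheme does, produces an adapted step function, and its limit is
    the left limit that appears in the jump integral. *)
Lemma gval_left (g : R -> R) s : path_cadlag g ->
  gval m (fun k => g (gpt m k)) s @[m --> \oo] --> \1_(`]0, t]%classic) s * left_lim g s.
Proof.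
move=> gc; case: (boolP (0 < s <= t)) => st; last first.
  rewrite (_ : \1_ _ s = 0); last by rewrite indicE memNset//= in_itv /=; exact/negP.
  rewrite mul0r (_ : (fun m => gval m (fun k => g (gpt m k)) s) = fun=> 0); first exact: cvg_cst.
  by apply/funext => m; rewrite gval_out//; exact/negP.
rewrite (_ : \1_ _ s = 1); last by rewrite indicE mem_set//= in_itv.
rewrite mul1r; apply/cvgrPdist_lt => e e0.
have s0 : 0 < s by case/andP: st.
have [dl dl0 hd] := cadlag_left gc s0 e0.
apply: filterS (small_mesh dl0) => m [m0 md].
have [k km ks] := cell_exists m0 st.
rewrite (gval_cell _ km ks) distrC; move: ks; rewrite /cell /= in_itv /= gptS => /andP[h1 h2].
by apply: hd => //; lra.
Qed.

Lemma measurable_cell m k : measurable (cell m k : set (measurableTypeR R)).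
Proof. exact: measurable_itv. Qed.

Lemma measurable_gval d (T : measurableType d) m (phi : nat -> T -> R) :
  (forall k, measurable_fun setT (phi k)) ->
  measurable_fun setT (fun z : measurableTypeR R * T => gval m (phi ^~ z.2) z.1).
Proof.
move=> mphi; apply: measurable_sum => k; apply: measurable_funM.
  have h : measurable_fun setT (\1_(cell m k) : measurableTypeR R -> R).
    by apply: measurable_indic; exact: measurable_cell.
  exact: (measurableT_comp h measurable_fst).
exact: (measurableT_comp (mphi k) measurable_snd).
Qed.

End grid.

Section time_integral.
Context (R : realType) d (T : measurableType d) (P : probability T R).

Lemma measurable_time_integral (D : set (measurableTypeR R)) (f : measurableTypeR R * T -> \bar R) :
  measurable D -> measurable_fun (D `*` setT) f -> (forall z, (0 <= f z)%E) ->
  measurable_fun setT (fun w => \int[@lebesgue_measure R]_(s in D) f (s, w))%E.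
Proof.
move=> mD mf f0.
have mDT : measurable (D `*` [set: T]) by exact: measurableX.
have mg := (measurable_restrictT f mDT).1 mf.
have g0 z : (0 <= (f \_ (D `*` setT)) z)%E by rewrite patchE; case: ifP.
have := @measurable_fun_fubini_tonelli_G _ _ _ _ R (@lebesgue_measure R) _ mg g0.
congr (measurable_fun _ _); apply/funext => w; rewrite /fubini_G [RHS]integral_mkcond.
apply: eq_integral => s _; rewrite !patchE; congr (if _ then _ else _).
by apply/idP/idP; rewrite !inE => //= -[].
Qed.

End time_integral.

Section restrict_indic.
Context (R : realType) d (T : measurableType d).

Lemma measurable_indicM (D : set T) (f : T -> R) : measurable D ->
  measurable_fun setT (fun z => \1_D z * f z) -> measurable_fun D f.
Proof.
move=> mD h; have := measurable_funS measurableT (@subsetT _ D) h.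
apply: eq_measurable_fun => z; rewrite inE => Dz.
by rewrite indicE mem_set// mul1r.
Qed.

End restrict_indic.

Section joint.
Context (R : realType) (n : nat) d (T : measurableType d).
Context dU (U : measurableType dU).
Variable c : 'cV[R]_n -> U -> 'cV[R]_n.
Hypothesis c_meas : measurable_fun [set: borel 'cV[R]_n * U]
  (fun z => (c z.1 z.2 : borel 'cV[R]_n)).
Hypothesis c_cont : forall u, continuous (c ^~ u).
Variable X : R -> T -> 'cV[R]_n.
Hypothesis mX : forall s, 0 <= s -> measurable_fun setT (X s : T -> borel 'cV[R]_n).
Hypothesis cX : forall w, path_cadlag (X ^~ w).
Variable t : R.
Hypothesis t0 : 0 < t.

Let It : set (measurableTypeR R) := `]0, t]%classic.

Let mIt : measurable It. Proof. exact: measurable_itv. Qed.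

Lemma cV_hausdorff : hausdorff_space ('cV[R]_n).
Proof. exact: norm_hausdorff. Qed.

Lemma measurable_path (phi : 'cV[R]_n -> R) : continuous phi ->
  measurable_fun (It `*` [set: T]) (fun z : measurableTypeR R * T => phi (X z.1 z.2)).
Proof.
move=> cphi; apply: measurable_indicM; first exact: (measurableX mIt measurableT).
have -> : (fun z : measurableTypeR R * T => \1_(It `*` setT) z * phi (X z.1 z.2)) =
    (fun z => \1_It z.1 * phi (X z.1 z.2)).
  by apply/funext => -[s w] /=; congr (_ * _); rewrite !indicE in_setX /= in_setT andbT.
apply: (@measurable_fun_cvg _ _ _ _
   (fun m (z : measurableTypeR R * T) => gval t m (fun k => phi (X (gpt t m k.+1) z.2)) z.1)).
  move=> m; apply: (measurable_gval t m (phi := fun k w => phi (X (gpt t m k.+1) w))) => k.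
  apply: (measurableT_comp (f := phi : borel 'cV[R]_n -> R)); first exact: borel_continuous.
  by apply: mX; exact: gpt_ge0.
move=> [s w] _ /=.
apply: (gval_right t0 (g := fun s => phi (X s w))).
by have [] := cadlag_comp cV_hausdorff cphi (cX w).
Qed.

Lemma measurable_jump_coef i :
  measurable_fun ((It `*` [set: T]) `*` [set: U])
    (fun z : measurableTypeR R * T * U => c (left_lim (X ^~ z.1.2) z.1.1) z.2 i ord0).
Proof.
apply: measurable_indicM; first exact: (measurableX (measurableX mIt measurableT) measurableT).
have -> : (fun z : measurableTypeR R * T * U => \1_((It `*` setT) `*` setT) z *
      c (left_lim (X ^~ z.1.2) z.1.1) z.2 i ord0) =
    (fun z => \1_It z.1.1 * c (left_lim (X ^~ z.1.2) z.1.1) z.2 i ord0).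
  apply/funext => -[[s w] u] /=; congr (_ * _).
  by rewrite !indicE in_setX /= in_setT andbT in_setX /= in_setT andbT.
apply: (@measurable_fun_cvg _ _ _ _
   (fun m (z : measurableTypeR R * T * U) =>
     gval t m (fun k => c (X (gpt t m k) z.1.2) z.2 i ord0) z.1.1)).
  move=> m; apply: measurable_sum => k; apply: measurable_funM.
    have h : measurable_fun setT (\1_(cell t m k) : measurableTypeR R -> R).
      by apply: measurable_indic; exact: measurable_cell.
    apply: (measurableT_comp h); exact: (measurableT_comp measurable_fst measurable_fst).
  have h1 : measurable_fun setT (fun z : measurableTypeR R * T * U =>
      (X (gpt t m k) z.1.2 : borel 'cV[R]_n, z.2)).
    apply: measurable_fun_pair; last exact: measurable_snd.
    apply: (measurableT_comp (mX (gpt_ge0 t0 m k))).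
    exact: (measurableT_comp measurable_snd measurable_fst).
  have h2 := measurableT_comp c_meas h1.
  apply: (measurableT_comp (f := fun M : borel 'cV[R]_n => (M : 'cV[R]_n) i ord0) _ h2).
  by apply: borel_continuous; exact: coord_continuous.
move=> [[s w] u] _ /=.
have cc : continuous (fun x => c x u i ord0).
  move=> x; apply: (cvg_comp (c ^~ u) (fun M : 'cV[R]_n => M i ord0)); first exact: c_cont.
  exact: coord_continuous.
have [h1 h2] := cadlag_comp cV_hausdorff cc (cX w).
have := gval_left t0 (s := s) h1.
case: (boolP (0 < s <= t)) => st; first by rewrite h2//; case/andP: st.
have z0 : \1_It s = 0 :> R by rewrite indicE memNset//= /It /= in_itv /=; exact/negP.
by rewrite -[\1_(`]0, t]%classic) s]/(\1_It s) z0 !mul0r.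
Qed.

End joint.

(** * Suprema of right-continuous processes *)

Section ucp.
Context (R : realType).

(** The comparison is limited to [u <= t]: off the null set used below, the counts of the jump
    measure are known to be finite on []0, t]] only. *)
Definition rcont (t : R) (g : R -> R) := forall s, 0 <= s -> forall e, 0 < e ->
  exists2 dl, 0 < dl & forall u, s <= u -> u < s + dl -> u <= t -> `|g u - g s| < e.

Lemma rcont_ext t g g' : g =1 g' -> rcont t g -> rcont t g'.
Proof. by move=> /funext ->. Qed.

Lemma rcont_cst t a : rcont t (fun=> a).
Proof. by move=> s _ e e0; exists 1 => // u _ _ _; rewrite subrr normr0. Qed.

Lemma rcont_cadlag t g : path_cadlag g -> rcont t g.
Proof.
by move=> gc s s0 e e0; have [dl dl0 h] := cadlag_right gc s0 e0; exists dl => // u su us _; exact: h.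
Qed.

Lemma rcontD t g g' : rcont t g -> rcont t g' -> rcont t (fun s => g s + g' s).
Proof.
move=> h h' s s0 e e0; have e2 : 0 < e / 2 by rewrite divr_gt0.
have [d1 d10 h1] := h s s0 _ e2; have [d2 d20 h2] := h' s s0 _ e2.
exists (Num.min d1 d2); first by rewrite lt_min d10.
move=> u su; rewrite -ltrBlDl lt_min => /andP[u1 u2] ut.
have -> : g u + g' u - (g s + g' s) = (g u - g s) + (g' u - g' s) by ring.
rewrite (splitr e); apply: le_lt_trans (ler_normD _ _) _.
by apply: ltrD; [apply: h1|apply: h2] => //; rewrite -ltrBlDl.
Qed.

Lemma rcontZ t a g : rcont t g -> rcont t (fun s => a * g s).
Proof.
move=> h s s0 e e0; have a1 : 0 < `|a| + 1 by rewrite ltr_wpDl.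
have [d1 d10 h1] := h s s0 (e / (`|a| + 1)) (divr_gt0 e0 a1).
exists d1 => // u su us ut; rewrite -mulrBr normrM.
have := h1 u su us ut; rewrite ltr_pdivlMr// mulrDr mulr1 mulrC.
by apply: le_lt_trans; rewrite lerDl.
Qed.

Lemma rcontB t g g' : rcont t g -> rcont t g' -> rcont t (fun s => g s - g' s).
Proof.
move=> h h'; apply: (rcont_ext (g := fun s => g s + (-1) * g' s)); last exact/rcontD/rcontZ.
by move=> s; rewrite mulN1r.
Qed.

Lemma rcont_sum t (S : Type) (L : seq S) (g : S -> R -> R) :
  (forall h, List.In h L -> rcont t (g h)) -> rcont t (fun s => \sum_(h <- L) g h s).
Proof.
elim: L => [|h L ih] hL.
  by apply: (rcont_ext (g := fun=> 0)) (rcont_cst _ _) => s; rewrite big_nil.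
apply: (rcont_ext (g := fun s => g h s + \sum_(h <- L) g h s)).
  by move=> s; rewrite big_cons.
by apply: rcontD; [apply: hL; left|apply: ih => h' ?; apply: hL; right].
Qed.

Lemma rcont_min t a g : rcont t g -> 0 <= a -> rcont t (fun s => g (Num.min a s)).
Proof.
move=> h a0 s s0 e e0; case: (leP a s) => as_.
  exists 1 => // u su _ _; rewrite (min_l (le_trans as_ su)) subrr.
  by rewrite normr0.
have [dl dl0 hd] := h s s0 e e0.
exists (Num.min dl (a - s)); first by rewrite lt_min dl0 subr_gt0.
move=> u su; rewrite -ltrBlDl lt_min => /andP[u1 u2] ut.
rewrite min_r; last by apply/ltW; rewrite -(ltrD2r (- s)).
by apply: hd => //; rewrite -ltrBlDl.
Qed.

Definition usup d (T : measurableType d) (D : R -> T -> R) t w :=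
  ereal_sup [set (`|D s w|)%:E | s in `[0, t]].

Section measurability.
Context d (T : measurableType d) (P : probability T R).
Hypothesis compl : P.-negligible `<=` @measurable d T.
Variable t : R.
Hypothesis t0 : 0 < t.
Variables (D : R -> T -> R) (Z : set T).
Hypothesis mD : forall s, 0 <= s -> s <= t -> measurable_fun setT (D s).
Hypothesis mZ : measurable Z.
Hypothesis PZ : P Z = 0%E.
Hypothesis rD : forall w, ~ Z w -> rcont t (D ^~ w).

(** All grid points of all meshes, enumerated through [pickle] and cut at [t]; indices that decode
    to nothing are sent to [0]. *)
Let qpt (i : nat) : R :=
  if unpickle i is Some (m, k) then Num.min t (gpt t m k) else 0.

Let qpt_itv i : 0 <= qpt i <= t.
Proof.
rewrite /qpt; case: (unpickle i) => [[m k]|]; last by rewrite lexx ltW.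
by rewrite le_min (ltW t0) gpt_ge0// ge_min lexx.
Qed.

Let qptE m k : (k <= m)%N -> (0 < m)%N -> exists i, qpt i = gpt t m k.
Proof.
move=> km m0; exists (pickle (m, k)); rewrite /qpt pickleK min_r//.
by rewrite -[leRHS](gpt_last t m0); exact: gpt_le.
Qed.

Let supE w : ~ Z w -> usup D t w =
  ereal_sup (range (fun i => (`|D (qpt i) w|)%:E)).
Proof.
move=> nZ; apply/eqP; rewrite eq_le; apply/andP; split; last first.
  apply: ub_ereal_sup => _ [i _ <-]; apply: ereal_sup_ubound; exists (qpt i) => //.
  by rewrite /= in_itv; exact: qpt_itv.
apply: ub_ereal_sup => _ [s + <-]; rewrite /= in_itv /= => /andP[s0 st].
apply/lee_addgt0Pr => e e0.
have [i hi] : exists i, `|D s w| <= `|D (qpt i) w| + e.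
  move: s0; rewrite le_eqVlt => /predU1P[<-|s0].
    have [i hi] := @qptE 1 0 isT isT; exists i; rewrite hi gpt0.
    by rewrite lerDl ltW.
  have [dl dl0 hd] := rD nZ (ltW s0) e0.
  have [m [m0 md]] := filter_ex (small_mesh t dl0).
  have sst : 0 < s <= t by rewrite s0.
  have [k km] := cell_exists m0 sst.
  rewrite /cell /= in_itv /= gptS => /andP[h1 h2].
  have [i hi] := @qptE m k.+1 km m0; exists i.
  have := hd (qpt i); rewrite hi gptS => /(_ h2) h3.
  have : `|D (gpt t m k + t / m%:R) w - D s w| < e.
    apply: h3; first lra.
    rewrite -gptS -[leRHS](gpt_last t m0); exact: gpt_le.
  move=> h4; have := ler_normB (D (gpt t m k + t / m%:R) w) (D (gpt t m k + t / m%:R) w - D s w).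
  by rewrite subKr; lra.
apply: le_trans (_ : ((`|D (qpt i) w| + e)%:E <= _)%E); first by rewrite lee_fin.
by rewrite EFinD leeD2r//; apply: ereal_sup_ubound; exists i.
Qed.

(** Off [Z], right-continuity reduces the supremum to the countable set of grid points; completeness
    of the probability space takes care of the part inside [Z]. *)
Lemma measurable_ucp_set (e : R) :
  measurable [set w | (e%:E <= usup D t w)%E].
Proof.
pose S w := ereal_sup (range (fun i => (`|D (qpt i) w|)%:E)).
have mS : measurable_fun setT S.
  have -> : S = fun w => esups (fun i => (`|D (qpt i) w|)%:E) 0.
    apply/funext => w; rewrite /S /esups /sdrop; congr ereal_sup.
    by apply/seteqP; split => _ [i _ <-]; exists i.
  apply: (@measurable_fun_esups _ _ _ _ (fun i w => (`|D (qpt i) w|)%:E)) => i.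
  apply/measurable_EFinP; apply: measurableT_comp => //.
  by apply: mD; case/andP: (qpt_itv i).
set A := [set w | _].
have -> : A = ([set w | (e%:E <= S w)%E] `\` Z) `|` (A `&` Z).
  apply/seteqP; split => [w Aw|w [[Sw nZ]|[]//]].
    have [Zw|nZ] := pselect (Z w); [by right|left; split => //].
    by rewrite /= /S -supE.
  by rewrite /A /= supE.
apply: measurableU.
  apply: measurableD => //; rewrite -[X in measurable X]setTI.
  exact: emeasurable_fun_c_infty.
apply: compl; exists Z; split => //; exact: subIsetr.
Qed.

Lemma ucp_bound (e : R) w : ~ [set w | (e%:E <= usup D t w)%E] w ->
  forall s, 0 <= s <= t -> `|D s w| < e.
Proof.
move=> /negP; rewrite -ltNge => h s st.
rewrite -lte_fin; apply: le_lt_trans h; apply: ereal_sup_ubound; exists s => //.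
Qed.

End measurability.
End ucp.

(** * Euclidean balls and the topology of the sup norm *)

Section euc_topology.
Context (R : realType) (n : nat).
Implicit Types x y : 'cV[R]_n.

Lemma nbhs_euc x (A : set 'cV[R]_n) :
  nbhs x A <-> exists2 dl, 0 < dl & forall y, euc (y - x) < dl -> A y.
Proof.
split=> [/nbhs_ballP[e /= e0 es]|[dl dl0 h]].
  exists e => // y yx; apply: es; split => // i j.
  rewrite /ball /= distrC; apply: le_lt_trans yx.
  by rewrite (_ : y i j - x i j = (y - x) i j); [exact: euc_entry|rewrite !mxE].
have h0 : euc (y - x) @[y --> x] --> (0 : R).
  by have := @euc_subr_cont R n 1 x x; rewrite /continuous_at subrr euc0.
move/cvgrPdist_lt : h0 => /(_ _ dl0); apply: filterS => y; rewrite sub0r normrN ger0_norm ?euc_ge0//; exact: h.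
Qed.

Lemma continuous_euc (f : 'cV[R]_n -> R) x e : continuous f -> 0 < e ->
  exists2 dl, 0 < dl & forall y, euc (y - x) < dl -> `|f y - f x| < e.
Proof.
move=> cf e0; have /cvgrPdist_lt/(_ _ e0)/nbhs_euc[dl dl0 h] := cf x.
by exists dl => // y yx; rewrite distrC; exact: h.
Qed.

Lemma continuous_euc_mx p q (f : 'cV[R]_n -> 'M[R]_(p, q)) x e : continuous f -> 0 < e ->
  exists2 dl, 0 < dl & forall y, euc (y - x) < dl -> euc (f y - f x) < e.
Proof.
move=> cf e0.
have h : euc (f y - f x) @[y --> x] --> (0 : R).
  have e1 : euc (f x - f x) = 0 by rewrite subrr euc0.
  rewrite -e1; apply: (cvg_comp f (fun A : 'M[R]_(p, q) => euc (A - f x)) (cf x)).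
  exact: euc_subr_cont.
move/cvgrPdist_lt : h => /(_ _ e0)/nbhs_euc[dl dl0 h].
by exists dl => // y yx; have := h y yx; rewrite /= sub0r normrN ger0_norm ?euc_ge0.
Qed.

Lemma cvg_euc (y : nat -> 'cV[R]_n) x : (forall k, euc (y k - x) < k.+1%:R^-1) ->
  y k @[k --> \oo] --> x.
Proof.
move=> h A /nbhs_euc[dl dl0 hA].
exists (Num.truncn dl^-1) => // k /= hk; apply: hA; apply: lt_le_trans (h k) _.
rewrite -[leRHS]invrK lef_pV2 ?posrE ?invr_gt0//.
by apply: le_trans (ltW (truncnS_gt _)) _; rewrite ler_nat.
Qed.

Lemma trmx_row_continuous : continuous (fun v : 'rV[R]_n => v^T).
Proof.
move=> M s /nbhs_ballP[e /= e0 es]; apply/nbhs_ballP; exists e => // N [? MN].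
by apply: es; split => // i j; rewrite !mxE; exact: MN.
Qed.

(** A closed subset of a cube; compactness of cubes is stated for row vectors and carried over by
    transposition. *)
Lemma compact_euc_ball (K : R) : compact [set x : 'cV[R]_n | euc x <= K].
Proof.
pose B : set 'rV[R]_n := [set v | forall i, `[- K, K]%classic (v ord0 i)].
have cB : compact B := @rV_compact R n (fun=> `[- K, K]%classic) (fun i => @segment_compact R _ _).
have cTB : compact ((fun v : 'rV[R]_n => v^T) @` B).
  apply: continuous_compact cB; apply: continuous_subspaceT; exact: trmx_row_continuous.
apply: (subclosed_compact _ cTB).
  rewrite (_ : [set x : 'cV[R]_n | euc x <= K] = (fun x : 'cV[R]_n => euc (x - 0)) @^-1` [set r | r <= K]).
    apply: closed_comp; last exact: closed_le.
    by move=> x _; exact: euc_subr_cont.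
  by apply/seteqP; split => x /=; rewrite subr0.
move=> x /= xK; exists (x^T); last by rewrite trmxK.
by move=> i; rewrite /= in_itv /= mxE -ler_norml; apply: le_trans (euc_entry _ _ _) xK.
Qed.

Lemma euc_ball_bound (f : 'cV[R]_n -> R) (K : R) : continuous f ->
  exists2 M, 0 <= M & forall x, euc x <= K -> `|f x| <= M.
Proof.
move=> cf.
have cb : compact [set x : 'cV[R]_n | euc x <= K] by exact: compact_euc_ball.
have /compact_near_coveringP cv := cb.
have := cv R +oo (fun M x => `|f x| <= M) _.
case=> [x _|M [_ hM]]; last first.
  exists (`|M| + 1) => [|x xK]; first by rewrite addr_ge0.
  by apply: hM => //; apply: le_lt_trans (ler_norm M) _; rewrite ltrDl.
have /nbhs_euc[dl dl0 hd] : nbhs x [set y | `|f y - f x| < 1].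
  by have /cvgrPdist_lt/(_ _ ltr01) := cf x; apply: filterS => y; rewrite distrC.
exists ([set y | `|f y - f x| < 1], [set M | `|f x| + 1 < M]).
  split => /=; first by apply/nbhs_euc; exists dl.
  by exists (`|f x| + 1); rewrite num_real.
move=> [y M] /= [h1 h2]; have := ler_normD (f y - f x) (f x); rewrite subrK; lra.
Qed.

End euc_topology.

(** * Continuity of the jump coefficient in L2 *)

Section jump_norm.
Context (R : realType) (n : nat) dU (U : measurableType dU).
Variable nu : {sigma_finite_measure set U -> \bar R}.
Variable c : 'cV[R]_n -> U -> 'cV[R]_n.
Hypothesis c_meas : measurable_fun [set: borel 'cV[R]_n * U]
  (fun z => (c z.1 z.2 : borel 'cV[R]_n)).
Hypothesis c_cont : forall u, continuous (c ^~ u).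
Hypothesis c_sq_fin : forall x, (I2 nu (c x) < +oo)%E.
Hypothesis c_sq_cont : continuous (fun x : 'cV[R]_n => fine (I2 nu (c x))).

Let i2 x := fine (I2 nu (c x)).
Let i2E x : I2 nu (c x) = (i2 x)%:E.
Proof. by rewrite fineK// ge0_fin_numE ?c_sq_fin// I2_ge0. Qed.

Lemma jump_norm_bound (K : R) : exists2 M, 0 <= M &
  forall x, euc x <= K -> (I2 nu (c x) <= M%:E)%E.
Proof.
have [M M0 hM] := euc_ball_bound K c_sq_cont; exists M => // x xK.
by rewrite i2E lee_fin; apply: le_trans (ler_norm _) _; exact: hM.
Qed.

(** The Riesz-Scheffe argument: pointwise convergence together with convergence of the norms gives
    convergence in L2, by Fatou's lemma applied to [2 |c y|^2 + 2 |c x|^2 - |c y - c x|^2 >= 0]. *)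
Lemma jump_continuous x e : 0 < e -> exists2 dl, 0 < dl &
  forall y, euc (y - x) < dl -> (I2 nu (fun u => (c y u - c x u)%R) <= e%:E)%E.
Proof.
move=> e0; apply: contrapT => nh.
(* If the claim fails, there are [y] within [1 / (k + 1)] of [x] with the integral above [e], while
   [c_sq_cont] keeps the norms within [e / 4]. *)
have ey k : exists y, [/\ euc (y - x) < k.+1%:R^-1, `|i2 y - i2 x| < e / 4 &
    ~ (I2 nu (fun u => (c y u - c x u)%R) <= e%:E)%E].
  apply: contrapT => nk; apply: nh.
  have e4 : 0 < e / 4 by rewrite divr_gt0.
  have [dl dl0 hd] := continuous_euc x c_sq_cont e4.
  exists (Num.min dl k.+1%:R^-1); first by rewrite lt_min dl0 invr_gt0 ltr0Sn.
  move=> y; rewrite lt_min => /andP[y1 y2]; apply: contrapT => ny; apply: nk.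
  by exists y; split => //; exact: hd.
have [y hy] := choice ey.
have cy : y k @[k --> \oo] --> x by apply: cvg_euc => k; have [] := hy k.
pose f k u := 2 * euc (c (y k) u) ^+ 2 + 2 * euc (c x u) ^+ 2 - euc (c (y k) u - c x u) ^+ 2.
have f0 k u : 0 <= f k u.
  have := @euc_sqrD_le R n (c (y k) u) (- c x u) 1 ltr01.
  by rewrite eucN invr1 subr_ge0 => h; apply: le_trans h _; rewrite -[1 + 1]/2.
have mv z := vmeas_euc2 (vmeas_c c_meas z).
have mB k := vmeas_euc2 (vmeasB (vmeas_c c_meas (y k)) (vmeas_c c_meas x)).
have mf k : measurable_fun setT (f k).
  by apply: measurable_funB => //; apply: measurable_funD; exact: measurable_funM.
(* [2 (i2 x + e / 4) + 2 i2 x - e] is [4 i2 x - e / 2], whereas Fatou's lemma requires at least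
   [4 i2 x] in the limit. *)
have int_le k : (\int[nu]_u (f k u)%:E <= (4 * i2 x - e / 2)%:E)%E.
  have : (\int[nu]_u (f k u)%:E + I2 nu (fun u => (c (y k) u - c x u)%R) =
     (2 * i2 (y k) + 2 * i2 x)%:E)%E.
    rewrite /I2 -ge0_integralD//; last 4 first.
    - by move=> u _; rewrite lee_fin.
    - exact/measurable_EFinP.
    - by move=> u _; rewrite lee_fin sqr_ge0.
    - exact/measurable_EFinP.
    pose a z u := euc (c z u) ^+ 2.
    have Z z : (\int[nu]_u (2 * a z u)%:E = (2 * i2 z)%:E)%E.
      under eq_integral do rewrite EFinM.
      rewrite ge0_integralZl//; last by move=> u _; rewrite lee_fin sqr_ge0.
        by rewrite [(2 * i2 z)%:E]EFinM -i2E.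
      exact/measurable_EFinP/mv.
    rewrite EFinD -(Z (y k)) -(Z x) -[RHS]ge0_integralD; last 5 first.
    - exact: measurableT.
    - by move=> u _; rewrite lee_fin mulr_ge0// sqr_ge0.
    - by apply/measurable_EFinP; exact: (measurable_funM (measurable_cst _) (mv _)).
    - by move=> u _; rewrite lee_fin mulr_ge0// sqr_ge0.
    - by apply/measurable_EFinP; exact: (measurable_funM (measurable_cst _) (mv _)).
    by apply: eq_integral => u _; rewrite -!EFinD subrK.
  have [_ hyi] := hy k; move/negP; rewrite -ltNge => hJ.
  have If : (0 <= \int[nu]_u (f k u)%:E)%E by apply: integral_ge0 => u _; rewrite lee_fin.
  have Jf := I2_ge0 nu (fun u => c (y k) u - c x u).
  case: (\int[nu]_u (f k u)%:E)%E If => [r1| |]//; case: (I2 _ _) hJ Jf => [r2| |]//.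
  rewrite !lee_fin lte_fin => h1 _ _ [h2].
  have h3 := ler_norm (i2 (y k) - i2 x).
  by move: (i2 (y k)) (i2 x) h3 hyi h1 h2 => a a'; lra.
have fat := @fatou _ _ _ nu setT measurableT (fun k u => (f k u)%:E) (fun k => proj2 (measurable_EFinP _ _) (mf k)) (fun k u _ => f0 k u).
have lhs : (\int[nu]_u limn_einf (fun k => (f k u)%:E) = (4 * i2 x)%:E)%E.
  rewrite EFinM -i2E /I2 -ge0_integralZl//; last 2 first.
  - exact/measurable_EFinP/mv.
  - by move=> u _; rewrite lee_fin sqr_ge0.
  apply: eq_integral => u _.
  have cu : c (y k) u @[k --> \oo] --> c x u by apply: (cvg_comp y (c ^~ u) cy); exact: c_cont.
  have c1 : euc (c (y k) u) @[k --> \oo] --> euc (c x u).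
    have e1 : euc (c x u) = euc (c x u - 0) by rewrite subr0.
    rewrite e1 (_ : (fun k => _) = (fun A : 'cV[R]_n => euc (A - 0)) \o (fun k => c (y k) u)).
      by apply: (cvg_comp _ _ cu); exact: euc_subr_cont.
    by apply/funext => k /=; rewrite subr0.
  have c2 : euc (c (y k) u - c x u) @[k --> \oo] --> (0 : R).
    by have := cvg_comp _ _ cu (@euc_subr_cont R n 1 (c x u) (c x u)); rewrite subrr euc0.
  have sq (g : nat -> R) (l : R) : g k @[k --> \oo] --> l -> g k ^+ 2 @[k --> \oo] --> l ^+ 2.
    move=> h; rewrite expr2 (_ : (fun k => g k ^+ 2) = g \* g); first exact: cvgM.
    by apply/funext => k; rewrite /= expr2.
  have c3 : f k u @[k --> \oo] --> 2 * euc (c x u) ^+ 2 + 2 * euc (c x u) ^+ 2 - 0 ^+ 2.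
    apply: cvgB; last exact: (sq _ _ c2).
    by apply: cvgD; [apply: cvgM; [exact: cvg_cst|exact: (sq _ _ c1)]|exact: cvg_cst].
  have c4 : (f k u)%:E @[k --> \oo] -->
      (2 * euc (c x u) ^+ 2 + 2 * euc (c x u) ^+ 2 - 0 ^+ 2)%:E.
    by apply/fine_cvgP; split; [exact: nearW|exact: c3].
  have [-> _] := cvg_limn_einf_sup c4.
  by rewrite -EFinM; congr EFin; ring.
move: fat; rewrite lhs leNgt => /negP; apply.
apply: le_lt_trans (_ : (4 * i2 x - e / 2)%:E < _)%E; last by rewrite lte_fin; lra.
rewrite limn_einf_lim; apply: lime_le; first exact: is_cvg_einfs.
apply: nearW => k; apply: le_trans (int_le k).
by apply: ereal_inf_lbound; exists k => /=.
Qed.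

End jump_norm.

Lemma lebesgue_integral_cst (R : realType) (t M : R) : 0 < t ->
  (\int[@lebesgue_measure R]_(s in `]0%R, t]) M%:E = (M * t)%:E)%E.
Proof.
move=> t0; rewrite integral_cst /=; last exact: measurable_itv.
by rewrite lebesgue_measure_itv /= lte_fin t0 EFinM sube0.
Qed.

Section in_probability.
Context (R : realType) d (T : measurableType d) (P : probability T R).

Lemma measurable_sum_In (S : Type) (L : seq S) d' (T' : measurableType d') (f : S -> T' -> R) :
  (forall h, List.In h L -> measurable_fun setT (f h)) ->
  measurable_fun setT (fun z => \sum_(h <- L) f h z).
Proof.
elim: L => [|h L ih] hL.
  by under eq_fun do rewrite big_nil; exact: measurable_cst.
under eq_fun do rewrite big_cons; apply: measurable_funD; first by apply: hL; left.
by apply: ih => h' h1; apply: hL; right.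
Qed.

Lemma cvg_in_prob_near (Y : nat -> T -> \bar R) (e de : R) : cvg_in_prob P Y ->
  0 < e -> 0 < de -> (forall n, measurable [set w | (e%:E <= Y n w)%E]) ->
  \forall n \near \oo, (P [set w | (e%:E <= Y n w)%E] <= de%:E)%E.
Proof.
move=> hY e0 de0 mY; have /fine_cvg/cvgrPdist_lt/(_ _ de0) := hY e e0.
apply: filterS => n /=; rewrite sub0r normrN ger0_norm ?fine_ge0// => h.
by rewrite -(PfineK P (mY n)) lee_fin ltW.
Qed.

Lemma measurable_ge_set (f : T -> \bar R) (e : \bar R) : measurable_fun setT f ->
  measurable [set w | (e <= f w)%E].
Proof.
by move=> mf; rewrite -[X in measurable X]setTI; exact: emeasurable_fun_c_infty.
Qed.

(** For each [w] the time integrals tend to [0] by dominated convergence with a bound depending on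
    [w]. Continuity from above, along the events that some [m >= k] violates the bound, yields one
    exceptional event for all large [m]. *)
Lemma grid_conv (t : R) (G : nat -> measurableTypeR R * T -> \bar R) : 0 < t ->
  (forall m, measurable_fun (`]0, t]%classic `*` setT) (G m)) ->
  (forall m z, (0 <= G m z)%E) ->
  (forall w, exists M : R, forall m s, 0 < s <= t -> (G m (s, w) <= M%:E)%E) ->
  (forall w, {ae (@lebesgue_measure R), forall s, 0 < s <= t ->
     G m (s, w) @[m --> \oo] --> 0%E}) ->
  forall e de : R, 0 < e -> 0 < de -> exists B m0, [/\ measurable B, (P B <= de%:E)%E &
    forall m w, (m0 <= m)%N -> ~ B w ->
      (\int[@lebesgue_measure R]_(s in `]0%R, t]) G m (s, w) <= e%:E)%E].
Proof.
move=> t0 mG G0 bG cG e de e0 de0.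
have mI : measurable (`]0, t]%classic : set (measurableTypeR R)) by exact: measurable_itv.
pose J m w := (\int[@lebesgue_measure R]_(s in `]0%R, t]) G m (s, w))%E.
have mJ m : measurable_fun setT (J m) := measurable_time_integral mI (mG m) (G0 m).
have J0 m w : (0 <= J m w)%E by apply: integral_ge0.
have mGw m w : measurable_fun (`]0, t]%classic : set (measurableTypeR R)) (fun s => G m (s, w)).
  have h : measurable_fun (`]0, t]%classic : set (measurableTypeR R)) (fun s : measurableTypeR R => (s, w)).
    by apply: measurable_funTS; exact: measurable_fun_pair.
  apply: (measurable_comp (F := `]0, t]%classic `*` setT) _ _ (mG m) h).
    exact: measurableX.
  by move=> _ [s st <-].
have Jfin m w : J m w \is a fin_num.
  have [M hM] := bG w; rewrite ge0_fin_numE//.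
  apply: (@le_lt_trans _ _ (\int[@lebesgue_measure R]_(s in `]0%R, t]) M%:E)%E).
    apply: ge0_le_integral => //.
    by move=> s /= st; apply: hM; move: st; rewrite in_itv.
  by rewrite lebesgue_integral_cst// ltry.
have cJ w : fine (J m w) @[m --> \oo] --> (0 : R).
  have [M hM] := bG w.
  apply: fine_cvg.
  have := @dominated_convergence _ _ R (@lebesgue_measure R) _ mI (fun m s => G m (s, w)) (cst 0%E) (cst M%:E)
    (fun m => mGw m w) (measurable_cst _).
  case.
  - have [A [mA A0 hA]] := cG w; exists A; split => // s h; apply: hA => h2; apply: h.
  - apply/integrableP; split; first exact: measurable_cst.
    rewrite (eq_integral (fun=> `|M|%:E))//; first by rewrite lebesgue_integral_cst// ltry.
  - apply: aeW => s m st; rewrite gee0_abs//; apply: hM; move: st; rewrite /= in_itv /=.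
    by [].
  by move=> _ _; rewrite integral0.
pose E k := \bigcup_(m in [set m | (k <= m)%N]) [set w | (e%:E <= J m w)%E].
have mE k : measurable (E k) by apply: bigcup_measurable => m _; exact: measurable_ge_set.
have E0 : \bigcap_k E k = set0.
  apply/seteqP; split => // w /= hw.
  have /cvgrPdist_lt/(_ _ e0)[k _ hk] := cJ w.
  have [m /= km] := hw k Logic.I; rewrite -(fineK (Jfin m w)) lee_fin leNgt => /negP; apply.
  by have := hk m km; rewrite /= sub0r normrN; apply: le_lt_trans; exact: ler_norm.
have EP : P (E k) @[k --> \oo] --> 0%E.
  rewrite -(measure0 P) -E0; apply: nonincreasing_cvg_mu => //.
  - by apply: le_lt_trans (probability_le1 P (mE 0%N)) _; rewrite ltry.
  - by rewrite E0.
  - move=> k l kl; apply/subsetPset => w [m /= lm hm]; exists m => //=.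
    exact: leq_trans lm.
have /fine_cvg/cvgrPdist_lt/(_ _ de0)[k _ /(_ k (leqnn k))] := EP.
rewrite /= sub0r normrN ger0_norm ?fine_ge0// => hk.
exists (E k), k; split => //; first by rewrite -(PfineK P (mE k)) lee_fin ltW.
move=> m w km nE; rewrite leNgt; apply/negP => h; apply: nE; exists m => //=.
exact: ltW.
Qed.

End in_probability.

(** * Simple integrands close to the stochastic integrals *)

Section approximation.
Context (R : realType) (n : nat) d (T : measurableType d) (P : probability T R).
Context dU (U : measurableType dU).
Variable nu : {sigma_finite_measure set U -> \bar R}.
Variables (F : R -> set (set T)) (W : R -> T -> 'cV[R]_n).
Variable N : T -> {measure set (measurableTypeR R * U) -> \bar R}.
Hypothesis drv : driven P nu F W N.
Variable c : 'cV[R]_n -> U -> 'cV[R]_n.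
Hypothesis c_meas : measurable_fun [set: borel 'cV[R]_n * U]
  (fun z => (c z.1 z.2 : borel 'cV[R]_n)).
Hypothesis c_cont : forall u, continuous (c ^~ u).
Variable X : R -> T -> 'cV[R]_n.
Hypothesis mX : forall s, 0 <= s -> measurable_fun setT (X s : T -> borel 'cV[R]_n).
Hypothesis cX : forall w, path_cadlag (X ^~ w).
Variable t : R.
Hypothesis t0 : 0 < t.

Let It : set (measurableTypeR R) := `]0, t]%classic.
Let mIt : measurable It. Proof. exact: measurable_itv. Qed.

Let compl : P.-negligible `<=` @measurable d T.
Proof. by move=> A /(filt_complete (dr_F drv)); apply: (filt_measurable (dr_F drv) (lexx 0)). Qed.

Lemma Gm_coef (h : step R T) : step_ok F h -> Gm (F (lo h)) (coef h).
Proof. by move=> [_ _ _ hc]; exact: (rv_wrt_Gm (h := id) hc (@measurable_id _ _ _)). Qed.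

Lemma meas_coef (h : step R T) : step_ok F h -> measurable_fun setT (coef h).
Proof.
by move=> hok; have [lo0 _ _ _] := hok; exact: (Gm_meas (filt_measurable (dr_F drv) lo0) (Gm_coef hok)).
Qed.

Lemma measurable_step_val (h : step R T) : step_ok F h ->
  measurable_fun setT (fun z : measurableTypeR R * T => step_val h z.1 z.2).
Proof.
move=> hok; apply: measurable_funM.
  exact: (measurableT_comp (meas_coef hok) measurable_snd).
have h1 : measurable_fun setT (\1_(`]lo h, hi h]%classic) : measurableTypeR R -> R).
  by apply: measurable_indic; exact: measurable_itv.
exact: (measurableT_comp h1 measurable_fst).
Qed.

Let rcontW w j : rcont t (fun s => W s w j ord0).
Proof.
move=> s s0 e e0.
have cW : {within `[0, +oo[, continuous (W ^~ w)} by exact: (bm_cont (dr_W drv)).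
move/subspace_continuousP : cW => /(_ s).
rewrite /= in_itv /= s0 => /(_ isT) h.
have h2 := cvg_comp _ _ h (@coord_continuous R n 1 j ord0 (W s w)).
have /cvgrPdist_lt/(_ _ e0) := h2; rewrite near_withinE => -[dl /= dl0 hd].
exists dl => // u su us _; rewrite distrC; apply: hd.
  by rewrite /= distrC ger0_norm ?subr_ge0// ltrBlDl.
by rewrite /= in_itv /= (le_trans s0 su).
Qed.

Lemma measurable_ito_error (phi : 'cV[R]_n -> R) (Hs : seq (step R T)) : continuous phi ->
  (forall h, List.In h Hs -> step_ok F h) ->
  measurable_fun (It `*` setT) (fun z : measurableTypeR R * T =>
    ((\sum_(h <- Hs) step_val h z.1 z.2 - phi (X z.1 z.2)) ^+ 2)%:E).
Proof.
move=> cphi okH; apply/measurable_EFinP; apply: measurable_funX; apply: measurable_funB.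
  apply: measurable_funTS; apply: measurable_sum_In => h hI.
  exact: measurable_step_val (okH _ hI).
exact: (measurable_path mX cX t0 cphi).
Qed.

(** The definition of the Ito integral gives convergence in probability of the energy and of the
    uniform distance; one index good for both is kept. The two exceptional events are measurable by
    [measurable_path] and by completeness. *)
Lemma ito_approx j (phi : 'cV[R]_n -> R) I (e de : R) : continuous phi ->
  ito_integral P F (fun s w => W s w j ord0) (fun s w => phi (X s w)) I ->
  0 < e -> 0 < de ->
  exists Hs : seq (step R T), (forall h, List.In h Hs -> step_ok F h) /\
    exists B, [/\ measurable B, (P B <= de%:E)%E & forall w, ~ B w ->
      (\int[@lebesgue_measure R]_(s in `]0%R, t])
         ((\sum_(h <- Hs) step_val h s w - phi (X s w)) ^+ 2)%:E <= e%:E)%E /\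
      forall s, 0 <= s <= t ->
        `|simple_int_bm (fun s w => W s w j ord0) Hs s w - I s w| < e].
Proof.
move=> cphi [aI cI [Hn [okH cH uH]]] e0 de0.
have de2 : 0 < de / 2 by rewrite divr_gt0.
pose E m w := (\int[@lebesgue_measure R]_(s in `]0%R, t])
  ((\sum_(h <- Hn m) step_val h s w - phi (X s w)) ^+ 2)%:E)%E.
have mE m : measurable_fun setT (E m).
  apply: (@measurable_time_integral _ _ _ _ (fun z : measurableTypeR R * T =>
    ((\sum_(h <- Hn m) step_val h z.1 z.2 - phi (X z.1 z.2)) ^+ 2)%:E)) => //.
    exact: (measurable_ito_error cphi (okH m)).
  by move=> z; rewrite lee_fin sqr_ge0.
pose Df m s w := simple_int_bm (fun s w => W s w j ord0) (Hn m) s w - I s w.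
have mU m : measurable [set w | (e%:E <= usup (Df m) t w)%E].
  apply: (@measurable_ucp_set _ _ _ P compl t t0 (Df m) set0) => //; last first.
    move=> w _; apply: rcontB; last exact: rcont_cadlag.
    apply: rcont_sum => h hI; apply: rcontZ.
    have [lo0 lohi _ _] := okH _ _ hI.
    by apply: rcontB; apply: (rcont_min (g := fun s => W s w j ord0)) => //; exact: le_trans lohi.
  move=> s s0 st; apply: measurable_funB; last first.
    have := aI s s0 => /(rv_wrt_Gm (h := id))/(_ (@measurable_id _ _ _)).
    exact: (Gm_meas (filt_measurable (dr_F drv) s0)).
  apply: measurable_sum_In => h hI; apply: measurable_funM.
    exact: meas_coef (okH _ _ hI).
  have [lo0 lohi _ _] := okH _ _ hI.
  have mW r : 0 <= r -> measurable_fun setT (fun w => W r w j ord0).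
    by move=> r0; exact: (Gm_meas (filt_measurable (dr_F drv) r0) (Gm_W (dr_W drv) j r0)).
  by apply: measurable_funB; apply: mW; rewrite le_min ?lo0 ?(le_trans lo0 lohi).
have f1 := cvg_in_prob_near (cH t (ltW t0)) e0 de2 (fun m => measurable_ge_set e%:E (mE m)).
have f2 := cvg_in_prob_near (Y := fun m => usup (Df m) t) (uH t (ltW t0)) e0 de2 mU.
have [m [h1 h2]] := filter_ex (filterI f1 f2).
exists (Hn m); split; first exact: okH.
exists ([set w | (e%:E <= E m w)%E] `|` [set w | (e%:E <= usup (Df m) t w)%E]); split.
- by apply: measurableU => //; exact: measurable_ge_set.
- rewrite (splitr de) EFinD; apply: le_trans (measureU2 _ _ _) _ => //.
    exact: measurable_ge_set.
  exact: leeD.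
move=> w /not_orP[n1 n2]; split.
  by move/negP : n1; rewrite -ltNge => /ltW.
exact: ucp_bound n2.
Qed.

Section jump_paths.
Variable A : set U.
Hypotheses (mA : measurable A) (nA : (nu A < +oo)%E).

Let mS a b : measurable (`]a, b]%classic `*` A : set (measurableTypeR R * U)).
Proof. by apply: measurableX => //; exact: measurable_itv. Qed.

(** The counts over []s, u]] decrease to [0] as [u] decreases to [s], by continuity from above of
    the measure [N w], finite on this slab; the compensator is Lipschitz in time. *)
Lemma rcont_dN w : ~ (N w (`]0, t]%classic `*` A) = +oo%E) -> rcont t (fun s => dN nu N 0 s A w).
Proof.
move=> fA s s0 e e0.
have [ts|st] := leP t s.
  exists 1 => // u su _ ut.
  have -> : u = s by apply/eqP; rewrite eq_le su (le_trans ut ts).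
  by rewrite subrr normr0.
pose S k := `]s, Num.min t (s + k.+1%:R^-1)]%classic `*` A.
have Sfin k : (N w (S k) < +oo)%E.
  rewrite ltey; apply/eqP; apply: (N_sub_fin s0 _ mA fA); by rewrite ge_min lexx.
have S0 : \bigcap_k S k = set0.
  apply/seteqP; split => // -[v u] /= h.
  have [/= + _] := h 0%N Logic.I; rewrite in_itv /= => /andP[sv _].
  have vs : 0 < v - s by rewrite subr_gt0.
  have [/= + _] := h (Num.truncn (v - s)^-1) Logic.I.
  rewrite in_itv /= le_min => /andP[_ /andP[_]]; apply/negP; rewrite -ltNge -ltrBrDl.
  by rewrite -[ltRHS]invrK ltf_pV2 ?posrE ?invr_gt0//; exact: truncnS_gt.
have NS : N w (S k) @[k --> \oo] --> 0%E.
  rewrite -(measure0 (N w)) -S0; apply: nonincreasing_cvg_mu => //.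
  - by move=> k; exact: mS.
  - by rewrite S0.
  - move=> k l kl; apply/subsetPset => -[v u]; rewrite /S => -[/= + Au]; rewrite !in_itv /= !le_min.
    move=> /andP[h1 /andP[h2 h]]; split => //; rewrite h1 h2 /=.
    apply: le_trans h _; rewrite lerD2l lef_pV2 ?posrE//.
    by rewrite ler_nat ltnS.
have e2 : 0 < e / 2 by rewrite divr_gt0.
have /fine_cvg/cvgrPdist_lt/(_ _ e2)[k _ /(_ k (leqnn k))] := NS.
rewrite /= sub0r normrN ger0_norm ?fine_ge0// => hk.
have a1 : 0 < fine (nu A) + 1 by rewrite ltr_wpDl// fine_ge0.
exists (Num.min k.+1%:R^-1 (e / 2 / (fine (nu A) + 1))).
  by rewrite lt_min invr_gt0 ltr0Sn divr_gt0.
move=> u su; rewrite -ltrBlDl lt_min => /andP[u1 u2] ut.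
rewrite (dN_cat (lexx 0) s0 su ut mA nA fA) addrAC subrr add0r /dN.
have n1 : fine (N w (`]s, u]%classic `*` A)) <= fine (N w (S k)).
  have sub : `]s, u]%classic `*` A `<=` S k.
    move=> [v y]; rewrite /S => -[/= + Ay]; rewrite !in_itv /= le_min => /andP[sv vu].
    split => //; rewrite sv /=.
    by rewrite (le_trans vu ut) /= -lerBlDl; apply: le_trans (ltW u1); rewrite lerD2r.
  have le1 : (N w (`]s, u]%classic `*` A) <= N w (S k))%E.
    by apply: le_measure => //; rewrite inE; exact: mS.
  apply: fine_le => //; rewrite ge0_fin_numE//; exact: le_lt_trans le1 _.
have n0 : 0 <= fine (N w (`]s, u]%classic `*` A)) by exact: fine_ge0.
have m1 : (u - s) * fine (nu A) <= e / 2.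
  apply: le_trans (_ : (u - s) * (fine (nu A) + 1) <= _).
    by apply: ler_wpM2l; [rewrite subr_ge0|rewrite lerDl].
  by rewrite -ler_pdivlMr//; exact: ltW.
have m0 : 0 <= (u - s) * fine (nu A) by apply: mulr_ge0; [rewrite subr_ge0|exact: fine_ge0].
by rewrite ltr_norml; apply/andP; split; lra.
Qed.

End jump_paths.

Lemma null_jumps (Hs : seq (step R T * set U)) :
  (forall h, List.In h Hs -> jump_step_ok nu F h) ->
  exists Z, [/\ measurable Z, P Z = 0%E &
    forall w, ~ Z w -> forall h, List.In h Hs -> ~ (N w (`]0, t]%classic `*` h.2) = +oo%E)].
Proof.
elim: Hs => [|h Hs ih] hH; first by exists set0; split => //; exact: measure0.
have [|Z [mZ PZ hZ]] := ih; first by move=> h' ?; apply: hH; right.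
have [_ mh nh] := hH h (or_introl erefl).
have [mE PE] := dN_finite (dr_N drv) (lexx 0) (ltW t0) mh nh.
eexists; split; [exact: (measurableU _ _ mE mZ)|exact: null_set_setU|].
move=> w /not_orP[n1 n2] h' /= [<-//|h'H]; exact: hZ.
Qed.

Lemma measurable_inner d1 (T1m : measurableType d1) (D : set T1m) (f : T1m * U -> \bar R) :
  measurable D -> measurable_fun (D `*` setT) f -> (forall z, (0 <= f z)%E) ->
  measurable_fun D (fun z => \int[nu]_u f (z, u))%E.
Proof.
move=> mD mf f0.
have mDU : measurable (D `*` [set: U]) by exact: measurableX.
have mg := (measurable_restrictT f mDU).1 mf.
have g0 z : (0 <= (f \_ (D `*` setT)) z)%E by rewrite patchE; case: ifP.
have h := @measurable_fun_fubini_tonelli_F _ _ _ _ R nu _ mg g0.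
have := measurable_funS measurableT (@subsetT _ D) h.
apply: eq_measurable_fun => z; rewrite inE => Dz; rewrite /fubini_F.
by apply: eq_integral => u _; rewrite patchE mem_set.
Qed.

Lemma measurable_comp_error i (Hs : seq (step R T * set U)) :
  (forall h, List.In h Hs -> jump_step_ok nu F h) ->
  measurable_fun (It `*` setT) (fun z : measurableTypeR R * T => \int[nu]_u
    ((jump_val Hs z.1 u z.2 - c (left_lim (X ^~ z.2) z.1) u i ord0) ^+ 2)%:E)%E.
Proof.
move=> okH; apply: (@measurable_inner _ _ _ (fun z : measurableTypeR R * T * U =>
  ((jump_val Hs z.1.1 z.2 z.1.2 - c (left_lim (X ^~ z.1.2) z.1.1) z.2 i ord0) ^+ 2)%:E)).
- exact: measurableX.
- apply/measurable_EFinP; apply: measurable_funX; apply: measurable_funB.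
    apply: measurable_funTS; apply: measurable_sum_In => h hI.
    have [hok mh _] := okH _ hI.
    apply: measurable_funM.
      exact: (measurableT_comp (measurable_step_val hok) measurable_fst).
    apply: (measurableT_comp (f := \1_(h.2) : U -> R)); last exact: measurable_snd.
    exact: measurable_indic.
  exact: (measurable_jump_coef c_meas c_cont mX cX t0).
- by move=> z; rewrite lee_fin sqr_ge0.
Qed.

Lemma comp_approx i I (e de : R) :
  compensated_integral P nu F N (fun s u w => c (left_lim (X ^~ w) s) u i ord0) I ->
  0 < e -> 0 < de ->
  exists Hs : seq (step R T * set U), (forall h, List.In h Hs -> jump_step_ok nu F h) /\
    exists B, [/\ measurable B, (P B <= de%:E)%E & forall w, ~ B w ->
      [/\ forall h, List.In h Hs -> ~ (N w (`]0, t]%classic `*` h.2) = +oo%E),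
      (\int[@lebesgue_measure R]_(s in `]0%R, t]) \int[nu]_u
         ((jump_val Hs s u w - c (left_lim (X ^~ w) s) u i ord0) ^+ 2)%:E <= e%:E)%E &
      forall s, 0 <= s <= t -> `|simple_int_jump nu N Hs s w - I s w| < e]].
Proof.
move=> [aI cI [Hn [okH cH uH]]] e0 de0.
have de2 : 0 < de / 2 by rewrite divr_gt0.
pose E m w := (\int[@lebesgue_measure R]_(s in `]0%R, t]) \int[nu]_u
  ((jump_val (Hn m) s u w - c (left_lim (X ^~ w) s) u i ord0) ^+ 2)%:E)%E.
have mE m : measurable_fun setT (E m).
  apply: (@measurable_time_integral _ _ _ _ (fun z : measurableTypeR R * T =>
    \int[nu]_u ((jump_val (Hn m) z.1 u z.2 - c (left_lim (X ^~ z.2) z.1) u i ord0) ^+ 2)%:E)%E) => //.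
    exact: measurable_comp_error (okH m).
  by move=> z; apply: integral_ge0 => u _; rewrite lee_fin sqr_ge0.
pose Df m s w := simple_int_jump nu N (Hn m) s w - I s w.
have mU m : measurable [set w | (e%:E <= usup (Df m) t w)%E].
  have [Z [mZ PZ hZ]] := null_jumps (okH m).
  apply: (@measurable_ucp_set _ _ _ P compl t t0 (Df m) Z) => //; last first.
    move=> w nZ; apply: rcontB; last exact: rcont_cadlag.
    apply: rcont_sum => h hI; apply: rcontZ.
    have [[lo0 lohi _ _] mh nh] := okH _ _ hI; have fh := hZ w nZ h hI.
    have hi0 := le_trans lo0 lohi.
    have rd := rcont_dN mh nh fh.
    have h1 := rcontB (rcont_min rd hi0) (rcont_min rd lo0).
    move=> s s0 e' e'0; have [dl dl0 hd] := h1 s s0 e' e'0; exists dl => // u su us ut.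
    (* The increment is a difference of paths [dN 0 _] for times up to [t] only, where the counts
       are finite. *)
    have dE v : 0 <= v -> v <= t -> fine (N w (`]Num.min (lo h.1) v, Num.min (hi h.1) v]%classic `*` h.2)) -
        (Num.min (hi h.1) v - Num.min (lo h.1) v) * fine (nu h.2) =
      dN nu N 0 (Num.min (hi h.1) v) h.2 w - dN nu N 0 (Num.min (lo h.1) v) h.2 w.
      move=> v0 vt; rewrite (@dN_cat _ _ _ _ _ _ _ 0 (Num.min (lo h.1) v) (Num.min (hi h.1) v) t)//.
      - by rewrite addrAC subrr add0r.
      - by rewrite le_min lo0.
      - by rewrite le_min !ge_min lohi lexx orbT.
      - by rewrite ge_min vt orbT.
    by rewrite dE//; [rewrite dE//; [exact: hd|exact: le_trans su ut]|exact: le_trans s0 su].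
  move=> s s0 st; apply: measurable_funB; last first.
    have := aI s s0 => /(rv_wrt_Gm (h := id))/(_ (@measurable_id _ _ _)).
    exact: (Gm_meas (filt_measurable (dr_F drv) s0)).
  apply: measurable_sum_In => h hI; have [hok mh nh] := okH _ _ hI.
  apply: measurable_funM; first exact: meas_coef hok.
  have [lo0 lohi _ _] := hok.
  have a0 : 0 <= Num.min (lo h.1) s by rewrite le_min lo0.
  have ab : Num.min (lo h.1) s <= Num.min (hi h.1) s by rewrite le_min !ge_min lohi lexx orbT.
  exact: (Gm_meas (filt_measurable (dr_F drv) (le_trans a0 ab)) (Gm_dN (dr_F drv) (dr_N drv) a0 ab mh)).
have f1 := cvg_in_prob_near (cH t (ltW t0)) e0 de2 (fun m => measurable_ge_set e%:E (mE m)).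
have f2 := cvg_in_prob_near (Y := fun m => usup (Df m) t) (uH t (ltW t0)) e0 de2 mU.
have [m [h1 h2]] := filter_ex (filterI f1 f2).
exists (Hn m); split; first exact: okH.
have [Z [mZ PZ hZ]] := null_jumps (okH m).
pose A := [set w | (e%:E <= E m w)%E] `|` [set w | (e%:E <= usup (Df m) t w)%E].
have mA : measurable A by apply: measurableU => //; exact: measurable_ge_set.
exists (Z `|` A); split; first exact: measurableU.
  apply: le_trans (measureU2 _ mZ mA) _.
  have -> : (measure_function.Measure.sort P Z + measure_function.Measure.sort P A = P A)%E by rewrite [X in (X + _)%E]PZ add0e.
  rewrite (splitr de) EFinD; apply: le_trans (measureU2 _ _ _) _ => //.
    exact: measurable_ge_set.
  exact: leeD.
move=> w /not_orP[nZ /not_orP[n1 n2]]; split; first exact: hZ.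
  by move/negP : n1; rewrite -ltNge => /ltW.
exact: ucp_bound n2.
Qed.

End approximation.

Section integrals.
Context (R : realType).

Lemma quad_integral dU (U : measurableType dU) (nu : {measure set U -> \bar R})
    (J : finType) (A : J -> set U) (a : J -> R) :
  (forall j, measurable (A j)) -> (forall j, (nu (A j) < +oo)%E) ->
  (\int[nu]_u ((\sum_j a j * \1_(A j) u) ^+ 2)%:E =
   (\sum_j \sum_j' a j * a j' * fine (nu (A j `&` A j')))%:E)%E.
Proof.
move=> mA nA.
pose f (p : J * J) (u : U) : \bar R := ((a p.1 * a p.2)%:E * (\1_(A p.1 `&` A p.2) u)%:E)%E.
have nI p : (nu (A p.1 `&` A p.2) < +oo)%E.
  apply: le_lt_trans (nA p.1); apply: le_measure; rewrite ?inE//.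
  exact: measurableI.
have iI p : nu.-integrable setT (fun u => (\1_(A p.1 `&` A p.2) u)%:E).
  have mI : measurable (A p.1 `&` A p.2) by exact: measurableI.
  apply/integrableP; split; first by apply/measurable_EFinP; exact: measurable_indic.
  rewrite (eq_integral (fun u => (\1_(A p.1 `&` A p.2) u)%:E)); last first.
    by move=> u _; rewrite gee0_abs// lee_fin.
  by rewrite integral_indic// setIT.
have fi p : nu.-integrable setT (f p) by apply: integrableZl.
have -> : (\int[nu]_u ((\sum_j a j * \1_(A j) u) ^+ 2)%:E =
    \int[nu]_u (\sum_(p : J * J) f p u))%E.
  apply: eq_integral => u _; rewrite expr2 big_distrl/=.
  under eq_bigr do rewrite big_distrr/=.
  rewrite pair_big/= -sumEFin; apply: eq_bigr => -[j j'] _ /=.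
  by rewrite /f /= indicI /= -EFinM; congr EFin; ring.
rewrite (_ : \sum_j \sum_j' _ = \sum_(p : J * J) a p.1 * a p.2 * fine (nu (A p.1 `&` A p.2))); last first.
  by rewrite pair_bigA.
rewrite integral_sum// -sumEFin.
apply: eq_bigr => p _; rewrite integralZl// integral_indic ?setIT//; last exact: measurableI.
by rewrite [in RHS]EFinM fineK// ge0_fin_numE.
Qed.

Lemma cells_le (r : nat -> R) (t : R) (G : R -> \bar R) k :
  r 0%N = 0 -> (forall i, r i <= r i.+1) -> (forall i, 0 <= r i <= t) ->
  measurable_fun (`]0, t]%classic : set (measurableTypeR R)) G ->
  (forall s, (0 <= G s)%E) ->
  (\sum_(i < k) \int[@lebesgue_measure R]_(s in `]r i, r i.+1]) G s <=
   \int[@lebesgue_measure R]_(s in `]0%R, t]) G s)%E.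
Proof.
move=> r0 rS rt mG G0.
have mI (a b : R) : measurable (`]a, b]%classic : set (measurableTypeR R)) by exact: measurable_itv.
have sub k' : `]0, r k']%classic `<=` `]0, t]%classic.
  by move=> s /=; rewrite !in_itv /= => /andP[-> h] /=; apply: le_trans h _; case/andP: (rt k').
apply: (@le_trans _ _ (\int[@lebesgue_measure R]_(s in `]0%R, r k]) G s)%E); last first.
  apply: ge0_subset_integral => //.
elim: k => [|k ih]; first by rewrite big_ord0; exact: integral_ge0.
rewrite big_ord_recr /=; apply: le_trans (leeD2r _ ih) _.
have -> : `]0, r k.+1]%classic = `]0, r k]%classic `|` `]r k, r k.+1]%classic.
  apply/seteqP; split => s /=; rewrite !in_itv /=.
    by move=> /andP[-> h] /=; case: (leP s (r k)) => hs; [left|right].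
  case=> /andP[h1 h2]; first by rewrite h1 (le_trans h2).
  by rewrite h2 andbT; apply: le_lt_trans h1; case/andP: (rt k).
rewrite ge0_integral_setU//.
  apply: (measurable_funS (mI 0 t)) mG => s [/sub//|/=]; rewrite !in_itv /= => /andP[h1 h2].
  rewrite (le_trans h2) ?andbT; last by case/andP: (rt k.+1).
  by apply: le_lt_trans h1; case/andP: (rt k).
rewrite disj_set2E; apply/eqP/seteqP; split => // s [] /=; rewrite !in_itv /= => /andP[_ h1] /andP[h2 _].
by have := lt_le_trans h2 h1; rewrite ltxx.
Qed.

(** Each cell contributes [(t / m) a j] to the integral of the step function, so the Riemann sum
    differs from the integral by at most the L1 distance of [f] to [gval]. *)
Lemma riemann_le (t : R) m k (f : R -> R) (a : nat -> R) (M e : R) : 0 < t -> (0 < m)%N ->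
  (k <= m)%N ->
  measurable_fun (`]0, t]%classic : set (measurableTypeR R)) f ->
  (forall s, 0 < s <= t -> `|f s| <= M) ->
  (\int[@lebesgue_measure R]_(s in `]0%R, t]) (`|f s - gval t m a s|)%:E <= e%:E)%E ->
  `|\int[@lebesgue_measure R]_(s in `[0, gpt t m k]) f s - \sum_(j < k) (t / m%:R) * a j| <= e.
Proof.
move=> t0 m0 km mf fM he.
have mI (x y : R) : measurable (`]x, y]%classic : set (measurableTypeR R)) by exact: measurable_itv.
pose g := gval t m a.
have mg : measurable_fun (`]0, t]%classic : set (measurableTypeR R)) g.
  apply: measurable_sum => l; apply: measurable_funM => //.
  by apply: measurable_funTS; apply: measurable_indic; exact: measurable_cell.
have sub l : (l <= m)%N -> `]0, gpt t m l]%classic `<=` `]0, t]%classic.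
  move=> lm s /=; rewrite !in_itv /= => /andP[-> h] /=; apply: le_trans h _.
  by rewrite -[leRHS](gpt_last t m0); exact: gpt_le.
have fin : (@lebesgue_measure R (`]0%R, t]%classic : set (measurableTypeR R)) < +oo)%E.
  by rewrite lebesgue_measure_itv /= lte_fin t0 sube0 ltry.
have bdd_int (u : R -> R) (C : R) : measurable_fun (`]0, t]%classic : set (measurableTypeR R)) u ->
    (forall s, 0 < s <= t -> `|u s| <= C) ->
    (@lebesgue_measure R).-integrable `]0, t]%classic (EFin \o u).
  move=> mu hu; apply: measurable_bounded_integrable => //.
  exists C; split; first exact: num_real.
  move=> x Cx s /=; rewrite in_itv /= => st; apply: le_trans (hu s st) _; exact: ltW.
have if_ := bdd_int f M mf fM.
have ig : (@lebesgue_measure R).-integrable `]0, t]%classic (EFin \o g).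
  apply: (bdd_int g (\sum_(l < m) `|a l|) mg) => s st.
  have [l lm ls] := cell_exists m0 st; rewrite /g (gval_cell t0 _ lm ls).
  rewrite (bigD1 (Ordinal lm))//= lerDl; exact: sumr_ge0.
have iS l (lm : (l <= m)%N) u : (@lebesgue_measure R).-integrable `]0, t]%classic u ->
    (@lebesgue_measure R).-integrable `]0, gpt t m l]%classic u.
  by move=> iu; apply: (integrableS (mI _ _) (mI _ _) (sub l lm) iu).
have Ig l : (l <= m)%N -> \int[@lebesgue_measure R]_(s in `]0, gpt t m l]) g s = \sum_(j < l) (t / m%:R) * a j.
  elim: l => [|l ih] lm.
    by rewrite big_ord0 gpt0 set_itv_ge ?bnd_simp ?ltxx// Rintegral_set0.
  rewrite big_ord_recr /= -ih; last exact: ltnW.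
  have := Rintegral_itvB (x := gpt t m l) (iS l.+1 lm _ ig).
  rewrite !bnd_simp => /(_ (gpt_ge0 t0 m l) (gpt_le t0 m (leqnSn l))) h.
  rewrite -[LHS](subrK (\int[@lebesgue_measure R]_(s in `]0, gpt t m l]) g s)) h addrC; congr (_ + _).
  rewrite (@eq_Rintegral _ _ _ _ _ (fun=> a l)); last first.
    by move=> s; rewrite inE => ls; exact: (gval_cell t0 _ lm ls).
  rewrite Rintegral_cst//.
  rewrite mulrC; congr (_ * _); rewrite /= lebesgue_measure_itv /= lte_fin gptS.
  have hp : 0 < t / m%:R by rewrite divr_gt0// ltr0n.
  by rewrite ltrDl hp /= addrAC subrr add0r.
rewrite -Rintegral_itv_obnd_cbnd; last exact: iS.
rewrite -Ig// -RintegralB//; [|exact: iS..].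
have ifg : (@lebesgue_measure R).-integrable `]0, t]%classic (EFin \o (fun s => f s - g s)).
  have := integrableB (mI 0 t) if_ ig; apply: eq_integrable => //.
apply: le_trans (le_normr_Rintegral _ _) _; [exact: mI|exact: iS|].
have inorm := integrable_norm ifg.
rewrite -lee_fin /Rintegral fineK; last first.
  apply: integrable_fin_num => //; exact: (iS _ km _ inorm).
apply: le_trans he; apply: ge0_subset_integral => //.
  by apply/measurable_EFinP; apply: measurableT_comp => //; exact: measurable_funB.
exact: sub.
Qed.

End integrals.

(** * Energy of the grid approximation *)

Section grid_energy.
Context (R : realType) (n : nat) d (T : measurableType d) (P : probability T R).
Context dU (U : measurableType dU).
Variable nu : {sigma_finite_measure set U -> \bar R}.
Variables (b : 'cV[R]_n -> 'cV[R]_n) (sigma : 'cV[R]_n -> 'M[R]_n) (c : 'cV[R]_n -> U -> 'cV[R]_n).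
Hypothesis c_meas : measurable_fun [set: borel 'cV[R]_n * U]
  (fun z => (c z.1 z.2 : borel 'cV[R]_n)).
Hypotheses (b_cont : continuous b) (sigma_cont : continuous sigma).
Hypothesis c_cont : forall u, continuous (c ^~ u).
Hypothesis c_sq_fin : forall x, (I2 nu (c x) < +oo)%E.
Hypothesis c_sq_cont : continuous (fun x : 'cV[R]_n => fine (I2 nu (c x))).
Variable X : R -> T -> 'cV[R]_n.
Hypothesis mX : forall s, 0 <= s -> measurable_fun setT (X s : T -> borel 'cV[R]_n).
Hypothesis cX : forall w, path_cadlag (X ^~ w).
Variable t : R.
Hypothesis t0 : 0 < t.

Let It : set (measurableTypeR R) := `]0, t]%classic.
Let mIt : measurable It. Proof. exact: measurable_itv. Qed.

Let cad (phi : 'cV[R]_n -> R) w : continuous phi -> path_cadlag (fun s => phi (X s w)) /\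
  forall s, 0 < s -> left_lim (fun s => phi (X s w)) s = phi (left_lim (X ^~ w) s).
Proof. by move=> cphi; apply: cadlag_comp (cphi) (cX w); exact: cV_hausdorff. Qed.

Lemma cont_entry p q (f : 'cV[R]_n -> 'M[R]_(p, q)) i j : continuous f ->
  continuous (fun x => f x i j).
Proof.
move=> cf x; apply: (cvg_comp f (fun M : 'M[R]_(p, q) => M i j)); first exact: cf.
exact: coord_continuous.
Qed.

Let euc_cont (a : 'cV[R]_n) : continuous (fun x : 'cV[R]_n => euc (x - a)).
Proof. exact: euc_subr_cont. Qed.

Lemma path_bound w : exists2 M, 0 <= M & forall s, 0 < s <= t -> euc (X s w) <= M /\
  euc (left_lim (X ^~ w) s) <= M.
Proof.
have [cg lg] := cad w (@euc_cont 0).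
have [M hM] := cadlag_bounded cg t.
have hM' s : 0 <= s <= t -> euc (X s w) <= M.
  by move=> st; have := hM s st; rewrite subr0 ger0_norm ?euc_ge0.
exists M; first by apply: le_trans (hM' 0 _); rewrite ?euc_ge0// lexx ltW.
move=> s /andP[s0 st]; split; first by apply: hM'; rewrite ltW.
apply/ler_addgt0Pr => e e0.
have [dl dl0 hd] := cadlag_left cg s0 e0.
pose u := Num.max (s / 2) (s - dl / 2).
have us : u < s by rewrite gt_max; apply/andP; split; lra.
have u0 : 0 <= u by rewrite le_max divr_ge0// ltW.
have du : s - dl < u by rewrite lt_max; apply/orP; right; lra.
have := hd u du us; rewrite lg// !subr0.
have := hM' u; rewrite u0 (ltW (lt_le_trans us st)) => /(_ isT).
have := ler_norm (euc (left_lim (X ^~ w) s) - euc (X u w)); rewrite distrC; lra.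
Qed.

Lemma measurable_grid (phi : 'cV[R]_n -> R) m : continuous phi ->
  measurable_fun (It `*` [set: T])
    (fun z : measurableTypeR R * T => gval t m (fun k => phi (X (gpt t m k) z.2)) z.1).
Proof.
move=> cphi; apply: measurable_funTS.
apply: (measurable_gval t m (phi := fun k w => phi (X (gpt t m k) w))) => k.
apply: (measurableT_comp (f := phi : borel 'cV[R]_n -> R)); first exact: borel_continuous.
by apply: mX; exact: gpt_ge0.
Qed.

Lemma measurable_jump_grid i m :
  measurable_fun ((It `*` [set: T]) `*` [set: U]) (fun z : measurableTypeR R * T * U =>
    gval t m (fun k => c (X (gpt t m k) z.1.2) z.2 i ord0) z.1.1).
Proof.
apply: measurable_funTS; apply: measurable_sum => k; apply: measurable_funM.
  have h : measurable_fun setT (\1_(cell t m k) : measurableTypeR R -> R).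
    by apply: measurable_indic; exact: measurable_cell.
  apply: (measurableT_comp h); exact: (measurableT_comp measurable_fst measurable_fst).
have h1 : measurable_fun setT (fun z : measurableTypeR R * T * U =>
    (X (gpt t m k) z.1.2 : borel 'cV[R]_n, z.2)).
  apply: measurable_fun_pair; last exact: measurable_snd.
  apply: (measurableT_comp (mX (gpt_ge0 t0 m k))).
  exact: (measurableT_comp measurable_snd measurable_fst).
have h2 := measurableT_comp c_meas h1.
apply: (measurableT_comp (f := fun M : borel 'cV[R]_n => (M : 'cV[R]_n) i ord0) _ h2).
by apply: borel_continuous; exact: coord_continuous.
Qed.

Variable i : 'I_n.

Let g1 m (z : measurableTypeR R * T) := \sum_(l < n)
  (sigma (X z.1 z.2) i l - gval t m (fun k => sigma (X (gpt t m k) z.2) i l) z.1) ^+ 2.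
Let g3 m (z : measurableTypeR R * T) :=
  `|b (X z.1 z.2) i ord0 - gval t m (fun k => b (X (gpt t m k) z.2) i ord0) z.1|.
Let G2 m (z : measurableTypeR R * T) := (\int[nu]_u
  ((c (left_lim (X ^~ z.2) z.1) u i ord0 -
    gval t m (fun k => c (X (gpt t m k) z.2) u i ord0) z.1) ^+ 2)%:E)%E.
Let G m z := ((g1 m z + g3 m z)%:E + G2 m z)%E.

Let g1_ge0 m z : 0 <= g1 m z. Proof. by apply: sumr_ge0 => l _; exact: sqr_ge0. Qed.
Let G2_ge0 m z : (0 <= G2 m z)%E.
Proof. by apply: integral_ge0 => u _; rewrite lee_fin sqr_ge0. Qed.
Let g13 m z : (0 <= (g1 m z + g3 m z)%:E)%E. Proof. by rewrite lee_fin; apply: addr_ge0 => //; exact: normr_ge0. Qed.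

Lemma measurable_jump_diff m : measurable_fun (It `*` setT) (G2 m).
Proof.
pose f (z : measurableTypeR R * T * U) := ((c (left_lim (X ^~ z.1.2) z.1.1) z.2 i ord0 -
    gval t m (fun k => c (X (gpt t m k) z.1.2) z.2 i ord0) z.1.1) ^+ 2)%:E.
have mf : measurable_fun ((It `*` [set: T]) `*` [set: U]) f.
  apply/measurable_EFinP; apply: measurable_funX; apply: measurable_funB.
    exact: (measurable_jump_coef c_meas c_cont mX cX t0).
  exact: measurable_jump_grid.
have f0 z : (0 <= f z)%E by rewrite lee_fin sqr_ge0.
have mIT : measurable (It `*` [set: T]) by exact: measurableX.
first [exact: (measurable_inner nu mIT mf f0)|exact: (measurable_inner mIT mf f0)].
Qed.

Let mg1 m : measurable_fun (It `*` setT) (g1 m).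
Proof.
apply: measurable_sum => l; apply: measurable_funX; apply: measurable_funB.
  exact: (measurable_path mX cX t0 (cont_entry sigma_cont)).
exact: (measurable_grid m (cont_entry (i := i) (j := l) sigma_cont)).
Qed.

Let mg3 m : measurable_fun (It `*` setT) (g3 m).
Proof.
apply: measurableT_comp => //; apply: measurable_funB.
  exact: (measurable_path mX cX t0 (cont_entry b_cont)).
exact: (measurable_grid m (cont_entry (i := i) (j := ord0) b_cont)).
Qed.

Let mG m : measurable_fun (It `*` setT) (G m).
Proof.
apply: emeasurable_funD; last exact: measurable_jump_diff.
by apply/measurable_EFinP; exact: measurable_funD.
Qed.

Let G2_cell m k s w : (k < m)%N -> cell t m k s ->
  (G2 m (s, w) <= I2 nu (fun u => (c (X (gpt t m k) w) u - c (left_lim (X ^~ w) s) u)%R))%E.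
Proof.
move=> km ks; apply: ge0_le_integral => //.
- by move=> u _; rewrite lee_fin sqr_ge0.
- apply/measurable_EFinP; apply: measurable_funX; apply: measurable_funB; first exact: vmeas_c.
  rewrite (_ : (fun u => _) = fun u => c (X (gpt t m k) w) u i ord0); first exact: vmeas_c.
  by apply/funext => u /=; rewrite (gval_cell t0 _ km ks).
- by apply/measurable_EFinP; apply: vmeas_euc2; apply: vmeasB; exact: vmeas_c.
move=> u _; rewrite lee_fin /= (gval_cell t0 _ km ks) -sqrrN opprB.
rewrite -[leLHS]real_normK ?num_real// ler_sqr ?nnegrE ?euc_ge0//.
rewrite (_ : _ - _ = (c (X (gpt t m k) w) u - c (left_lim (X ^~ w) s) u) i ord0); first exact: euc_entry.
by rewrite !mxE.
Qed.

Let bG w : exists M : R, forall m s, 0 < s <= t -> (G m (s, w) <= M%:E)%E.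
Proof.
have [M M0 hM] := path_bound w.
have [Cc Cc0 hCc] := jump_norm_bound c_sq_fin c_sq_cont M.
have [Bb _ hb] := euc_ball_bound M (cont_entry (i := i) (j := ord0) b_cont).
have [Bs hs] : exists Bs : 'I_n -> R, forall l x, euc x <= M -> `|sigma x i l| <= Bs l.
  have h l : exists B : R, forall x, euc x <= M -> `|sigma x i l| <= B.
    by have [B _ hB] := euc_ball_bound M (cont_entry (i := i) (j := l) sigma_cont); exists B.
  by have [Bs hs] := choice h; exists Bs.
have M0b : euc (0 : 'cV[R]_n) <= M by rewrite euc0.
exists (\sum_(l < n) (2 * Bs l) ^+ 2 + 2 * Bb + 4 * Cc) => m s st.
have [h1 h2] := hM s st.
(* The domination is wanted for every [m]; for [m = 0] there are no cells and [gval] is [0]. *)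
case: (posnP m) => [m00|m0].
  have gv phi : gval t m phi s = 0 by rewrite m00 /gval big_ord0.
  rewrite EFinD; apply: leeD.
    rewrite lee_fin; apply: lerD; rewrite /g1 /g3 /=.
      apply: ler_sum => l _; rewrite gv subr0 -[leLHS]real_normK ?num_real//.
      have hl := hs l _ h1; have := normr_ge0 (sigma (X s w) i l) => h0.
      by rewrite ler_sqr ?nnegrE//; lra.
    by rewrite gv subr0; have := hb _ h1; have := normr_ge0 (b (X s w) i ord0); lra.
  apply: le_trans (_ : (I2 nu (c (left_lim (X ^~ w) s)) <= _)%E); last first.
    by apply: le_trans (hCc _ h2) _; rewrite lee_fin; lra.
  apply: ge0_le_integral => //.
  - by move=> u _; rewrite lee_fin sqr_ge0.
  - apply/measurable_EFinP; apply: measurable_funX; apply: measurable_funB; first exact: vmeas_c.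
    by rewrite (_ : (fun u => _) = cst 0)//; apply/funext => u /=; rewrite gv.
  - by apply/measurable_EFinP; apply: vmeas_euc2; exact: vmeas_c.
  move=> u _; rewrite lee_fin /= gv subr0 -[leLHS]real_normK ?num_real//.
  by rewrite ler_sqr ?nnegrE ?euc_ge0//; exact: euc_entry.
have [k km ks] := cell_exists m0 st.
have h3 : euc (X (gpt t m k) w) <= M.
  move: ks => /=; rewrite /cell /= in_itv /= => /andP[k1 k2].
  case: k km k1 k2 => [|k] km k1 k2; last first.
    have [] := hM (gpt t m k.+1); last by [].
    rewrite (le_trans (ltW k1) _); last by case/andP: st.
    by rewrite andbT /gpt mulr_gt0// divr_gt0// ltr0n.
  (* [path_bound] covers positive times only; at time [0] the bound follows from
     right-continuity. *)
  rewrite gpt0; apply/ler_addgt0Pr => e e0.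
  have [cg _] := cad w (@euc_cont 0).
  have [dl dl0 hd] := cadlag_right cg (lexx 0) e0.
  pose v := Num.min t (dl / 2).
  have v0 : 0 < v by rewrite lt_min t0 divr_gt0.
  have vt : v <= t by rewrite ge_min lexx.
  have vd : v < 0 + dl by rewrite add0r gt_min; apply/orP; right; lra.
  have := hd v (ltW v0) vd; rewrite !subr0.
  have [hv _] := hM v (introT andP (conj v0 vt)).
  have := ler_norm (euc (X 0 w) - euc (X v w)); rewrite distrC; lra.
rewrite EFinD; apply: leeD.
  rewrite lee_fin; apply: lerD; rewrite /g1 /g3 /=.
    apply: ler_sum => l _; rewrite (gval_cell t0 _ km ks) -[leLHS]real_normK ?num_real//.
    have h0 := ler_normB (sigma (X s w) i l) (sigma (X (gpt t m k) w) i l).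
    have hl := hs l _ h1; have hl' := hs l _ h3.
    have hn := normr_ge0 (sigma (X s w) i l - sigma (X (gpt t m k) w) i l).
    by rewrite ler_sqr ?nnegrE//; lra.
  rewrite (gval_cell t0 _ km ks).
  have := ler_normB (b (X s w) i ord0) (b (X (gpt t m k) w) i ord0).
  by have := hb _ h1; have := hb _ h3; lra.
apply: le_trans (G2_cell w km ks) _.
have vN : vmeas (fun u => - c (left_lim (X ^~ w) s) u).
  by move=> j; under eq_fun do rewrite mxE; apply: measurable_funN; exact: vmeas_c.
apply: le_trans (I2D nu ltr01 (vmeas_c c_meas _) vN) _; rewrite I2N.
have -> : 4 * Cc = (1 + 1) * Cc + (1 + 1^-1) * Cc by rewrite invr1; ring.
rewrite [leRHS]EFinD [((1 + 1) * Cc)%:E]EFinM [((1 + 1^-1) * Cc)%:E]EFinM; apply: leeD; apply: lee_pmul => //; rewrite ?I2_ge0//; try exact: hCc.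
Qed.

(** The scheme samples at left ends, so [b] and [sigma] converge to left limits; these equal the
    values off the countably many jump times ([None] indexes [b], [Some l] the entries of [sigma]).
    The jump coefficient is taken at the left limit already and converges at every time by
    [jump_continuous]. *)
Let cG w : {ae (@lebesgue_measure R), forall s, 0 < s <= t -> G m (s, w) @[m --> \oo] --> 0%E}.
Proof.
pose J (phi : 'cV[R]_n -> R) := [set s | 0 < s /\ phi (X s w) <> left_lim (fun s => phi (X s w)) s].
pose Jb := J (fun x => b x i ord0).
pose Js l := J (fun x => sigma x i l).
pose A := \bigcup_(o in [set: option 'I_n]) (if o is Some l then Js l else Jb).
have cA : countable A.
  apply: bigcup_countable => // -[l|] _; apply: countable_jumps.
    by have [] := cad w (cont_entry (i := i) (j := l) sigma_cont).
  by have [] := cad w (cont_entry (i := i) (j := ord0) b_cont).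
exists A; split; [exact: countable_measurable|exact: countable_lebesgue_measure0|].
move=> s ns; apply: contrapT => nA; apply: ns => st.
have s0 : 0 < s by case/andP: st.
have Is : \1_(`]0, t]%classic) s = 1 :> R by rewrite indicE mem_set//= in_itv.
have conv (phi : 'cV[R]_n -> R) : continuous phi -> ~ J phi s ->
    phi (X s w) - gval t m (fun k => phi (X (gpt t m k) w)) s @[m --> \oo] --> (0 : R).
  move=> cphi nJ; have [cg lg] := cad w cphi.
  have eq1 : phi (X s w) = left_lim (fun s => phi (X s w)) s.
    by apply: contrapT => h; apply: nJ.
  have := gval_left t0 (s := s) cg; rewrite Is mul1r => h.
  have -> : (0 : R) = phi (X s w) - left_lim (fun s => phi (X s w)) s by rewrite -eq1 subrr.
  by apply: cvgB h; exact: cvg_cst.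
have c1 : g1 m (s, w) + g3 m (s, w) @[m --> \oo] --> (0 : R).
  rewrite -[X in _ --> X]addr0; apply: cvgD.
    rewrite (_ : 0 = \sum_(l < n) (0 : R)); last by rewrite big1.
    apply: cvgr_sum => l; rewrite -[X in _ --> X](mulr0 (0 : R)).
    have nJl : ~ Js l s by move=> h; apply: nA; exists (Some l).
    by have h := conv _ (cont_entry (i := i) (j := l) sigma_cont) nJl; exact: (cvgM h h).
  have nJb : ~ Jb s by move=> h; apply: nA; exists None.
  have h := conv _ (cont_entry (i := i) (j := ord0) b_cont) nJb.
  by rewrite -[X in _ --> X](normr0 R); apply: cvg_norm.
have c2 : G2 m (s, w) @[m --> \oo] --> 0%E.
  apply/fine_cvgP; split.
    have [M hM] := bG w; apply: nearW => m; rewrite ge0_fin_numE//.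
    apply: le_lt_trans (_ : (M%:E < +oo)%E); last by rewrite ltry.
    by apply: le_trans (hM m s st); rewrite leeDr.
  apply/cvgrPdist_le => e e0.
  have [dl dl0 hd] := jump_continuous c_meas c_cont c_sq_fin c_sq_cont (left_lim (X ^~ w) s) e0.
  have [cg lg] := cad w (@euc_cont (left_lim (X ^~ w) s)).
  have := gval_left t0 (s := s) cg; rewrite Is mul1r lg// subrr euc0.
  move=> /cvgrPdist_lt/(_ _ dl0) h.
  apply: filterS2 h (small_mesh t ltr01) => m hm [m0 _].
  have [k km ks] := cell_exists m0 st.
  move: hm; rewrite (gval_cell t0 _ km ks) sub0r normrN ger0_norm ?euc_ge0// => hk.
  have le1 := le_trans (G2_cell w km ks) (hd _ hk).
  rewrite /= sub0r normrN ger0_norm ?fine_ge0//.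
  rewrite -lee_fin fineK//; rewrite ge0_fin_numE//.
  by apply: le_lt_trans le1 _; rewrite ltry.
rewrite -[X in _ --> X]adde0; apply: cvgeD => //.
by apply/fine_cvgP; split; [exact: nearW|exact: c1].
Qed.

(** All three errors are nonnegative, so [grid_conv] is applied once to their sum [G], which bounds
    each of them. *)
Lemma grid_energy (e eps : R) : 0 < e -> 0 < eps -> exists B m0,
  [/\ measurable B, (P B <= eps%:E)%E & forall m w, (m0 <= m)%N -> ~ B w ->
   [/\ (\int[@lebesgue_measure R]_(s in `]0%R, t]) (g1 m (s, w))%:E <= e%:E)%E,
       (\int[@lebesgue_measure R]_(s in `]0%R, t]) (g3 m (s, w))%:E <= e%:E)%E &
       (\int[@lebesgue_measure R]_(s in `]0%R, t]) G2 m (s, w) <= e%:E)%E]].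
Proof.
move=> e0 eps0.
have G0 m z : (0 <= G m z)%E := adde_ge0 (g13 m z) (G2_ge0 m z).
have [B [m0 [mB PB hB]]] := grid_conv P t0 mG G0 bG cG e0 eps0.
exists B, m0; split => // m w hm nB; have h := hB m w hm nB.
have sec (f : measurableTypeR R * T -> \bar R) : measurable_fun (It `*` setT) f ->
    measurable_fun It (fun s => f (s, w)).
  move=> mf; have h1 : measurable_fun It (fun s : measurableTypeR R => (s, w)).
    by apply: measurable_funTS; exact: measurable_fun_pair.
  apply: (measurable_comp (F := It `*` setT) _ _ mf h1); first exact: measurableX.
  by move=> _ [s st <-].
split; apply: le_trans h; apply: ge0_le_integral => //.
- by move=> s _; rewrite lee_fin.
- by apply: (sec (fun z => (g1 m z)%:E)); apply/measurable_EFinP.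
- exact: sec.
- move=> s _; apply: (@le_trans _ _ (g1 m (s, w) + g3 m (s, w))%:E); last by rewrite /G leeDl.
  by rewrite lee_fin lerDl; exact: normr_ge0.
- by move=> s _; rewrite lee_fin; exact: normr_ge0.
- by apply: (sec (fun z => (g3 m z)%:E)); apply/measurable_EFinP.
- exact: sec.
- move=> s _; apply: (@le_trans _ _ (g1 m (s, w) + g3 m (s, w))%:E); last by rewrite /G leeDl.
  by rewrite lee_fin lerDr.
- by apply: sec; exact: measurable_jump_diff.
- exact: sec.
- by move=> s _; rewrite leeDr.
Qed.

End grid_energy.

(** * Error of the scheme along a solution *)

Section assembly.
Context (R : realType) (n : nat) d (T : measurableType d) (P : probability T R).
Context dU (U : measurableType dU).
Variable nu : {sigma_finite_measure set U -> \bar R}.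
Variables (b : 'cV[R]_n -> 'cV[R]_n) (sigma : 'cV[R]_n -> 'M[R]_n) (c : 'cV[R]_n -> U -> 'cV[R]_n).
Hypothesis c_meas : measurable_fun [set: borel 'cV[R]_n * U]
  (fun z => (c z.1 z.2 : borel 'cV[R]_n)).
Hypotheses (b_cont : continuous b) (sigma_cont : continuous sigma).
Hypothesis c_cont : forall u, continuous (c ^~ u).
Variables (F : R -> set (set T)) (W : R -> T -> 'cV[R]_n).
Variable N : T -> {measure set (measurableTypeR R * U) -> \bar R}.
Hypothesis drv : driven P nu F W N.
Variable X : R -> T -> 'cV[R]_n.
Hypothesis mX : forall s, 0 <= s -> measurable_fun setT (X s : T -> borel 'cV[R]_n).
Hypothesis GX : forall s i, 0 <= s -> Gm (F s) (fun w => X s w i ord0).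
Hypothesis cX : forall w, path_cadlag (X ^~ w).
Variable t : R.
Hypothesis t0 : 0 < t.
Variables (s : scheme R n U) (K q : R) (l1 : Prop).
Hypothesis ok : scheme_ok nu b sigma c s K q l1.
Hypotheses (q0 : 0 <= q) (q1 : q <= 1).
Variable i : 'I_n.
Variables (HW : 'I_n -> seq (step R T)) (HN : seq (step R T * set U)).
Hypothesis okW : forall l h, List.In h (HW l) -> step_ok F h.
Hypothesis okN : forall h, List.In h HN -> jump_step_ok nu F h.
Variable m : nat.
Hypothesis m0 : (0 < m)%N.
Notation g := (gpt t m).
Notation J := ('I_(size HN) + sc_J s)%type.
Notation E := ('I_n + J)%type.

Let It : set (measurableTypeR R) := `]0, t]%classic.
Let mIt : measurable It. Proof. exact: measurable_itv. Qed.

(** Cells of the approximating simple integrand together with those of the scheme. They may overlap,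
    hence the full Gram matrix in [quad_integral]. *)
Let A (j : J) : set U := match j with inl k => (tnth (in_tuple HN) k).2 | inr j => sc_A j end.

Let mA j : measurable (A j).
Proof. by case: j => [k|j]; [have [] := okN (In_tnth k)|exact: (so_mA ok)]. Qed.
Let nA j : (nu (A j) < +oo)%E.
Proof. by case: j => [k|j]; [have [] := okN (In_tnth k)|exact: (so_nA ok)]. Qed.

Let piX k w := sc_pi s (X (g k) w).

(** The difference between the simple integrands and the coefficients of the scheme, on a common
    index set, so that a single discrete integral carries the whole noise error. *)
Let Phi (e : E) u w : R := match e with
  | inl l => \sum_(h <- HW l) step_val h u w - gval t m (fun k => sigma (piX k w) i l) u
  | inr (inl k) => step_val (tnth (in_tuple HN) k).1 u w
  | inr (inr j) => - gval t m (fun k => sc_a j (piX k w) i ord0) u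
  end.

Let zeta (x y : R) (e : E) w : R := match e with inl l => dW W x y l w | inr j => dN nu N x y (A j) w end.

Let pts : seq R := [seq g k | k <- iota 0 m.+1] ++
  flatten [seq flatten [seq [:: lo h; hi h] | h <- HW l] | l <- enum 'I_n] ++
  flatten [seq [:: lo h.1; hi h.1] | h <- HN].

Let in_flat (S : Type) (L : seq S) (f : S -> seq R) h (a : R) : List.In h L -> a \in f h ->
  a \in flatten [seq f h | h <- L].
Proof.
elim: L => //= h' L ih [->|hL] af; rewrite mem_cat; first by rewrite af.
by rewrite ih ?orbT.
Qed.

Let ptsg k : (k <= m)%N -> g k \in pts.
Proof. by move=> km; rewrite mem_cat map_f// mem_iota ltnS. Qed.

Let ptsW l h : List.In h (HW l) -> (lo h \in pts) /\ (hi h \in pts).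
Proof.
move=> hI; rewrite /pts !mem_cat.
have inW a : a \in [:: lo h; hi h] ->
    a \in flatten [seq flatten [seq [:: lo h; hi h] | h <- HW l] | l <- enum 'I_n].
  move=> ah; apply/flattenP; exists (flatten [seq [:: lo h; hi h] | h <- HW l]).
    by apply/mapP; exists l => //; rewrite mem_enum.
  by apply: (in_flat hI).
by split; apply/orP; right; apply/orP; left; apply: inW; rewrite !inE eqxx ?orbT.
Qed.

Let ptsN h : List.In h HN -> (lo h.1 \in pts) /\ (hi h.1 \in pts).
Proof.
move=> hI; rewrite /pts !mem_cat.
by split; apply/orP; right; apply/orP; right; apply: (in_flat hI (f := fun h => [:: lo h.1; hi h.1]));
  rewrite !inE eqxx ?orbT.
Qed.

Variables (r : nat -> R) (M : nat).
Hypotheses (r0 : r 0%N = 0) (rS : forall i, r i <= r i.+1) (rt : forall i, 0 <= r i <= t).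
Hypothesis sf : forall a, a \in pts -> 0 <= a -> straddle_free r a.
Hypothesis hit : forall a, a \in pts -> 0 <= a <= t -> exists2 k, (k <= M)%N & r k = a.

Let rge0 k : 0 <= r k. Proof. by case/andP: (rt k). Qed.
Let rle k l : (k <= l)%N -> r k <= r l.
Proof. by move=> /subnK <-; elim: (l - k)%N => // j ih; rewrite addSn; exact: le_trans (rS _). Qed.

(** A cut-off known at time [a]: only the grid points already passed are tested. It keeps the
    sampled solution in the ball, where the bounds of [scheme_ok] hold. *)
Let chi_at k a w : bool := (g k <= a) ==> (euc (X (g k) w) <= K).
Let chi a w : bool := [forall k : 'I_m, chi_at k a w].

Let Fr k : sigma_algebra setT (F (r k)) := filt_algebra (dr_F drv) (rge0 k).

Let GXg k (j : nat) l : g j <= r k -> Gm (F (r k)) (fun w => X (g j) w l ord0).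
Proof. by move=> gr; apply: (Gm_mono (dr_F drv) (gpt_ge0 t0 m j) gr); apply: GX; exact: gpt_ge0. Qed.

Let Gb_all (I : finType) (G : set (set T)) (p : I -> T -> bool) : sigma_algebra setT G ->
  (forall x, Gb G (p x)) -> Gb G (fun w => [forall x, p x w]).
Proof.
move=> sG hp.
have -> : (fun w => [forall x, p x w]) = (fun w => all (fun x => p x w) (enum I)).
  apply/funext => w; apply/forallP/allP => [h x _|h x]; first exact: h.
  by apply: h; rewrite mem_enum.
elim: (enum I) => [|x L ih] /=; last exact: (Gb_and sG).
rewrite /Gb (_ : [set w | _] = setT); last by apply/seteqP; split.
have [g0 gC _] := sG; have := gC _ g0; by rewrite setD0.
Qed.

Let Gchi k : Gb (F (r k)) (chi (r k)).
Proof.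
apply: (Gb_all (Fr k)) => j; rewrite /chi_at; case: (leP (g j) (r k)) => gr /=.
  apply: Gb_ler; have := cmeas_euc (0 : 'cV[R]_n) (Fr k) (fun l => GXg l gr).
  by rewrite (_ : (fun w => _) = fun w => euc (X (g j) w))//; apply/funext => w; rewrite subr0.
rewrite /Gb (_ : [set w | _] = setT); last by apply/seteqP; split.
have [g0 gC _] := Fr k; have := gC _ g0; by rewrite setD0.
Qed.

Let ind_next l u k : straddle_free r l -> straddle_free r u -> forall x, r k < x -> x <= r k.+1 ->
  \1_(`]l, u]%classic) (r k.+1) = \1_(`]l, u]%classic) x :> R.
Proof.
move=> sl su x kx xk; rewrite !indicE; congr (nat_of_bool _)%:R.
apply/idP/idP; rewrite !inE /= !in_itv /= => /andP[h1 h2]; apply/andP; split.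
- by case: (sl k) => h; [exact: le_lt_trans kx|have := lt_le_trans h1 h; rewrite ltxx].
- exact: le_trans h2.
- exact: lt_le_trans xk.
- by case: (su k) => h //; have := lt_le_trans (le_lt_trans h kx) h2; rewrite ltxx.
Qed.

Let sfg k : (k <= m)%N -> straddle_free r (g k).
Proof. by move=> km; apply: sf; [exact: ptsg|exact: gpt_ge0]. Qed.

Let gval_next phi k x : r k < x -> x <= r k.+1 -> gval t m phi (r k.+1) = gval t m phi x.
Proof.
move=> kx xk; apply: eq_bigr => j _; congr (_ * _).
by apply: ind_next kx xk; apply: sfg; [exact: ltnW|].
Qed.

Let Phi_next e k x w : r k < x -> x <= r k.+1 -> Phi e (r k.+1) w = Phi e x w.
Proof.
move=> kx xk.
have sv h : step_ok F h -> (lo h \in pts) /\ (hi h \in pts) ->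
    step_val h (r k.+1) w = step_val h x w.
  move=> [lo0 lohi _ _] [p1 p2]; congr (_ * _); apply: ind_next kx xk; apply: sf => //.
  exact: le_trans lohi.
case: e => [l|[j|j]] /=; last by rewrite (gval_next _ kx xk).
- rewrite (gval_next _ kx xk); congr (_ - _); apply: eq_bigr_In => h hI.
  by apply: sv; [exact: okW hI|exact: ptsW hI].
- by have [hok _ _] := okN (In_tnth j); apply: sv => //; exact: ptsN (In_tnth j).
Qed.

Let Gstep h k : step_ok F h -> lo h \in pts -> Gm (F (r k)) (fun w => step_val h (r k.+1) w).
Proof.
move=> hok ph; have [lo0 _ _ _] := hok.
have [lr|rl] := sf ph lo0 k.
  apply: (GmM (Fr k)); last exact: (Gm_cst (Fr k)).
  exact: (Gm_mono (dr_F drv) lo0 lr (Gm_coef hok)).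
rewrite (_ : (fun w => _) = fun=> 0); first exact: (Gm_cst (Fr k)).
apply/funext => w; rewrite /step_val indicE memNset ?mulr0//= in_itv /= => /andP[h1 _].
by have := lt_le_trans h1 rl; rewrite ltxx.
Qed.

Let Ggval (phi : 'cV[R]_n -> R) k :
  Gm (F (r k)) (fun w => gval t m (fun j => phi (piX j w)) (r k.+1)).
Proof.
apply: (Gm_sum (Fr k)) => j.
have [gr|rg] := sfg (ltnW (ltn_ord j)) k.
  apply: (GmM (Fr k)); first exact: (Gm_cst (Fr k)).
  exact: (so_meas ok phi (Fr k) (fun l => GXg l gr)).
rewrite (_ : (fun w => _) = fun=> 0); first exact: (Gm_cst (Fr k)).
apply/funext => w; rewrite indicE memNset ?mul0r//= /cell /= in_itv /= => /andP[h1 _].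
by have := lt_le_trans h1 rg; rewrite ltxx.
Qed.

Let GPhi k e : Gm (F (r k)) (fun w => Phi e (r k.+1) w).
Proof.
case: e => [l|[j|j]] /=.
- apply: (GmB (Fr k)); last exact: (Ggval (fun x => sigma x i l)).
  apply: (Gm_sum_In (Fr k)) => h hI; apply: Gstep; first exact: okW hI.
  by have [] := ptsW hI.
- have [hok _ _] := okN (In_tnth j); apply: Gstep => //.
  by have [] := ptsN (In_tnth j).
- rewrite (_ : (fun w => _) = fun w => 0 - gval t m (fun k => sc_a j (piX k w) i ord0) (r k.+1)); last first.
    by apply/funext => w; rewrite sub0r.
  by apply: (GmB (Fr k)); [exact: (Gm_cst (Fr k))|exact: (Ggval (fun x => sc_a j x i ord0))].
Qed.

Let bstep h u : step_ok F h -> exists C : R, forall w, `|step_val h u w| <= C.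
Proof.
move=> [_ _ [C hC] _]; exists C => w; rewrite normrM -[leRHS]mulr1; apply: ler_pM => //.
by rewrite indicE; case: (_ \in _); rewrite ?normr1 ?normr0.
Qed.

Let bgval (phi : 'cV[R]_n -> R) u : exists C : R, forall w, `|gval t m (fun j => phi (piX j w)) u| <= C.
Proof.
have [C hC] := so_bdd ok phi; exists (\sum_(j < m) C) => w.
apply: le_trans (ler_norm_sum _ _ _) _; apply: ler_sum => j _.
rewrite normrM -[leRHS]mul1r; apply: ler_pM => //; last exact: hC.
by rewrite indicE; case: (_ \in _); rewrite ?normr1 ?normr0.
Qed.

Let bPhi u e : exists C : R, forall w, `|Phi e u w| <= C.
Proof.
case: e => [l|[j|j]] /=.
- have [C1 h1] : exists C : R, forall w, `|\sum_(h <- HW l) step_val h u w| <= C.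
    by apply: bdd_sum_In => h hI; apply: bstep; exact: okW hI.
  have [C2 h2] := bgval (fun x => sigma x i l) u.
  by exists (C1 + C2) => w; apply: le_trans (ler_normB _ _) _; apply: lerD.
- by have [hok _ _] := okN (In_tnth j); exact: bstep.
- by have [C hC] := bgval (fun x => sc_a j x i ord0) u; exists C => w; rewrite normrN.
Qed.

(** Steps and grid cells are open on the left, so the value at the right end [r k.+1] is the value
    on the whole cell; it is nevertheless known at time [r k] ([GPhi]), which makes [V]
    predictable. *)
Let V k (e : E) w : R := (chi (r k) w)%:R * Phi e (r k.+1) w.

Let GV k e : Gm (F (r k)) (V k e).
Proof. by apply: (GmM (Fr k)); [exact: (Gm_bool (Fr k) (Gchi k))|exact: GPhi]. Qed.

Let bV k e : exists C : R, forall w, `|V k e w| <= C.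
Proof.
have [C hC] := bPhi (r k.+1) e; exists C => w; rewrite /V.
by case: (chi _ _); rewrite ?mul1r ?mul0r ?normr0//; exact: le_trans (hC w).
Qed.

Let hz : discrete_noise P (fun k => F (r k)) M (noise_z nu W N r A) (noise_q nu r A).
Proof. exact: driven_noise drv rge0 rS mA nA. Qed.

Let zE k e w : noise_z nu W N r A k e w = zeta (r k) (r k.+1) e w.
Proof. by case: e. Qed.

Section pathwise.
Variable w : T.
Hypothesis finN : forall j, ~ (N w (`]0, t]%classic `*` A j) = +oo%E).

Let zeta_refl a e : zeta a a e w = 0.
Proof. by case: e => [l|j]; [exact: dW_refl|exact: dN_refl]. Qed.

Let zeta_cat a x y e : 0 <= a -> a <= x -> x <= y -> y <= t ->
  zeta a y e w = zeta a x e w + zeta x y e w.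
Proof.
move=> a0 ax xy yt; case: e => [l|j]; first exact: dW_cat.
have h := @dN_cat _ _ _ _ _ nu N a x y t (A j) w a0 ax xy yt (mA j) (nA j) (@finN j).
exact: h.
Qed.

Let tele l u k e : 0 <= l -> l <= u -> straddle_free r l -> straddle_free r u ->
  \sum_(j < k) \1_(`]l, u]%classic) (r j.+1) * zeta (r j) (r j.+1) e w =
  zeta (Num.min l (r k)) (Num.min u (r k)) e w.
Proof.
move=> l0 lu sl su.
apply/esym/(@telescope R (fun a a' => zeta a a' e w) r t l u k r0 rS rt l0 lu sl su).
  by move=> a; exact: zeta_refl.
by move=> a x y a0 ax xy yt; exact: zeta_cat.
Qed.

Let tele_step h k e : step_ok F h -> (lo h \in pts) /\ (hi h \in pts) ->
  \sum_(j < k) step_val h (r j.+1) w * zeta (r j) (r j.+1) e w =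
  coef h w * zeta (Num.min (lo h) (r k)) (Num.min (hi h) (r k)) e w.
Proof.
move=> [lo0 lohi _ _] [p1 p2].
rewrite -(tele k e lo0 lohi); [|exact: sf|by apply: sf => //; exact: le_trans lohi].
by rewrite mulr_sumr; apply: eq_bigr => j _; rewrite mulrA.
Qed.

Let tele_gval phi k kk e : (k <= m)%N -> r kk = g k ->
  \sum_(j < kk) gval t m phi (r j.+1) * zeta (r j) (r j.+1) e w =
  \sum_(j < k) phi j * zeta (g j) (g j.+1) e w.
Proof.
move=> km rk.
have -> : \sum_(j < kk) gval t m phi (r j.+1) * zeta (r j) (r j.+1) e w =
    \sum_(j' < m) phi j' * zeta (Num.min (g j') (g k)) (Num.min (g j'.+1) (g k)) e w.
  rewrite (eq_bigr (fun j : 'I_kk => \sum_(j' < m) \1_(cell t m j') (r j.+1) * phi j' * zeta (r j) (r j.+1) e w)); last first.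
    by move=> j _; rewrite /gval mulr_suml.
  rewrite exchange_big /=; apply: eq_bigr => j' _.
  rewrite -rk -(@tele (g j') (g j'.+1) kk e (gpt_ge0 t0 m j') (gpt_le t0 m (leqnSn j'))).
  - by rewrite mulr_sumr; apply: eq_bigr => j _; rewrite mulrCA mulrA.
  - by apply: sfg; exact: ltnW.
  - exact: sfg.
rewrite (bigID (fun j' : 'I_m => (j' < k)%N))/= [X in _ + X]big1 ?addr0; last first.
  move=> j'; rewrite -leqNgt => kj.
  by rewrite !min_r ?gpt_le// ?zeta_refl ?mulr0//; exact: leqW.
rewrite (big_ord_widen_cond m xpredT (fun j => phi j * zeta (g j) (g j.+1) e w) km).
by apply: eq_bigr => j' /= jk; rewrite !min_l ?gpt_le//; exact: ltnW.
Qed.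

(** Both sides are sums over cells of the common partition, regrouped by [telescope]; the cut-off in
    [V] is inactive while the solution stays in the ball at the grid points before [k]. *)
Lemma dsum_eq k kk : (k <= m)%N -> r kk = g k ->
  (forall j, (j < k)%N -> euc (X (g j) w) <= K) ->
  dsum (noise_z nu W N r A) V kk w =
  \sum_(l < n) simple_int_bm (fun s w => W s w l ord0) (HW l) (g k) w +
  simple_int_jump nu N HN (g k) w -
  \sum_(j < k) \sum_(e : ('I_n + sc_J s)%type) sc_coef sigma (X (g j) w) e i *
     noise_z nu W N g (@sc_A _ _ _ _ s) j e w.
Proof.
move=> km rk hK.
have -> : dsum (noise_z nu W N r A) V kk w =
    \sum_e \sum_(j < kk) Phi e (r j.+1) w * zeta (r j) (r j.+1) e w.
  rewrite exchange_big/=; apply: eq_bigr => j _; apply: eq_bigr => e _; rewrite zE /V.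
  case: (ltP (r j) (g k)) => jk.
    rewrite (_ : chi (r j) w) ?mul1r//; apply/forallP => l; apply/implyP => gl.
    apply: hK; rewrite ltnNge; apply/negP => kl.
    by have := lt_le_trans (le_lt_trans gl jk) (gpt_le t0 m kl); rewrite ltxx.
  (* Since [r kk = g k], an index [j < kk] with [r j >= g k] belongs to a cell of length zero. *)
  have -> : r j.+1 = r j by apply/eqP; rewrite eq_le rS andbT (le_trans _ jk)// -rk rle.
  by rewrite zeta_refl !mulr0.
rewrite big_sumType/= big_sumType/= addrA.
have e1 : \sum_(l < n) \sum_(j < kk) Phi (inl l) (r j.+1) w * zeta (r j) (r j.+1) (inl l) w =
   \sum_(l < n) simple_int_bm (fun s w => W s w l ord0) (HW l) (g k) w -
   \sum_(l < n) \sum_(j < k) sigma (piX j w) i l * zeta (g j) (g j.+1) (inl l) w.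
  rewrite -sumrB; apply: eq_bigr => l _.
  rewrite -(tele_gval (fun k => sigma (piX k w) i l) (inl l) km rk).
  rewrite (eq_bigr (fun j : 'I_kk => \sum_(h <- HW l) step_val h (r j.+1) w * zeta (r j) (r j.+1) (inl l) w -
      gval t m (fun k => sigma (piX k w) i l) (r j.+1) * zeta (r j) (r j.+1) (inl l) w)); last first.
    by move=> j _; rewrite mulrBl mulr_suml.
  rewrite sumrB exchange_big/=; congr (_ - _); apply: eq_bigr_In => h hI.
  by rewrite (tele_step kk (inl l) (okW hI) (ptsW hI)) rk.
have e2 : \sum_(p < size HN) \sum_(j < kk) Phi (inr (inl p)) (r j.+1) w * zeta (r j) (r j.+1) (inr (inl p)) w =
    simple_int_jump nu N HN (g k) w.
  rewrite /simple_int_jump [RHS]big_tnth; apply: eq_bigr => p _.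
  have [hok _ _] := okN (In_tnth p).
  by rewrite (tele_step kk (inr (inl p)) hok (ptsN (In_tnth p))) rk.
have e3 : \sum_(p : sc_J s) \sum_(j < kk) Phi (inr (inr p)) (r j.+1) w * zeta (r j) (r j.+1) (inr (inr p)) w =
    - \sum_(p : sc_J s) \sum_(j < k) sc_a p (piX j w) i ord0 * zeta (g j) (g j.+1) (inr (inr p)) w.
  rewrite -sumrN; apply: eq_bigr => p _.
  rewrite -(tele_gval (fun k => sc_a p (piX k w) i ord0) (inr (inr p)) km rk) -sumrN.
  by apply: eq_bigr => j _; rewrite mulNr.
have e4 : \sum_(j < k) \sum_(e : ('I_n + sc_J s)%type) sc_coef sigma (X (g j) w) e i *
     noise_z nu W N g (@sc_A _ _ _ _ s) j e w =
   \sum_(l < n) \sum_(j < k) sigma (piX j w) i l * zeta (g j) (g j.+1) (inl l) w +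
   \sum_(p : sc_J s) \sum_(j < k) sc_a p (piX j w) i ord0 * zeta (g j) (g j.+1) (inr (inr p)) w.
  rewrite [X in _ = X + _]exchange_big/= [X in _ = _ + X]exchange_big/= -big_split/=.
  by apply: eq_bigr => j _; rewrite big_sumType.
rewrite e1 e2 e3 e4; move: (\sum_(l < n) simple_int_bm _ _ _ _) (simple_int_jump _ _ _ _ _).
move: (\sum_(l < n) _) (\sum_(p : sc_J s) _) => x1 x2 x3 x4; ring.
Qed.

End pathwise.

Let I3 (f1 f2 f3 : U -> R) : measurable_fun setT f1 -> measurable_fun setT f2 -> measurable_fun setT f3 ->
  (\int[nu]_u ((f1 u + f2 u + f3 u) ^+ 2)%:E <=
   3%:E * (\int[nu]_u (f1 u ^+ 2)%:E + \int[nu]_u (f2 u ^+ 2)%:E + \int[nu]_u (f3 u ^+ 2)%:E))%E.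
Proof.
move=> m1 m2 m3.
have mX2 (f : U -> R) : measurable_fun setT f -> measurable_fun setT (fun u => (f u ^+ 2)%:E).
  by move=> mf; apply/measurable_EFinP; exact: measurable_funX.
have p0 (f : U -> R) u : (0 <= (f u ^+ 2)%:E)%E by rewrite lee_fin sqr_ge0.
rewrite -ge0_integralD//; [|exact: mX2..].
rewrite -ge0_integralD//; [|by move=> u _; rewrite adde_ge0|by apply: emeasurable_funD; exact: mX2|exact: mX2].
rewrite -ge0_integralZl//; last 2 first.
- by apply: emeasurable_funD; [apply: emeasurable_funD; exact: mX2|exact: mX2].
- by move=> u _; rewrite !adde_ge0.
apply: ge0_le_integral => //.
- by move=> u _; rewrite lee_fin sqr_ge0.
- by apply: mX2; apply: measurable_funD => //; exact: measurable_funD.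
- apply: measurable_funeM; apply: emeasurable_funD; [apply: emeasurable_funD; exact: mX2|exact: mX2].
move=> u _; rewrite -!EFinD -EFinM lee_fin.
have := sqr_ge0 (f1 u - f2 u); have := sqr_ge0 (f2 u - f3 u); have := sqr_ge0 (f1 u - f3 u).
by move: (f1 u) (f2 u) (f3 u) => x y z; rewrite !expr2; nra.
Qed.

Let A1 x w := \sum_(l < n) (\sum_(h <- HW l) step_val h x w - sigma (X x w) i l) ^+ 2.
Let B1 x w := \sum_(l < n) (sigma (X x w) i l - gval t m (fun k => sigma (X (g k) w) i l) x) ^+ 2.
Let A2 x w := (\int[nu]_u ((jump_val HN x u w - c (left_lim (X ^~ w) x) u i ord0) ^+ 2)%:E)%E.
Let B2 x w := (\int[nu]_u ((c (left_lim (X ^~ w) x) u i ord0 -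
   gval t m (fun k => c (X (g k) w) u i ord0) x) ^+ 2)%:E)%E.
Let Gt x w := ((3 * (A1 x w + B1 x w) + 15 * q)%:E + 3%:E * (A2 x w + B2 x w))%E.

Let quadE (v : E -> R) :
  (\sum_e \sum_e' v e * v e' * noise_q0 nu A e e')%:E =
  ((\sum_(l < n) v (inl l) ^+ 2)%R%:E + \int[nu]_u ((\sum_(j : J) v (inr j) * \1_(A j) u) ^+ 2)%:E)%E.
Proof.
rewrite (quad_integral (fun j => v (inr j)) mA nA) -EFinD; congr EFin.
rewrite [LHS]big_sumType/=; congr (_ + _).
  apply: eq_bigr => l _; rewrite big_sumType/= [X in _ + X]big1 ?addr0; last by move=> j _; rewrite mulr0.
  rewrite (bigD1 l)//= eqxx big1 ?addr0; first by rewrite mulr1 expr2.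
  by move=> l' ll; rewrite eq_sym (negbTE ll) mulr0.
by apply: eq_bigr => j _; rewrite big_sumType/= [X in X + _]big1 ?add0r// => l _; rewrite mulr0.
Qed.

(** Three errors: simple integrand against the coefficient at time [x] ([A1], [A2]), this against
    its grid value ([B1], [B2]), the grid value against the scheme. The square of a sum of three
    costs a factor [3]; the last error gives [3 q] for [sigma] and [3 (4 q)] for [c], whose
    projection and step approximation are combined by Young's inequality. *)
Let cell_energy x w k : (k < m)%N -> cell t m k x -> euc (X (g k) w) <= K ->
  ((\sum_e \sum_e' Phi e x w * Phi e' x w * noise_q0 nu A e e')%:E <= Gt x w)%E.
Proof.
move=> km kx hK.
have gk phi : gval t m phi x = phi k := gval_cell t0 phi km kx.
rewrite (quadE (fun e => Phi e x w)).
have partW : \sum_(l < n) Phi (inl l) x w ^+ 2 <= 3 * (A1 x w + B1 x w) + 3 * q.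
  have q2 : \sum_(l < n) (sigma (X (g k) w) i l - sigma (piX k w) i l) ^+ 2 <= q.
    have h1 := so_s ok hK; rewrite eucB in h1.
    apply: (@le_trans _ _ (euc (sigma (X (g k) w) - sigma (piX k w)) ^+ 2)).
      rewrite euc_sqr [leRHS](bigD1 i)//= -[leLHS]addr0; apply: lerD.
        by apply: ler_sum => l _; rewrite !mxE.
      by apply: sumr_ge0 => j _; apply: sumr_ge0 => l _; exact: sqr_ge0.
    (* [q <= 1] replaces the squared error [q^2] by [q]. *)
    rewrite expr2; apply: le_trans (_ : q * 1 <= _); last by rewrite mulr1.
    by apply: ler_pM => //; [exact: euc_ge0|exact: euc_ge0|exact: le_trans h1 q1].
  apply: le_trans (_ : _ <= 3 * (A1 x w + B1 x w) +
     3 * \sum_(l < n) (sigma (X (g k) w) i l - sigma (piX k w) i l) ^+ 2) _; last by rewrite lerD2l ler_pM2l.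
  rewrite /A1 /B1 -big_split/= !mulr_sumr -big_split/=; apply: ler_sum => l _; rewrite !gk.
  move: (\sum_(h <- HW l) _) (sigma (X x w) i l) (sigma (X (g k) w) i l) (sigma (piX k w) i l) => a0 a1 a2 a3.
  have := sqr_ge0 ((a0 - a1) - (a1 - a2)); have := sqr_ge0 ((a1 - a2) - (a2 - a3)).
  have := sqr_ge0 ((a0 - a1) - (a2 - a3)); rewrite !expr2; nra.
have mjv : measurable_fun setT (fun u => jump_val HN x u w).
  apply: measurable_sum_In => h hI; have [_ mh _] := okN hI.
  by apply: measurable_funM => //; exact: measurable_indic.
have mc y : measurable_fun setT (fun u => c y u i ord0) := vmeas_c c_meas y i.
have msc : measurable_fun setT (fun u => sc_fun s (piX k w) u i ord0).
  have vs : vmeas (sc_fun s (piX k w)) by apply: vmeas_step; exact: so_mA ok.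
  exact: vs.
have partN : (\int[nu]_u ((\sum_(j : J) Phi (inr j) x w * \1_(A j) u) ^+ 2)%:E <=
    3%:E * (A2 x w + B2 x w) + (12 * q)%:E)%E.
  have e1 u : \sum_(j : J) Phi (inr j) x w * \1_(A j) u =
     (jump_val HN x u w - c (left_lim (X ^~ w) x) u i ord0) +
     (c (left_lim (X ^~ w) x) u i ord0 - gval t m (fun k => c (X (g k) w) u i ord0) x) +
     (c (X (g k) w) u i ord0 - sc_fun s (piX k w) u i ord0).
    rewrite big_sumType/= gk.
    have -> : \sum_(p < size HN) step_val (tnth (in_tuple HN) p).1 x w * \1_((tnth (in_tuple HN) p).2) u = jump_val HN x u w.
      by rewrite /jump_val [RHS]big_tnth.
    have -> : \sum_(j : sc_J s) - gval t m (fun k => sc_a j (piX k w) i ord0) x * \1_(sc_A j) u =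
        - sc_fun s (piX k w) u i ord0.
      by rewrite /sc_fun summxE -sumrN; apply: eq_bigr => j _; rewrite gk mxE mulNr mulrC.
    by ring.
  under eq_integral do rewrite e1.
  apply: le_trans (I3 (f1 := fun u => jump_val HN x u w - c (left_lim (X ^~ w) x) u i ord0)
    (f2 := fun u => c (left_lim (X ^~ w) x) u i ord0 - gval t m (fun k => c (X (g k) w) u i ord0) x)
    (f3 := fun u => c (X (g k) w) u i ord0 - sc_fun s (piX k w) u i ord0) _ _ _) _.
  - exact: measurable_funB.
  - apply: measurable_funB => //; rewrite (_ : (fun u => _) = fun u => c (X (g k) w) u i ord0)//.
    by apply/funext => u; rewrite gk.
  - exact: measurable_funB.
  have -> : (12 * q)%:E = (3%:E * (4 * q)%:E)%E by rewrite -EFinM; congr EFin; ring.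
  rewrite -/(A2 x w) -/(B2 x w).
  have pA : (0 <= A2 x w + B2 x w)%E.
    by apply: adde_ge0; apply: integral_ge0 => u _; rewrite lee_fin sqr_ge0.
  rewrite -ge0_muleDr//; last by rewrite lee_fin mulr_ge0.
  apply: lee_wpmul2l; first by rewrite lee_fin.
  apply: leeD2l.
  have vc y : vmeas (c y) by exact: vmeas_c.
  have vs : vmeas (sc_fun s (piX k w)) by apply: vmeas_step; exact: so_mA ok.
  apply: (@le_trans _ _ (I2 nu (fun u => (c (X (g k) w) u - c (piX k w) u) +
      (c (piX k w) u - sc_fun s (piX k w) u)))%R).
    apply: ge0_le_integral => //.
    - by move=> u _; rewrite lee_fin sqr_ge0.
    - by apply/measurable_EFinP; apply: measurable_funX; exact: measurable_funB.
    - by apply/measurable_EFinP; apply: vmeas_euc2; apply: vmeasD; exact: vmeasB.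
    move=> u _; rewrite lee_fin addrA subrK -[leLHS]real_normK ?num_real//.
    rewrite ler_sqr ?nnegrE ?euc_ge0//.
    rewrite (_ : _ - _ = (c (X (g k) w) u - sc_fun s (piX k w) u) i ord0); first exact: euc_entry.
    by rewrite !mxE.
  apply: le_trans (I2D nu ltr01 (vmeasB (vc _) (vc _)) (vmeasB (vc _) vs)) _.
  have h1 := so_c ok hK; have h2 := so_a ok hK.
  have -> : I2 nu (fun u => c (X (g k) w) u - c (piX k w) u) = I2 nu (fun u => c (piX k w) u - c (X (g k) w) u).
    by apply: eq_integral => u _; rewrite eucB.
  have -> : 4 * q = (1 + 1) * q + (1 + 1^-1) * q by rewrite invr1; ring.
  rewrite [leRHS]EFinD [((1 + 1) * q)%:E]EFinM [((1 + 1^-1) * q)%:E]EFinM.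
  by apply: leeD; [apply: lee_wpmul2l h1|apply: lee_wpmul2l h2]; rewrite lee_fin ?invr1.
apply: (@le_trans _ _ ((3 * (A1 x w + B1 x w) + 3 * q)%:E + (3%:E * (A2 x w + B2 x w) + (12 * q)%:E))%E).
  by apply: leeD => //; rewrite lee_fin.
rewrite [X in (_ + X)%E]addeC addeA -EFinD; apply: leeD => //.
by rewrite lee_fin; lra.
Qed.

(** Lenglart's inequality for [V]: on each partition cell the energy is the integral of a constant
    that [cell_energy] bounds by [Gt], so a pathwise bound on the integral of [Gt] suffices. *)
Lemma euler_error (de ep : R) : 0 <= de -> 0 < ep -> exists B,
  [/\ measurable B, (P B <= (de / ep ^+ 2)%:E)%E & forall w, ~ B w ->
   (forall j, ~ (N w (`]0, t]%classic `*` A j) = +oo%E)) ->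
   measurable_fun It (fun x => Gt x w) ->
   (\int[@lebesgue_measure R]_(x in `]0%R, t]) Gt x w <= de%:E)%E ->
   forall k, (k <= m)%N -> (forall j, (j < k)%N -> euc (X (g j) w) <= K) ->
   `|\sum_(l < n) simple_int_bm (fun s w => W s w l ord0) (HW l) (g k) w +
     simple_int_jump nu N HN (g k) w -
     \sum_(j < k) \sum_(e : ('I_n + sc_J s)%type) sc_coef sigma (X (g j) w) e i *
       noise_z nu W N g (@sc_A _ _ _ _ s) j e w| < ep].
Proof.
move=> de0 ep0; have [B [mB PB hB]] := lenglart hz GV bV de0 ep0.
exists B; split => // w nB finN mG hG k km hK.
have [kk kM rk] := hit (ptsg km) (introT andP (conj (gpt_ge0 t0 m k)
   (le_trans (gpt_le t0 m km) (eq_ind_r (fun x => x <= t) (lexx t) (gpt_last t m0))))).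
rewrite -(dsum_eq finN km rk hK); apply: hB => // l lM.
have G0 x : (0 <= Gt x w)%E.
  apply: adde_ge0.
    rewrite lee_fin; apply: addr_ge0; apply: mulr_ge0 => //; apply: addr_ge0;
    by apply: sumr_ge0 => l' _; exact: sqr_ge0.
  apply: mule_ge0 => //.
  by apply: adde_ge0; apply: integral_ge0 => u _; rewrite lee_fin sqr_ge0.
rewrite -lee_fin; apply: le_trans hG; apply: le_trans (cells_le l r0 rS rt mG G0).
rewrite /denergy -sumEFin; apply: lee_sum => j _.
have -> : \sum_e \sum_e' V j e w * V j e' w * noise_q nu r A j e e' =
    (r j.+1 - r j) * ((chi (r j) w)%:R * \sum_e \sum_e' Phi e (r j.+1) w * Phi e' (r j.+1) w * noise_q0 nu A e e').
  rewrite !mulr_sumr; apply: eq_bigr => e _; rewrite !mulr_sumr; apply: eq_bigr => e' _.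
  rewrite /V /noise_q; case: (chi (r j) w); rewrite ?mul1r ?mul0r ?mulr0//; ring.
have mcell : measurable (`]r j, r j.+1]%classic : set (measurableTypeR R)) by exact: measurable_itv.
case E : (chi (r j) w); last by rewrite mul0r mulr0; exact: integral_ge0.
rewrite mul1r; set Q := \sum_e _.
have [rj|rj] := ltP (r j) (r j.+1); last first.
  have -> : r j.+1 = r j by apply/eqP; rewrite eq_le rS rj.
  by rewrite subrr mul0r; exact: integral_ge0.
have sub : `]r j, r j.+1]%classic `<=` It.
  move=> x /=; rewrite /It /= !in_itv /= => /andP[h1 h2].
  by rewrite (le_lt_trans (rge0 j) h1) (le_trans h2)//; case/andP: (rt j.+1).
have le x : (`]r j, r j.+1]%classic : set R) x -> (Q%:E <= Gt x w)%E.
  move=> hx; have := sub x hx; rewrite /It /= in_itv /= => xt.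
  move: hx; rewrite /= in_itv /= => /andP[h1 h2].
  have [k' km' kx] := cell_exists m0 xt.
  have -> : Q = \sum_e \sum_e' Phi e x w * Phi e' x w * noise_q0 nu A e e'.
    by apply: eq_bigr => e _; apply: eq_bigr => e' _; rewrite !(Phi_next _ _ h1 h2).
  apply: (cell_energy km' kx).
  have /forallP/(_ (Ordinal km'))/implyP := E; apply => /=.
  have [//|h3] := sfg (ltnW km') j.
  move: kx; rewrite /cell /= in_itv /= => /andP[h4 _].
  by have := lt_le_trans h4 (le_trans h2 h3); rewrite ltxx.
have Q0 : (0 <= Q%:E)%E.
  rewrite /Q (quadE (fun e => Phi e (r j.+1) w)); apply: adde_ge0.
    by rewrite lee_fin; apply: sumr_ge0 => l' _; exact: sqr_ge0.
  by apply: integral_ge0 => u _; rewrite lee_fin sqr_ge0.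
have -> : ((r j.+1 - r j) * Q)%:E = (\int[@lebesgue_measure R]_(x in `]r j, r j.+1]) Q%:E)%E.
  rewrite integral_cst /=; last exact: measurable_itv.
  by rewrite lebesgue_measure_itv /= lte_fin rj -EFinB -EFinM mulrC.
apply: ge0_le_integral => //.
exact: (measurable_funS mIt sub mG).
Qed.

End assembly.

(** * Consistency of the scheme *)

Section whp.
Context (R : realType) d (T : measurableType d) (P : probability T R).

(* [Q] need not be an event. *)
Definition whp (e : R) (Q : T -> Prop) := exists B,
  [/\ measurable B, (P B <= e%:E)%E & forall w, ~ B w -> Q w].

Lemma whpS e (Q Q' : T -> Prop) : (forall w, Q w -> Q' w) -> whp e Q -> whp e Q'.
Proof. by move=> h [B [mB PB hB]]; exists B; split => // w /hB/h. Qed.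

Lemma whp_le e e' (Q : T -> Prop) : e <= e' -> whp e Q -> whp e' Q.
Proof. by move=> h [B [mB PB hB]]; exists B; split => //; apply: le_trans PB _; rewrite lee_fin. Qed.

Lemma whp_and e e' (Q Q' : T -> Prop) : whp e Q -> whp e' Q' -> whp (e + e') (fun w => Q w /\ Q' w).
Proof.
move=> [B [mB PB hB]] [B' [mB' PB' hB']]; exists (B `|` B'); split.
- exact: measurableU.
- by rewrite EFinD; apply: le_trans (measureU2 _ mB mB') _; exact: leeD.
- by move=> w /not_orP[/hB h /hB' h'].
Qed.

Lemma whp_true e (Q : T -> Prop) : 0 <= e -> (forall w, Q w) -> whp e Q.
Proof. by move=> e0 hQ; exists set0; split => //; rewrite measure0. Qed.

Lemma whp_null e (Q : T -> Prop) : 0 <= e -> {ae P, forall w, Q w} -> whp e Q.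
Proof.
move=> e0 [B [mB PB hB]]; exists B; split => //; first by rewrite PB.
by move=> w nB; apply: contrapT => nQ; apply: nB; exact: hB.
Qed.

Lemma whp_all (I : finType) e (Q : I -> T -> Prop) : 0 <= e -> (forall i, whp e (Q i)) ->
  whp (#|I|%:R * e) (fun w => forall i, Q i w).
Proof.
move=> e0 h.
suff : whp ((size (enum I))%:R * e) (fun w => forall i, i \in enum I -> Q i w).
  by rewrite -cardE; apply: whpS => w hw i; apply: hw; rewrite mem_enum.
elim: (enum I) => [|i L ih]; first by apply: whp_true; rewrite ?mul0r.
rewrite /= -natr1 mulrDl mul1r addrC; apply: whpS (whp_and (h i) ih) => w [hi hL] j.
by rewrite inE => /predU1P[->|/hL].
Qed.

End whp.

Section le_integral.
Context (R : realType) d (T : measurableType d) (mu : {measure set T -> \bar R}).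
Variable D : set T.
Hypothesis mD : measurable D.
Implicit Types f g : T -> \bar R.

(* Measurability is bundled so that bounds on integrals of sums compose. *)
Definition int_le f (a : R) := [/\ measurable_fun D f, forall x, (0 <= f x)%E &
  (\int[mu]_(x in D) f x <= a%:E)%E].

Lemma int_leD f g a a' : int_le f a -> int_le g a' -> int_le (fun x => f x + g x)%E (a + a').
Proof.
move=> [mf f0 hf] [mg g0 hg]; split; first exact: emeasurable_funD.
  by move=> x; exact: adde_ge0.
by rewrite ge0_integralD//; rewrite EFinD; exact: leeD.
Qed.

Lemma int_leZ f a (r : R) : 0 <= r -> int_le f a -> int_le (fun x => r%:E * f x)%E (r * a).
Proof.
move=> r0 [mf f0 hf]; split; first exact: measurable_funeM.
  by move=> x; apply: mule_ge0 => //; rewrite lee_fin.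
by rewrite ge0_integralZl//; rewrite EFinM; apply: lee_wpmul2l => //; rewrite lee_fin.
Qed.

Lemma int_le_sum (I : finType) (f : I -> T -> R) (a : R) :
  (forall i, int_le (fun x => (f i x)%:E) a) ->
  int_le (fun x => (\sum_i f i x)%:E) (#|I|%:R * a).
Proof.
move=> h; rewrite cardE -[X in int_le X](_ : (fun x => (\sum_(i <- enum I) f i x)%:E) = _); last first.
  by apply/funext => x; rewrite big_enum.
elim: (enum I) => [|i L ih].
  rewrite (_ : (fun x => _) = cst 0%E); last by apply/funext => x; rewrite big_nil.
  by rewrite mul0r; split => //; rewrite integral0.
rewrite /= -natr1 mulrDl mul1r addrC; under eq_fun do rewrite big_cons EFinD.
exact: int_leD.
Qed.

End le_integral.

Section consistency.
Context (R : realType) (n : nat) d (T : measurableType d) (P : probability T R).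
Context dU (U : measurableType dU).
Variable nu : {sigma_finite_measure set U -> \bar R}.
Variables (b : 'cV[R]_n -> 'cV[R]_n) (sigma : 'cV[R]_n -> 'M[R]_n) (c : 'cV[R]_n -> U -> 'cV[R]_n).
Hypothesis c_meas : measurable_fun [set: borel 'cV[R]_n * U]
  (fun z => (c z.1 z.2 : borel 'cV[R]_n)).
Hypotheses (b_cont : continuous b) (sigma_cont : continuous sigma).
Hypothesis c_cont : forall u, continuous (c ^~ u).
Hypothesis c_sq_fin : forall x, (I2 nu (c x) < +oo)%E.
Hypothesis c_sq_cont : continuous (fun x : 'cV[R]_n => fine (I2 nu (c x))).
Variables (F : R -> set (set T)) (W : R -> T -> 'cV[R]_n).
Variable N : T -> {measure set (measurableTypeR R * U) -> \bar R}.
Hypothesis drv : driven P nu F W N.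
Variable X : R -> T -> 'cV[R]_n.
Hypothesis mX : forall s, 0 <= s -> measurable_fun setT (X s : T -> borel 'cV[R]_n).
Hypothesis GX : forall s i, 0 <= s -> Gm (F s) (fun w => X s w i ord0).
Hypothesis cX : forall w, path_cadlag (X ^~ w).
Variable t : R.
Hypothesis t0 : 0 < t.
Variable x0 : 'cV[R]_n.
Hypothesis sde : solves_sde P nu b sigma c x0 F W N X.
Variable K : R.

Let It : set (measurableTypeR R) := `]0, t]%classic.
Let mIt : measurable It. Proof. exact: measurable_itv. Qed.

Definition sc_noise (s : scheme R n U) m k e w := noise_z nu W N (gpt t m) (@sc_A _ _ _ _ s) k e w.

Let sec w (f : measurableTypeR R * T -> \bar R) : measurable_fun (It `*` setT) f ->
  measurable_fun It (fun s => f (s, w)).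
Proof.
move=> mf; have h1 : measurable_fun It (fun s : measurableTypeR R => (s, w)).
  by apply: measurable_funTS; exact: measurable_fun_pair.
apply: (measurable_comp (F := It `*` setT) _ _ mf h1); first exact: measurableX.
by move=> _ [s st <-].
Qed.

(** Three shares of [eta / 3]: the discrete martingale of [euler_error], the approximation of the
    drift and stochastic integrals, and the projection inside the drift. *)
Lemma consistency_entry i (eta eps : R) : 0 < eta -> 0 < eps -> exists q0 m0, [/\ 0 < q0, q0 <= 1 &
  forall s q l1 m, scheme_ok nu b sigma c s K q l1 -> 0 <= q -> q <= q0 -> (m0 <= m)%N -> (0 < m)%N ->
  whp P eps (fun w => forall k, (k <= m)%N -> (forall j, (j < k)%N -> euc (X (gpt t m j) w) <= K) ->
    `|X (gpt t m k) w i ord0 -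
      sc_sum b sigma (s := s) (t / m%:R) (fun k e => sc_noise m k e w) (fun k => X (gpt t m k) w) x0 k i ord0| <= eta)].
Proof.
move=> eta0 eps0.
have sum4 (y z : R) : y <= z / 4 -> y + z / 4 + (z / 4 + z / 4) <= z by lra.
have sumde (x y z : R) : (3 * n%:R + 9) * x <= z / 2 -> y <= z / 30 ->
    3 * (n%:R * x + x) + 15 * y + 3 * (x + x) <= z by move: (n%:R) => p; lra.
have split_le (x a1 a2 a3 a4 a5 a6 a7 a8 y e r : R) : `|a1 - a2| <= e -> `|a2 - a3| <= r ->
    `|a4 - a5| <= n%:R * e -> `|a6 - a7| < e -> `|a4 + a6 - a8| < y / 3 -> r <= y / 3 ->
    n%:R * e + e + e <= y / 3 -> `|x + a1 + a5 + a7 - (x + a3 + a8)| <= y.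
  move: (n%:R * e) => ne.
  rewrite !ler_norml !ltr_norml => /andP[? ?] /andP[? ?] /andP[? ?] /andP[? ?] /andP[? ?] ? ?.
  by apply/andP; split; lra.
have [IW [IN [hIW hIN hX]]] := sde.
have n1 : 0 < n.+1%:R :> R by rewrite ltr0n.
(* [de / ep^2 = eps / 4] is the probability lost in Lenglart's inequality; the other quarters go to
   the Brownian integrals, the jump integral and the grid. *)
pose ep := eta / 3; pose de := eps / 4 * ep ^+ 2.
have ep0 : 0 < ep by rewrite divr_gt0.
have de0 : 0 < de by rewrite mulr_gt0 ?exprn_gt0// divr_gt0.
(* The first bound makes [n e1] for the Brownian integrals plus [e1] each for the jumps and the
   drift at most [eta / 3]; the second keeps the share [(3 n + 9) e1] of the energy below
   [de / 2]. *)
pose e1 := Num.min (eta / (3 * n.+2%:R)) (de / (2 * (3 * n%:R + 9))).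
have n9 : 0 < 3 * n%:R + 9 :> R by rewrite ltr_wpDl// mulr_ge0.
have e10 : 0 < e1 by rewrite lt_min !divr_gt0// mulr_gt0// ltr0n.
have e1a : n.+2%:R * e1 <= eta / 3.
  have h : e1 <= eta / (3 * n.+2%:R) by rewrite ge_min lexx.
  rewrite -ler_pdivlMl ?ltr0n//; apply: le_trans h _.
  by rewrite invfM mulrA [leRHS]mulrC.
have e1b : (3 * n%:R + 9) * e1 <= de / 2.
  have h : e1 <= de / (2 * (3 * n%:R + 9)) by rewrite ge_min lexx orbT.
  rewrite -ler_pdivlMl//; apply: le_trans h _.
  by rewrite invfM mulrA [leRHS]mulrC.
(* [de / (30 t)] bounds the share [15 q t] of the energy by [de / 2], and [eta / (3 t)] bounds the
   error [q t] of the projected drift. *)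
pose q0 := Num.min 1 (Num.min (de / (30 * t)) (eta / (3 * t))).
have hW l : exists Hs : seq (step R T), (forall h, List.In h Hs -> step_ok F h) /\
    whp P (eps / (4 * n.+1%:R)) (fun w =>
      (\int[@lebesgue_measure R]_(s in `]0%R, t])
         ((\sum_(h <- Hs) step_val h s w - sigma (X s w) i l) ^+ 2)%:E <= e1%:E)%E /\
      forall s, 0 <= s <= t ->
        `|simple_int_bm (fun s w => W s w l ord0) Hs s w - IW i l s w| < e1).
  apply: (ito_approx drv mX cX t0 (cont_entry (i := i) (j := l) sigma_cont) (hIW i l) e10).
  by rewrite divr_gt0// mulr_gt0.
have [HW hHW] := choice hW.
have eps4 : 0 < eps / 4 by rewrite divr_gt0.
have [HN [okN hHN]] := comp_approx drv c_meas c_cont mX cX t0 (hIN i) e10 eps4.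
have [BG [m0 [mBG PBG hBG]]] := grid_energy P c_meas b_cont sigma_cont c_cont c_sq_fin c_sq_cont
  mX cX t0 i e10 eps4.
exists q0, m0; split.
- by rewrite !lt_min ltr01 !divr_gt0// mulr_gt0.
- by rewrite ge_min lexx.
move=> s q l1 m ok q00 qq0 mm0 m1.
have [q1 qde qeta] : [/\ q <= 1, q * t <= de / 30 & q * t <= eta / 3].
  move: qq0; rewrite !le_min => /andP[-> /andP[h2 h3]]; split => //.
    by rewrite -ler_pdivlMr//; apply: le_trans h2 _; rewrite invfM mulrA.
  by rewrite -ler_pdivlMr//; apply: le_trans h3 _; rewrite invfM mulrA.
have okW l h : List.In h (HW l) -> step_ok F h := (hHW l).1 h.
have [rr [M [r0 rS rt rM [sf hit]]]] := partition_exists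
  ([seq gpt t m k | k <- iota 0 m.+1] ++
   flatten [seq flatten [seq [:: lo h; hi h] | h <- HW l] | l <- enum 'I_n] ++
   flatten [seq [:: lo h.1; hi h.1] | h <- HN]) (ltW t0).
have hE := euler_error c_meas drv GX t0 ok q00 q1 i okW okN m1 r0 rS rt sf hit (ltW de0) ep0.
have hA : whp P 0 (fun w => forall j : sc_J s, ~ (N w (`]0, t]%classic `*` sc_A j) = +oo%E)).
  rewrite -{1}(mulr0 #|sc_J s|%:R); apply: whp_all => // j.
  have [mE PE] := dN_finite (dr_N drv) (lexx 0) (ltW t0) (so_mA ok j) (so_nA ok j).
  eexists; split; [exact: mE|exact: (eq_ind_r (fun x => (x <= 0)%E) (lexx _) PE)|by []].
have hall := whp_and (whp_and (whp_all (ltW (divr_gt0 eps0 (mulr_gt0 _ n1))) (fun l => (hHW l).2)) hHN)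
   (whp_and (whp_and (ex_intro _ BG (And3 mBG PBG (fun w nB => hBG m w mm0 nB)) : whp P _ _) (hE : whp P _ _))
     (whp_and hA (whp_null (lexx 0) hX))).
apply: whp_le (whpS _ (hall _)) => //.
  rewrite card_ord.
  have -> : de / ep ^+ 2 = eps / 4 by rewrite /de mulfK// gt_eqF// exprn_gt0.
  rewrite addr0 addr0.
  apply: sum4; have -> : n%:R * (eps / (4 * n.+1%:R)) = eps / 4 * (n%:R / n.+1%:R) by field; rewrite gt_eqF.
  rewrite -[leRHS]mulr1; apply: ler_wpM2l; first exact: ltW.
  by rewrite ler_pdivrMr// mul1r ler_nat.
move=> w [[hw1 [finN hw2 hw3]] [[[g1 g3 g2] hw4] [finA hsol]]] k km hK.
have gk0 : 0 <= gpt t m k by exact: gpt_ge0.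
have gkt : gpt t m k <= t by rewrite -[leRHS](gpt_last t m1) gpt_le.
have gkt' : 0 <= gpt t m k <= t by rewrite gk0.
pose il f a := int_le (@lebesgue_measure R) It f a.
have iW : il (fun x => (\sum_(l < n) (\sum_(h <- HW l) step_val h x w - sigma (X x w) i l) ^+ 2)%:E) (n%:R * e1).
  rewrite /il -[X in X%:R * _](card_ord n); apply: int_le_sum => // l; split; last exact: (hw1 l).1.
    apply: (@sec w (fun z => ((\sum_(h <- HW l) step_val h z.1 z.2 - sigma (X z.1 z.2) i l) ^+ 2)%:E)).
    exact: (measurable_ito_error drv mX cX t0 (cont_entry (i := i) (j := l) sigma_cont) (okW l)).
  by move=> x; rewrite lee_fin sqr_ge0.
have iB : il (fun x => (\sum_(l < n) (sigma (X x w) i l - gval t m (fun k => sigma (X (gpt t m k) w) i l) x) ^+ 2)%:E) e1.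
  split; [|by move=> x; rewrite lee_fin; apply: sumr_ge0 => l _; exact: sqr_ge0|exact: g1].
  apply/measurable_EFinP; apply: measurable_sum => l; apply: measurable_funX; apply: measurable_funB.
    apply/measurable_EFinP; apply: (@sec w (fun z => (sigma (X z.1 z.2) i l)%:E)).
    by apply/measurable_EFinP; exact: (measurable_path mX cX t0 (cont_entry (i := i) (j := l) sigma_cont)).
  apply/measurable_EFinP; apply: (@sec w (fun z => (gval t m (fun k => sigma (X (gpt t m k) z.2) i l) z.1)%:E)).
  by apply/measurable_EFinP; exact: (measurable_grid mX t0 m (cont_entry (i := i) (j := l) sigma_cont)).
have iN : il (fun x => (\int[nu]_u ((jump_val HN x u w - c (left_lim (X ^~ w) x) u i ord0) ^+ 2)%:E)%E) e1.
  split; [|by move=> x; apply: integral_ge0 => u _; rewrite lee_fin sqr_ge0|exact: hw2].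
  exact: (@sec w (fun z => \int[nu]_u ((jump_val HN z.1 u z.2 - c (left_lim (X ^~ z.2) z.1) u i ord0) ^+ 2)%:E)%E
    (measurable_comp_error drv c_meas c_cont mX cX t0 i okN)).
have iC : il (fun x => (\int[nu]_u ((c (left_lim (X ^~ w) x) u i ord0 -
    gval t m (fun k => c (X (gpt t m k) w) u i ord0) x) ^+ 2)%:E)%E) e1.
  split; [|by move=> x; apply: integral_ge0 => u _; rewrite lee_fin sqr_ge0|exact: g2].
  exact: (@sec w (fun z => \int[nu]_u ((c (left_lim (X ^~ z.2) z.1) u i ord0 -
    gval t m (fun k => c (X (gpt t m k) z.2) u i ord0) z.1) ^+ 2)%:E)%E
    (measurable_jump_diff nu c_meas c_cont mX cX t0 i m)).
have iQ : il (fun=> (15 * q)%:E) (15 * q * t).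
  split; [exact: measurable_cst|by move=> x; rewrite lee_fin mulr_ge0|].
  by rewrite lebesgue_integral_cst.
have [mG _ hG] := int_leD mIt (int_leD mIt (int_leZ mIt (ler0n R 3) (int_leD mIt iW iB)) iQ)
  (int_leZ mIt (ler0n R 3) (int_leD mIt iN iC)).
have err : `|\sum_(l < n) simple_int_bm (fun s w => W s w l ord0) (HW l) (gpt t m k) w +
     simple_int_jump nu N HN (gpt t m k) w -
     \sum_(j < k) \sum_(e : ('I_n + sc_J s)%type) sc_coef sigma (X (gpt t m j) w) e i *
       noise_z nu W N (gpt t m) (@sc_A _ _ _ _ s) j e w| < ep.
  apply: hw4 km hK; first by case=> [p|p]; [exact: finN (In_tnth p)|exact: finA].
    by apply: eq_measurable_fun mG => x _; rewrite EFinD EFinM EFinD.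
  apply: (@le_trans _ _ ((3 * (n%:R * e1 + e1) + 15 * q * t + 3 * (e1 + e1))%:E)%E); last first.
    by rewrite lee_fin -mulrA; exact: sumde.
  by apply: le_trans hG; rewrite le_eqVlt; apply/orP; left; apply/eqP; apply: eq_integral => x _; rewrite EFinD EFinM EFinD.
rewrite (hsol _ i gk0).
set x := x0 i ord0.
have sE : forall k, sc_sum b sigma (s := s) (t / m%:R) (fun k e => sc_noise m k e w) (fun k => X (gpt t m k) w) x0 k i ord0 =
   x + \sum_(j < k) (t / m%:R) * b (sc_pi s (X (gpt t m j) w)) i ord0 +
   \sum_(j < k) \sum_(e : ('I_n + sc_J s)%type) sc_coef sigma (X (gpt t m j) w) e i *
       noise_z nu W N (gpt t m) (@sc_A _ _ _ _ s) j e w.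
  elim=> [|l ih]; first by rewrite /= !big_ord0 !addr0.
  by rewrite /= mxE ih mxE !big_ord_recr/= /sc_noise; ring.
rewrite sE.
have drift : `|\int[@lebesgue_measure R]_(s in `[0, gpt t m k]) b (X s w) i ord0 -
    \sum_(j < k) (t / m%:R) * b (X (gpt t m j) w) i ord0| <= e1.
  have [MX _ hMX] := path_bound cX t0 w.
  have [Mb _ hMb] := euc_ball_bound MX (cont_entry (i := i) (j := ord0) b_cont).
  apply: (@riemann_le _ t m k (fun s => b (X s w) i ord0) (fun j => b (X (gpt t m j) w) i ord0) Mb) => //.
    apply/measurable_EFinP; apply: (@sec w (fun z => (b (X z.1 z.2) i ord0)%:E)).
    by apply/measurable_EFinP; exact: (measurable_path mX cX t0 (cont_entry (i := i) (j := ord0) b_cont)).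
  by move=> u /(hMX u)[h _]; exact: hMb.
have quad : `|\sum_(j < k) (t / m%:R) * b (X (gpt t m j) w) i ord0 -
    \sum_(j < k) (t / m%:R) * b (sc_pi s (X (gpt t m j) w)) i ord0| <= q * t.
  rewrite -sumrB; apply: le_trans (ler_norm_sum _ _ _) _.
  have tm0 : 0 <= t / m%:R by apply: divr_ge0 => //; exact: ltW.
  apply: (@le_trans _ _ (\sum_(j < k) (t / m%:R) * q)).
    apply: ler_sum => j _; rewrite -mulrBr normrM ger0_norm//; apply: ler_wpM2l => //.
    rewrite distrC; apply: le_trans (so_b ok (hK j (ltn_ord j))).
    by apply: le_trans (euc_entry _ i ord0); rewrite !mxE.
  rewrite sumr_const card_ord -[leLHS]mulr_natl mulrA mulrC; apply: ler_wpM2l => //; exact: gkt.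
have ito : `|\sum_(l < n) simple_int_bm (fun s w => W s w l ord0) (HW l) (gpt t m k) w -
    \sum_(l < n) IW i l (gpt t m k) w| <= n%:R * e1.
  rewrite -sumrB; apply: le_trans (ler_norm_sum _ _ _) _.
  apply: (@le_trans _ _ (\sum_(l < n) e1)); last by rewrite sumr_const card_ord mulr_natl.
  by apply: ler_sum => l _; apply/ltW/(hw1 l).2.
have comp := hw3 _ gkt'.
have e1c : n%:R * e1 + e1 + e1 <= eta / 3 by move: e1a; rewrite -natr1 -natr1 !mulrDl mul1r.
exact: (split_le _ _ _ _ _ _ _ _ _ _ _ _ drift quad ito comp err qeta e1c).
Qed.

Lemma consistency (eta eps : R) : 0 < eta -> 0 < eps -> exists q0 m0, [/\ 0 < q0, q0 <= 1 &
  forall s q l1 m, scheme_ok nu b sigma c s K q l1 -> 0 <= q -> q <= q0 -> (m0 <= m)%N -> (0 < m)%N ->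
  whp P eps (fun w => forall k, (k <= m)%N -> (forall j, (j < k)%N -> euc (X (gpt t m j) w) <= K) ->
    euc (sc_sum b sigma (s := s) (t / m%:R) (fun k e => sc_noise m k e w)
      (fun k => X (gpt t m k) w) x0 k - X (gpt t m k) w) <= eta)].
Proof.
move=> eta0 eps0; have n1 : 0 < n.+1%:R :> R by rewrite ltr0n.
have [eta1 eps1] : 0 < eta / n.+1%:R /\ 0 < eps / n.+1%:R by rewrite !divr_gt0.
have [q0 hq0] := choice (fun i => consistency_entry i eta1 eps1).
have [m0 h] := choice hq0.
exists (\big[Num.min/1]_(i < n) q0 i), (\max_(i < n) m0 i)%N; split.
- by apply: (big_ind (fun y => 0 < y)) => //[x y x1 y1|i _]; [rewrite lt_min x1|case: (h i)].
- by apply: (big_ind (fun y => y <= 1)) => //[x y x1 y1|i _]; [rewrite ge_min x1|case: (h i)].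
move=> s q l1 m ok q00 qq mm m1.
have hi i : whp P (eps / n.+1%:R) (fun w => forall k, (k <= m)%N ->
    (forall j, (j < k)%N -> euc (X (gpt t m j) w) <= K) ->
    `|X (gpt t m k) w i ord0 - sc_sum b sigma (s := s) (t / m%:R) (fun k e => sc_noise m k e w)
      (fun k => X (gpt t m k) w) x0 k i ord0| <= eta / n.+1%:R).
  have [_ _ hi] := h i; apply: (hi s q l1 m) => //.
  - by apply: le_trans qq _; rewrite (bigD1 i)//= ge_min lexx.
  - exact: leq_trans (leq_bigmax i) mm.
apply: whp_le (whpS _ (whp_all (ltW eps1) hi)).
  rewrite card_ord mulrCA -[leRHS]mulr1; apply: ler_wpM2l; first exact: ltW.
  by rewrite ler_pdivrMr// mul1r ler_nat.
move=> w hw k km hK; apply: le_trans (euc_sum_le _) _.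
apply: (@le_trans _ _ (\sum_(i < n) eta / n.+1%:R)).
  apply: ler_sum => i _; rewrite big_ord1 mxE [X in _ + X]mxE.
  by have := hw i k km hK; rewrite distrC.
rewrite sumr_const card_ord -[leLHS]mulr_natl mulrCA -[leRHS]mulr1; apply: ler_wpM2l; first exact: ltW.
by rewrite ler_pdivrMr// mul1r ler_nat.
Qed.

End consistency.

(** * Existence of schemes *)

Lemma near_in (T : eqType) (P : T -> nat -> Prop) (L : seq T) :
  (forall y, \forall k \near \oo, P y k) -> \forall k \near \oo, forall y, y \in L -> P y k.
Proof.
move=> h; elim: L => [|x L ih]; first by exists 0%N.
by apply: filterS2 (h x) ih => k hx hL y; rewrite inE => /predU1P[->|/hL].
Qed.

(** * Quantisation of the jump coefficient *)

Section quantizer.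
Context (R : realType).
Implicit Types r : R.

(** As a sum of threshold indicators, the value is determined by finitely many comparisons; these
    become the boolean tags of the cells in [scheme_exists]. *)
Definition stairs (dl : R) N r : R := \sum_(m < N) dl * (m.+1%:R * dl <= r)%R%:R.
(** Rounding towards [0] to multiples of [1 / (k + 1)], cut at absolute value [k + 1]. This
    direction of rounding makes the error at most [|r|], which is the domination for the convergence
    in L1 and L2. *)
Definition quant k r : R := stairs k.+1%:R^-1 (k.+1 ^ 2)%N r - stairs k.+1%:R^-1 (k.+1 ^ 2)%N (- r).

Lemma stairs_bound dl N r : 0 <= dl -> 0 <= r ->
  [/\ 0 <= stairs dl N r, stairs dl N r <= r & Num.min (r - dl) (N%:R * dl) <= stairs dl N r <= N%:R * dl].
Proof.
move=> dl0 r0; rewrite /stairs; elim: N => [|N [h0 h1 /andP[h2 h3]]].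
  by rewrite big_ord0 mul0r ge_min !lexx orbT.
have eN : N.+1%:R * dl = N%:R * dl + dl by rewrite -natr1 mulrDl mul1r.
rewrite big_ord_recr/=; move: h2 h0 h1 h3; move: (\sum_(i < N) _) => S.
rewrite !ge_min eN; have [hc|hc] := leP (N%:R * dl + dl) r => h2 h0 h1 h3; rewrite ?mulr1 ?mulr0.
  have hS : N%:R * dl <= S by case/orP: h2 => // h; lra.
  by split; [lra|lra|apply/andP; split; [apply/orP; right; lra|lra]].
have hS : r - dl <= S by case/orP: h2 => // h; lra.
by split; [lra|lra|apply/andP; split; [apply/orP; left; lra|lra]].
Qed.

Lemma stairs_neg dl N r : 0 < dl -> r <= 0 -> stairs dl N r = 0.
Proof.
move=> dl0 r0; rewrite /stairs big1// => m _; rewrite leNgt (le_lt_trans r0) ?mulr0//.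
by rewrite mulr_gt0// ltr0n.
Qed.

Let dk k : 0 < k.+1%:R^-1 :> R. Proof. by rewrite invr_gt0 ltr0n. Qed.

Let NkE k : (k.+1 ^ 2)%N%:R * k.+1%:R^-1 = k.+1%:R :> R.
Proof. by rewrite natrX expr2 mulfK// pnatr_eq0. Qed.

Let quantN k r : quant k (- r) = - quant k r.
Proof. by rewrite /quant opprK opprB. Qed.

Let quant_pos k r : 0 <= r -> `|r - quant k r| <= r /\ (r <= k.+1%:R -> `|r - quant k r| <= k.+1%:R^-1).
Proof.
move=> r0; rewrite /quant [X in _ - (_ - X)](stairs_neg _ (dk k)) ?oppr_le0// subr0.
have [s0 s1 /andP[s2 s3]] := stairs_bound (k.+1 ^ 2)%N (ltW (dk k)) r0.
rewrite ger0_norm ?subr_ge0//; split; first by rewrite gerBl.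
move=> rk; move: s2; rewrite NkE ge_min => /orP[|h]; first by rewrite !lerBlDr addrC.
by rewrite (le_trans (_ : _ <= 0))// ?(ltW (dk k))// subr_le0 (le_trans rk).
Qed.

Lemma quant_bound k r : `|r - quant k r| <= `|r|.
Proof.
have [r0|/ltW r0] := leP 0 r; first by have [h _] := quant_pos k r0; rewrite (ger0_norm r0).
have r1 : 0 <= - r by rewrite oppr_ge0.
have [h _] := quant_pos k r1; rewrite -[leRHS]normrN (ger0_norm r1).
by move: h; rewrite quantN -opprD normrN.
Qed.

Lemma quant_near k r : `|r| <= k.+1%:R -> `|r - quant k r| <= k.+1%:R^-1.
Proof.
have [r0|/ltW r0] := leP 0 r; first by have [_ h] := quant_pos k r0; rewrite (ger0_norm r0).
have r1 : 0 <= - r by rewrite oppr_ge0.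
have [_ h] := quant_pos k r1; rewrite -normrN (ger0_norm r1) => /h.
by rewrite quantN -opprD normrN.
Qed.

Lemma quant_cvg r : quant k r @[k --> \oo] --> r.
Proof.
apply/cvgrPdist_lt => e e0; exists (Num.truncn (`|r| + e^-1)).+1 => // k /= hk.
have lk : `|r| + e^-1 < k.+1%:R.
  by apply: lt_le_trans (truncnS_gt _) _; rewrite ler_nat; exact: leqW.
have ei : 0 < e^-1 by rewrite invr_gt0.
apply: le_lt_trans (quant_near _) _; first by apply/ltW; apply: le_lt_trans lk; rewrite lerDl ltW.
rewrite -[ltRHS]invrK ltf_pV2 ?posrE ?ltr0n//; apply: le_lt_trans lk.
by rewrite lerDr.
Qed.

Lemma measurable_quant k : measurable_fun setT (quant k : measurableTypeR R -> measurableTypeR R).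
Proof.
have h (f : measurableTypeR R -> measurableTypeR R) : measurable_fun setT f ->
    measurable_fun setT (fun r => stairs k.+1%:R^-1 (k.+1 ^ 2)%N (f r)).
  move=> mf; apply: measurable_sum => m; apply: measurable_funM; first exact: measurable_cst.
  rewrite (_ : (fun r => _) = \1_(f @^-1` `[m.+1%:R * k.+1%:R^-1, +oo[)).
    apply: measurable_indic; rewrite -[X in measurable X]setTI; apply: mf => //; exact: measurable_itv.
  by apply/funext => r; rewrite indicE; congr (nat_of_bool _)%:R; apply/idP/idP; rewrite inE/= in_itv/= andbT.
apply: measurable_funB; first exact: (h id (@measurable_id _ _ _)).
apply: (h (fun r => - r)); exact: measurable_funN.
Qed.

End quantizer.

Section step_approximation.
Context (R : realType) (n : nat) dU (U : measurableType dU).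
Variable nu : {sigma_finite_measure set U -> \bar R}.
Variable V : nat -> set U.
Hypotheses (mV : forall k, measurable (V k)) (ndV : nondecreasing_seq V) (cV : \bigcup_k V k = setT).

(** The cut to [V k], which will have finite measure, is what gives cells of finite measure. *)
Definition trunc_quant k (v : U -> 'cV[R]_n) u : 'cV[R]_n := \1_(V k) u *: \col_i quant k (v u i ord0).

Variable v : U -> 'cV[R]_n.
Hypothesis mv : vmeas v.
Let err k u := v u - trunc_quant k v u.

Let errE k u i : err k u i ord0 = if u \in V k then v u i ord0 - quant k (v u i ord0) else v u i ord0.
Proof. by rewrite /err !mxE indicE; case: (_ \in _); rewrite ?mul1r// mul0r subr0. Qed.

Let err_le k u : euc (err k u) <= euc (v u).
Proof.
rewrite -ler_sqr ?nnegrE ?euc_ge0// !euc_sqr; apply: ler_sum => i _; rewrite !big_ord1 errE.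
case: (_ \in _) => //; rewrite -[leLHS]real_normK ?num_real// -[leRHS]real_normK ?num_real//.
by rewrite ler_sqr ?nnegrE//; exact: quant_bound.
Qed.

Let err_cvg u : euc (err k u) @[k --> \oo] --> (0 : R).
Proof.
have e0 i : `|err k u i ord0| @[k --> \oo] --> (0 : R).
  have h : `|v u i ord0 - quant k (v u i ord0)| @[k --> \oo] --> (0 : R).
    have := @quant_cvg R (v u i ord0) => /cvgrPdist_lt h; apply/cvgrPdist_lt => e e0.
    by apply: filterS (h e e0) => k hk; rewrite sub0r normrN normr_id.
  apply: cvg_trans h; apply: near_eq_cvg.
  have [k0 _ uk0] : (\bigcup_k V k) u by rewrite cV.
  exists k0 => // k /= kk; rewrite errE mem_set//.
  by have /subsetPset := ndV kk; exact.
have S0 : \sum_(i < n) `|err k u i ord0| @[k --> \oo] --> (0 : R).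
  have h := @cvgr_sum R nat \oo 'I_n (index_enum 'I_n) (fun i k => `|err k u i ord0|) (fun=> 0) _ e0.
  by rewrite big1_eq in h; exact: h.
apply: (squeeze_cvgr _ (cvg_cst 0) S0); apply: nearW => k; rewrite euc_ge0/=.
by apply: le_trans (euc_sum_le _) _; apply: ler_sum => i _; rewrite big_ord1.
Qed.

Let verr k : vmeas (err k).
Proof.
apply: vmeasB => // i; rewrite (_ : (fun u => _) = fun u => \1_(V k) u * quant k (v u i ord0)).
  apply: measurable_funM; first exact: measurable_indic.
  exact: (measurableT_comp (@measurable_quant R k) (mv i)).
by apply/funext => u; rewrite /trunc_quant !mxE.
Qed.

Let dominated0 (f : nat -> U -> R) (g : U -> R) (q : R) : (forall k, measurable_fun setT (f k)) ->
  measurable_fun setT g -> (forall k u, 0 <= f k u <= g u) ->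
  (\int[nu]_u (g u)%:E < +oo)%E -> (forall u, f k u @[k --> \oo] --> (0 : R)) -> 0 < q ->
  \forall k \near \oo, (\int[nu]_u (f k u)%:E <= q%:E)%E.
Proof.
move=> mf mg fg ig f0 q0.
have g0 u : 0 <= g u by have /andP[h1 h2] := fg 0%N u; exact: le_trans h2.
have mfE k : measurable_fun setT (fun u => (f k u)%:E) by exact/measurable_EFinP.
have := @dominated_convergence _ _ R nu setT measurableT (fun k u => (f k u)%:E) (cst 0%E) (EFin \o g)
  mfE (measurable_cst _).
case.
- by apply: aeW => u _; apply: cvg_EFin; [exact: nearW|exact: f0].
- apply/integrableP; split; first exact/measurable_EFinP.
  by under eq_integral do rewrite /= ger0_norm//.
- by apply: aeW => u k _ /=; have /andP[h1 h2] := fg k u; rewrite lee_fin ger0_norm.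
rewrite integral0 => _ _ /fine_cvgP[fin /cvgrPdist_lt/(_ _ q0) h].
apply: filterS2 fin h => k fk; rewrite sub0r normrN => h.
by rewrite -[leLHS](fineK fk) lee_fin; apply/ltW; apply: le_lt_trans h; exact: ler_norm.
Qed.

Lemma trunc_quant_cvg2 (q : R) : (I2 nu v < +oo)%E -> 0 < q ->
  \forall k \near \oo, (I2 nu (fun u => v u - trunc_quant k v u)%R <= q%:E)%E.
Proof.
move=> fv; apply: (dominated0 (f := fun k u => euc (err k u) ^+ 2) (g := fun u => euc (v u) ^+ 2)) => //.
- by move=> k; exact: vmeas_euc2 (verr k).
- exact: vmeas_euc2.
- by move=> k u; rewrite sqr_ge0 ler_sqr ?nnegrE ?euc_ge0// err_le.
- move=> u; rewrite -[X in _ --> X](mulr0 (0 : R)); exact: (cvgM (@err_cvg u) (@err_cvg u)).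
Qed.

Lemma trunc_quant_cvg1 (q : R) : (I1 nu v < +oo)%E -> 0 < q ->
  \forall k \near \oo, (I1 nu (fun u => v u - trunc_quant k v u)%R <= q%:E)%E.
Proof.
move=> fv; apply: (dominated0 (f := fun k u => euc (err k u)) (g := fun u => euc (v u))) => //.
- by move=> k; exact: vmeas_euc (verr k).
- exact: vmeas_euc.
- by move=> k u; rewrite euc_ge0/=.
Qed.

End step_approximation.

Section scheme_exists.
Context (R : realType) (n : nat) dU (U : measurableType dU).
Variable nu : {sigma_finite_measure set U -> \bar R}.
Variables (b : 'cV[R]_n -> 'cV[R]_n) (sigma : 'cV[R]_n -> 'M[R]_n) (c : 'cV[R]_n -> U -> 'cV[R]_n).
Hypothesis c_meas : measurable_fun [set: borel 'cV[R]_n * U]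
  (fun z => (c z.1 z.2 : borel 'cV[R]_n)).
Hypotheses (b_cont : continuous b) (sigma_cont : continuous sigma).
Hypothesis c_cont : forall u, continuous (c ^~ u).
Hypothesis c_sq_fin : forall x, (I2 nu (c x) < +oo)%E.
Hypothesis c_sq_cont : continuous (fun x : 'cV[R]_n => fine (I2 nu (c x))).

(** The first hit in the order of the list, with a radius that depends on the centre: [dl g] will be
    a modulus of continuity at [g]. The default [0] occurs only outside all the balls. *)
Fixpoint net_point (dl : 'cV[R]_n -> R) (L : seq 'cV[R]_n) (x : 'cV[R]_n) : 'cV[R]_n :=
  if L is g :: L' then if euc (x - g) < dl g then g else net_point dl L' x else 0.

Lemma net_pointP dl L x : (exists2 g, g \in L & euc (x - g) < dl g) ->
  net_point dl L x \in L /\ euc (x - net_point dl L x) < dl (net_point dl L x).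
Proof.
elim: L => [|g L ih] [g' //] gL xg /=; case: ifPn => [h|h]; first by rewrite mem_head.
have [|h1 h2] := ih; last by rewrite inE h1 orbT.
exists g' => //; move: gL; rewrite inE => /predU1P[e|//].
by move: h; rewrite -e xg.
Qed.

Lemma cmeas_net dl L (phi : 'cV[R]_n -> R) : cmeas (fun x => phi (net_point dl L x)).
Proof.
move=> d T G Y sG hY; elim: L => [|g L ih] /=; first exact: Gm_cst.
have hb : Gb G (fun w => euc (Y w - g) < dl g).
  by apply: Gb_ltr; exact: (cmeas_euc g sG hY).
rewrite (_ : (fun w => _) = fun w => (euc (Y w - g) < dl g)%R%:R * phi g +
    (~~ (euc (Y w - g) < dl g))%R%:R * phi (net_point dl L (Y w))).
  apply: (GmD sG); first by apply: (GmM sG); [exact: (Gm_bool sG hb)|exact: (Gm_cst sG)].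
  by apply: (GmM sG) => //; apply: (Gm_bool sG); exact: (Gb_not sG hb).
by apply/funext => w; case: ifP => h; rewrite ?mul1r ?mul0r ?addr0 ?add0r.
Qed.

Lemma net_bdd dl L (phi : 'cV[R]_n -> R) : exists M, forall x, `|phi (net_point dl L x)| <= M.
Proof.
elim: L => [|g L [M hM]]; first by exists `|phi 0|.
exists (Num.max `|phi g| M) => x /=; case: ifP => _; first by rewrite le_max lexx.
by rewrite le_max hM orbT.
Qed.

Lemma net_exists (K : R) (dl : 'cV[R]_n -> R) : (forall x, 0 < dl x) -> exists L : seq 'cV[R]_n,
  (forall g, g \in L -> euc g <= K) /\
  forall x, euc x <= K -> exists2 g, g \in L & euc (x - g) < dl g.
Proof.
move=> dl0; have := @compact_euc_ball R n K; rewrite compact_cover.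
move=> /(_ _ [set x | euc x <= K] (fun g => [set x | euc (x - g) < dl g])).
case.
- move=> g _; rewrite (_ : [set x | _] = (fun x => euc (x - g)) @^-1` `]-oo, dl g[%classic); last first.
    by apply/seteqP; split => x /=; rewrite in_itv.
  by apply: open_comp; [move=> x _; exact: euc_subr_cont|exact: lray_open].
- by move=> x xK; exists x => //=; rewrite subrr euc0.
move=> D hD hc; exists (finmap.enum_fset D); split; first by move=> g /hD; rewrite inE.
by move=> x /hc[g /= gD gx]; exists g.
Qed.

Let level (f : U -> R) (x : R) (v : bool) : measurable_fun setT f ->
  measurable [set u | (x <= f u) = v].
Proof.
move=> mf; have m1 : measurable [set u | x <= f u].
  rewrite (_ : [set u | _] = setT `&` f @^-1` `[x, +oo[%classic); last first.
    by apply/seteqP; split => u /=; rewrite in_itv /= andbT => // -[].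
  by apply: mf => //; exact: measurable_itv.
case: v => //; rewrite (_ : [set u | _] = ~` [set u | x <= f u]); first exact: measurableC.
by apply/seteqP; split => u /=; [move=> ->|move/negP/negbTE].
Qed.

(** A finite net of the ball controls [b], [sigma] and, in L2, [c] at once. For its finitely many
    points, [c] is truncated and quantised with a common [k]; the cells are the atoms on which all
    these quantised functions are constant. *)
Lemma scheme_exists (K q : R) (l1 : Prop) : 0 < q -> (l1 -> forall x, (I1 nu (c x) < +oo)%E) ->
  exists s, scheme_ok nu b sigma c s K q l1.
Proof.
move=> q0 hl1.
have hx x : exists dl, 0 < dl /\ forall y, euc (y - x) < dl ->
    [/\ euc (y - x) <= q, euc (b y - b x) <= q, euc (sigma y - sigma x) <= q &
        (I2 nu (fun u => (c y u - c x u)%R) <= q%:E)%E].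
  have [d1 d10 h1] := continuous_euc_mx x b_cont q0.
  have [d2 d20 h2] := continuous_euc_mx x sigma_cont q0.
  have [d3 d30 h3] := jump_continuous c_meas c_cont c_sq_fin c_sq_cont x q0.
  exists (Num.min (Num.min d1 d2) (Num.min d3 q)); rewrite !lt_min d10 d20 d30 q0; split => // y.
  rewrite !lt_min => /andP[/andP[y1 y2] /andP[y3 y4]].
  by split; [exact: ltW|exact/ltW/h1|exact/ltW/h2|exact: h3].
have [dl hdl] := choice hx.
have [L [LK Lc]] := @net_exists K dl (fun x => (hdl x).1).
have [V [cV ndV hV]] := (sigma_finiteP setT nu).1 (sigma_finiteT nu).
have mV k := (hV k).1.
have [k hk] : exists k, forall y, y \in L ->
    (I2 nu (fun u => c y u - trunc_quant V k (c y) u)%R <= q%:E)%E /\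
    (l1 -> I1 nu (fun u => c y u - trunc_quant V k (c y) u)%R <= q%:E)%E.
  have h : \forall k \near \oo, forall y, y \in L ->
      (I2 nu (fun u => c y u - trunc_quant V k (c y) u)%R <= q%:E)%E /\
      (l1 -> I1 nu (fun u => c y u - trunc_quant V k (c y) u)%R <= q%:E)%E.
    apply: near_in => y; have vy := vmeas_c c_meas y.
    have h2 := trunc_quant_cvg2 mV ndV (esym cV) vy (c_sq_fin y) q0.
    have [h1|h1] := pselect l1; last by apply: filterS h2 => k ? ; split.
    have h3 := trunc_quant_cvg1 mV ndV (esym cV) vy (hl1 h1 y) q0.
    by apply: filterS2 h2 h3 => k ? ?; split.
  by have [k _ /(_ k (leqnn k)) h0] := h; exists k.
pose Nk := (k.+1 ^ 2)%N; pose dk : R := k.+1%:R^-1.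
(* A cell records the outcomes of all threshold tests, for each net point, coordinate and level,
   with both signs. *)
pose J : finType := {ffun ('I_(size L) * 'I_n * 'I_Nk)%type -> bool * bool}.
pose val (l : 'I_(size L)) (i : 'I_n) u : R := c (tnth (in_tuple L) l) u i ord0.
pose tag u : J := [ffun p : ('I_(size L) * 'I_n * 'I_Nk)%type => (p.2.+1%:R * dk <= val p.1.1 p.1.2 u, p.2.+1%:R * dk <= - val p.1.1 p.1.2 u)].
pose A (j : J) : set U := V k `&` [set u | tag u = j].
(* The quantised value is recomputed from the recorded outcomes; points outside the net get [0]. *)
pose a (j : J) (y : 'cV[R]_n) : 'cV[R]_n := if insub (index y L) is Some l then
  \col_i (\sum_(m < Nk) dk * (j (l, i, m)).1%:R - \sum_(m < Nk) dk * (j (l, i, m)).2%:R) else 0.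
pose s := Scheme (net_point dl L) A a.
have scE y u : y \in L -> sc_fun s y u = trunc_quant V k (c y) u.
  move=> yL; have yi : (index y L < size L)%N by rewrite index_mem.
  rewrite /sc_fun /trunc_quant indicE; case: (boolP (u \in V k)) => [uV|/negP uV].
    rewrite (bigD1 (tag u))//= [X in _ + X]big1 ?addr0; last first.
      move=> j jt; rewrite indicE memNset ?scale0r// => -[_ /= tj].
      by move: jt; rewrite tj eqxx.
    rewrite indicE mem_set ?scale1r; last by split => //; rewrite inE in uV.
    rewrite /a insubT; apply/colP => i; rewrite !mxE.
    have e m : tag u (Sub (index y L) yi, i, m) = (m.+1%:R * dk <= c y u i ord0, m.+1%:R * dk <= - c y u i ord0).
      by rewrite ffunE /val (tnth_nth 0)/= nth_index.
    by rewrite /quant /stairs; congr (_ - _); apply: eq_bigr => m _; rewrite e.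
  rewrite big1 ?scale0r// => j _; rewrite indicE memNset ?scale0r// => -[h _].
  by apply: uV; rewrite inE.
have piL x : euc x <= K -> net_point dl L x \in L /\ euc (x - net_point dl L x) < dl (net_point dl L x).
  by move=> /Lc; exact: net_pointP.
have near_pi x : euc x <= K -> [/\ euc (x - sc_pi s x) <= q, euc (b x - b (sc_pi s x)) <= q,
    euc (sigma x - sigma (sc_pi s x)) <= q & (I2 nu (fun u => (c x u - c (sc_pi s x) u)%R) <= q%:E)%E].
  by move=> /piL[_ h]; exact: (hdl _).2.
have mA j : measurable (A j).
  apply: measurableI => //.
  rewrite (_ : [set u | _] = \bigcap_(p in setT) [set u | tag u p = j p]); last first.
    by apply/seteqP; split => u; [move=> /= h p _ /=; rewrite h|move=> h; apply/ffunP => p; exact: h].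
  apply: fin_bigcap_measurable; first exact: finite_finset.
  move=> p _; have mval : measurable_fun setT (val p.1.1 p.1.2) by exact: meas_c_entry.
  rewrite (_ : [set u | _] = [set u | (p.2.+1%:R * dk <= val p.1.1 p.1.2 u) = (j p).1] `&`
      [set u | (p.2.+1%:R * dk <= - val p.1.1 p.1.2 u) = (j p).2]).
    by apply: measurableI; apply: level => //; exact: measurable_funN.
  by apply/seteqP; split => u /=; rewrite ffunE; [move=> <-|case: (j p) => v1 v2 /= [-> ->]].
exists s; split.
- by move=> phi; exact: cmeas_net.
- by move=> phi; exact: net_bdd.
- exact: mA.
- move=> j; apply: le_lt_trans (hV k).2; apply: le_measure; rewrite ?inE; [exact: mA|exact: mV|by move=> u []].
- move=> i j ij; rewrite -subset0 => u [[_ /= h1] [_ /= h2]].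
  by move: ij; rewrite -h1 -h2 eqxx.
- by move=> x /piL[h _]; exact: LK.
- by move=> x /near_pi[h _ _ _]; rewrite eucB.
- by move=> x /near_pi[_ h _ _]; rewrite eucB.
- by move=> x /near_pi[_ _ h _]; rewrite eucB.
- by move=> x /near_pi[_ _ _ h]; under eq_integral do rewrite eucB.
- move=> x /piL[h _]; under eq_integral do rewrite scE//; exact: (hk _ h).1.
- move=> l x /piL[h _]; under eq_integral do rewrite scE//; exact: (hk _ h).2.
Qed.

End scheme_exists.

(** * Joint law of the increments *)

Lemma sigma_all (T : pointedType) (G : set (set T)) (I : finType) (S : I -> set T) :
  sigma_algebra setT G -> (forall i, G (S i)) -> G [set w | forall i, S i w].
Proof.
move=> sG hS; have mE := measurable_g_measurableTypeE sG.
rewrite (_ : [set w | _] = \bigcap_(i in setT) S i); last first.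
  by apply/seteqP; split => w h i //; exact: h.
rewrite -mE; apply: (@fin_bigcap_measurable _ (g_sigma_algebraType G)) => [|i _]; first exact: finite_finset.
by rewrite mE.
Qed.

Section rectangles.
Context (R : realType) (n : nat) dU (U : measurableType dU).
Variable nu : {sigma_finite_measure set U -> \bar R}.
Variables (p : nat -> R) (J : finType) (A : J -> set U).
Hypotheses (p0 : forall k, 0 <= p k) (pS : forall k, p k < p k.+1).
Hypotheses (mA : forall j, measurable (A j)) (nA : forall j, (nu (A j) < +oo)%E).
Hypothesis dA : forall i j, i != j -> A i `&` A j = set0.
Notation E := ('I_n + J)%type.

Definition rect m (B : nat -> E -> set (measurableTypeR R)) : set (nat -> E -> R) :=
  [set om | forall k e, (k < m)%N -> B k e (om k e)].

Definition rects m : set (set (nat -> E -> R)) :=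
  [set S | exists2 B, (forall k e, measurable (B k e)) & S = rect m B].

Let mean k j : R := (p k.+1 - p k) * fine (nu (A j)).

Definition rect_jump_law k j (B : set (measurableTypeR R)) : \bar R :=
  (\sum_(l <oo) (\1_B (l%:R - mean k j) * (mean k j ^+ l / l`!%:R * expR (- mean k j)))%:E)%E.

(** The expression contains [p], [A] and [nu] but no basis, which makes the laws on two bases
    comparable. Pairs of a step and a cell are enumerated by ordinals, the index type of
    [prm_indep]. *)
Definition rect_law m (B : nat -> E -> set (measurableTypeR R)) : \bar R :=
  ((\prod_(k < m) \prod_(i < n) normal_prob 0 (Num.sqrt (p k.+1 - p k)) (B k (inl i))) *
   \prod_(x < #|{: 'I_m * J}|) rect_jump_law (enum_val x).1 (enum_val x).2
     (B (enum_val x).1 (inr (enum_val x).2)))%E.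

Section one_basis.
Context d (T : measurableType d) (P : probability T R).
Variables (F : R -> set (set T)) (W : R -> T -> 'cV[R]_n).
Variable N : T -> {measure set (measurableTypeR R * U) -> \bar R}.
Hypothesis drv : driven P nu F W N.
Variable B : nat -> E -> set (measurableTypeR R).
Hypothesis mB : forall k e, measurable (B k e).

Let EW m := [set w | forall k i, (k < m)%N -> B k (inl i) (dW W (p k) (p k.+1) i w)].
Let EN m := [set w | forall k j, (k < m)%N -> B k (inr j) (dN nu N (p k) (p k.+1) (A j) w)].

Let EWE m : EW m = [set w | forall ki : 'I_m * 'I_n, B ki.1 (inl ki.2) (dW W (p ki.1) (p ki.1.+1) ki.2 w)].
Proof.
apply/seteqP; split => w h; first by move=> [k i]; exact: h.
by move=> k i km; exact: (h (Ordinal km, i)).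
Qed.

Let pm k l : (k <= l)%N -> p k <= p l.
Proof. by move=> /subnK <-; elim: (l - k)%N => // j ih; rewrite addSn; exact: le_trans (ltW (pS _)). Qed.

Let FEW m : F (p m) (EW m).
Proof.
rewrite EWE; apply: (sigma_all (filt_algebra (dr_F drv) (p0 m))) => -[k i].
have h := Gm_mono (dr_F drv) (p0 k.+1) (pm (ltn_ord k)) (Gm_dW (dr_F drv) (dr_W drv) i (p0 k) (ltW (pS k))).
exact: (h _ (mB k (inl i))).
Qed.

(** Induction on the number of steps: the event of the first [m] steps lies in [F (p m)], to which
    [bm_incr] applies. *)
Let PW m : P (EW m) =
  (\prod_(k < m) \prod_(i < n) normal_prob 0 (Num.sqrt (p k.+1 - p k)) (B k (inl i)))%E.
Proof.
elim: m => [|m ih].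
  rewrite big_ord0 (_ : EW 0 = setT); first exact: probability_setT.
  by apply/seteqP; split.
rewrite big_ord_recr /= -ih.
rewrite (_ : EW m.+1 = EW m `&` [set w | forall i, B m (inl i) (W (p m.+1) w i ord0 - W (p m) w i ord0)]).
  exact: (bm_incr (dr_W drv) (p0 m) (pS m) (FEW m) (fun i => mB m (inl i))).
apply/seteqP; split => w; first by move=> h; split => [k i km|i]; [exact/h/ltnW|exact: h].
by move=> [h1 h2] k i; rewrite ltnS leq_eqVlt => /predU1P[->|]; [exact: h2|exact: h1].
Qed.

Let sW := sigma_gen [set t | 0 <= t] (W : R -> T -> borel 'cV[R]_n).
Let sN := sigma_gen (time_slab `[0, +oo[) (fun A w => N w A : \bar R).

Let sEW m : sW (EW m).
Proof.
have sa : sigma_algebra setT sW by exact: sigma_gen_algebra.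
rewrite EWE; apply: (sigma_all sa) => -[k i].
have hW l : Gm sW (fun w => W (p l) w i ord0).
  have hr := @sigma_gen_rv _ _ _ _ _ [set t | 0 <= t] (W : R -> T -> borel 'cV[R]_n) (p l) (p0 l).
  exact: (rv_wrt_comp hr (borel_continuous (@coord_continuous R n 1 i ord0))).
exact: (GmB sa (hW k.+1) (hW k) (mB k (inl i))).
Qed.

Let slabk k j : time_slab `[0, +oo[ (`]p k, p k.+1]%classic `*` A j) := slab0 (p k.+1) (p0 k) (mA j).

Let lawN k j (C : set (measurableTypeR R)) : measurable C ->
  P [set w | C (dN nu N (p k) (p k.+1) (A j) w)] = rect_jump_law k j C.
Proof.
move=> mC; pose K w := N w (`]p k, p k.+1]%classic `*` A j).
have mK : measurable_fun setT (K : T -> \bar R) := prm_rv (dr_N drv) (slabk k j).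
have la0 : 0 <= mean k j by rewrite mulr_ge0 ?fine_ge0// subr_ge0 ltW.
have KE (l : nat) : P [set w | K w = (l%:R)%:E] = poisson_prob (mean k j) 0 [set l].
  have := prm_law (dr_N drv) (slabk k j); rewrite (intensity_itv (ltW (pS k)))// => h.
  by rewrite h// ltry.
have mh : measurable_fun setT (fun x : R => \1_C (x - mean k j) : R).
  have mi : measurable_fun setT (\1_C : measurableTypeR R -> R) by exact: measurable_indic.
  have ms : measurable_fun setT (fun x : measurableTypeR R => (x - mean k j : measurableTypeR R)).
    by apply: measurable_funB; [exact: measurable_id|exact: measurable_cst].
  exact: (measurableT_comp mi ms).
have := ge0_integral_poisson la0 mK KE mh (fun x => _); rewrite /rect_jump_law => <-; last first.
  by move=> x; rewrite indicE; case: (_ \in _).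
rewrite (_ : (fun w => _) = EFin \o \1_[set w | C (dN nu N (p k) (p k.+1) (A j) w)]); last first.
  by apply/funext => w; rewrite /= !indicE; congr ((nat_of_bool _)%:R%:E); apply/idP/idP; rewrite !inE.
rewrite integral_indic ?setIT//.
apply: (filt_measurable (dr_F drv) (p0 k.+1)).
exact: (Gm_dN (dr_F drv) (dr_N drv) (p0 k) (ltW (pS k)) (mA j) mC).
Qed.

Let PN m : P (EN m) = (\prod_(x < #|{: 'I_m * J}|) rect_jump_law (enum_val x).1 (enum_val x).2
     (B (enum_val x).1 (inr (enum_val x).2)))%E /\ sN (EN m).
Proof.
pose A' (x : 'I_#|{: 'I_m * J}|) := `]p (enum_val x).1, p (enum_val x).1.+1]%classic `*` A (enum_val x).2.
pose B' (x : 'I_#|{: 'I_m * J}|) : set (\bar R) := [set y |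
  B (enum_val x).1 (inr (enum_val x).2) (fine y - mean (enum_val x).1 (enum_val x).2)].
have mB' x : measurable (B' x).
  rewrite -[X in measurable X]setTI.
  have mf : measurable_fun setT (fun y : \bar R => fine y - mean (enum_val x).1 (enum_val x).2 : measurableTypeR R).
    by apply: measurable_funB; [exact: fine_measurable|exact: measurable_cst].
  exact: (mf measurableT _ (mB _ _)).
have ENE : EN m = [set w | forall x, B' x (N w (A' x))].
  apply/seteqP; split => w h; first by move=> x; exact: h.
  by move=> k j km; have := h (enum_rank (Ordinal km, j)); rewrite /B' /A' /= enum_rankK.
split; last first.
  have sa : sigma_algebra setT sN by exact: sigma_gen_algebra.
  rewrite ENE; apply: (sigma_all sa) => x; apply: (sigma_gen_rv (i := A' x)); first exact: slabk.
  by exists (B' x); [exact: mB'|rewrite setTI].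
(* Disjoint in space by [dA] for different cells, disjoint in time for the same cell at different
   steps. *)
have tA : trivIset setT A'.
  apply/trivIsetP => x y _ _ xy; apply/seteqP; split => // -[s u] [[/= sx ux] [/= sy uy]].
  have [e|ne] := eqVneq (enum_val x).2 (enum_val y).2; last first.
    by have : (A (enum_val x).2 `&` A (enum_val y).2) u by []; rewrite dA.
  have ne1 : (enum_val x).1 != (enum_val y).1.
    apply: contra xy => /eqP e1; apply/eqP/enum_val_inj.
    by rewrite [LHS]surjective_pairing [RHS]surjective_pairing e e1.
  move: sx sy; rewrite !in_itv /= => /andP[x1 x2] /andP[y1 y2].
  have : (enum_val x).1 != (enum_val y).1 :> nat by [].
  rewrite neq_ltn => /orP[lt|lt].
    by have := lt_le_trans y1 (le_trans x2 (pm lt)); rewrite ltxx.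
  by have := lt_le_trans x1 (le_trans y2 (pm lt)); rewrite ltxx.
rewrite ENE (prm_indep (dr_N drv) (fun x => slabk _ _) tA mB').
by apply: eq_bigr => x _; exact: lawN.
Qed.

Lemma rect_prob m : P [set w | rect m B (fun k e => noise_z nu W N p A k e w)] = rect_law m B.
Proof.
have [PE sE] := PN m.
rewrite (_ : [set w | _] = EW m `&` EN m).
  rewrite /rect_law -PW -PE; exact: (dr_WN drv (sEW m) sE).
apply/seteqP; split => w; first by move=> h; split => [k i km|k j km]; [exact: (h k (inl i))|exact: (h k (inr j))].
by move=> [h1 h2] k [i|j] km; [exact: h1|exact: h2].
Qed.

Lemma rect_measurable m : measurable [set w | rect m B (fun k e => noise_z nu W N p A k e w)].
Proof.
rewrite (_ : [set w | _] = \bigcap_(x in setT : set ('I_m * E)%type)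
    [set w | B x.1 x.2 (noise_z nu W N p A x.1 x.2 w)]); last first.
  apply/seteqP; split => w h; first by move=> x _; exact: h.
  by move=> k e km; exact: (h (Ordinal km, e)).
apply: fin_bigcap_measurable => [|[k e] _]; first exact: finite_finset.
apply: (filt_measurable (dr_F drv) (p0 k.+1)).
case: e => [i|j]; first exact: (Gm_dW (dr_F drv) (dr_W drv) i (p0 k) (ltW (pS k)) (mB k (inl i))).
exact: (Gm_dN (dr_F drv) (dr_N drv) (p0 k) (ltW (pS k)) (mA j) (mB k (inr j))).
Qed.

End one_basis.

Let setI_rects m : setI_closed (rects m).
Proof.
move=> _ _ [B mB ->] [B' mB' ->]; exists (fun k e => B k e `&` B' k e).
  by move=> k e; exact: measurableI.
apply/seteqP; split => om; first by move=> [h h'] k e km; split; [exact: h|exact: h'].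
by move=> h; split => k e km; have [] := h k e km.
Qed.

Lemma noise_measurable d (T : measurableType d) (P : probability T R)
    (F : R -> set (set T)) (W : R -> T -> 'cV[R]_n)
    (N : T -> {measure set (measurableTypeR R * U) -> \bar R}) m : driven P nu F W N ->
  measurable_fun setT ((fun w k e => noise_z nu W N p A k e w) : T -> g_sigma_algebraType (rects m)).
Proof.
move=> drv; apply: (@measurability _ _ T (g_sigma_algebraType (rects m)) setT _ (rects m) erefl) => _ [_ [B mB ->] <-].
by rewrite setTI; exact: (rect_measurable drv mB m).
Qed.

Section two_bases.
Variable m : nat.
Notation Om := (g_sigma_algebraType (rects m)).
Context d1 (T1 : measurableType d1) (P1 : probability T1 R) d2 (T2 : measurableType d2) (P2 : probability T2 R).
Variables (F1 : R -> set (set T1)) (W1 : R -> T1 -> 'cV[R]_n) (F2 : R -> set (set T2)) (W2 : R -> T2 -> 'cV[R]_n).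
Variable N1 : T1 -> {measure set (measurableTypeR R * U) -> \bar R}.
Variable N2 : T2 -> {measure set (measurableTypeR R * U) -> \bar R}.
Hypotheses (drv1 : driven P1 nu F1 W1 N1) (drv2 : driven P2 nu F2 W2 N2).

Let Z1 : T1 -> Om := fun w k e => noise_z nu W1 N1 p A k e w.
Let Z2 : T2 -> Om := fun w k e => noise_z nu W2 N2 p A k e w.

Let mZ1 : measurable_fun setT Z1 := noise_measurable drv1.
Let mZ2 : measurable_fun setT Z2 := noise_measurable drv2.

Let mu1 := measure_function_pushforward__canonical__measure_function_Measure P1 mZ1.
Let mu2 := measure_function_pushforward__canonical__measure_function_Measure P2 mZ2.

(** Rectangles are stable under intersection and generate the sigma-algebra, and both laws give them
    the mass [rect_law]. *)
Let mu12 (S : set Om) : measurable S -> mu1 S = mu2 S.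
Proof.
move=> mS; apply: (@measure_unique _ R Om (rects m) (fun=> setT)) => //.
- by move=> _; exists (fun _ _ => setT) => //; apply/seteqP; split.
- by apply: bigcup_const; exists 0%N.
- by move=> _ [B mB ->]; rewrite /mu1 /mu2 /= /pushforward (rect_prob drv1 mB) (rect_prob drv2 mB).
- by move=> _; rewrite /mu1 /= /pushforward preimage_setT probability_setT ltry.
Qed.

Lemma law_eq (Phi : Om -> R) : measurable_fun setT Phi -> (forall om, 0 <= Phi om) ->
  Ex P1 (fun w => Phi (fun k e => noise_z nu W1 N1 p A k e w)) =
  Ex P2 (fun w => Phi (fun k e => noise_z nu W2 N2 p A k e w)).
Proof.
move=> mPhi Phi0; have mE : measurable_fun setT (EFin \o Phi) by exact/measurable_EFinP.
rewrite /Ex /Rintegral; congr fine.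
transitivity (\int[mu1]_om (Phi om)%:E)%E.
  by rewrite (ge0_integral_pushforward mZ1 P1 measurableT mE)// => om _; rewrite lee_fin.
transitivity (\int[mu2]_om (Phi om)%:E)%E.
  by apply: (eq_measure_integral mu2) => S mS _; exact: mu12.
by rewrite (ge0_integral_pushforward mZ2 P2 measurableT mE)// => om _; rewrite lee_fin.
Qed.

End two_bases.

End rectangles.

(** * Euler schemes close to a solution *)

Section solution.
Context (R : realType) (n : nat) dU (U : measurableType dU).
Variable nu : {sigma_finite_measure set U -> \bar R}.
Variables (b : 'cV[R]_n -> 'cV[R]_n) (sigma : 'cV[R]_n -> 'M[R]_n) (c : 'cV[R]_n -> U -> 'cV[R]_n).
Variables (x : 'cV[R]_n) (S : weak_solution nu b sigma c x).

Lemma ws_driven : driven (ws_prob S) nu (ws_filt S) (ws_bm S) (ws_prm S).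
Proof. by split; [exact: ws_usual|exact: ws_brownian|exact: ws_poisson|exact: ws_indep]. Qed.

Lemma ws_Gm s i : 0 <= s -> Gm (ws_filt S s) (fun w => ws_proc S s w i ord0).
Proof.
move=> s0; apply: (rv_wrt_comp (f := fun M : 'cV[R]_n => M i ord0) (ws_adapted (w0 := S) s0)).
by apply: borel_continuous; exact: coord_continuous.
Qed.

Lemma ws_measurable s : 0 <= s -> measurable_fun setT (ws_proc S s : ws_space S -> borel 'cV[R]_n).
Proof.
move=> s0 _ B mB; apply: (filt_measurable (ws_usual S) s0).
by apply: (ws_adapted (w0 := S) s0); exists B.
Qed.

Lemma ws_measurable_comp (f : 'cV[R]_n -> R) s : 0 <= s -> continuous f ->
  measurable_fun setT (fun w => f (ws_proc S s w)).
Proof.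
move=> s0 cf; apply: (measurableT_comp (f := f : borel 'cV[R]_n -> R)); first exact: borel_continuous.
exact: ws_measurable.
Qed.

Definition ws_euler (s : scheme R n U) (t : R) m y0 k (w : ws_space S) : 'cV[R]_n :=
  euler b sigma (s := s) (t / m%:R) (fun k e => sc_noise nu (ws_bm S) (ws_prm S) t m k e w) y0 k.

Definition ws_interp (s : scheme R n U) (t : R) m k (w : ws_space S) : 'cV[R]_n :=
  sc_sum b sigma (s := s) (t / m%:R) (fun k e => sc_noise nu (ws_bm S) (ws_prm S) t m k e w)
    (fun k => ws_proc S (gpt t m k) w) x k.

End solution.

Section core.
Context (R : realType) (n : nat) dU (U : measurableType dU).
Variable nu : {sigma_finite_measure set U -> \bar R}.
Variables (b : 'cV[R]_n -> 'cV[R]_n) (sigma : 'cV[R]_n -> 'M[R]_n) (c : 'cV[R]_n -> U -> 'cV[R]_n).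
Hypothesis c_meas : measurable_fun [set: borel 'cV[R]_n * U]
  (fun z => (c z.1 z.2 : borel 'cV[R]_n)).
Hypotheses (b_cont : continuous b) (sigma_cont : continuous sigma).
Hypothesis c_cont : forall u, continuous (c ^~ u).
Hypothesis c_sq_fin : forall x, (I2 nu (c x) < +oo)%E.
Hypothesis c_sq_cont : continuous (fun x : 'cV[R]_n => fine (I2 nu (c x))).
Variables (t K : R).
Hypotheses (t0 : 0 < t) (K0 : 0 < K).

Let Cb : exists2 M, 0 <= M & forall x, euc x <= K -> euc (b x) <= M.
Proof.
have cf : continuous (fun x => euc (b x)).
  move=> x; have h := cvg_comp b (fun A : 'cV[R]_n => euc (A - 0)) (@b_cont x) (@euc_subr_cont R n 1 0 (b x)).
  by rewrite (_ : (fun x => euc (b x)) = (fun A => euc (A - 0)) \o b)//=; apply/funext => y /=; rewrite subr0.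
have [M M0 hM] := euc_ball_bound K cf; exists M => // x xK.
by have := hM x xK; rewrite ger0_norm ?euc_ge0.
Qed.

Let mesh (m : nat) : (0 < m)%N -> 0 < t / m%:R.
Proof. by move=> m0; rewrite divr_gt0// ltr0n. Qed.

Let mesh_le (m : nat) : (0 < m)%N -> m%:R * (t / m%:R) <= t.
Proof. by move=> m0; rewrite mulrC divfK// pnatr_eq0 -lt0n. Qed.

(** [dx] and [eta] precede the starting points, the solution and its basis; this uniformity lets the
    neighbourhood of [x] be fixed before [z]. *)
Definition stable (l1 : Prop) (th eps dx eta : R) := forall x0 y0 (S : weak_solution nu b sigma c x0) s m,
  euc (y0 - x0) <= dx -> scheme_ok nu b sigma c s K eta l1 -> (0 < m)%N -> t / m%:R <= eta ->
  whp (ws_prob S) eps (fun w => forall k, (k <= m)%N ->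
    (forall j, (j < k)%N -> [/\ euc (ws_proc S (gpt t m j) w) <= K, euc (ws_euler s t m y0 j w) <= K &
      euc (ws_interp s t m j w - ws_proc S (gpt t m j) w) <= eta]) ->
    euc (ws_euler s t m y0 k w - ws_interp s t m k w) <= th).

Lemma stable_b l1 th eps : condition_b nu b sigma c -> 0 < th -> 0 < eps ->
  exists dx eta, [/\ 0 < dx, 0 < eta & stable l1 th eps dx eta].
Proof.
move=> [dl [rho [dl0 hr _ hK]]] th0 eps0; have [kappa k0 hk] := hK K K0.
have [M M0 hM] := Cb.
have [C C0 hC] := jump_norm_bound c_sq_fin c_sq_cont K.
pose th' := Num.min th (Num.min 1 (dl / 2)).
have th'0 : 0 < th' by rewrite !lt_min th0 ltr01 divr_gt0.
have [th'1 th'2 th'3] : [/\ th' <= th, th' <= 1 & th' <= dl / 2].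
  by have : th' <= th' by []; rewrite {2}/th' !le_min => /andP[-> /andP[-> ->]].
(* With this [psi] the probability [psi / th'^2] of the exit estimate is [eps]. *)
have psi0 : 0 < eps * th' ^+ 2 by rewrite mulr_gt0// exprn_gt0.
have [e e0 he] := lyapunov hr t k0 psi0.
have cb : cond_b nu b sigma c rho K kappa dl.
  by move=> x z xK zK xz; apply: hk => //; rewrite ge_max xK.
have [eta eta0 heta] := rate_b_le c_meas hr k0 dl0 M0 C0 hM hC cb e0 th'0 th'2 th'3.
(* A distance at most [min 1 e] has its square at most [e]. *)
exists (Num.min 1 e), eta; split => //; first by rewrite lt_min ltr01.
move=> x0 y0 S s m; rewrite le_min => /andP[d1 d2] ok m0 hm.
have GX k i : Gm (ws_filt S (k%:R * (t / m%:R))) (fun w => ws_proc S (gpt t m k) w i ord0).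
  by apply: ws_Gm; exact: gpt_ge0.
have d2e : euc (y0 - x0) ^+ 2 <= e.
  rewrite expr2; apply: le_trans d2; rewrite -[leRHS]mulr1.
  by apply: ler_wpM2l => //; exact: euc_ge0.
pose X k w := ws_proc S (gpt t m k) w; pose Y k (w : ws_space S) := ws_euler s t m y0 k w.
have YE k w : Y k w = euler b sigma (s := s) (t / m%:R)
  (fun k e => noise_z nu (ws_bm S) (ws_prm S) (fun k => k%:R * (t / m%:R)) (@sc_A _ _ _ _ s) k e w) y0 k by [].
pose D k w := Dv nu b sigma (ws_bm S) (ws_prm S) s (t / m%:R) X Y x0 k w.
have hrate k w : Ga nu b sigma (ws_bm S) (ws_prm S) s K eta th' (t / m%:R) X Y x0 k w ->
  rate_b nu b sigma s (t / m%:R) (X k w) (Y k w) (D k w) <=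
    kappa * rho (euc (D k w) ^+ 2 + e) + kappa * rho e.
  move=> /Ga_good/and4P[g1 g2 g3 g4]; apply: (heta s l1 ok) => //; first exact/ltW/mesh.
  rewrite /D /Dv opprB addrC addrA subrK -eucN opprB; exact: g3.
have [B [mB PB hB]] := stability_b (ws_driven S) ok (mesh m0) (ltW th'0) GX YE he th'0 (mesh_le m0) d2e hrate.
exists B; split => //; first by move: PB; rewrite mulfK// gt_eqF// ?exprn_gt0.
by move=> w nB k km hj; apply: le_trans th'1; exact: (hB w nB k km hj).
Qed.

Lemma stable_a th eps : condition_a nu b sigma c -> 0 < th -> 0 < eps ->
  exists dx eta, [/\ 0 < dx, 0 < eta & stable True th eps dx eta].
Proof.
move=> [[dl [rho [dl0 hr hK]]] _] th0 eps0; have [kappa k0 hk] := hK K K0.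
have [M M0 hM] := Cb.
pose th' := Num.min th (dl / 2).
have th'0 : 0 < th' by rewrite lt_min th0 divr_gt0.
have [th'1 th'3] : th' <= th /\ th' <= dl / 2.
  by have : th' <= th' by []; rewrite {2}/th' le_min => /andP[-> ->].
have psi0 : 0 < eps * th' by rewrite mulr_gt0.
have k30 : 0 < 3 * kappa by rewrite mulr_gt0.
have [e e0 he] := lyapunov hr t k30 psi0.
have ca : cond_a nu b sigma c rho K kappa dl.
  by move=> x z xK zK xz; apply: hk => //; rewrite ge_max xK.
have e2 : 0 < e / 2 by rewrite divr_gt0.
have [eta eta0 heta] := rate_a_le c_meas hr k0 dl0 M0 hM ca e0 e2 th'0 th'3.
(* The smoothing parameter and the initial distance take one half of [e] each. *)
exists (e / 2), eta; split => //.
move=> x0 y0 S s m d1 ok m0 hm.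
have GX k i : Gm (ws_filt S (k%:R * (t / m%:R))) (fun w => ws_proc S (gpt t m k) w i ord0).
  by apply: ws_Gm; exact: gpt_ge0.
have d2e : soft (e / 2) (y0 - x0) <= e.
  apply: le_trans (soft_le _ (ltW e2)) _; by rewrite [leRHS](splitr e); apply: lerD.
pose X k w := ws_proc S (gpt t m k) w; pose Y k (w : ws_space S) := ws_euler s t m y0 k w.
have YE k w : Y k w = euler b sigma (s := s) (t / m%:R)
  (fun k e => noise_z nu (ws_bm S) (ws_prm S) (fun k => k%:R * (t / m%:R)) (@sc_A _ _ _ _ s) k e w) y0 k by [].
pose D k w := Dv nu b sigma (ws_bm S) (ws_prm S) s (t / m%:R) X Y x0 k w.
have hrate k w : Ga nu b sigma (ws_bm S) (ws_prm S) s K eta th' (t / m%:R) X Y x0 k w ->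
  rate_a nu b sigma s (t / m%:R) (e / 2) (X k w) (Y k w) (D k w) <=
    (3 * kappa) * rho (soft (e / 2) (D k w) + e) + (3 * kappa) * rho e.
  move=> /Ga_good/and4P[g1 g2 g3 g4]; apply: (heta s ok) => //; first exact/ltW/mesh.
  rewrite /D /Dv opprB addrC addrA subrK -eucN opprB; exact: g3.
have [B [mB PB hB]] := stability_a (ws_driven S) ok (mesh m0) (ltW th'0) GX YE e2 he th'0 (mesh_le m0) d2e hrate.
exists B; split => //; first by move: PB; rewrite mulfK// gt_eqF// ?exprn_gt0.
by move=> w nB k km hj; apply: le_trans th'1; exact: (hB w nB k km hj).
Qed.

(** Condition (a) compares [c] only at points within [delta0] of each other, so integrability is
    carried from [0] to [x] along a segment cut into [N] short pieces. *)
Lemma jump_integrable : condition_a nu b sigma c -> forall x, (I1 nu (c x) < +oo)%E.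
Proof.
move=> [[dl [rho [dl0 hr hK]]] c0] x.
have x1 : 0 < euc x + 1 by rewrite ltr_wpDl// euc_ge0.
have [kappa k0 hk] := hK _ x1.
pose N := (Num.truncn (euc x / dl)).+1.
have N0 : 0 < N%:R :> R by rewrite ltr0n.
pose y i : 'cV[R]_n := (i%:R / N%:R) *: x.
have yK i : (i <= N)%N -> euc (y i) <= euc x + 1.
  move=> iN; rewrite eucZ ger0_norm ?divr_ge0//; apply: (@le_trans _ _ (1 * euc x)).
    by apply: ler_wpM2r; rewrite ?euc_ge0// ler_pdivrMr// mul1r ler_nat.
  by rewrite mul1r lerDl.
have yS i : euc (y i.+1 - y i) <= dl.
  rewrite /y -scalerBl -mulrBl -natrB// subSnn div1r eucZ ger0_norm ?invr_ge0// mulrC ler_pdivrMr//.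
  by rewrite mulrC -ler_pdivrMr//; apply/ltW; exact: truncnS_gt.
have fin i : (i <= N)%N -> (I1 nu (c (y i)) < +oo)%E.
  elim: i => [|i ih] iN; first by rewrite /y mul0r scale0r.
  have [_ h] : 2 * dotv (y i.+1 - y i) (b (y i.+1) - b (y i)) + euc (sigma (y i.+1) - sigma (y i)) ^+ 2
      <= kappa * euc (y i.+1 - y i) * rho (euc (y i.+1 - y i)) /\
      (\int[nu]_u (euc (c (y i.+1) u - c (y i) u))%:E <= (kappa * rho (euc (y i.+1 - y i)))%:E)%E.
    by apply: hk; [rewrite ge_max !yK// ltnW|rewrite eucB].
  rewrite (_ : c (y i.+1) = fun u => (c (y i.+1) u - c (y i) u) + c (y i) u); last first.
    by apply/funext => u; rewrite subrK.
  apply: le_lt_trans (I1D nu (vmeasB (vmeas_c c_meas _) (vmeas_c c_meas _)) (vmeas_c c_meas _)) _.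
  by apply: lte_add_pinfty; [apply: le_lt_trans h _; rewrite ltry|exact/ih/ltnW].
by have := fin N (leqnn N); rewrite /y divff ?scale1r// gt_eqF.
Qed.

(** The error splits into the stability of the scheme and the consistency of the interpolant,
    [th / 2] each. [l1] and [dx] come from stability and are uniform in the solution; [q0] and [m0]
    come from consistency and depend on it. *)
Lemma euler_close (hab : condition_a nu b sigma c \/ condition_b nu b sigma c) th eps :
  0 < th -> 0 < eps -> exists l1 dx, [/\ l1 -> forall x, (I1 nu (c x) < +oo)%E, 0 < dx &
  forall x0 y0 (S : weak_solution nu b sigma c x0), euc (y0 - x0) <= dx ->
  exists q0 m0, 0 < q0 /\ forall s q m, scheme_ok nu b sigma c s K q l1 -> 0 <= q -> q <= q0 ->
    (m0 <= m)%N -> (0 < m)%N ->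
  whp (ws_prob S) eps (fun w => forall k, (k <= m)%N ->
    (forall j, (j < k)%N -> euc (ws_proc S (gpt t m j) w) <= K /\ euc (ws_euler s t m y0 j w) <= K) ->
    euc (ws_euler s t m y0 k w - ws_proc S (gpt t m k) w) <= th)].
Proof.
move=> th0 eps0; have th2 : 0 < th / 2 by rewrite divr_gt0.
have eps2 : 0 < eps / 2 by rewrite divr_gt0.
have [l1 [dx [eta [hl1 dx0 eta0 st]]]] : exists l1 dx eta, [/\ l1 -> forall x, (I1 nu (c x) < +oo)%E,
    0 < dx, 0 < eta & stable l1 (th / 2) (eps / 2) dx eta].
  case: hab => h.
    by have [dx [eta [? ? ?]]] := stable_a h th2 eps2; exists True, dx, eta; split => // _; exact: jump_integrable.
  by have [dx [eta [? ? ?]]] := stable_b False h th2 eps2; exists False, dx, eta.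
exists l1, dx; split => // x0 y0 S d1.
have eta1 : 0 < Num.min eta (th / 2) by rewrite lt_min eta0.
have [q0 [m0 [q00 q01 cons]]] := consistency c_meas b_cont sigma_cont c_cont c_sq_fin c_sq_cont
  (ws_driven S) (@ws_measurable _ _ _ _ _ _ _ _ _ S) (@ws_Gm _ _ _ _ _ _ _ _ _ S) (ws_cadlag (w0 := S)) t0
  (ws_sde S) K eta1 eps2.
have [m1 _ hm1] := small_mesh t eta0.
exists (Num.min q0 eta), (maxn m0 m1); split; first by rewrite lt_min q00.
move=> s q m ok q0' ; rewrite le_min geq_max => /andP[qq qeta] /andP[mm0 mm1] m_gt0.
have h1 := cons s q l1 m ok q0' qq mm0 m_gt0.
have h2 := st x0 y0 S s m d1 (scheme_ok_le qeta ok) m_gt0 (ltW (hm1 m mm1).2).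
apply: (whp_le (e := eps / 2 + eps / 2)); first by rewrite -splitr.
apply: whpS (whp_and h1 h2) => w [c1 c2] k km hk.
have c1' j : (j <= k)%N -> euc (ws_interp s t m j w - ws_proc S (gpt t m j) w) <= Num.min eta (th / 2).
  by move=> jk; apply: c1 => [|i ij]; [exact: leq_trans km|have [] := hk i (leq_trans ij jk)].
rewrite [leRHS](splitr th); apply: le_trans (euc_triangleB _ (ws_interp s t m k w) _) _; apply: lerD.
  apply: c2 => // j jk; have [? ?] := hk j jk; split => //.
  by have := c1' j (ltnW jk); rewrite le_min => /andP[].
by have := c1' k (leqnn k); rewrite le_min => /andP[].
Qed.

End core.

(** * Continuity of the semigroup *)

Lemma Ex_close (R : realType) d (T : measurableType d) (P : probability T R) (f g : T -> R) (M e eps : R) :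
  measurable_fun setT f -> measurable_fun setT g -> (forall w, `|f w| <= M) -> (forall w, `|g w| <= M) ->
  0 <= e -> 0 <= M -> whp P eps (fun w => `|f w - g w| <= e) -> `|Ex P f - Ex P g| <= e + 2 * M * eps.
Proof.
move=> mf mg fM gM e0 M0 [B [mB PB hB]].
have lf := L1_bdd P mf fM; have lg := L1_bdd P mg gM.
have li := L1_indic P mB.
rewrite -ExB//; apply: le_trans (Ex_abs (L1B lf lg)) _.
apply: (@le_trans _ _ (Ex P (fun w => e + 2 * M * \1_B w))).
  apply: Ex_le; [exact: L1_norm (L1B lf lg)|by apply: L1D; [exact: L1_cst|exact: L1Z]|].
  move=> w; rewrite indicE; case: (boolP (w \in B)) => [_|/negP nB].
    by rewrite mulr1; apply: le_trans (ler_normB _ _) _; have := fM w; have := gM w; lra.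
  by rewrite mulr0 addr0; apply: hB => Bw; apply: nB; rewrite inE.
rewrite ExD; [|exact: L1_cst|exact: L1Z]; rewrite Ex_cst ExZ// Ex_indic// lerD2l.
apply: ler_wpM2l; first by rewrite mulr_ge0.
by rewrite -lee_fin PfineK.
Qed.

(** [z] may lie outside the ball, so the cover uses half radii: [z] then stays in the full ball
    around the centre chosen for [y]. *)
Lemma uniform_continuity (R : realType) n (f : 'cV[R]_n -> R) (K e : R) : continuous f -> 0 < e ->
  exists2 th, 0 < th & forall y z, euc y <= K -> euc (z - y) <= th -> `|f z - f y| <= e.
Proof.
move=> cf e0; have e2 : 0 < e / 2 by rewrite divr_gt0.
have hx x : exists dl, 0 < dl /\ forall y, euc (y - x) < dl -> `|f y - f x| < e / 2.
  by have [dl dl0 h] := continuous_euc x cf e2; exists dl.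
have [dl hdl] := choice hx.
have d20 x : 0 < dl x / 2 by rewrite divr_gt0//; case: (hdl x).
have [L [_ hL]] := @net_exists R n K (fun x => dl x / 2) d20.
have [k _ /(_ k (leqnn k)) hk] : \forall k \near \oo, forall g, g \in L -> k.+1%:R^-1 < dl g / 2.
  apply: near_in => g; exists (Num.truncn (dl g / 2)^-1) => // k /= hk.
  rewrite -[ltRHS]invrK ltf_pV2 ?posrE ?invr_gt0//.
  by apply: lt_le_trans (truncnS_gt _) _; rewrite ler_nat.
exists k.+1%:R^-1; first by rewrite invr_gt0.
move=> y z yK zy; have [g gL yg] := hL y yK.
have h1 := (hdl g).2 y (lt_trans yg _).
have {h1} h1 : `|f y - f g| < e / 2 by apply: h1; have := d20 g; lra.
have h2 : `|f z - f g| < e / 2.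
  apply: (hdl g).2; apply: le_lt_trans (euc_triangleB z y g) _.
  by rewrite [ltRHS]splitr; apply: ler_ltD => //; exact: le_trans zy (ltW (hk g gL)).
have -> : f z - f y = (f z - f g) - (f y - f g) by ring.
by apply: le_trans (ler_normB _ _) _; rewrite [leRHS](splitr e); apply: lerD; exact: ltW.
Qed.

Section exit.
Context (R : realType) (n : nat) dU (U : measurableType dU).
Variable nu : {sigma_finite_measure set U -> \bar R}.
Variables (b : 'cV[R]_n -> 'cV[R]_n) (sigma : 'cV[R]_n -> 'M[R]_n) (c : 'cV[R]_n -> U -> 'cV[R]_n).
Variables (x : 'cV[R]_n) (S : weak_solution nu b sigma c x) (t : R).
Hypothesis t0 : 0 < t.

Let euc_cont : continuous (fun y : 'cV[R]_n => euc y).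
Proof.
have -> : (fun y : 'cV[R]_n => euc y) = fun y => euc (y - 0) by apply/funext => y; rewrite subr0.
exact: euc_subr_cont.
Qed.

(** Cadlag paths are bounded on [[0, t]], so the events that the supremum reaches [k + 1] decrease
    to the empty set. *)
Lemma exit_bound (eps : R) : 0 < eps -> exists2 K, 0 < K &
  whp (ws_prob S) eps (fun w => forall s, 0 <= s <= t -> euc (ws_proc S s w) <= K).
Proof.
move=> eps0; pose D s w := euc (ws_proc S s w).
have cD w : path_cadlag (D ^~ w) := (cadlag_comp (@cV_hausdorff R n) euc_cont (ws_cadlag w)).1.
have compl : (ws_prob S).-negligible `<=` measurable.
  by move=> B /(filt_complete (ws_usual S)); exact: (filt_measurable (ws_usual S) (lexx 0)).
pose A k := [set w | (k.+1%:R%:E <= usup D t w)%E].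
have mA k : measurable (A k).
  apply: (@measurable_ucp_set _ _ _ (ws_prob S) compl t t0 D set0) => //.
  - by move=> s s0 _; exact: ws_measurable_comp.
  - by move=> w _; exact: rcont_cadlag.
have A0 : \bigcap_k A k = set0.
  apply/seteqP; split => // w /= hw; have [M hM] := cadlag_bounded (cD w) t.
  have : (usup D t w <= M%:E)%E.
    by apply: ub_ereal_sup => _ [s + <-]; rewrite /= in_itv /= lee_fin => /hM.
  move=> /(le_trans (hw (Num.truncn M) Logic.I)); rewrite lee_fin leNgt.
  by rewrite truncnS_gt.
have AP : ws_prob S (A k) @[k --> \oo] --> 0%E.
  rewrite -(measure0 (ws_prob S)) -A0; apply: nonincreasing_cvg_mu => //.
  - by apply: le_lt_trans (probability_le1 (ws_prob S) (mA 0%N)) _; rewrite ltry.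
  - by rewrite A0.
  - move=> k l kl; apply/subsetPset => w; rewrite /A /=; apply: le_trans.
    by rewrite lee_fin ler_nat ltnS.
have /fine_cvg/cvgrPdist_lt/(_ _ eps0)[k _ /(_ k (leqnn k))] := AP.
rewrite /= sub0r normrN ger0_norm ?fine_ge0// => hk.
exists k.+1%:R; first by rewrite ltr0n.
exists (A k); split => //; first by rewrite -(PfineK (ws_prob S) (mA k)) lee_fin ltW.
move=> w nA s st; have := ucp_bound nA st; rewrite ger0_norm ?euc_ge0//; exact: ltW.
Qed.

End exit.

Section euler_law.
Context (R : realType) (n : nat) dU (U : measurableType dU).
Variable nu : {sigma_finite_measure set U -> \bar R}.
Variables (b : 'cV[R]_n -> 'cV[R]_n) (sigma : 'cV[R]_n -> 'M[R]_n) (c : 'cV[R]_n -> U -> 'cV[R]_n).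
Variables (s : scheme R n U) (K q t : R) (l1 : Prop) (m : nat).
Hypothesis ok : scheme_ok nu b sigma c s K q l1.
Hypotheses (t0 : 0 < t) (m0 : (0 < m)%N).
Variable y0 : 'cV[R]_n.
Notation E := ('I_n + sc_J s)%type.
Notation Om := (g_sigma_algebraType (@rects R n (sc_J s) m)).

Let eul k (om : Om) : 'cV[R]_n := euler b sigma (s := s) (t / m%:R) om y0 k.
Let Gom : set (set Om) := measurable.
Let sG : sigma_algebra setT Gom. Proof. exact: sigma_algebra_measurable. Qed.

Let Gcoord k e : (k < m)%N -> Gm Gom (fun om : Om => om k e).
Proof.
move=> km B mB; apply: sub_sigma_algebra.
exists (fun k' e' => if (k' == k) && (e' == e) then B else setT); first by move=> k' e'; case: ifP.
apply/seteqP; split => om /=; last by move=> /(_ k e km); rewrite !eqxx.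
by move=> Bo k' e' _; case: ifP => // /andP[/eqP -> /eqP ->].
Qed.

Let Geul k i : (k <= m)%N -> Gm Gom (fun om => eul k om i ord0).
Proof.
elim: k i => [|k ih] i km; first exact: (Gm_cst sG).
rewrite (_ : (fun om => _) = fun om => eul k om i ord0 + ((t / m%:R) * b (sc_pi s (eul k om)) i ord0 +
    \sum_e sc_coef sigma (eul k om) e i * om k e)); last first.
  by apply/funext => om; rewrite /eul /= mxE [X in _ + X]mxE.
have Gk j : Gm Gom (fun om => eul k om j ord0) by apply: ih; exact: ltnW.
apply: (GmD sG) => //; apply: (GmD sG).
  apply: (GmM sG); first exact: (Gm_cst sG).
  exact: (so_meas ok (fun y => b y i ord0) sG Gk).
apply: (Gm_sum sG) => e; apply: (GmM sG); last exact: Gcoord.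
case: e => [l|j] /=; first exact: (so_meas ok (fun y => sigma y i l) sG Gk).
exact: (so_meas ok (fun y => sc_a j y i ord0) sG Gk).
Qed.

Variables (r M : R) (f : 'cV[R]_n -> R).
Hypothesis fM : forall y, `|f y| <= M.

Definition inside (y : nat -> 'cV[R]_n) : bool := [forall k : 'I_m.+1, euc (y k) <= r].

Let Ginside : Gb Gom (fun om => inside (eul ^~ om)).
Proof.
rewrite /Gb (_ : [set om | _] = [set om | forall k : 'I_m.+1, euc (eul k om) <= r]); last first.
  by apply/seteqP; split => om /= /forallP.
apply: (@sigma_all Om Gom 'I_m.+1 (fun k => [set om | euc (eul k om) <= r])) => // k.
suff h : Gb Gom (fun om => euc (eul k om) <= r) by exact: h.
apply: Gb_ler; have := cmeas_euc (0 : 'cV[R]_n) sG (fun i => Geul i (ltn_ord k : (k <= m)%N)).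
by rewrite (_ : (fun om => euc (eul k om - 0)) = fun om => euc (eul k om))//; apply/funext => om; rewrite subr0.
Qed.

Let Gf : Gm Gom (fun om => f (sc_pi s (eul m om))).
Proof. exact: (so_meas ok f sG (fun i => Geul i (leqnn m))). Qed.

Section one_solution.
Variables (x : 'cV[R]_n) (S : weak_solution nu b sigma c x).

Definition inside_ind (w : ws_space S) : R := (inside (fun k => ws_euler s t m y0 k w))%:R.
(** [f] is evaluated at the projected point because [so_meas] provides the measurability of every
    function of [sc_pi]; inside the ball the projection moves a point by at most [q]. *)
Definition inside_val (w : ws_space S) : R := inside_ind w * f (sc_pi s (ws_euler s t m y0 m w)).

Let Z (w : ws_space S) : Om := fun k e => noise_z nu (ws_bm S) (ws_prm S) (gpt t m) (@sc_A _ _ _ _ s) k e w.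

Let gS k : gpt t m k < gpt t m k.+1.
Proof. by rewrite gptS ltrDl divr_gt0// ltr0n. Qed.

Let mZ : measurable_fun setT Z := noise_measurable (m := m) (gpt_ge0 t0 m) gS (so_mA ok) (ws_driven S).

Let comp_meas (h : Om -> R) : Gm Gom h -> measurable_fun setT (fun w => h (Z w)).
Proof.
move=> Gh; apply: (measurableT_comp (f := h)) => //.
by move=> _ B mB; rewrite setTI; exact: Gh.
Qed.

Lemma measurable_inside_ind : measurable_fun setT inside_ind.
Proof. exact: (comp_meas (Gm_bool sG Ginside)). Qed.

Lemma measurable_inside_val : measurable_fun setT inside_val.
Proof. by apply: measurable_funM; [exact: measurable_inside_ind|exact: (comp_meas Gf)]. Qed.

Lemma inside_ind_bound w : `|inside_ind w| <= 1.
Proof. by rewrite /inside_ind; case: (inside _); rewrite ?normr1 ?normr0. Qed.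

Lemma inside_val_bound w : `|inside_val w| <= M.
Proof.
rewrite normrM -[leRHS]mul1r; apply: ler_pM => //; exact: inside_ind_bound.
Qed.

End one_solution.

Lemma inside_law x (S : weak_solution nu b sigma c x) x' (S' : weak_solution nu b sigma c x') :
  Ex (ws_prob S) (inside_ind (S := S)) = Ex (ws_prob S') (inside_ind (S := S')) /\
  Ex (ws_prob S) (inside_val (S := S)) = Ex (ws_prob S') (inside_val (S := S')).
Proof.
have gS k : gpt t m k < gpt t m k.+1 by rewrite gptS ltrDl divr_gt0// ltr0n.
have law h := law_eq (Phi := h) (gpt_ge0 t0 m) gS (so_mA ok) (so_nA ok) (so_dis ok) (ws_driven S) (ws_driven S').
have mG (h : Om -> R) : Gm Gom h -> measurable_fun setT h.
  by move=> Gh _ B mB; rewrite setTI; exact: Gh.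
pose ind om : R := (inside (eul ^~ om))%:R.
have Gind : Gm Gom ind := Gm_bool sG Ginside.
have ind0 om : 0 <= ind om by rewrite /ind; case: (inside _).
have e1 : Ex (ws_prob S) (inside_ind (S := S)) = Ex (ws_prob S') (inside_ind (S := S')) :=
  law _ _ (mG _ Gind) ind0.
split => //.
(* [law_eq] is for nonnegative functionals: [f] is shifted by its bound [M], and the shift is
   removed with the equality for [inside_ind]. *)
pose val om := ind om * (f (sc_pi s (eul m om)) + M).
have val0 om : 0 <= val om.
  by apply: mulr_ge0 => //; have := fM (sc_pi s (eul m om)); rewrite ler_norml => /andP[h _]; lra.
have Gval : Gm Gom val by apply: (GmM sG) => //; apply: (GmD sG) => //; exact: (Gm_cst sG).
have e2 := law _ _ (mG _ Gval) val0.
have key x1 (S1 : weak_solution nu b sigma c x1) : Ex (ws_prob S1) (inside_val (S := S1)) =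
   Ex (ws_prob S1) (fun w => val (fun k e => noise_z nu (ws_bm S1) (ws_prm S1) (gpt t m) (@sc_A _ _ _ _ s) k e w)) -
   M * Ex (ws_prob S1) (inside_ind (S := S1)).
  have l1' := L1_bdd (ws_prob S1) (measurable_inside_val (S := S1)) (inside_val_bound (S := S1)).
  have l2 := L1_bdd (ws_prob S1) (measurable_inside_ind (S := S1)) (inside_ind_bound (S := S1)).
  rewrite -(ExZ _ l2) [X in _ = X - _](Ex_ext _ (g := fun w => inside_val w + M * inside_ind w)); last first.
    by move=> w; rewrite /val /inside_val /inside_ind mulrDr [M * _]mulrC.
  by rewrite ExD ?addrK//; exact: L1Z.
by rewrite !key e1 e2.
Qed.

End euler_law.

Section feller.
Context (R : realType) (n : nat) dU (U : measurableType dU).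
Variable nu : {sigma_finite_measure set U -> \bar R}.
Variables (b : 'cV[R]_n -> 'cV[R]_n) (sigma : 'cV[R]_n -> 'M[R]_n) (c : 'cV[R]_n -> U -> 'cV[R]_n).
Hypothesis c_meas : measurable_fun [set: borel 'cV[R]_n * U]
  (fun z => (c z.1 z.2 : borel 'cV[R]_n)).
Hypotheses (b_cont : continuous b) (sigma_cont : continuous sigma).
Hypothesis c_cont : forall u, continuous (c ^~ u).
Hypothesis c_sq_fin : forall x, (I2 nu (c x) < +oo)%E.
Hypothesis c_sq_cont : continuous (fun x : 'cV[R]_n => fine (I2 nu (c x))).
Hypothesis hab : condition_a nu b sigma c \/ condition_b nu b sigma c.
Variables (f : 'cV[R]_n -> R) (M : R).
Hypotheses (cf : continuous f) (fM : forall y, `|f y| <= M).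

Let M0 : 0 <= M. Proof. exact: le_trans (normr_ge0 _) (fM 0). Qed.

(** The initial value is encoded in the equation only; it is read off [euler_close] at [k = 0] on
    the interval [[0, 1]], the scheme starting exactly at [x]. *)
Lemma initial_law x (S : weak_solution nu b sigma c x) : Ex (ws_prob S) (fun w => f (ws_proc S 0 w)) = f x.
Proof.
have mf : measurable_fun setT (fun w => f (ws_proc S 0 w)) := ws_measurable_comp (S := S) (lexx 0) cf.
apply/eqP; rewrite -subr_eq0 -normr_le0; apply/ler_addgt0Pl => e e0; rewrite addr0.
have M1 : 0 < M + 1 by rewrite ltr_wpDl.
have e2 : 0 < e / 2 by rewrite divr_gt0.
have eps0 : 0 < e / (4 * (M + 1)) by rewrite divr_gt0// mulr_gt0.
have K0 : 0 < euc x + 1 by rewrite ltr_wpDl// euc_ge0.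
have [dl dl0 hdl] := continuous_euc x cf e2.
have th0 : 0 < dl / 2 by rewrite divr_gt0.
have [l1 [dx [hl1 dx0 close]]] := euler_close c_meas b_cont sigma_cont c_cont c_sq_fin c_sq_cont
  ltr01 K0 hab th0 eps0.
have [|q0 [m0 [q00 h]]] := close x x S; first by rewrite subrr euc0 ltW.
have [s ok] := scheme_exists c_meas b_cont sigma_cont c_cont c_sq_fin c_sq_cont (euc x + 1) q00 hl1.
have := h s q0 m0.+1 ok (ltW q00) (lexx _) (leqnSn _) isT.
have eqx w : ws_euler (S := S) s 1 m0.+1 x 0 w = x by [].
move=> hw; rewrite -[f x](Ex_cst (ws_prob S)).
have := Ex_close mf (measurable_cst (f x)) (fun w => fM _) (fun=> fM x) (ltW e2) M0 (whpS _ hw).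
move=> /(_ _)/le_trans; apply.
  move=> w h'; have hx : euc (x - ws_proc S 0 w) <= dl / 2.
    by have := h' 0%N isT; rewrite eqx gpt0; apply.
  by apply/ltW/hdl; rewrite eucB; apply: le_lt_trans hx _; rewrite ltr_pdivrMr// ltr_pMr// ltr1n.
have -> : 2 * M * (e / (4 * (M + 1))) = e / 2 * (M / (M + 1)) by field; rewrite gt_eqF.
rewrite [leRHS](splitr e) lerD2l -[leRHS]mulr1; apply: ler_wpM2l; first exact: ltW.
by rewrite ler_pdivrMr// mul1r lerDl.
Qed.

Variable X : forall x : 'cV[R]_n, weak_solution nu b sigma c x.
Let Pt t x := Ex (ws_prob (X x)) (fun w => f (ws_proc (X x) t w)).

Lemma semigroup_bounded t x : 0 <= t -> `|Pt t x| <= M.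
Proof.
move=> t0; have mf := ws_measurable_comp (S := X x) t0 cf.
have lf := L1_bdd (ws_prob (X x)) mf (fun w => fM _).
apply: le_trans (Ex_abs lf) _; rewrite -[leRHS](Ex_cst (ws_prob (X x))).
by apply: Ex_le; [exact: L1_norm|exact: L1_cst|].
Qed.

(** Both expectations are compared with that of [inside_val], which is the same on the two bases by
    [inside_law]. The scheme starts at [z] on both, so on the basis of [X x] its initial error is
    [|z - x| < dx], and on the other it is [0]. *)
Lemma semigroup_close t x e : 0 < t -> 0 < e -> exists2 dl, 0 < dl &
  forall z, euc (z - x) < dl -> `|Pt t z - Pt t x| <= e.
Proof.
move=> t0 e0.
have combine (a p1 p2 ep : R) : `|a - p1| <= e / 4 + 2 * M * (ep + ep) ->
    `|a - p2| <= e / 4 + 2 * M * (4 * ep + ep) -> 14 * M * ep <= e / 2 -> `|p2 - p1| <= e.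
  rewrite -!mulrA !(mulrDr M) (mulrCA M); move: (M * ep) => y.
  by rewrite !ler_norml => /andP[? ?] /andP[? ?] ?; apply/andP; split; lra.
have M1 : 0 < M + 1 by rewrite ltr_wpDl.
(* The two comparisons cost [e / 4 + 4 M eps] and [e / 4 + 10 M eps], so [14 M eps <= e / 2] is
   wanted; [M + 1] allows [M = 0]. *)
pose eps := e / (28 * (M + 1)).
have eps0 : 0 < eps by rewrite divr_gt0// mulr_gt0.
have e4 : 0 < e / 4 by rewrite divr_gt0.
have [K1 K10 hK1] := exit_bound (X x) t0 eps0.
(* [K1] bounds [X x]; one unit is left for the scheme, kept within [r = K1 + 1], and one more for
   [X z]. *)
pose K := K1 + 2; have K0 : 0 < K by rewrite addr_gt0.
have [th th0 hth] := uniform_continuity K cf e4.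
pose th1 := Num.min (th / 2) 1.
have th10 : 0 < th1 by rewrite lt_min divr_gt0//= ltr01.
have [th1a th1b] : th1 <= th / 2 /\ th1 <= 1 by have : th1 <= th1 by []; rewrite {2}/th1 le_min => /andP[].
have [l1 [dx [hl1 dx0 close]]] := euler_close c_meas b_cont sigma_cont c_cont c_sq_fin c_sq_cont
  t0 K0 hab th10 eps0.
exists dx => // z zx.
have [q1 [m1 [q10 h1]]] := close x z (X x) (ltW zx).
have [|q2 [m2 [q20 h2]]] := close z z (X z); first by rewrite subrr euc0 ltW.
pose q := Num.min (Num.min q1 q2) th1.
have q0 : 0 < q by rewrite lt_min th10 andbT lt_min q10.
have [qq1 qq2 qth] : [/\ q <= q1, q <= q2 & q <= th1].
  by have : q <= q by []; rewrite {2}/q le_min (le_min q q1) => /andP[/andP[-> ->] ->].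
have [s ok] := scheme_exists c_meas b_cont sigma_cont c_cont c_sq_fin c_sq_cont K q0 hl1.
pose m := (m1 + m2).+1; have m0 : (0 < m)%N by [].
have c1 := h1 s q m ok (ltW q0) qq1 (leqW (leq_addr _ _)) m0.
have c2 := h2 s q m ok (ltW q0) qq2 (leqW (leq_addl _ _)) m0.
pose r := K1 + 1.
have gt' k : (k <= m)%N -> 0 <= gpt t m k <= t.
  by move=> km; rewrite gpt_ge0//= -[leRHS](gpt_last t m0) gpt_le.
have fin x' (S : weak_solution nu b sigma c x') w :
    (forall k, (k <= m)%N -> euc (ws_euler (S := S) s t m z k w) <= r /\
      euc (ws_euler (S := S) s t m z k w - ws_proc S (gpt t m k) w) <= th1) ->
    `|inside_val s t m z r f w - f (ws_proc S t w)| <= e / 4.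
  move=> h; have ii : inside_ind s t m z r (S := S) w = 1.
    rewrite /inside_ind (_ : inside _ _ _)//; apply/forallP => k.
    by have [] := h k (ltn_ord k : (k <= m)%N).
  rewrite /inside_val ii mul1r; have [y1 y2] := h m (leqnn m).
  have yK : euc (ws_euler (S := S) s t m z m w) <= K by apply: le_trans y1 _; rewrite lerD2l ler1n.
  rewrite distrC; apply: hth; first exact: (so_K ok yK).
  rewrite eucB; apply: le_trans (euc_triangleB _ (ws_euler (S := S) s t m z m w) _) _.
  apply: (@le_trans _ _ (th1 + th1)); last lra.
  apply: lerD; first exact: le_trans (so_pi ok yK) qth.
  by rewrite -[X in ws_proc S X](gpt_last t m0).
have on_x : whp (ws_prob (X x)) (eps + eps) (fun w => inside_ind s t m z r (S := X x) w = 1 /\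
    `|inside_val s t m z r f w - f (ws_proc (X x) t w)| <= e / 4).
  apply: whpS (whp_and hK1 c1) => w [hX hY].
  have hk : forall k, (k <= m)%N -> euc (ws_euler (S := X x) s t m z k w) <= r /\
      euc (ws_euler (S := X x) s t m z k w - ws_proc (X x) (gpt t m k) w) <= th1.
    (* Closeness at step [k] needs both processes in the ball at earlier steps, which the induction
       provides; closeness then puts the scheme within [r] at step [k]. *)
    elim/ltn_ind => k ih km.
    have hd : euc (ws_euler (S := X x) s t m z k w - ws_proc (X x) (gpt t m k) w) <= th1.
      apply: hY => // j jk; have jm := leq_trans (ltnW jk) km; split.
        by apply: le_trans (hX _ (gt' j jm)) _; rewrite lerDl.
      by have [h _] := ih j jk jm; apply: le_trans h _; rewrite lerD2l ler1n.
    split => //; rewrite -[ws_euler _ _ _ _ _ _](subrK (ws_proc (X x) (gpt t m k) w)).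
    apply: le_trans (euc_triangle _ _) _; rewrite /r addrC; apply: lerD; first exact: hX (gt' k km).
    exact: le_trans hd _.
  split; last exact: fin.
  by rewrite /inside_ind (_ : inside _ _ _)//; apply/forallP => k; have [] := hk k (ltn_ord k : (k <= m)%N).
have mi x' (S : weak_solution nu b sigma c x') := measurable_inside_ind ok t0 m0 z r (S := S).
have mv x' (S : weak_solution nu b sigma c x') := measurable_inside_val ok t0 m0 z r f (S := S).
have [law1 law2] := inside_law ok t0 m0 z r fM (X x) (X z).
have bi x' (S : weak_solution nu b sigma c x') := inside_ind_bound s t m z r (S := S).
have bv x' (S : weak_solution nu b sigma c x') := inside_val_bound s t m z r fM (S := S).
(* The indicator differs from [1] with probability at most [2 eps], and [Ex_close] with bound [1]
   doubles this. *)
have near1 : `|Ex (ws_prob (X x)) (inside_ind s t m z r (S := X x)) - 1| <= 4 * eps.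
  have b1 : `|1 : R| <= 1 by rewrite normr1.
  have w1 : whp (ws_prob (X x)) (eps + eps) (fun w => `|inside_ind s t m z r (S := X x) w - cst 1 w| <= 0).
    by apply: whpS on_x => w [-> _]; rewrite subrr normr0.
  have := Ex_close (@mi x (X x)) (measurable_cst (1 : R)) (@bi x (X x)) (fun=> b1) (lexx 0) ler01 w1.
  by rewrite Ex_cst (_ : 4 * eps = 0 + 2 * 1 * (eps + eps))//; ring.
(* The event is a function of the increments, so its probability is the one estimated on the basis
   of [X x]; this is how a bound for [X z] is obtained that is uniform in [z]. *)
have inside_z : whp (ws_prob (X z)) (4 * eps) (fun w => inside (n := n) m r (fun k => ws_euler (S := X z) s t m z k w)).
  pose B := [set w | inside_ind s t m z r (S := X z) w < 1].
  have mB : measurable B.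
    rewrite (_ : B = setT `&` inside_ind s t m z r (S := X z) @^-1` `]-oo, 1[%classic); last first.
      by rewrite setTI; apply/seteqP; split => w /=; rewrite in_itv.
    by apply: (@mi z (X z)) => //; exact: measurable_itv.
  exists B; split => //; last first.
    by move=> w nB; apply: contrapT => /negP h; apply: nB; rewrite /B /= /inside_ind (negbTE h) ltr01.
  rewrite -(PfineK (ws_prob (X z)) mB) lee_fin -Ex_indic//.
  have li := L1_bdd (ws_prob (X z)) (@mi z (X z)) (@bi z (X z)).
  have -> : Ex (ws_prob (X z)) (\1_B) = 1 - Ex (ws_prob (X z)) (inside_ind s t m z r (S := X z)).
    rewrite -[X in X - _](Ex_cst (ws_prob (X z))) -ExB//; last exact: L1_cst.
    apply: Ex_ext => w; rewrite indicE /inside_ind; case: (boolP (inside _ _ _)) => h.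
      by rewrite memNset ?subrr// /B /= /inside_ind h ltxx.
    by rewrite mem_set ?subr0// /B /= /inside_ind (negbTE h) ltr01.
  by rewrite -law1; move: near1; rewrite ler_norml => /andP[h _]; lra.
have on_z : whp (ws_prob (X z)) (4 * eps + eps) (fun w =>
    `|inside_val s t m z r f w - f (ws_proc (X z) t w)| <= e / 4).
  apply: whpS (whp_and inside_z c2) => w [/forallP hI hY]; apply: fin.
  (* The roles are reversed: the scheme is within [r] by assumption, and the induction places [X z]
     within [1] of it, hence within [K]. *)
  elim/ltn_ind => k ih km.
  have hr j : (j <= m)%N -> euc (ws_euler (S := X z) s t m z j w) <= r.
    by move=> jm; exact: (hI (Ordinal (jm : (j < m.+1)%N))).
  split; first exact: hr.
  apply: hY => // j jk; have jm := leq_trans (ltnW jk) km; have yj := hr j jm; split; last first.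
    by apply: le_trans yj _; rewrite lerD2l ler1n.
  have [_ hd] := ih j jk jm; rewrite eucB in hd.
  rewrite -[ws_proc _ _ _](subrK (ws_euler (S := X z) s t m z j w)).
  apply: le_trans (euc_triangle _ _) _; have -> : K = 1 + r by rewrite /K /r; ring.
  by apply: lerD => //; exact: le_trans hd _.
have mf x' := ws_measurable_comp (S := X x') (ltW t0) cf.
have d1 := Ex_close (@mv x (X x)) (@mf x) (@bv x (X x)) (fun w => fM _) (ltW e4) M0 (whpS (fun w => @proj2 _ _) on_x).
have d2 := Ex_close (@mv z (X z)) (@mf z) (@bv z (X z)) (fun w => fM _) (ltW e4) M0 on_z.
have sm : 14 * M * eps <= e / 2.
  have -> : 14 * M * eps = e / 2 * (M / (M + 1)) by rewrite /eps; field; rewrite gt_eqF.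
  rewrite -[leRHS]mulr1; apply: ler_wpM2l; first by rewrite divr_ge0// ltW.
  by rewrite ler_pdivrMr// mul1r lerDl.
by move: d1; rewrite law2 => d1; exact: (combine _ _ _ _ d1 d2 sm).
Qed.

End feller.

Theorem proposition4p2 (R : realType) (d : nat) (hd : (2 <= d)%N)
  (dU : measure_display) (U : measurableType dU)
  (nu : {sigma_finite_measure set U -> \bar R})
  (b : 'cV[R]_d -> 'cV[R]_d) (sigma : 'cV[R]_d -> 'M[R]_d)
  (c : 'cV[R]_d -> U -> 'cV[R]_d)
  (b_meas : measurable_fun [set: borel 'cV[R]_d] (b : _ -> borel 'cV[R]_d))
  (sigma_meas :
    measurable_fun [set: borel 'cV[R]_d] (sigma : _ -> borel 'M[R]_d))
  (c_meas : measurable_fun [set: borel 'cV[R]_d * U]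
     (fun z => (c z.1 z.2 : borel 'cV[R]_d)))
  (b_cont : continuous b) (sigma_cont : continuous sigma)
  (c_cont : forall u, continuous (c ^~ u))
  (c_sq_fin : forall x, (\int[nu]_u (euc (c x u) ^+ 2)%:E < +oo)%E)
  (c_sq_cont : continuous
     (fun x : 'cV[R]_d => fine (\int[nu]_u (euc (c x u) ^+ 2)%:E)%E))
  (X : forall x : 'cV[R]_d, weak_solution nu b sigma c x)
  (X_unique : forall (x : 'cV[R]_d) (S1 S2 : weak_solution nu b sigma c x),
     same_law S1 S2)
  (hab : condition_a nu b sigma c \/ condition_b nu b sigma c) :
  feller_continuous (semigroup X).
Proof.
move=> t f t0 [cf [M fM]].
have PE x : semigroup X t f x = Ex (ws_prob (X x)) (fun w => f (ws_proc (X x) t w)).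
  by rewrite /semigroup unlock.
split; last by exists M => x; rewrite PE; exact: semigroup_bounded.
(* The grid needs a positive horizon; time [0] is left to [initial_law]. *)
move: t0 PE; rewrite le_eqVlt => /predU1P[<-|t0] PE.
  rewrite (_ : semigroup X 0 f = f)//; apply/funext => x; rewrite PE.
  exact: (initial_law c_meas b_cont sigma_cont c_cont c_sq_fin c_sq_cont hab cf fM (X x)).
move=> x A /nbhs_ballP[e /= e0 eA]; have e2 : 0 < e / 2 by rewrite divr_gt0.
have [dl dl0 hdl] := semigroup_close c_meas b_cont sigma_cont c_cont c_sq_fin c_sq_cont hab cf fM X x t0 e2.
apply/nbhs_euc; exists dl => // z zx; apply: eA.
rewrite /ball /= !PE distrC; apply: le_lt_trans (hdl z zx) _.
by rewrite ltr_pdivrMr// ltr_pMr// ltr1n.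
Qed.
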